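(* Let $n\ge2$ and let $\rho:\Gamma\to\mathrm{SO}_0(2,n)$ be a GHC-regular representation of a group $\Gamma$ whose limit set $\Lambda_\rho\subset\mathrm{Ein}_n$ is acausal, and assume that $\mathrm{Conv}(\Lambda_\rho)$ has non-empty interior. Then the metric spaces $(\widetilde{S}^+_\rho,\tilde d^+)$ and $(\widetilde{S}^-_\rho,\tilde d^-)$ are complete $\mathrm{CAT}(-1)$ spaces.
   Context: $\mathbb{R}^{2,n}$ is $\mathbb{R}^{n+2}$ with $q_{2,n}(u,v,x_1,\dots,x_n)=-u^2-v^2+x_1^2+\dots+x_n^2$ and bilinear form $\langle\cdot|\cdot\rangle$; $\mathrm{SO}_0(2,n)$ is the identity component of its isometry group; $\mathbb{S}(\mathbb{R}^{2,n})$ is the sphere of rays. $\mathrm{Ein}_n\subset\mathbb{S}(\mathbb{R}^{2,n})$ is the set of rays of nonzero isotropic vectors, identified with $\mathbb{S}^1\times\mathbb{S}^{n-1}$ by $(\theta,y)\mapsto$ ray of $(\cos\theta,\sin\theta,y)$; it is covered by $\widetilde{\mathrm{Ein}}_n=\mathbb{R}\times\mathbb{S}^{n-1}$ with the conformal class of $-d\theta^2+ds^2$. $\mathrm{AdS}_{n+1}=\{q_{2,n}=-1\}$ with the induced Lorentzian metric (constant curvature $-1$), identified with its image $\{q_{2,n}<0\}$ in $\mathbb{S}(\mathbb{R}^{2,n})$, whose boundary there is $\mathrm{Ein}_n$. An acausal topological $(n-1)$-sphere $\Lambda\subset\mathrm{Ein}_n$ is the injective projection of the graph of a function $f:\mathbb{S}^{n-1}\to\mathbb{R}$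 with $|f(y)-f(y')|<d(y,y')$ for $y\neq y'$ ($d$ the round distance), i.e. of a sphere in $\widetilde{\mathrm{Ein}}_n$ with no two distinct points joined by a causal curve. Its regular domain is $E(\Lambda)=\{x\in\mathrm{AdS}_{n+1}:\langle x|y\rangle<0\ \forall y\in\Lambda\}$. Here a GHC-regular representation with acausal limit set is a faithful representation with discrete image preserving such a $\Lambda_\rho$, such that $\rho(\Gamma)$ acts freely and properly discontinuously on $E(\Lambda_\rho)$ with quotient a globally hyperbolic spacetime with compact Cauchy hypersurfaces. $\mathrm{Conv}(\Lambda_\rho)\subset\mathbb{S}(\mathbb{R}^{2,n})$ is the set of rays of combinations $t_1x_1+\dots+t_kx_k$ with $t_i>0$, $\sum t_i=1$ and $x_i$ isotropic vectors whose rays are in $\Lambda_\rho$. When it has non-empty interior, $\partial\mathrm{Conv}(\Lambda_\rho)\setminus\Lambda_\rho$ has exactly two connected components, denoted $\widetilde S^+_\rho$ (the future one) and $\widetilde S^-_\rho$ (the past one); they are locally Lipschitz spacelike hypersurfaces of $\mathrm{AdS}_{n+1}$. The length of a Lipschitz curve $c:I\to\widetilde S^\pm_\rho$ is the integral over $I$ of the Lorentzian norm of its (almost everywhere defined) tangent vector in $\mathrm{AdS}_{n+1}$, and $\tilde d^\pm(x,y)$ is the infimum of the lengths of Lipschitz curves in $\widetilde S^\pm_\rho$ joining $x$ to $y$; $\tilde d^\pm$ is a distance on $\widetilde S^\pm_\rho$. *)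

(* Defs.v *)
From HB Require Import structures.
From mathcomp Require Import all_boot all_order all_algebra.
From mathcomp Require Import all_classical all_reals all_analysis.

Set Implicit Arguments.
Unset Strict Implicit.
Unset Printing Implicit Defensive.

Import Order.TTheory GRing.Theory Num.Theory.
Import numFieldNormedType.Exports.

Local Open Scope classical_set_scope.
Local Open Scope ring_scope.
Local Open Scope quotient_scope.

(* Metric spaces are given as a set [X] of points of an ambient type [T] with a
   function [d], which only matters on [X]. *)
Section MetricSpaces.
Context {R : realType} {T : Type}.
Implicit Types (X : set T) (d : T -> T -> R).

Definition is_metric X d : Prop :=
  [/\ forall x y, X x -> X y -> 0 <= d x y,
      forall x y, X x -> X y -> d x y = 0 <-> x = y,
      forall x y, X x -> X y -> d x y = d y x &
      forall x y z, X x -> X y -> X z -> d x z <= d x y + d y z].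

Definition is_complete X d : Prop :=
  forall u : nat -> T, (forall k, X (u k)) ->
    (forall e : R, 0 < e -> exists N : nat,
       forall i j, (N <= i)%N -> (N <= j)%N -> d (u i) (u j) < e) ->
    exists2 l, X l & (fun k => d (u k) l) @ \oo --> (0 : R).

(* [c], restricted to [0, d x y], is a geodesic segment from [x] to [y] *)
Definition is_geodesic X d (x y : T) (c : R -> T) : Prop :=
  [/\ c 0 = x, c (d x y) = y,
      forall s, 0 <= s <= d x y -> X (c s) &
      forall s t, 0 <= s <= d x y -> 0 <= t <= d x y ->
        d (c s) (c t) = `|s - t|].

Definition geodesic_space X d : Prop :=
  forall x y, X x -> X y -> exists c, is_geodesic X d x y c.

End MetricSpaces.

(* The standard bilinear form of R^{p,q}, with the p negative coordinates first *)
Definition form {R : realType} (p q : nat) (x y : 'cV[R]_(p + q)) : R :=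
  - (\sum_(i < p) x (lshift q i) 0 * y (lshift q i) 0)
  + \sum_(i < q) x (rshift p i) 0 * y (rshift p i) 0.

Section HyperbolicPlane.
Context {R : realType}.

Definition arcosh (s : R) : R := ln (s + Num.sqrt (s ^+ 2 - 1)).

Definition H2 : set 'cV[R]_(1 + 2) :=
  [set u | form u u = -1 /\ 0 < u (lshift 2 0) 0].

Definition dH2 (u v : 'cV[R]_(1 + 2)) : R := arcosh (- form u v).

End HyperbolicPlane.

(* The CAT(-1) inequality.  Two points lying on different sides of a geodesic
   triangle lie on two sides [x, y] and [x, z] issued from a common vertex, which
   up to relabelling is [x]; [u], [v], [w] is a comparison triangle and [p'], [q']
   are the comparison points of [c1 s], [c2 t].  Comparison triangles always
   exist, and for two points on the same side the inequality is an equality. *)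
Definition CATm1 {R : realType} {T : Type} (X : set T) (d : T -> T -> R) : Prop :=
  [/\ is_metric X d, geodesic_space X d &
      forall (x y z : T) (c1 c2 c3 : R -> T), X x -> X y -> X z ->
      is_geodesic X d x y c1 -> is_geodesic X d x z c2 ->
      is_geodesic X d y z c3 ->
      forall u v w : 'cV[R]_(1 + 2), H2 u -> H2 v -> H2 w ->
      dH2 u v = d x y -> dH2 u w = d x z -> dH2 v w = d y z ->
      forall s t, 0 <= s <= d x y -> 0 <= t <= d x z ->
      forall p' q' : 'cV[R]_(1 + 2), H2 p' -> H2 q' ->
      dH2 u p' = s -> dH2 p' v = d x y - s ->
      dH2 u q' = t -> dH2 q' w = d x z - t ->
      d (c1 s) (c2 t) <= dH2 p' q'].

Definition complete_CATm1 {R : realType} {T : Type} (X : set T)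
    (d : T -> T -> R) : Prop :=
  is_complete X d /\ CATm1 X d.

Section AntiDeSitter.
Context {R : realType} {n : nat}.
Local Notation V := 'cV[R]_(2 + n).
Implicit Types x y w : V.

Definition bil x y : R := @form R 2 n x y.
Definition qf x : R := bil x x.

Definition isometries : set 'M[R]_(2 + n) :=
  [set A | forall x y, bil (A *m x) (A *m y) = bil x y].

Definition SO0 : set 'M[R]_(2 + n) := connected_component isometries 1%:M.

Definition AdS : set V := [set x | qf x = -1].

Definition lorentz_norm w : R := Num.sqrt `|qf w|.

(* Time orientation of AdS: a timelike vector [w] tangent at [x] is future-directed
   when the angle theta of the first two coordinates (u, v) of [x] increases
   along [w], i.e. u dv - v du is positive on [w]. *)
Definition future_directed x w : Prop :=
  qf w < 0 /\
  0 < x (lshift n 0) 0 * w (lshift n 1) 0 - x (lshift n 1) 0 * w (lshift n 0) 0.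

(* The point of Ein_n (more precisely, its isotropic representative) with
   coordinates (theta, y) *)
Definition ein_point (theta : R) (y : 'cV[R]_n) : V :=
  col_mx (\col_(i < 2) if i == 0 then cos theta else sin theta) y.

Definition dotR (y z : 'cV[R]_n) : R := \sum_i y i 0 * z i 0.
Definition unit_sphere : set 'cV[R]_n := [set y | dotR y y = 1].
Definition dround (y z : 'cV[R]_n) : R := acos (dotR y z).

End AntiDeSitter.

(* The sphere of rays: nonzero vectors modulo positive scalars, with the
   quotient topology *)
Section Rays.
Context {R : realType} {n : nat}.
Local Notation V := 'cV[R]_(2 + n).

Definition nzvec : Type := [set x : V | x != 0].
HB.instance Definition _ := Topological.on nzvec.

Definition ray_rel (x y : nzvec) : bool :=
  `[< exists2 t : R, 0 < t & set_val y = t *: set_val x >].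

Lemma ray_rel_refl : reflexive ray_rel.
Proof. by move=> x; apply/asboolP; exists 1; rewrite ?ltr01 ?scale1r. Qed.

Lemma ray_rel_trans : transitive ray_rel.
Proof.
move=> y x z /asboolP[s s0 ys] /asboolP[t t0 zt]; apply/asboolP.
by exists (t * s); rewrite ?mulr_gt0// zt ys scalerA.
Qed.

Lemma ray_rel_sym : symmetric ray_rel.
Proof.
have H x y : ray_rel x y -> ray_rel y x.
  move=> /asboolP[s s0 ys]; apply/asboolP; exists s^-1; rewrite ?invr_gt0//.
  by rewrite ys scalerA mulVf ?scale1r// gt_eqF.
by move=> x y; apply/idP/idP => /H.
Qed.

Definition ray_equiv : equiv_rel nzvec :=
  EquivRel ray_rel ray_rel_refl ray_rel_sym ray_rel_trans.

Definition rays : Type := quotient_topology {eq_quot ray_equiv}.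
HB.instance Definition _ := Topological.on rays.
HB.instance Definition _ := Quotient.on rays.

(* the rays of the nonzero vectors of [A] *)
Definition rays_through (A : set V) : set rays :=
  [set \pi_rays v | v in [set v : nzvec | A (set_val v)]].

(* the nonzero vectors whose rays are in [S] *)
Definition cone (S : set rays) : set V :=
  [set set_val v | v in [set v : nzvec | S (\pi_rays v)]].

(* The projection of the graph of [f] to Ein_n is automatically injective: the
   ray of [ein_point theta y], with [y] of norm one, determines [y]. *)
Definition acausal_sphere (Lambda : set rays) : Prop :=
  exists f : 'cV[R]_n -> R,
    (forall y z, unit_sphere y -> unit_sphere z -> y <> z ->
       `|f y - f z| < dround y z) /\
    Lambda = rays_through [set ein_point (f y) y | y in unit_sphere].

Definition regular_domain (Lambda : set rays) : set V :=
  [set x | AdS x /\ forall y, cone Lambda y -> bil x y < 0].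

Definition Conv (Lambda : set rays) : set rays :=
  rays_through [set x | exists (k : nat) (t : 'I_k -> R) (p : 'I_k -> V),
    [/\ forall i, 0 < t i, \sum_i t i = 1,
        forall i, qf (p i) = 0 /\ cone Lambda (p i) &
        x = \sum_i t i *: p i]].

Definition boundary_Conv (Lambda : set rays) : set rays :=
  closure (Conv Lambda) `\` (Conv Lambda)°.

(* the set of connected components of the boundary of Conv minus Lambda *)
Definition boundary_components (Lambda : set rays) : set (set rays) :=
  let B := boundary_Conv Lambda `\` Lambda in
  [set connected_component B r | r in B].

(* the subset of AdS identified with [S] *)
Definition AdS_lift (S : set rays) : set V := AdS `&` cone S.

End Rays.
Arguments rays R n : clear implicits.

Section Curves.
Context {R : realType} {n : nat}.
Local Notation V := 'cV[R]_(2 + n).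
Implicit Types (E A : set V) (c : R -> V).

(* [c] is, at the time [t], in [E], C^1 and timelike *)
Definition timelike_at E c (t : R) : Prop :=
  [/\ E (c t), derivable c t 1, {for t, continuous (derive1 c)} &
      qf (derive1 c t) < 0].

Definition chronological_future E A : set V :=
  [set y | exists c : R -> V, [/\ A (c 0), c 1 = y &
     forall t, 0 <= t <= 1 ->
       timelike_at E c t /\ future_directed (c t) (derive1 c t)]].

Definition curve_length c (a b : R) : \bar R :=
  (\int[lebesgue_measure]_(t in `[a, b]) (lorentz_norm (derive1 c t))%:E)%E.

(* Infimum of the lengths of the Lipschitz curves in [X] from [x] to [y].  The
   value of [fine] on +oo is 0, so that [is_metric] for this function includes the existence
   of curves of finite length between distinct points of [X]. *)
Definition length_dist (X : set V) (x y : V) : R :=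
  fine (ereal_inf [set l | exists (c : R -> V) (a b : R),
    [/\ a <= b, [lipschitz c t | t in `[a, b]%classic],
        forall t, a <= t <= b -> X (c t),
        c a = x /\ c b = y & l = curve_length c a b]]).

End Curves.

(* [Sp] is the future component and [Sm] the past component of the boundary of
   Conv minus Lambda; both lie in [regular_domain Lambda], where the future is
   taken because AdS itself has closed timelike curves. *)
Definition future_past_components {R : realType} {n : nat}
    (Lambda Sp Sm : set (rays R n)) : Prop :=
  [/\ boundary_components Lambda Sp, boundary_components Lambda Sm, Sp <> Sm &
      AdS_lift Sp `<=`
        chronological_future (regular_domain Lambda) (AdS_lift Sm)].

Record representation (Gamma : groupType) (R : realType) (n : nat) :=
  Representation {
    rep_fun :> Gamma -> 'M[R]_(2 + n);
    rep_SO0 : forall g, SO0 (rep_fun g);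
    rep1 : rep_fun 1%g = 1%:M;
    repM : forall g h, rep_fun (g * h)%g = rep_fun g *m rep_fun h }.

(* The topological quotient of R^{2,n} by rho(Gamma).  The quotient map is open,
   so for an invariant set [E] the image of [E], with the topology induced by
   [orbit_space], is the topological quotient of [E]. *)
Section OrbitSpace.
Context {Gamma : groupType} {R : realType} {n : nat}.
Variable rho : representation Gamma R n.
Local Notation V := 'cV[R]_(2 + n).

Definition orbit_rel (x y : V) : bool := `[< exists g, y = rho g *m x >].

Lemma orbit_rel_refl : reflexive orbit_rel.
Proof. by move=> x; apply/asboolP; exists 1%g; rewrite rep1 mul1mx. Qed.

Lemma orbit_rel_trans : transitive orbit_rel.
Proof.
move=> y x z /asboolP[g yg] /asboolP[h zh]; apply/asboolP.
by exists (h * g)%g; rewrite repM -mulmxA -yg.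
Qed.

Lemma orbit_rel_sym : symmetric orbit_rel.
Proof.
have H x y : orbit_rel x y -> orbit_rel y x.
  move=> /asboolP[g yg]; apply/asboolP; exists (g^-1)%g.
  by rewrite yg mulmxA -repM mulVg rep1 mul1mx.
by move=> x y; apply/idP/idP => /H.
Qed.

Definition orbit_equiv : equiv_rel V :=
  EquivRel orbit_rel orbit_rel_refl orbit_rel_sym orbit_rel_trans.

Definition orbit_space : Type := quotient_topology {eq_quot orbit_equiv}.
HB.instance Definition _ := Topological.on orbit_space.
HB.instance Definition _ := Quotient.on orbit_space.

Definition quotient_of (E : set V) : set orbit_space :=
  [set \pi_orbit_space x | x in E].

(* The Lorentzian metric of the quotient of [E] is the one for which the quotient
   map is a local isometry, so timelike curves are those which locally lift to
   timelike curves of [E].  Inextendible curves have open intervals of definition,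
   which can be taken to be R. *)
Definition quotient_timelike (E : set V) (c : R -> orbit_space) : Prop :=
  forall t0 : R, exists c' : R -> V,
    \forall t \near t0, timelike_at E c' t /\ \pi_orbit_space (c' t) = c t.

Definition inextendible (E : set V) (c : R -> orbit_space) : Prop :=
  forall p, quotient_of E p ->
    ~ (c t @[t --> +oo] --> p) /\ ~ (c t @[t --> -oo] --> p).

Definition Cauchy_hypersurface (E : set V) (S : set orbit_space) : Prop :=
  S `<=` quotient_of E /\
  forall c, quotient_timelike E c -> inextendible E c -> exists! t : R, S (c t).

Definition acts_freely (E : set V) : Prop :=
  forall g x, E x -> rho g *m x = x -> g = 1%g.

Definition acts_properly_discontinuously (E : set V) : Prop :=
  forall K : set V, K `<=` E -> compact K ->
    finite_set [set g | exists2 x, K x & K (rho g *m x)].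

(* [rho] is GHC-regular, with limit set the acausal sphere [Lambda].  Its quotient
   is globally hyperbolic with compact Cauchy hypersurfaces, i.e. it has a compact
   Cauchy hypersurface. *)
Definition GHC_regular_acausal (Lambda : set (rays R n)) : Prop :=
  let E := regular_domain Lambda in
  [/\ injective rho /\ range rho `<=` isolated (range rho),
      acausal_sphere Lambda /\
        (forall g, [set rho g *m x | x in cone Lambda] = cone Lambda),
      acts_freely E, acts_properly_discontinuously E &
      exists S, Cauchy_hypersurface E S /\ compact S].

End OrbitSpace.

(* Main.v *)
(** A component of the boundary of the convex hull, lifted to AdS, is an achronal
    surface [S] with a timelike support normal [N] at each point.  A finite family of
    such normals cuts out a polyhedral surface whose faces are pieces of hyperbolic
    spaces [N^perp].  The length distances of these polyhedra increase with the family: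
    removing a plane shortens chains, by a triangle inequality for unrolled faces.
    At a vertex of a shortest chain the two sides make an angle at least pi in the link,
    and straightening the chain in the model plane gives the CAT(-1) inequality for the
    distance to a point, first locally, then along the chain by sinh-convexity.
    The inequality passes to the limit [idist] of the polyhedral distances, which on
    bounded parts lies between a multiple of the Euclidean distance and
    [arcosh (- bil x y)].  Comparison at points of differentiability shows that [idist]
    is the length distance.

    The lifted boundary consists of the points of the bipolar cone of the limit sphere
    with an orthogonal vector in the polar cone, of future or past type; rotation circles
    of the two negative coordinates meet it exactly once.  Completeness follows from
    cocompactness: the arc of such a circle in the regular domain is an inextendible
    timelike curve of the quotient, hence meets the compact Cauchy hypersurface. *)
From HB Require Import structures.
From mathcomp Require Import all_boot all_order all_algebra.
From mathcomp Require Import all_classical all_reals all_analysis.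
From mathcomp Require Import ring lra.
Require Import Defs.

Set Implicit Arguments.
Unset Strict Implicit.
Unset Printing Implicit Defensive.

Import Order.TTheory GRing.Theory Num.Theory.
Import numFieldNormedType.Exports.

Local Open Scope classical_set_scope.
Local Open Scope ring_scope.
Local Open Scope quotient_scope.

(** * Timelike vectors, their sheets and acausality *)

Section Bilinear.
Context {R : realType} {n : nat}.
Local Notation V := 'cV[R]_(2 + n).
Implicit Types x y z a b t N M : V.

(** The surface is only Lipschitz and its support normals are not unique, so no curvature is
    computed. Two facts replace this. Acausality passes from the points of the surface to their
    support normals, since exchanging points and normals only reverses time; a finite family of
    pairwise acausal normals is all that the polyhedral geometry needs. Moreover, the comparison
    inequality at a point of a side is proved for the distance to an arbitrary point, however far: a
    minimal chain to that point is unfolded from its far end, each corner being balanced by the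
    normals of the planes through it. The families of normals are directed by inclusion without
    being a sequence, hence limits are taken along ultrafilters, which also select one of finitely
    many faces. The parameter [e] carries the time orientation: the values 1 and -1 give the two
    components, while the polyhedral part uses only [e != 0]. *)

Definition tu x : R := x (lshift n 0) 0.
Definition tv x : R := x (lshift n 1) 0.
Definition sp x y : R := \sum_(i < n) x (rshift 2 i) 0 * y (rshift 2 i) 0.

Lemma bil_coord x y : bil x y = - (tu x * tu y + tv x * tv y) + sp x y.
Proof.
rewrite /bil /form !big_ord_recl big_ord0 addr0.
by rewrite (_ : lift ord0 ord0 = 1)//; apply: val_inj.
Qed.

Lemma spC x y : sp x y = sp y x.
Proof. by apply: eq_bigr => i _; rewrite mulrC. Qed.

Lemma spDl x y z : sp (x + y) z = sp x z + sp y z.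
Proof. by rewrite -big_split; apply: eq_bigr => i _; rewrite mxE mulrDl. Qed.

Lemma spZl (k : R) x y : sp (k *: x) y = k * sp x y.
Proof. by rewrite mulr_sumr; apply: eq_bigr => i _; rewrite mxE mulrA. Qed.

Lemma sp_ge0 x : 0 <= sp x x.
Proof. by apply: sumr_ge0 => i _; rewrite -expr2 sqr_ge0. Qed.

Lemma col_ext x y : tu x = tu y -> tv x = tv y ->
  (forall i, x (rshift 2 i) 0 = y (rshift 2 i) 0) -> x = y.
Proof.
move=> hu hv h; apply/matrixP => i j; rewrite ord1 {j}.
case: (split_ordP i) => k ->; last exact: h.
case: k => [[|[|k]] hk] //.
  by rewrite (_ : Ordinal hk = 0)//; apply: val_inj.
by rewrite (_ : Ordinal hk = 1)//; apply: val_inj.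
Qed.

Lemma sp_eq0 x : sp x x = 0 -> tu x = 0 -> tv x = 0 -> x = 0.
Proof.
move=> /eqP; rewrite psumr_eq0; last by move=> i _; rewrite -expr2 sqr_ge0.
move=> /allP h hu hv; apply: col_ext; rewrite ?hu ?hv /tu /tv ?mxE// => i.
have /implyP/(_ isT) := h i (mem_index_enum i).
by rewrite -expr2 sqrf_eq0 => /eqP ->; rewrite mxE.
Qed.

Lemma bilC x y : bil x y = bil y x.
Proof. by rewrite !bil_coord spC (mulrC (tu x)) (mulrC (tv x)). Qed.

Lemma bilDl x y z : bil (x + y) z = bil x z + bil y z.
Proof. by rewrite !bil_coord spDl /tu /tv !mxE; ring. Qed.

Lemma bilZl (k : R) x y : bil (k *: x) y = k * bil x y.
Proof. by rewrite !bil_coord spZl /tu /tv !mxE; ring. Qed.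

Lemma bilDr x y z : bil x (y + z) = bil x y + bil x z.
Proof. by rewrite bilC bilDl !(bilC x). Qed.

Lemma bilZr (k : R) x y : bil x (k *: y) = k * bil x y.
Proof. by rewrite bilC bilZl bilC. Qed.

Lemma bilNl x y : bil (- x) y = - bil x y.
Proof. by rewrite -scaleN1r bilZl mulN1r. Qed.

Lemma bilNr x y : bil x (- y) = - bil x y.
Proof. by rewrite bilC bilNl bilC. Qed.

Lemma bil0l y : bil 0 y = 0.
Proof. by rewrite -(scale0r (0 : V)) bilZl mul0r. Qed.

Lemma bil0r x : bil x 0 = 0.
Proof. by rewrite bilC bil0l. Qed.

Definition bilE := (bilDl, bilDr, bilNl, bilNr, bilZl, bilZr, bil0l, bil0r).

Lemma bil_suml m (t : 'I_m -> R) (p : 'I_m -> V) y :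
  bil (\sum_i t i *: p i) y = \sum_i t i * bil (p i) y.
Proof.
elim/big_ind2: _ => [|a s b r <- <-|i _]; by rewrite ?bilE.
Qed.

(** The determinant of the negative coordinates, up to the factor [e]. For [w] timelike and tangent
    to AdS at [x], the sign of [om 1 x w] is the time orientation; changing the sign of [e] reverses
    time. *)
Definition om (e : R) x y : R := e * (tu x * tv y - tv x * tu y).

Lemma omDl e x y z : om e (x + y) z = om e x z + om e y z.
Proof. by rewrite /om /tu /tv !mxE; ring. Qed.
Lemma omDr e x y z : om e x (y + z) = om e x y + om e x z.
Proof. by rewrite /om /tu /tv !mxE; ring. Qed.
Lemma omZl e k x y : om e (k *: x) y = k * om e x y.
Proof. by rewrite /om /tu /tv !mxE; ring. Qed.
Lemma omZr e k x y : om e x (k *: y) = k * om e x y.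
Proof. by rewrite /om /tu /tv !mxE; ring. Qed.
Lemma omNl e x y : om e (- x) y = - om e x y.
Proof. by rewrite -scaleN1r omZl mulN1r. Qed.
Lemma omNr e x y : om e x (- y) = - om e x y.
Proof. by rewrite -scaleN1r omZr mulN1r. Qed.
Lemma omxx e x : om e x x = 0.
Proof. by rewrite /om; ring. Qed.
Lemma omC e x y : om e x y = - om e y x.
Proof. by rewrite /om; ring. Qed.
Definition omE := (omDl, omDr, omNl, omNr, omZl, omZr, omxx).

Lemma CS_quad (A B C : R) : 0 <= A ->
  (forall k, 0 <= C + 2 * k * B + k ^+ 2 * A) -> B ^+ 2 <= A * C.
Proof.
move=> A0 h; have [A00|A00] := eqVneq A 0.
  have hB k : 0 <= C + 2 * k * B by have := h k; rewrite A00 mulr0 addr0.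
  have [->|B0] := eqVneq B 0; first by rewrite A00 mul0r expr0n.
  have := hB (- (C + 1) / (2 * B)).
  rewrite (_ : _ + _ = -1); last by field.
  by rewrite oppr_ge0 ler10.
have Ap : 0 < A by rewrite lt0r A00.
have := h (- (B / A)).
rewrite (_ : _ + _ = (A * C - B ^+ 2) / A); last by field.
by rewrite pmulr_lge0 ?invr_gt0// subr_ge0.
Qed.

Lemma sp_CS x y : (sp x y) ^+ 2 <= sp x x * sp y y.
Proof.
apply: CS_quad; first exact: sp_ge0.
move=> k; have := sp_ge0 (k *: x + y).
rewrite !(spDl, spZl, spC _ (_ + _), spC _ (_ *: _)) (spC y x).
by congr (0 <= _); ring.
Qed.

(** If [om e a b] vanished, the negative parts of [a] and [b] would be proportional. Equality in the
    planar Cauchy-Schwarz inequality, together with orthogonality, would then contradict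
    Cauchy-Schwarz for the space parts, as [a] is timelike. *)
Lemma om_neq0 e a b : e != 0 -> qf a < 0 -> qf b <= 0 -> b != 0 ->
  bil a b = 0 -> om e a b != 0.
Proof.
rewrite /qf !bil_coord => e0 ha hb b0 hab; apply: contra b0.
rewrite /om mulf_eq0 (negbTE e0)/= => /eqP hom.
have := sp_CS a b; have := sp_ge0 a; have := sp_ge0 b.
move: (@sp_eq0 b) ha hb hab hom.
set s := sp a b; set A := sp a a; set B := sp b b.
move: (tu a) (tv a) (tu b) (tv b) => a0 a1 b0 b1 hB ha hb hab hom B0 A0 cs.
have hs : s = a0 * b0 + a1 * b1 by lra.
have e1 : (a0 ^+ 2 + a1 ^+ 2) * (b0 ^+ 2 + b1 ^+ 2) = s ^+ 2.
  rewrite hs; have -> : (a0 * b0 + a1 * b1) ^+ 2 =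
    (a0 ^+ 2 + a1 ^+ 2) * (b0 ^+ 2 + b1 ^+ 2) - (a0 * b1 - a1 * b0) ^+ 2 by ring.
  by rewrite hom expr0n/= subr0.
have hT : b0 ^+ 2 + b1 ^+ 2 = 0 by nra.
have hb0 : b0 = 0 by nra.
have hb1 : b1 = 0 by nra.
by apply/eqP/hB => //; nra.
Qed.

(* The combination of three vectors in which the two negative coordinates
   cancel has non-negative norm. *)
Lemma neg_orth_pos a b t : qf a < 0 -> qf b < 0 -> bil a b = 0 ->
  bil a t = 0 -> bil b t = 0 -> 0 <= qf t /\ (qf t = 0 -> t = 0).
Proof.
move=> ha hb hab hat hbt.
have b0 : b != 0 by apply: contraTneq hb => ->; rewrite /qf bil0l ltxx.
have hg := om_neq0 (oner_neq0 R) ha (ltW hb) b0 hab.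
pose al := om 1 b t; pose be := om 1 t a; pose g := om 1 a b.
pose c := al *: a + be *: b + g *: t.
have cu : tu c = 0 by rewrite /c /al /be /g /om /tu /tv !mxE; ring.
have cv : tv c = 0 by rewrite /c /al /be /g /om /tu /tv !mxE; ring.
have qc : sp c c = al ^+ 2 * qf a + be ^+ 2 * qf b + g ^+ 2 * qf t.
  have -> : sp c c = bil c c by rewrite bil_coord cu cv !mul0r addr0 oppr0 add0r.
  rewrite /qf /c !bilE (bilC t) (bilC t b) (bilC b a) hab hat hbt; ring.
have g2 : 0 < g ^+ 2 by rewrite exprn_even_gt0.
have c0 := sp_ge0 c.
have a2 := sqr_ge0 al; have be2 := sqr_ge0 be.
have tge : 0 <= qf t.
  rewrite -(pmulr_rge0 _ g2); rewrite qc in c0.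
  have ? : al ^+ 2 * qf a <= 0 by apply: mulr_ge0_le0 => //; exact: ltW.
  have ? : be ^+ 2 * qf b <= 0 by apply: mulr_ge0_le0 => //; exact: ltW.
  lra.
split=> // t0; rewrite t0 mulr0 addr0 in qc.
have scc : sp c c = 0.
  have ? : al ^+ 2 * qf a <= 0 by apply: mulr_ge0_le0 => //; exact: ltW.
  have ? : be ^+ 2 * qf b <= 0 by apply: mulr_ge0_le0 => //; exact: ltW.
  lra.
have cc := sp_eq0 scc cu cv.
have al0 : al = 0.
  have : bil a c = 0 by rewrite cc bil0r.
  rewrite /c !bilE hab hat !mulr0 !addr0 => /eqP; rewrite mulf_eq0 => /orP[/eqP//|].
  by rewrite lt_eqF.
have be0 : be = 0.
  have : bil b c = 0 by rewrite cc bil0r.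
  rewrite /c !bilE (bilC b a) hab hbt !mulr0 !addr0 add0r => /eqP.
  by rewrite mulf_eq0 => /orP[/eqP//|]; rewrite lt_eqF.
move: cc; rewrite /c al0 be0 !scale0r !add0r => /eqP.
by rewrite scaler_eq0 (negbTE hg) => /eqP.
Qed.

(** The form is positive definite on the orthogonal of the negative plane of [a] and [b], so the
    discriminant argument applies there. *)
Lemma spacelike_CS a b t s : qf a < 0 -> qf b < 0 -> bil a b = 0 ->
  bil a t = 0 -> bil b t = 0 -> bil a s = 0 -> bil b s = 0 ->
  (bil t s) ^+ 2 <= qf t * qf s.
Proof.
move=> ha hb hab hat hbt has hbs; apply: CS_quad.
  by have [] := neg_orth_pos ha hb hab hat hbt.
move=> k; have [] // := @neg_orth_pos a b (k *: t + s) ha hb hab.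
- by rewrite !bilE hat has mulr0 addr0.
- by rewrite !bilE hbt hbs mulr0 addr0.
by move=> h _; move: h; rewrite /qf !bilE (bilC s t); congr (0 <= _); ring.
Qed.

(** The component [t] of [y] orthogonal to [x] is also orthogonal to [N], hence spacelike or
    zero. *)
Lemma reverse_CS N x y : qf N < 0 -> qf x < 0 -> bil N x = 0 -> bil N y = 0 ->
  qf x * qf y <= (bil x y) ^+ 2 /\
  ((bil x y) ^+ 2 = qf x * qf y -> y = (bil x y / qf x) *: x).
Proof.
move=> hN hx hNx hNy; pose t := y - (bil x y / qf x) *: x.
have x0 : qf x != 0 by rewrite lt_eqF.
have [] := @neg_orth_pos N x t hN hx hNx.
- by rewrite /t !bilE hNx hNy mulr0 subr0.
- by rewrite /t !bilE -/(qf x) divfK ?subrr.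
have -> : qf t = qf y - (bil x y) ^+ 2 / qf x.
  by rewrite /t /qf !bilE (bilC y x) -/(qf x) -/(qf y); field.
move=> h1 h2; split.
  have : (bil x y) ^+ 2 / qf x * qf x >= qf y * qf x by rewrite ler_nM2r// -subr_ge0.
  by rewrite divfK// mulrC.
move=> h; apply/eqP; rewrite -subr_eq0; apply/eqP/h2.
by rewrite h mulrAC divff// mul1r subrr.
Qed.

(** If the signs differed, some nonnegative combination [z] of [x] and [y] would satisfy
    [om e z N = 0]. It is still timelike because [bil x y < 0], which contradicts [om_neq0]. *)
Lemma same_sheet e N x y : e != 0 -> qf N < 0 -> bil x N = 0 -> bil y N = 0 ->
  qf x < 0 -> qf y <= 0 -> bil x y < 0 -> 0 < om e x N * om e y N.
Proof.
move=> e0 hN hxN hyN hx hy hxy.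
have y0 : y != 0 by apply: contraTneq hxy => ->; rewrite bil0r ltxx.
have nz z : bil z N = 0 -> z != 0 -> qf z <= 0 -> om e z N != 0.
  move=> h z0 hz; rewrite omC oppr_eq0; apply: om_neq0 => //; by rewrite bilC.
have x0 : x != 0 by apply: contraTneq hxy => ->; rewrite bil0l ltxx.
have ox := nz x hxN x0 (ltW hx); have oy := nz y hyN y0 hy.
rewrite lt0r mulf_neq0//=; rewrite leNgt; apply/negP => h.
pose z := - (om e y N * om e x N) *: x + (om e x N)^+2 *: y.
have hz : om e z N = 0 by rewrite /z !omE; ring.
have x2 : 0 < om e x N ^+ 2 by rewrite exprn_even_gt0.
suff qz : qf z < 0.
  suff : om e z N != 0 by rewrite hz eqxx.
  apply: nz => //; last exact: ltW.
    by rewrite /z !bilE hxN hyN !mulr0 addr0.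
  by apply: contraTneq qz => ->; rewrite /qf bil0l ltxx.
have -> : qf z = (om e x N * om e y N) ^+ 2 * qf x
   + 2 * (- (om e x N * om e y N)) * om e x N ^+ 2 * bil x y
   + (om e x N ^+ 2) ^+ 2 * qf y.
  by rewrite /z /qf !bilE (bilC y x); ring.
have h1 : 0 < (om e x N * om e y N) ^+ 2 by rewrite exprn_even_gt0 //= lt_eqF.
have h2 : (om e x N * om e y N) ^+ 2 * qf x < 0 by rewrite pmulr_rlt0.
have h3 : 2 * (- (om e x N * om e y N)) * om e x N ^+ 2 * bil x y < 0.
  by rewrite pmulr_rlt0// mulr_gt0// mulr_gt0// ?ltr0n// oppr_gt0.
have h4 : (om e x N ^+ 2) ^+ 2 * qf y <= 0 by rewrite mulr_ge0_le0// sqr_ge0.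
lra.
Qed.

Lemma same_sheet_lt0 e N x y : e != 0 -> qf N < 0 -> bil x N = 0 -> bil y N = 0 ->
  qf x < 0 -> qf y < 0 -> 0 < om e x N * om e y N -> bil x y < 0.
Proof.
move=> e0 hN hxN hyN hx hy ho; rewrite ltNge; apply/negP => h.
have [h0|h0] := eqVneq (bil x y) 0.
  have [] := @neg_orth_pos N x y hN hx; rewrite ?(bilC N)//.
  by rewrite leNgt hy.
have := @same_sheet e N x (- y) e0 hN hxN; rewrite /qf !bilE hyN oppr0 opprK.
rewrite oppr_lt0 lt0r h0 h => /(_ erefl hx (ltW hy) isT).
by rewrite omNl mulrN oppr_gt0 ltNge (ltW ho).
Qed.

Lemma sheet_ge1 e N x y : e != 0 -> qf N < 0 -> bil x N = 0 -> bil y N = 0 ->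
  qf x = -1 -> qf y = -1 -> 0 < om e x N * om e y N ->
  1 <= - bil x y /\ (- bil x y = 1 -> x = y).
Proof.
move=> e0 hN hxN hyN hx hy ho.
have m1 : (-1 : R) < 0 by rewrite oppr_lt0.
have hl : bil x y < 0 by apply: (same_sheet_lt0 e0 hN hxN hyN _ _ ho); rewrite ?hx ?hy.
have xx : qf x < 0 by rewrite hx.
have [h1 h2] := reverse_CS hN xx (etrans (bilC _ _) hxN) (etrans (bilC _ _) hyN).
rewrite hx hy in h1 h2; split; first by nra.
move=> h; have b1 : bil x y = -1 by lra.
rewrite [RHS]h2 b1; first by rewrite divff ?scale1r// oppr_eq0 oner_eq0.
by rewrite sqrrN expr1n mulrNN mulr1.
Qed.

(** [K'] is the projection of [K] to the orthogonal of [p] and [q]: the vector [q + bil p q *: p] is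
    the part of [q] orthogonal to [p], of norm [(bil p q) ^+ 2 - 1]. A normal at [p] thus yields a
    common normal of [p] and [q] on the same side. *)
Lemma pair_normal e p q K : e != 0 -> qf K = -1 -> qf p = -1 -> qf q = -1 ->
  bil p K = 0 -> 0 < (bil p q) ^+ 2 - 1 -> 0 < om e p K ->
  let K' := K - (bil q K / ((bil p q) ^+ 2 - 1)) *: (q + bil p q *: p) in
  [/\ bil p K' = 0, bil q K' = 0, qf K' < 0, 0 < om e p K' & bil K K' = qf K'].
Proof.
move=> e0 hK hp hq pK b2 o' K'.
have m1 : (-1 : R) < 0 by rewrite oppr_lt0.
have b20 : (bil p q) ^+ 2 - 1 != 0 by rewrite gt_eqF.
have e1 : bil p K' = 0 by rewrite /K' !bilE -/(qf p) hp pK; ring.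
have e2 : bil q K' = 0.
  by rewrite /K' !bilE -/(qf q) hq (bilC q p); field.
have e3 : bil K K' = -1 - (bil q K) ^+ 2 / ((bil p q) ^+ 2 - 1).
  by rewrite /K' !bilE -/(qf K) hK (bilC K q) (bilC K p) pK; field.
have e4 : qf K' = bil K K'.
  by rewrite /qf {1}/K' bilDl bilNl bilZl bilDl bilZl e1 e2; ring.
have e5 : bil K K' < 0.
  by rewrite e3; have := divr_ge0 (sqr_ge0 (bil q K)) (ltW b2); lra.
split=> //; first by rewrite e4.
have := @same_sheet e p K K' e0; rewrite hp hK bilC pK bilC e1 e4.
move=> /(_ m1 erefl erefl m1 (ltW e5) e5).
by rewrite (omC e K) (omC e K') mulrNN pmulr_rgt0.
Qed.

(* The statement is symmetric under (x, y, e) <-> (N, M, -e): it says both that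
   points of a convex surface are acausal and that their support normals are. *)
Lemma support_acausal e N M x y : e != 0 ->
  qf N = -1 -> qf M = -1 -> qf x = -1 -> qf y = -1 ->
  bil x N = 0 -> bil y M = 0 -> bil y N <= 0 -> bil x M <= 0 -> bil N M < 0 ->
  0 < om e x N -> 0 < om e y M -> x = y \/ bil x y < -1.
Proof.
move=> e0 hN hM hx hy xN yM yN xM NM oN oM.
have m1 : (-1 : R) < 0 by rewrite oppr_lt0.
have [->|xy] := eqVneq x y; [by left|right].
set b := bil x y; rewrite ltNge; apply/negP => hb.
have [b1|b1] := leP b 1.
  (* When [bil p q] is between -1 and 1, the part [q'] of [q] orthogonal to [p] is causal, and it
     lies on the side of [K]. Applied at [x] and at [y], this gives the same sign to [om e x y] and
     to its opposite. *)
  have sgn (p q K : V) : qf K = -1 -> qf p = -1 -> qf q = -1 -> bil p K = 0 ->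
      bil q K <= 0 -> `|bil p q| <= 1 -> q + bil p q *: p != 0 -> 0 < om e p K ->
      0 < om e p q.
    move=> hK hp hq pK qK b' q0 o'; set q' := q + _ in q0.
    have qq' : qf q' <= 0.
      rewrite (_ : qf q' = (bil p q) ^+ 2 - 1).
        by rewrite subr_le0 -[_ ^+ 2]ger0_norm ?sqr_ge0// normrX expr_le1.
      by rewrite /q' /qf !bilE -/(qf p) -/(qf q) (bilC q p) hp hq; ring.
    have q'p : bil q' p = 0 by rewrite /q' !bilE -/(qf p) hp (bilC q p); ring.
    have q'K : bil K q' <= 0 by rewrite /q' bilC !bilE pK mulr0 addr0.
    have KK : qf K < 0 by rewrite hK.
    have pp : qf p < 0 by rewrite hp.
    have q'K' : bil K q' < 0.
      rewrite lt_neqAle q'K andbT; apply/eqP => h.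
      have [||h1 h2] := neg_orth_pos KK pp _ h _; rewrite 1?bilC//.
      by move/eqP: q0; apply; apply: h2; lra.
    have := @same_sheet e p K q' e0 pp; rewrite bilC pK => /(_ erefl q'p KK qq' q'K').
    rewrite (omC e K) (omC e q') mulrNN pmulr_rgt0//.
    by rewrite /q' !omE mulr0 addr0.
  have nb : `|b| <= 1 by rewrite ler_norml hb b1.
  have [y0|y0] := eqVneq (y + b *: x) 0.
    have yx : y = - b *: x by rewrite scaleNr; apply/eqP; rewrite -addr_eq0 y0.
    have b2 : b = 1 \/ b = -1.
      move: hy; rewrite yx /qf !bilE -/(qf x) hx => h.
      have : (b - 1) * (b + 1) = 0 by lra.
      move/eqP; rewrite mulf_eq0 subr_eq0 addr_eq0 => /orP[/eqP|/eqP]; by [left|right].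
    case: b2 => b2; last by move: xy; rewrite yx b2 opprK scale1r eqxx.
    rewrite b2 scaleN1r in yx.
    have xM0 : bil x M = 0 by apply: oppr_inj; rewrite -bilNl -yx yM oppr0.
    have := @same_sheet e x N M e0; rewrite hx hN hM bilC xN bilC xM0.
    move=> /(_ m1 erefl erefl m1 (ltW m1) NM).
    rewrite (omC e N) (omC e M) mulrNN pmulr_rgt0//.
    by move: oM; rewrite yx omNl; lra.
  have h1 := sgn x y N hN hx hy xN yN nb y0 oN.
  have : 0 < om e y x.
    apply: (sgn y x M hM hy hx yM xM); rewrite // (bilC y) -/b//.
    apply: contra_neq y0 => /eqP; rewrite addr_eq0 => /eqP h.
    have b2 : b ^+ 2 = 1.
      by move: hx; rewrite h /qf !bilE -/(qf y) hy; lra.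
    by rewrite h scalerN scalerA -expr2 b2 scale1r subrr.
  by rewrite omC; lra.
(* In the case [b > 1] both normals are projected to the orthogonal of [x] and [y], where they still
   lie on the same side. Then [x] and [y] belong to one sheet of the orthogonal of [M'], which makes
   [b] negative. *)
have b2 : 0 < b ^+ 2 - 1 by nra.
have b20 : b ^+ 2 - 1 != 0 by rewrite gt_eqF.
have [xN' yN' qN' oN' _] := pair_normal e0 hN hx hy xN b2 oN.
have b2' : 0 < (bil y x) ^+ 2 - 1 by rewrite bilC.
have [yM' xM' qM' oM' _] := pair_normal e0 hM hy hx yM b2' oM.
set N' := N - _ in xN' yN' qN' oN'; set M' := M - _ in yM' xM' qM' oM'.
have NM' : bil N' M' < 0.
  have -> : bil N' M' = bil N M - b * (bil y N * bil x M) / (b ^+ 2 - 1).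
    rewrite {1}/N' bilDl bilNl bilZl bilDl bilZl xM' yM' /M' bilDr bilNr bilZr.
    by rewrite bilDr bilZr (bilC N y) (bilC N x) xN (bilC y x) -/b; field.
  have := divr_ge0 (mulr_ge0 (le_trans ler01 (ltW b1)) (mulr_le0 yN xM)) (ltW b2).
  by lra.
have := @same_sheet e x N' M' e0; rewrite hx bilC xN' bilC xM'.
move=> /(_ m1 erefl erefl qN' (ltW qM') NM').
rewrite (omC e N') (omC e M') mulrNN pmulr_rgt0// => oxM'.
have : b < 0.
  by apply: (@same_sheet_lt0 e M' x y); rewrite ?hx ?hy// mulr_gt0.
by move: b1; lra.
Qed.

End Bilinear.

(** * Hyperbolic functions *)

Section HyperbolicFunctions.
Context {R : realType}.
Implicit Types x y s t c : R.

Definition cosh x : R := (expR x + expR (- x)) / 2.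
Definition sinh x : R := (expR x - expR (- x)) / 2.

Let expRxN x : expR x * expR (- x) = 1.
Proof. by rewrite -expRD subrr expR0. Qed.

Lemma cosh0 : cosh 0 = 1 :> R.
Proof. by rewrite /cosh oppr0 expR0; field. Qed.
Lemma sinh0 : sinh 0 = 0 :> R.
Proof. by rewrite /sinh oppr0 expR0; field. Qed.
Lemma coshN x : cosh (- x) = cosh x.
Proof. by rewrite /cosh opprK addrC. Qed.
Lemma sinhN x : sinh (- x) = - sinh x.
Proof. by rewrite /sinh opprK; field. Qed.
Lemma coshD x y : cosh (x + y) = cosh x * cosh y + sinh x * sinh y.
Proof. by rewrite /cosh /sinh opprD !expRD; field. Qed.
Lemma sinhD x y : sinh (x + y) = sinh x * cosh y + cosh x * sinh y.
Proof. by rewrite /cosh /sinh opprD !expRD; field. Qed.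
Lemma coshB x y : cosh (x - y) = cosh x * cosh y - sinh x * sinh y.
Proof. by rewrite coshD coshN sinhN mulrN. Qed.
Lemma sinhB x y : sinh (x - y) = sinh x * cosh y - cosh x * sinh y.
Proof. by rewrite sinhD coshN sinhN mulrN. Qed.

Lemma cosh2 x : cosh x ^+ 2 = 1 + sinh x ^+ 2.
Proof.
rewrite /cosh /sinh; have := expRxN x; move: (expR x) (expR (- x)) => a b h.
have -> : ((a + b) / 2) ^+ 2 = a * b + ((a - b) / 2) ^+ 2 by field.
by rewrite h.
Qed.

Lemma sinh_ge0 x : 0 <= x -> 0 <= sinh x.
Proof. by move=> x0; rewrite /sinh divr_ge0// subr_ge0 ler_expR; lra. Qed.
Lemma sinh_gt0 x : 0 < x -> 0 < sinh x.
Proof. by move=> x0; rewrite /sinh divr_gt0// subr_gt0 ltr_expR; lra. Qed.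
Lemma cosh_gt0 x : 0 < cosh x.
Proof. by rewrite /cosh divr_gt0// addr_gt0// expR_gt0. Qed.
Lemma cosh_ge1 x : 1 <= cosh x.
Proof. by have := cosh2 x; have := cosh_gt0 x; have := sqr_ge0 (sinh x); nra. Qed.

Lemma coshBcosh x y : cosh y - cosh x = 2 * sinh ((x + y) / 2) * sinh ((y - x) / 2).
Proof.
have {1}-> : y = (x + y) / 2 + (y - x) / 2 by field.
have {3}-> : x = (x + y) / 2 - (y - x) / 2 by field.
by rewrite coshD coshB; ring.
Qed.

Lemma ltr_cosh : {in `[0, +oo[ &, {mono cosh : x y / x < y}}.
Proof.
have h x y : 0 <= x -> x < y -> cosh x < cosh y.
  move=> x0 xy; rewrite -subr_gt0 coshBcosh; apply: mulr_gt0; last by apply: sinh_gt0; lra.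
  by apply: mulr_gt0 => //; apply: sinh_gt0; lra.
move=> x y; rewrite !in_itv/= !andbT => x0 y0; apply/idP/idP; last exact: h.
by apply: contraTT; rewrite -!leNgt le_eqVlt => /orP[/eqP ->//|/h-/(_ y0)/ltW].
Qed.

Lemma cosh_lt x y : 0 <= x -> 0 <= y -> (cosh x < cosh y) = (x < y).
Proof. by move=> x0 y0; rewrite ltr_cosh ?in_itv/= ?x0 ?y0. Qed.
Lemma cosh_le x y : 0 <= x -> 0 <= y -> (cosh x <= cosh y) = (x <= y).
Proof. by move=> x0 y0; rewrite !leNgt cosh_lt. Qed.
Lemma cosh_inj x y : 0 <= x -> 0 <= y -> cosh x = cosh y -> x = y.
Proof.
by move=> x0 y0 h; apply/eqP; rewrite eq_le -(cosh_le x0 y0) -(cosh_le y0 x0) h lexx.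
Qed.

Lemma cosh_abs x : cosh `|x| = cosh x.
Proof. by case: (ger0P x) => // _; rewrite coshN. Qed.

Let arcosh_arg s : 1 <= s -> 1 <= s + Num.sqrt (s ^+ 2 - 1).
Proof. by move=> s1; rewrite (le_trans s1)// lerDl sqrtr_ge0. Qed.

Lemma arcosh_ge0 s : 1 <= s -> 0 <= arcosh s.
Proof. by move=> s1; rewrite /arcosh ln_ge0// arcosh_arg. Qed.

Lemma cosh_arcosh s : 1 <= s -> cosh (arcosh s) = s.
Proof.
move=> s1; have h := arcosh_arg s1; rewrite /cosh expRN /arcosh lnK; last first.
  by rewrite posrE (lt_le_trans ltr01 h).
have q : Num.sqrt (s ^+ 2 - 1) ^+ 2 = s ^+ 2 - 1 by rewrite sqr_sqrtr//; nra.
move: q h; set r := Num.sqrt _ => q h.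
have r0 : s + r != 0 by rewrite gt_eqF// (lt_le_trans ltr01 h).
have -> : (s + r)^-1 = s - r.
  apply: (mulfI r0); rewrite divff//; lra.
by field.
Qed.

Lemma arcosh_cosh x : 0 <= x -> arcosh (cosh x) = x.
Proof.
move=> x0; have h := cosh_ge1 x.
by apply: cosh_inj; rewrite ?cosh_arcosh// arcosh_ge0.
Qed.

Lemma arcosh1 : arcosh 1 = 0 :> R.
Proof. by rewrite -cosh0 arcosh_cosh. Qed.

Lemma arcosh_le s t : 1 <= s -> s <= t -> arcosh s <= arcosh t.
Proof.
move=> s1 st; have t1 := le_trans s1 st.
by rewrite -cosh_le ?arcosh_ge0// !cosh_arcosh.
Qed.

Lemma arcosh_gt0 s : 1 < s -> 0 < arcosh s.
Proof.
by move=> s1; rewrite -cosh_lt ?arcosh_ge0 ?cosh_arcosh ?cosh0// ltW.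
Qed.

Lemma arcosh_le_cosh s x : 1 <= s -> 0 <= x -> s <= cosh x -> arcosh s <= x.
Proof. by move=> s1 x0 h; rewrite -[leRHS]arcosh_cosh// arcosh_le. Qed.

Lemma cosh_le_arcosh s x : 0 <= x -> cosh x <= s -> x <= arcosh s.
Proof. by move=> x0 h; rewrite -[leLHS]arcosh_cosh// arcosh_le// cosh_ge1. Qed.

Lemma continuous_cosh : continuous (@cosh).
Proof.
move=> x; apply: cvgMl; apply: cvgD; first exact: continuous_expR.
by apply: (continuous_comp (f := -%R) (g := expR));
  [exact: oppr_continuous|exact: continuous_expR].
Qed.

Lemma continuous_sinh : continuous (@sinh).
Proof.
move=> x; apply: cvgMl; apply: cvgB; first exact: continuous_expR.
by apply: (continuous_comp (f := -%R) (g := expR));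
  [exact: oppr_continuous|exact: continuous_expR].
Qed.

Lemma continuous_arcosh s : 1 <= s -> {for s, continuous (@arcosh R)}.
Proof.
move=> s1; apply: (continuous_comp (f := fun s : R => s + Num.sqrt (s ^+ 2 - 1))).
  apply: cvgD; first exact: cvg_id.
  apply: (continuous_comp (f := fun s : R => s ^+ 2 - 1)).
    by apply: cvgB; [exact: exprn_continuous|exact: cvg_cst].
  exact: sqrt_continuous.
by apply: continuous_ln; rewrite (lt_le_trans ltr01)// arcosh_arg.
Qed.

Lemma cos_sum_le0 x y : 0 <= x <= pi -> 0 <= y <= pi -> pi <= x + y ->
  cos x + cos y <= 0.
Proof.
move=> /andP[x0 xp] /andP[y0 yp] xy.
have : cos x <= cos (pi - y).
  rewrite leNgt ltr_cos ?in_itv/=; [|lra|lra].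
  by rewrite -leNgt; lra.
by rewrite addrC cosDpi cosN; lra.
Qed.

(** Two sides seen under angles whose cosines have a nonpositive sum: adding the two laws of cosines
    leaves the midpoint form of sinh-convexity. *)
Lemma cosh_sum_coslaw x y c1 c2 l1 l2 : 0 <= x -> 0 <= y ->
  cosh x * cosh y - sinh x * sinh y * c1 <= l1 ->
  cosh x * cosh y - sinh x * sinh y * c2 <= l2 -> c1 + c2 <= 0 ->
  2 * cosh x * cosh y <= l1 + l2.
Proof.
move=> x0 y0 h1 h2 c.
by have := mulr_ge0 (mulr_ge0 (sinh_ge0 x0) (sinh_ge0 y0)) (_ : 0 <= - (c1 + c2)); lra.
Qed.

End HyperbolicFunctions.

(** * Hyperbolic faces, polyhedral surfaces and chains *)

Section HyperbolicPoints.
Context {R : realType} {n : nat}.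
Local Notation V := 'cV[R]_(2 + n).
Implicit Types x y z N M : V.
Implicit Types F E : seq V.

(** The hyperbolic distance of two points of one face. For points of different faces it is the
    length of the chord in AdS, an upper bound for the distance on the surface. *)
Definition ch x y : R := arcosh (- bil x y).

Lemma chC x y : ch x y = ch y x. Proof. by rewrite /ch bilC. Qed.
Lemma chxx x : qf x = -1 -> ch x x = 0.
Proof. by rewrite /ch -/(qf x) => ->; rewrite opprK arcosh1. Qed.

Definition nrm x : V := (Num.sqrt (- qf x))^-1 *: x.

Lemma nrm_coef_gt0 x : qf x < 0 -> 0 < (Num.sqrt (- qf x))^-1.
Proof. by move=> h; rewrite invr_gt0 sqrtr_gt0; lra. Qed.

Lemma qf_nrm x : qf x < 0 -> qf (nrm x) = -1.
Proof.
move=> h; rewrite /nrm /qf !bilE -/(qf x).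
have s0 : Num.sqrt (- qf x) != 0 by rewrite gt_eqF// sqrtr_gt0; lra.
have {3}-> : qf x = - Num.sqrt (- qf x) ^+ 2 by rewrite sqr_sqrtr; lra.
by field.
Qed.

Lemma nrm_id x : qf x = -1 -> nrm x = x.
Proof. by rewrite /nrm => ->; rewrite opprK sqrtr1 invr1 scale1r. Qed.

Variable e : R.

(* The sheet of the hyperbolic space [N^perp] which is selected by [e]. *)
Definition hyp N x := [/\ qf x = -1, bil N x = 0 & 0 < om e x N].

Lemma hyp_ge1 N x y : e != 0 -> qf N = -1 -> hyp N x -> hyp N y ->
  1 <= - bil x y /\ (- bil x y = 1 -> x = y).
Proof.
move=> e0 hN [hx Nx ox] [hy Ny oy]; apply: (@sheet_ge1 _ _ e N) => //.
- by rewrite hN oppr_lt0.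
- by rewrite bilC.
- by rewrite bilC.
- by rewrite mulr_gt0.
Qed.

(* The hyperbolic law of cosines combined with the Cauchy-Schwarz inequality
   in [y^perp]. *)
Lemma hyp_tri N x y z : e != 0 -> qf N = -1 -> hyp N x -> hyp N y -> hyp N z ->
  ch x z <= ch x y + ch y z.
Proof.
move=> e0 hN hx hy hz.
have [xy1 _] := hyp_ge1 e0 hN hx hy.
have [yz1 _] := hyp_ge1 e0 hN hy hz.
have [xz1 _] := hyp_ge1 e0 hN hx hz.
have a0 := arcosh_ge0 xy1; have b0 := arcosh_ge0 yz1.
apply: arcosh_le_cosh => //; first exact: addr_ge0.
rewrite coshD !cosh_arcosh//.
case: hx hy hz => qx Nx _ [qy Ny _] [qz Nz _].
have := cosh2 (arcosh (- bil x y)); have := cosh2 (arcosh (- bil y z)).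
rewrite !cosh_arcosh//; have := sinh_ge0 a0; have := sinh_ge0 b0.
rewrite -!/(ch _ _); move: (sinh (ch y z)) (sinh (ch x y)) => s2 s1 s20 s10 e2 e1.
have NN : qf N < 0 by rewrite hN oppr_lt0.
have yy : qf y < 0 by rewrite qy oppr_lt0.
have : (bil x z + bil x y * bil y z) ^+ 2 <= (s1 * s2) ^+ 2.
  have := @spacelike_CS _ _ N y (x + bil x y *: y) (z + bil y z *: y) NN yy Ny.
  rewrite !bilE -/(qf y) -/(qf z) qy Nx Ny Nz (bilC y x) !mulr0 !addr0 !mulrN1 !subrr.
  move=> /(_ erefl erefl erefl erefl).
  rewrite /qf !bilE -/(qf y) -/(qf x) -/(qf z) qy qx qz (bilC y x) (bilC z y) => h.
  apply: (le_trans (le_trans _ h)); last by rewrite exprMn; nra.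
  by rewrite le_eqVlt; apply/orP; left; apply/eqP; ring.
rewrite -ler_sqrt ?sqr_ge0// !sqrtr_sqr (ger0_norm (mulr_ge0 s10 s20)) ler_norml.
by move=> /andP[h _]; lra.
Qed.

(** The hyperbolic sines of the two parts are [be] and [al] times that of the whole, so the addition
    formula for [cosh] reduces to the normalization of [y]. *)
Lemma ch_collinear N x y z (al be : R) : e != 0 -> qf N = -1 ->
  hyp N x -> hyp N y -> hyp N z -> 0 <= al -> 0 <= be ->
  y = al *: x + be *: z -> ch x y + ch y z = ch x z.
Proof.
move=> e0 hN hx hy hz al0 be0 ey.
have [xy1 _] := hyp_ge1 e0 hN hx hy.
have [yz1 _] := hyp_ge1 e0 hN hy hz.
have [xz1 _] := hyp_ge1 e0 hN hx hz.
have a0 := arcosh_ge0 xy1; have b0 := arcosh_ge0 yz1.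
apply: cosh_inj; rewrite ?addr_ge0 ?arcosh_ge0//.
rewrite coshD !cosh_arcosh//.
case: hx hy hz => qx _ _ [qy _ _] [qz _ _].
have := cosh2 (arcosh (- bil x y)); have := cosh2 (arcosh (- bil y z)).
have := cosh2 (arcosh (- bil x z)).
rewrite !cosh_arcosh//; have := sinh_ge0 a0; have := sinh_ge0 b0.
have := sinh_ge0 (arcosh_ge0 xz1).
rewrite -!/(ch _ _).
move: (sinh (ch y z)) (sinh (ch x y)) (sinh (ch x z)) => s2 s1 s s0 s20 s10 e3 e2 e1.
have b1 : bil x y = - al + be * bil x z by rewrite ey !bilE -/(qf x) qx; ring.
have b2 : bil y z = al * bil x z - be by rewrite ey !bilE -/(qf z) qz; ring.
have q1 : al ^+ 2 + be ^+ 2 - 2 * al * be * bil x z = 1.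
  move: qy; rewrite ey /qf !bilE -/(qf x) -/(qf z) qx qz (bilC z x); lra.
move: e1 e2 e3; rewrite b1 b2; move: (bil x z) q1 => c q1 e1 e2 e3.
have f1 : s1 = be * s.
  apply/eqP; rewrite -(eqrXn2 (n := 2))// ?mulr_ge0//; apply/eqP.
  rewrite exprMn; have -> : s ^+ 2 = c ^+ 2 - 1 by lra.
  have -> : s1 ^+ 2 = (- al + be * c) ^+ 2 - 1 by lra.
  lra.
have f2 : s2 = al * s.
  apply/eqP; rewrite -(eqrXn2 (n := 2))// ?mulr_ge0//; apply/eqP.
  rewrite exprMn; have -> : s ^+ 2 = c ^+ 2 - 1 by lra.
  have -> : s2 ^+ 2 = (al * c - be) ^+ 2 - 1 by lra.
  lra.
rewrite f1 f2.
have -> : be * s * (al * s) = al * be * (c ^+ 2 - 1).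
  have -> : c ^+ 2 - 1 = s ^+ 2 by lra.
  ring.
have -> : - c = - c * (al ^+ 2 + be ^+ 2 - 2 * al * be * c) by rewrite q1 mulr1.
ring.
Qed.

(** Unit timelike normals, pairwise equal or acausal with negative product. Support normals of an
    acausal surface have this property by [support_acausal], read with points and normals
    exchanged. *)
Definition good F := (forall N, N \in F -> qf N = -1) /\
  (forall N M, N \in F -> M \in F -> N = M \/ bil N M < -1).

Definition inF F x := forall N, N \in F -> bil N x <= 0.

Definition face F N x := [/\ N \in F, inF F x & hyp N x].

Definition surf F x := exists N, face F N x.

Lemma good_lt0 F N M : good F -> N \in F -> M \in F -> bil N M < 0.
Proof.
move=> [g1 g2] hN hM; have [->|] := g2 _ _ hN hM; last by lra.
by rewrite -/(qf M) g1// oppr_lt0.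
Qed.

Lemma good_sub F F' : good F -> {subset F' <= F} -> good F'.
Proof.
by move=> [g1 g2] s; split=> [N /s/g1//|N M /s hN /s hM]; exact: g2.
Qed.

(** The condition on [om] comes for free: two normals of planes through [x] are timelike in the
    orthogonal of [x], with negative product, hence in the same sheet. *)
Lemma surf_face F N x : e != 0 -> good F -> surf F x -> N \in F -> bil N x = 0 ->
  face F N x.
Proof.
move=> e0 gF [M [MF xF [qx Mx oM]]] NF Nx; split => //; split=> //.
have m1 : (-1 : R) < 0 by rewrite oppr_lt0.
have := @same_sheet _ _ e x M N e0; rewrite qx Mx Nx !(proj1 gF)//.
move=> /(_ m1 erefl erefl m1 (ltW m1) (good_lt0 gF MF NF)).
by rewrite (omC e M) (omC e N) mulrNN pmulr_rgt0.
Qed.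

Lemma surf_acausal F x y : e != 0 -> good F -> surf F x -> surf F y ->
  x = y \/ bil x y < -1.
Proof.
move=> e0 gF [N [NF xF [qx Nx oN]]] [M [MF yF [qy My oM]]].
apply: (@support_acausal _ _ e N M) => //; rewrite ?(proj1 gF)// 1?bilC ?yF ?xF//.
exact: (good_lt0 gF).
Qed.

Lemma surf_ge1 F x y : e != 0 -> good F -> surf F x -> surf F y -> 1 <= - bil x y.
Proof.
move=> e0 gF sx sy; have [<-|] := surf_acausal e0 gF sx sy; last by lra.
by case: sx => N [_ _ [qx _ _]]; rewrite -/(qf x) qx opprK.
Qed.

Lemma surf_qf F x : surf F x -> qf x = -1.
Proof. by case=> N [_ _ []]. Qed.

Inductive chain F : V -> V -> R -> Prop :=
| chain_nil x : surf F x -> chain F x x 0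
| chain_cons N x y z l : face F N x -> face F N y -> chain F y z l ->
    chain F x z (ch x y + l).

Lemma chain_cat F x y z l l' : chain F x y l -> chain F y z l' ->
  chain F x z (l + l').
Proof.
elim=> {x y l} [x _|N x y w l hx hy _ ih] h; first by rewrite add0r.
by rewrite -addrA; apply: (chain_cons hx hy); exact: ih.
Qed.

Lemma chain_edge F N x y : face F N x -> face F N y -> chain F x y (ch x y).
Proof.
by move=> hx hy; rewrite -[ch _ _]addr0; apply: (chain_cons hx hy); apply: chain_nil; exists N.
Qed.

Lemma chain_sym F x y l : chain F x y l -> chain F y x l.
Proof.
elim=> {x y l} [x h|N x y w l hx hy _ ih]; first exact: chain_nil.
by rewrite addrC; apply: (chain_cat ih); rewrite chC; exact: chain_edge hy hx.
Qed.

Lemma chain_surf F x y l : chain F x y l -> surf F x /\ surf F y.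
Proof.
elim=> {x y l} [x h//|N x y w l hx hy _ [_ h]]; by split=> //; exists N.
Qed.

Lemma face_ch_ge0 F N x y : e != 0 -> good F -> face F N x -> face F N y -> 0 <= ch x y.
Proof.
by move=> e0 gF hx hy; apply: arcosh_ge0; apply: (surf_ge1 e0 gF); exists N.
Qed.

Lemma chain_ge0 F x y l : e != 0 -> good F -> chain F x y l -> 0 <= l.
Proof.
move=> e0 gF; elim=> {x y l} // N x y w l hx hy _ ih.
by rewrite addr_ge0// (face_ch_ge0 e0 gF hx hy).
Qed.

End HyperbolicPoints.

(** * The minimum of finitely many affine functions *)

Section AffinePartition.
Context {R : realType} {T : eqType}.
Variables (f : T -> R -> R).
Hypothesis f_affine : forall i, exists A C, forall t, f i t = A + t * C.
Implicit Types (L : seq T) (s t u : R).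

Definition argmin L t i := i \in L /\ forall j, j \in L -> f i t <= f j t.

(** A subdivision into intervals for each of which some index is minimal at both ends; as the
    functions are affine, it is minimal in between. *)
Inductive part L : R -> R -> Prop :=
| part_one i s t : s <= t -> argmin L s i -> argmin L t i -> part L s t
| part_cat s u t : s <= u -> u <= t -> part L s u -> part L u t -> part L s t.

Lemma argmin_cons L t i j : argmin L t i -> f i t <= f j t -> argmin (j :: L) t i.
Proof.
move=> [iL h] hj; split=> [|k]; first by rewrite inE iL orbT.
by rewrite inE => /orP[/eqP->//|/h].
Qed.

Lemma argmin_head L t i j : argmin L t i -> f j t <= f i t -> argmin (j :: L) t j.
Proof.
move=> [iL h] hj; split=> [|k]; first by rewrite inE eqxx.
by rewrite inE => /orP[/eqP->//|/h]; apply: le_trans.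
Qed.

Lemma argmin_between L s t u i : s <= u <= t -> argmin L s i -> argmin L t i ->
  argmin L u i.
Proof.
move=> /andP[su ut] [iL hs] [_ ht]; split=> // j jL.
have [A [C e]] := f_affine i; have [A' [C' e']] := f_affine j.
have := hs j jL; have := ht j jL; rewrite !e !e'.
by have [c|c] := leP C C'; nra.
Qed.

(** On a piece with minimizer [i] the new function crosses [f i] at most once; if it does, the piece
    is cut at the crossing point [u]. *)
Lemma part_add L s t j : part L s t -> part (j :: L) s t.
Proof.
elim=> {s t} [i s t st hs ht|s u t su ut _ h1 _ h2]; last exact: part_cat h1 h2.
have [js|js] := leP (f j s) (f i s); have [jt|jt] := leP (f j t) (f i t).
- exact: (part_one st (argmin_head hs js) (argmin_head ht jt)).
- have [A [C e]] := f_affine i; have [A' [C' e']] := f_affine j.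
  rewrite !e !e' in js jt.
  have d0 : C' - C != 0 by apply/eqP => h; nra.
  have d1 : 0 < C' - C by nra.
  pose u := (A - A') / (C' - C).
  have uE : u * (C' - C) = A - A' by rewrite /u divfK.
  have su : s <= u by rewrite -(ler_pM2r d1) uE; lra.
  have ut : u <= t by rewrite -(ler_pM2r d1) uE; lra.
  have eu : f j u = f i u by rewrite e e'; lra.
  have hu : argmin L u i by apply: (argmin_between _ hs ht); rewrite su.
  apply: (part_cat su ut).
    by apply: (part_one su (argmin_head hs _) (argmin_head hu _)); rewrite ?eu// e e'.
  by apply: (part_one ut (argmin_cons hu _) (argmin_cons ht _)); rewrite ?eu// e e' ltW.
- have [A [C e]] := f_affine i; have [A' [C' e']] := f_affine j.
  rewrite !e !e' in js jt.
  have d0 : C - C' != 0 by apply/eqP => h; nra.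
  have d1 : 0 < C - C' by nra.
  pose u := (A' - A) / (C - C').
  have uE : u * (C - C') = A' - A by rewrite /u divfK.
  have su : s <= u by rewrite -(ler_pM2r d1) uE; lra.
  have ut : u <= t by rewrite -(ler_pM2r d1) uE; lra.
  have eu : f j u = f i u by rewrite e e'; lra.
  have hu : argmin L u i by apply: (argmin_between _ hs ht); rewrite su.
  apply: (part_cat su ut).
    by apply: (part_one su (argmin_cons hs _) (argmin_cons hu _)); rewrite ?eu// e e' ltW.
  by apply: (part_one ut (argmin_head hu _) (argmin_head ht _)); rewrite ?eu// e e'.
- exact: (part_one st (argmin_cons hs (ltW js)) (argmin_cons ht (ltW jt))).
Qed.

Lemma part_exists L s t : L != [::] -> s <= t -> part L s t.
Proof.
case: L => // i L _ st; elim: L i => [i|j L ih i].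
  by apply: (part_one (i := i) st); split=> [|j]; rewrite inE// => /eqP->.
exact/part_add/ih.
Qed.

End AffinePartition.

(** * Pushing a chord onto the polyhedral surface *)

Section PushedSegment.
Context {R : realType} {n : nat}.
Local Notation V := 'cV[R]_(2 + n).
Implicit Types (F : seq V) (N M : V).
Variables (e : R) (F : seq V) (a b nu : V).
Hypotheses (e0 : e != 0) (gF : good F) (qa : qf a = -1) (qb : qf b = -1).
Hypotheses (ab : bil a b < 0) (qnu : qf nu = -1) (anu : bil a nu = 0).
Hypotheses (bnu : bil b nu = 0) (onu : 0 < om e a nu).
Hypotheses (Fa : inF F a) (Fb : inF F b).

Let xx t := (1 - t) *: a + t *: b.
(** The chord point [xx t], moved in the direction [- nu], reaches the plane of [N] after the height
    [f N t]. The least height over [L] leads to the surface, and since heights are affine in [t] the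
    pushed chord is a chain. *)
Let f N t := bil N (xx t) / bil N nu.
Let L := [seq N <- F | bil N nu < 0].
Let P N t := nrm (xx t - f N t *: nu).

Let f_affine N : exists A C, forall t, f N t = A + t * C.
Proof.
exists (bil N a / bil N nu), ((bil N b - bil N a) / bil N nu) => t.
rewrite /f /xx !bilE; ring.
Qed.

Let q_xx t : 0 <= t <= 1 -> qf (xx t) < 0.
Proof.
move=> /andP[t0 t1]; rewrite /xx /qf !bilE -/(qf a) -/(qf b) qa qb (bilC b a).
have : t * (1 - t) * bil a b <= 0 by rewrite mulr_ge0_le0// ?mulr_ge0//; [lra|exact: ltW].
nra.
Qed.

Let xx_nu t : bil (xx t) nu = 0.
Proof. by rewrite /xx !bilE anu bnu; ring. Qed.

Let om_b : 0 < om e b nu.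
Proof.
have m1 : (-1 : R) < 0 by rewrite oppr_lt0.
have := @same_sheet _ _ e nu a b e0.
rewrite qa qb qnu => /(_ m1 anu bnu m1 (ltW m1) ab).
by rewrite pmulr_rgt0.
Qed.

Let om_xx t : 0 <= t <= 1 -> 0 < om e (xx t) nu.
Proof.
move=> /andP[t0 t1]; rewrite /xx !omE.
by have := onu; have := om_b; nra.
Qed.

Let hyp_xx t : 0 <= t <= 1 -> hyp e nu (nrm (xx t)).
Proof.
move=> t01; split; first exact/qf_nrm/q_xx.
- by rewrite /nrm bilZr bilC xx_nu mulr0.
- by rewrite /nrm omZl mulr_gt0 ?om_xx ?nrm_coef_gt0 ?q_xx.
Qed.

Let q_push t g : qf (xx t - g *: nu) = qf (xx t) - g ^+ 2.
Proof.
rewrite /qf; move: (xx t) (xx_nu t) => x hx; rewrite !bilE -/(qf nu) qnu (bilC nu x) hx; ring.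
Qed.

Let f_ge0 N t : N \in L -> 0 <= t <= 1 -> 0 <= f N t.
Proof.
rewrite mem_filter => /andP[D NF] /andP[t0 t1].
rewrite /f mulr_le0 ?invr_le0 ?(ltW D)// /xx !bilE.
by have := Fa NF; have := Fb NF; nra.
Qed.

Let face_push N t : 0 <= t <= 1 -> argmin f L t N -> face e F N (P N t).
Proof.
move=> t01 [NL hN]; have := NL; rewrite mem_filter => /andP[D NF].
have g0 := f_ge0 NL t01.
have qP : qf (xx t - f N t *: nu) < 0.
  by rewrite q_push; have := q_xx t01; have := sqr_ge0 (f N t); lra.
have NP : bil N (xx t - f N t *: nu) = 0.
  by rewrite bilDr bilNr bilZr /f divfK ?subrr// lt_eqF.
have k0 := nrm_coef_gt0 qP.
split=> // [M MF|].
  rewrite /P /nrm bilZr pmulr_rle0// bilDr bilNr bilZr subr_le0.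
  have Mx : bil M (xx t) <= 0.
    by rewrite /xx !bilE; have := Fa MF; have := Fb MF; case/andP: t01 => ? ?; nra.
  have [DM|DM] := ltP (bil M nu) 0; last exact: (le_trans Mx (mulr_ge0 g0 DM)).
  have := hN M; rewrite mem_filter DM MF => /(_ isT).
  by rewrite {2}/f ler_ndivlMr.
split; [exact: qf_nrm|by rewrite /P /nrm bilZr NP mulr0|].
rewrite /P /nrm omZl mulr_gt0//.
(* [J] is the vector orthogonal to [p] in the plane of [xx t] and [nu]. Its side is known from that
   of [nu], and it is compared with [N] inside the orthogonal of [p]. *)
pose s := - f N t / qf (xx t).
have qx0 : qf (xx t) != 0 by rewrite lt_eqF// q_xx.
have s0 : 0 <= s by rewrite /s mulr_le0 ?oppr_le0// invr_le0 ltW// q_xx.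
pose J := nu + s *: xx t.
set p := xx t - _ in qP NP *.
have sE : s * qf (xx t) = - f N t by rewrite /s divfK.
have pJ : bil p J = 0.
  rewrite /p /J; move: (xx t) (xx_nu t) sE => x hx sE'.
  by rewrite !bilE -/(qf nu) -/(qf x) qnu (bilC nu x) hx sE'; ring.
have oJ : 0 < om e p J.
  have -> : om e p J = (1 + f N t * s) * om e (xx t) nu.
    rewrite /p /J; move: (xx t) => x; rewrite !omE (omC e nu x); ring.
  by rewrite mulr_gt0// ?om_xx// ltr_wpDr// mulr_ge0.
have NJ : bil N J < 0.
  rewrite /J bilDr bilZr.
  have : bil N (xx t) <= 0.
    by rewrite /xx !bilE; have := Fa NF; have := Fb NF; case/andP: t01 => ? ?; nra.
  by move: D; nra.
have qN : qf N < 0 by rewrite (proj1 gF)// oppr_lt0.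
have qJ : qf J < 0.
  rewrite /J; move: (xx t) (xx_nu t) sE qx0 (q_xx t01) => x hx sE' _ hq.
  rewrite /qf !bilE -/(qf nu) -/(qf x) qnu (bilC nu x) hx.
  rewrite [ltLHS](_ : _ = -1 + s * (s * qf x)); last by ring.
  by rewrite sE' mulrN; move: (s * f N t) (mulr_ge0 s0 g0) => k k0'; lra.
have := @same_sheet _ _ e p J N e0 qP.
rewrite bilC pJ NP (bilC J) => /(_ erefl erefl qJ (ltW qN) NJ).
by rewrite (omC e J) (omC e N) mulrNN pmulr_rgt0.
Qed.

(** Pushing off the hyperbolic space orthogonal to [nu] is a contraction. With norms [r], [r'] of
    the chord points, heights [g], [g'] and norms [p], [p'] after the push, this follows from
    [r r' + g g' <= p p'] and from [r r' <= - X], the reverse Cauchy-Schwarz inequality on the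
    chord. *)
Let ch_push s t N : 0 <= s <= 1 -> 0 <= t <= 1 -> argmin f L s N -> argmin f L t N ->
  ch (P N s) (P N t) <= ch (nrm (xx s)) (nrm (xx t)).
Proof.
move=> s01 t01 hs ht.
have ge1 := surf_ge1 e0 gF (ex_intro _ N (face_push s01 hs)) (ex_intro _ N (face_push t01 ht)).
apply: arcosh_le => //.
have [X1 _] := hyp_ge1 e0 qnu (hyp_xx s01) (hyp_xx t01).
move: X1; rewrite /P /nrm !bilZl !bilZr !q_push.
set r := Num.sqrt (- qf (xx s)); set r' := Num.sqrt (- qf (xx t)).
have g0 := f_ge0 (proj1 hs) s01; have g0' := f_ge0 (proj1 ht) t01.
have r0 : 0 < r by rewrite sqrtr_gt0; have := q_xx s01; lra.
have r0' : 0 < r' by rewrite sqrtr_gt0; have := q_xx t01; lra.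
have r2 : r ^+ 2 = - qf (xx s) by rewrite sqr_sqrtr//; have := q_xx s01; lra.
have r2' : r' ^+ 2 = - qf (xx t) by rewrite sqr_sqrtr//; have := q_xx t01; lra.
have -> : bil (xx s - f N s *: nu) (xx t - f N t *: nu) = bil (xx s) (xx t) - f N s * f N t.
  move: (xx s) (xx_nu s) (xx t) (xx_nu t) => x hx y hy.
  rewrite !bilE -/(qf nu) qnu hx (bilC nu y) hy; ring.
move: g0 g0' r2 r2'; move: (f N s) (f N t) (qf (xx s)) (qf (xx t)) (bil (xx s) (xx t)).
move=> g g' A A' X g0 g0' r2 r2'.
have -> : A = - r ^+ 2 by lra.
have -> : A' = - r' ^+ 2 by lra.
rewrite !opprB !opprK.
set p := Num.sqrt _; set p' := Num.sqrt _.
have p2 : p ^+ 2 = g ^+ 2 + r ^+ 2 by rewrite sqr_sqrtr// addr_ge0 ?sqr_ge0.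
have p2' : p' ^+ 2 = g' ^+ 2 + r' ^+ 2 by rewrite sqr_sqrtr// addr_ge0 ?sqr_ge0.
have p0 : 0 < p by rewrite sqrtr_gt0 ltr_wpDl ?sqr_ge0// exprn_gt0.
have p0' : 0 < p' by rewrite sqrtr_gt0 ltr_wpDl ?sqr_ge0// exprn_gt0.
clearbody r r' p p'.
have -> : - (r^-1 * (r'^-1 * X)) = - X / (r * r') by field; rewrite !gt_eqF.
have -> : - (p^-1 * (p'^-1 * (X - g * g'))) = (- X + g * g') / (p * p').
  by field; rewrite !gt_eqF.
rewrite ler_pdivlMr ?mulr_gt0// mul1r => hX.
rewrite ler_pdivrMr ?mulr_gt0// mulrAC ler_pdivlMr ?mulr_gt0//.
have pp : r * r' + g * g' <= p * p'.
  have n1 : 0 <= r * r' + g * g' by rewrite addr_ge0// mulr_ge0// ltW.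
  have n2 : 0 <= p * p' by rewrite mulr_ge0// ltW.
  rewrite -(ler_pXn2r (n := 2))//.
  rewrite exprMn p2 p2' -subr_ge0 (_ : _ - _ = (r * g' - r' * g) ^+ 2) ?sqr_ge0//.
  ring.
have gg := mulr_ge0 g0 g0'; have rr := mulr_gt0 r0 r0'.
move: (g * g') (r * r') (p * p') gg rr pp hX => G Q W G0 Q0 hW hX.
have X0 : 0 <= - X by lra.
have := ler_wpM2l X0 hW; nra.
Qed.

Let ch_xx s u t : 0 <= s -> s <= u -> u <= t -> t <= 1 ->
  ch (nrm (xx s)) (nrm (xx u)) + ch (nrm (xx u)) (nrm (xx t)) =
  ch (nrm (xx s)) (nrm (xx t)).
Proof.
move=> s0 su ut t1.
have s01 : 0 <= s <= 1 by rewrite s0 (le_trans su)// (le_trans ut).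
have u01 : 0 <= u <= 1 by rewrite (le_trans s0 su) (le_trans ut).
have t01 : 0 <= t <= 1 by rewrite t1 (le_trans s0)// (le_trans su).
have hs := hyp_xx s01; have hu := hyp_xx u01; have ht := hyp_xx t01.
have [st|st] := ltP s t; last first.
  have -> : u = s by lra.
  by rewrite chxx ?add0r//; case: hs.
have ts0 : t - s != 0 by rewrite subr_eq0 gt_eqF.
pose k t := (Num.sqrt (- qf (xx t)))^-1.
have k0 t' : 0 <= t' <= 1 -> 0 < k t' by move=> h; exact/nrm_coef_gt0/q_xx.
have kge t' : 0 <= t' <= 1 -> 0 <= k t' by move=> /k0/ltW.
pose al := k u * ((t - u) / (t - s)) / k s.
pose be := k u * ((u - s) / (t - s)) / k t.
apply: (@ch_collinear _ _ e nu _ _ _ al be) => //.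
- by rewrite /al divr_ge0 ?kge// mulr_ge0 ?kge// divr_ge0//; lra.
- by rewrite /be divr_ge0 ?kge// mulr_ge0 ?kge// divr_ge0//; lra.
rewrite /nrm -/(k s) -/(k u) -/(k t) !scalerA.
have -> : al * k s = k u * ((t - u) / (t - s)) by rewrite /al divfK// gt_eqF// k0.
have -> : be * k t = k u * ((u - s) / (t - s)) by rewrite /be divfK// gt_eqF// k0.
rewrite -!scalerA -scalerDr; congr (_ *: _).
rewrite /xx !scalerDr !scalerA addrACA -!scalerDl.
by congr (_ *: _ + _ *: _); field.
Qed.

Lemma pushed_chain N M : N \in F -> bil N a = 0 -> bil N nu < 0 ->
  M \in F -> bil M b = 0 -> bil M nu < 0 ->
  exists2 l, l <= ch a b & chain e F a b l.
Proof.
move=> NF Na Nnu MF Mb Mnu.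
have NL : N \in L by rewrite mem_filter Nnu NF.
have ML : M \in L by rewrite mem_filter Mnu MF.
have x0 : xx 0 = a by rewrite /xx subr0 scale1r scale0r addr0.
have x1 : xx 1 = b by rewrite /xx subrr scale1r scale0r add0r.
have argP t K K' : argmin f L t K -> argmin f L t K' -> P K t = P K' t.
  move=> [k1 h1] [k2 h2]; rewrite /P; suff -> : f K t = f K' t by [].
  by apply/eqP; rewrite eq_le h1// h2.
have L0 : L != [::] by apply: contraTneq NL => ->.
have pt := @part_exists _ _ f f_affine L 0 1 L0 ler01.
suff [K [K' [l [hK hK' hl cl]]]] : exists K K' l, [/\ argmin f L 0 K, argmin f L 1 K',
    l <= ch (nrm (xx 0)) (nrm (xx 1)) & chain e F (P K 0) (P K' 1) l].
  have z0 : 0 <= (0 : R) <= 1 by rewrite lexx ler01.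
  have z1 : 0 <= (1 : R) <= 1 by rewrite lexx ler01.
  have Pa : P K 0 = a.
    rewrite (argP 0 K N)//; last first.
      by split=> // j jL; rewrite {1}/f x0 Na mul0r; exact: f_ge0.
    by rewrite /P /f x0 Na mul0r scale0r subr0 nrm_id.
  have Pb : P K' 1 = b.
    rewrite (argP 1 K' M)//; last first.
      by split=> // j jL; rewrite {1}/f x1 Mb mul0r; exact: f_ge0.
    by rewrite /P /f x1 Mb mul0r scale0r subr0 nrm_id.
  by rewrite x0 x1 !nrm_id// Pa Pb in hl cl; exists l.
have : forall s t, part f L s t -> 0 <= s -> t <= 1 ->
    exists K K' l, [/\ argmin f L s K, argmin f L t K',
    l <= ch (nrm (xx s)) (nrm (xx t)) & chain e F (P K s) (P K' t) l].
  move=> s t; elim=> {s t} [K s t st hs ht s0 t1|s u t su ut _ h1 _ h2 s0 t1].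
    have s01 : 0 <= s <= 1 by rewrite s0 (le_trans st).
    have t01 : 0 <= t <= 1 by rewrite t1 (le_trans s0).
    exists K, K, (ch (P K s) (P K t)); split=> //; first exact: ch_push.
    exact: chain_edge (face_push s01 hs) (face_push t01 ht).
  have [K [K1 [l [hK hK1 hl cl]]]] := h1 s0 (le_trans ut t1).
  have [K2 [K' [l' [hK2 hK' hl' cl']]]] := h2 (le_trans s0 su) t1.
  exists K, K', (l + l'); split=> //.
    by rewrite -(ch_xx s0 su ut t1) lerD.
  by apply: (chain_cat cl); rewrite (argP _ _ _ hK1 hK2).
by move=> /(_ _ _ pt (lexx _) (lexx _)).
Qed.

End PushedSegment.

Section ChainLength.
Context {R : realType} {n : nat}.
Local Notation V := 'cV[R]_(2 + n).
Variable (e : R).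
Hypothesis e0 : e != 0.
Implicit Types (F : seq V) (a b x y N : V).

(** The chord is pushed in the direction opposite to the common normal of [a] and [b] obtained from
    a normal at [a] by [pair_normal]. *)
Lemma chain_le_ch F a b : good F -> surf e F a -> surf e F b ->
  exists2 l, l <= ch a b & chain e F a b l.
Proof.
move=> gF sa sb; have [<-|ab] := surf_acausal e0 gF sa sb.
  by exists 0; [rewrite chxx// (surf_qf sa)|exact: chain_nil].
have [N [NF Fa [qa Na oa]]] := sa; have [M [MF Fb [qb Mb ob]]] := sb.
have qN := proj1 gF _ NF; have qM := proj1 gF _ MF.
have b2 : 0 < bil a b ^+ 2 - 1 by nra.
have [] := pair_normal e0 qN qa qb (etrans (bilC _ _) Na) b2 oa.
set K := N - _ => aK bK qK oK NK.
have k0 := nrm_coef_gt0 qK.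
have qnu := qf_nrm qK.
have anu : bil a (nrm K) = 0 by rewrite /nrm bilZr aK mulr0.
have bnu : bil b (nrm K) = 0 by rewrite /nrm bilZr bK mulr0.
have onu : 0 < om e a (nrm K) by rewrite /nrm omZr mulr_gt0.
have m1 : (-1 : R) < 0 by rewrite oppr_lt0.
have ab0 : bil a b < 0 by lra.
apply: (@pushed_chain _ _ e F a b (nrm K) e0 gF qa qb ab0 qnu anu bnu onu Fa Fb N M) => //.
  by rewrite /nrm bilZr NK pmulr_rlt0.
have ob' : 0 < om e b (nrm K).
  have := @same_sheet _ _ e (nrm K) a b e0.
  rewrite qa qb qnu => /(_ m1 anu bnu m1 (ltW m1) ab0).
  by rewrite pmulr_rgt0.
apply: (@same_sheet_lt0 _ _ e b) => //; rewrite ?qb ?qM ?qnu//; first by rewrite bilC.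
by rewrite (omC e M) (omC e (nrm K)) mulrNN mulr_gt0.
Qed.

End ChainLength.

(** * Removing planes from a polyhedron *)

Section ChainRemoval.
Context {R : realType} {n : nat}.
Local Notation V := 'cV[R]_(2 + n).
Variable (e : R).
Hypothesis e0 : e != 0.
Implicit Types (F D : seq V) (a b x y N K : V) (l : R).

(* The maximal pieces of the chain in the removed plane [K] are shortened to
   geodesics of that plane and then pushed onto the remaining faces. *)
Lemma chain_drop K F a b l : good (K :: F) -> chain e (K :: F) a b l -> surf e F b ->
  (surf e F a -> exists2 l', l' <= l & chain e F a b l') /\
  (face e (K :: F) K a ->
    exists y l', [/\ surf e F y, hyp e K y, chain e F y b l' & ch a y + l' <= l]).
Proof.
move=> gK; have gF : good F by apply: (good_sub gK) => N h; rewrite inE h orbT.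
have qK : qf K = -1 by apply: (proj1 gK); rewrite mem_head.
elim=> {a b l} [x _ sx|N x y z l fx fy cyz ih sz].
  split=> [_|[_ _ hx]]; first by exists 0 => //; exact: chain_nil.
  exists x, 0; split=> //; first exact: chain_nil.
  by rewrite chxx ?addr0// (surf_qf sx).
have {ih} [ih1 ih2] := ih sz.
have [NF|NF] := boolP (N \in F).
  have toF w : face e (K :: F) N w -> face e F N w.
    by move=> [_ h1 h2]; split=> // M MF; apply: h1; rewrite inE MF orbT.
  have fx' := toF _ fx; have fy' := toF _ fy.
  have [l' hl cl] := ih1 (ex_intro _ N fy').
  have cx := chain_cons fx' fy' cl.
  split=> [_|[_ _ hx]]; first by exists (ch x y + l'); rewrite ?lerD2l.
  exists x, (ch x y + l'); split=> //; first by exists N.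
  by rewrite chxx ?add0r ?lerD2l//; case: hx.
have NK : N = K by case: fx => + _ _; rewrite inE (negbTE NF) orbF => /eqP.
subst N; have [y0 [l' [sy0 hy0 cl hl]]] := ih2 fy.
have tri : ch x y0 + l' <= ch x y + l.
  have : ch x y0 <= ch x y + ch y y0.
    by apply: (@hyp_tri _ _ e K) => //; [case: fx|case: fy].
  lra.
split=> [sx|_]; last by exists y0, l'.
have [l1 hl1 c1] := chain_le_ch e0 gF sx sy0.
exists (l1 + l'); last exact: chain_cat c1 cl.
by apply: le_trans tri; rewrite lerD2r.
Qed.

Lemma chain_eq_mem F F' a b l : F =i F' -> chain e F a b l -> chain e F' a b l.
Proof.
move=> h; have fE N x : face e F N x -> face e F' N x.
  by move=> [NF xF hx]; split=> // [|M]; rewrite -h//; exact: xF.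
elim=> {a b l} [x [N /fE hN]|N x y z l /fE hx /fE hy _ ih].
  by apply: chain_nil; exists N.
exact: (chain_cons hx hy ih).
Qed.

Lemma surf_sub F F' x : {subset F' <= F} -> surf e F' x -> inF F x -> surf e F x.
Proof. by move=> s [N [NF _ hN]] xF; exists N; split=> //; exact: s. Qed.

(** The planes outside [F'] are removed one at a time. The endpoints remain on the intermediate
    surfaces, since they lie on the surface of [F'] and below all planes of [F]. *)
Lemma chain_restrict F F' a b l : good F -> {subset F' <= F} -> chain e F a b l ->
  surf e F' a -> surf e F' b -> exists2 l', l' <= l & chain e F' a b l'.
Proof.
move=> gF s c sa sb; pose D := [seq N <- F | N \notin F'].
have DF : F =i D ++ F'.
  move=> N; rewrite mem_cat mem_filter; have [/s->|] := boolP (N \in F') => //=.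
  by rewrite orbF.
have {c} := chain_eq_mem DF c.
have {gF} : good (D ++ F').
  by apply: (good_sub gF) => N; rewrite DF.
elim: D l {DF} => [|K D ih] l /= gD c; first by exists l.
have [[_ [_ Ia _]] [_ [_ Ib _]]] := chain_surf c.
have sD : {subset F' <= D ++ F'} by move=> N NF; rewrite mem_cat NF orbT.
have sK : {subset D ++ F' <= K :: D ++ F'} by move=> N NF; rewrite inE NF orbT.
have gD' := good_sub gD sK.
have sa' : surf e (D ++ F') a by apply: (surf_sub sD sa) => N /sK; exact: Ia.
have sb' : surf e (D ++ F') b by apply: (surf_sub sD sb) => N /sK; exact: Ib.
have [/(_ sa') [l1 h1 c1] _] := chain_drop gD c sb'.
by have [l2 h2 c2] := ih l1 gD' c1; exists l2 => //; exact: le_trans h1.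
Qed.

(** When every plane but that of [N] is removed, the chain lives in a single hyperbolic space, where
    the triangle inequality applies. *)
Lemma chain_ge_ch F N a b l : good F -> face e F N a -> face e F N b ->
  chain e F a b l -> ch a b <= l.
Proof.
move=> gF [NF _ ha] [_ _ hb] c.
have fN x : hyp e N x -> face e [:: N] N x.
  by move=> hx; split; rewrite ?inE// => M; rewrite inE => /eqP ->; case: hx => _ -> _.
have sN : {subset [:: N] <= F} by move=> M; rewrite inE => /eqP->.
have [l' hl c'] := chain_restrict gF sN c (ex_intro _ N (fN _ ha)) (ex_intro _ N (fN _ hb)).
apply: le_trans hl; elim: c' {c} ha hb => {a b l l'} [x _ [hx _ _] _|M x y z l].
  by rewrite chxx.
move=> [/[!inE]/eqP-> _ hx] [_ _ hy] _ ih _ hz.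
apply: (@le_trans _ _ (ch x y + ch y z)); last by rewrite lerD2l ih.
by apply: (hyp_tri e0 _ hx hy hz); exact: (proj1 gF).
Qed.

End ChainRemoval.

(** * The model plane and the angle swept by a path *)

Section HyperbolicModel.
Context {R : realType}.
Local Notation W := 'cV[R]_(2 + 2).
Implicit Types (r s t phi psi Theta : R).

Definition cosine_law r s c : R := cosh r * cosh s - sinh r * sinh s * c.

(* Geodesic polar coordinates of the hyperbolic plane in R^{1,2}, seen in R^{2,2}. *)
Definition mvec (x y z : R) : W :=
  col_mx (\col_(i < 2) if i == 0 then x else 0) (\col_(i < 2) if i == 0 then y else z).
Definition mnormal : W := col_mx (\col_(i < 2) if i == 0 then 0 else 1) 0.

Lemma bil_mvec x y z x' y' z' :
  bil (mvec x y z) (mvec x' y' z') = - (x * x') + y * y' + z * z'.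
Proof.
rewrite bil_coord /sp !big_ord_recl big_ord0 /tu /tv /mvec !col_mxEu !col_mxEd !mxE/=; ring.
Qed.

Lemma mvec_lin (a b : R) x y z x' y' z' : a *: mvec x y z + b *: mvec x' y' z' =
  mvec (a * x + b * x') (a * y + b * y') (a * z + b * z').
Proof.
rewrite /mvec !scale_col_mx add_col_mx; congr col_mx;
  apply/matrixP => i j; rewrite !mxE; case: ifP => // _; ring.
Qed.

Lemma mvecZ (a : R) x y z : a *: mvec x y z = mvec (a * x) (a * y) (a * z).
Proof.
rewrite -[LHS]addr0 -(scale0r (mvec x y z)) mvec_lin; congr mvec; ring.
Qed.

Lemma qf_mnormal : qf mnormal = -1.
Proof.
rewrite /qf bil_coord /sp /tu /tv /mnormal !col_mxEu !mxE/= big1 => [|i _]; first by ring.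
by rewrite !col_mxEd !mxE mul0r.
Qed.

Lemma hyp_mvec x y z : 0 < x -> - x ^+ 2 + y ^+ 2 + z ^+ 2 = -1 ->
  hyp 1 mnormal (mvec x y z).
Proof.
move=> x0 q; split.
- by rewrite /qf bil_mvec -q; ring.
- rewrite bil_coord /sp /tu /tv /mnormal /mvec !col_mxEu !mxE/= big1 => [|i _]; first by ring.
  by rewrite !col_mxEd !mxE mul0r.
- by rewrite /om /tu /tv /mnormal /mvec !col_mxEu !mxE/=; lra.
Qed.

Definition polar r phi := mvec (cosh r) (sinh r * cos phi) (sinh r * sin phi).

Lemma hyp_polar r phi : hyp 1 mnormal (polar r phi).
Proof.
apply: hyp_mvec; first exact: cosh_gt0.
by rewrite cosh2 !exprMn sin2cos2; ring.
Qed.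

Lemma bil_polar r s phi psi :
  - bil (polar r phi) (polar s psi) = cosine_law r s (cos (phi - psi)).
Proof. by rewrite bil_mvec cosB /cosine_law; ring. Qed.

Lemma cosine_law_ge1 r s phi : 1 <= cosine_law r s (cos phi).
Proof.
rewrite -(subr0 phi) -bil_polar.
by have [] := hyp_ge1 (oner_neq0 R) qf_mnormal (hyp_polar r phi) (hyp_polar s 0).
Qed.

Lemma cosine_law_tri r s t phi psi :
  arcosh (cosine_law r t (cos (phi + psi))) <=
  arcosh (cosine_law r s (cos phi)) + arcosh (cosine_law s t (cos psi)).
Proof.
have := hyp_tri (oner_neq0 R) qf_mnormal (hyp_polar r (phi + psi)) (hyp_polar s psi)
  (hyp_polar t 0).
by rewrite /ch !bil_polar !subr0 addrK.
Qed.

Lemma cosine_law_pi r s : cosine_law r s (-1) = cosh (r + s).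
Proof. by rewrite /cosine_law coshD; ring. Qed.

Lemma cosine_law0 r s : cosine_law r s 1 = cosh (r - s).
Proof. by rewrite /cosine_law coshB; ring. Qed.

Lemma cosine_law_mono r s c c' : 0 <= r -> 0 <= s -> c <= c' ->
  cosine_law r s c' <= cosine_law r s c.
Proof.
move=> r0 s0 cc; have := mulr_ge0 (sinh_ge0 r0) (sinh_ge0 s0).
by rewrite /cosine_law; nra.
Qed.

(* A lower bound for the length of a path that sweeps the angle [Theta]
   from distance [r] to distance [s] of the origin. *)
Definition sweep r s Theta (l : R) := 0 <= l /\
  if Theta < pi then cosine_law r s (cos Theta) <= cosh l else r + s <= l.

Lemma sweep_far r s Theta l : 0 <= r -> 0 <= s -> r + s <= l -> sweep r s Theta l.
Proof.
move=> r0 s0 h; have l0 : 0 <= l by rewrite (le_trans _ h)// addr_ge0.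
split=> //; case: ifP => // _; apply: (@le_trans _ _ (cosh (r + s))).
  by rewrite -cosine_law_pi cosine_law_mono// cos_geN1.
by rewrite cosh_le// addr_ge0.
Qed.

(** A triangle with angle [phi] at the origin is glued in front of the swept region. Below the total
    angle [pi] this is the triangle inequality in the model plane; beyond it the bound degenerates
    to the path through the origin. *)
Lemma sweep_add r s t phi psi a l : 0 < r -> 0 < s -> 0 < t ->
  0 <= phi <= pi -> 0 <= psi -> a = arcosh (cosine_law r s (cos phi)) ->
  sweep s t psi l -> sweep r t (phi + psi) (a + l).
Proof.
move=> /ltW r0 /ltW s0 /ltW t0 /andP[p0 p1] q0 ea [l0].
have a0 : 0 <= a by rewrite ea arcosh_ge0// cosine_law_ge1.
case: ltP => hpsi hl; last first.
  apply: sweep_far => //.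
  have : r <= a + s; last by lra.
  have := cosine_law_tri r s 0 phi 0.
  rewrite -ea addr0 cos0 cosine_law0 subr0 /cosine_law cosh0 sinh0 mulr1 mulr0 mul0r subr0.
  by rewrite !arcosh_cosh.
split; first exact: addr_ge0.
case: ltP => hs.
  rewrite -[leLHS]cosh_arcosh ?cosine_law_ge1//.
  rewrite cosh_le ?addr_ge0 ?arcosh_ge0 ?cosine_law_ge1//.
  apply: (le_trans (cosine_law_tri r s t phi psi)); rewrite -ea lerD2l.
  exact: (arcosh_le_cosh (cosine_law_ge1 _ _ _)).
(* As [pi - phi <= psi], the second part is at least as long as one that sweeps only [pi - phi], for
   which the two ends are opposite. *)
have := cosine_law_tri r s t phi (pi - phi).
rewrite addrC subrK cospi cosine_law_pi arcosh_cosh ?addr_ge0// -ea => h.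
apply: (le_trans h); rewrite lerD2l.
apply: arcosh_le_cosh => //; first exact: cosine_law_ge1.
apply: le_trans hl; apply: cosine_law_mono => //.
by rewrite leNgt ltr_cos ?in_itv/= -?leNgt; lra.
Qed.

End HyperbolicModel.

(** * Links of vertices *)

Section Links.
Context {R : realType} {n : nat}.
Local Notation V := 'cV[R]_(2 + n).
Variables (e : R) (E : seq V) (o : V).
Hypotheses (e0 : e != 0) (gE : good E) (qo : qf o = -1).
Hypotheses (Eo : forall K, K \in E -> bil K o = 0) (oE : forall K, K \in E -> 0 < om e o K).
Implicit Types (x y xi eta K : V) (r s l Theta : R) (Q : V -> Prop).

Let oo : qf o < 0. Proof. by rewrite qo oppr_lt0. Qed.
Let NN K : K \in E -> qf K < 0. Proof. by move=> /(proj1 gE) ->; rewrite oppr_lt0. Qed.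

Definition pt r xi : V := cosh r *: o + sinh r *: xi.

Definition lface K xi := [/\ K \in E, bil o xi = 0, qf xi = 1, inF E xi & bil K xi = 0].

Lemma bil_pt r s xi eta : bil o xi = 0 -> bil o eta = 0 ->
  - bil (pt r xi) (pt s eta) = cosine_law r s (bil xi eta).
Proof.
by move=> h1 h2; rewrite /pt !bilE -/(qf o) qo h2 (bilC xi) h1 /cosine_law; ring.
Qed.

Lemma hyp_center K : K \in E -> hyp e K o.
Proof. by move=> KE; split=> //; [exact: Eo|exact: oE]. Qed.

Lemma face_center K : K \in E -> face e E K o.
Proof. by move=> KE; split=> //; [move=> M /Eo ->|exact: hyp_center]. Qed.

Lemma face_pt K r xi : lface K xi -> 0 <= r -> face e E K (pt r xi).
Proof.
move=> [KE oxi qxi Exi Kxi] r0.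
have qp : qf (pt r xi) = -1.
  by rewrite /qf -[LHS]opprK bil_pt// -/(qf xi) qxi cosine_law0 subrr cosh0.
split=> // [M ME|]; first by rewrite /pt !bilE Eo// mulr0 add0r mulr_ge0_le0 ?sinh_ge0// Exi.
have Kp : bil K (pt r xi) = 0 by rewrite /pt !bilE Eo// Kxi; ring.
split=> //.
have := @same_sheet _ _ e K o (pt r xi) e0 (NN KE).
rewrite bilC Eo// bilC Kp => /(_ erefl erefl oo).
rewrite qp /pt !bilE -/(qf o) oxi qo => /(_ (ltW (ltrN10 _))).
rewrite mulr0 addr0 mulrN1 oppr_lt0 cosh_gt0 => /(_ isT).
by rewrite pmulr_rgt0 ?oE.
Qed.

Lemma face_dir K x : face e E K x -> x != o ->
  exists r xi, [/\ 0 < r, r = ch o x, x = pt r xi & forall M, face e E M x -> lface M xi].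
Proof.
move=> [KE Ex hx] xo.
have [h1 h2] := hyp_ge1 e0 (proj1 gE _ KE) (hyp_center KE) hx.
have r1 : 1 < - bil o x.
  rewrite lt_neqAle h1 andbT; apply: contra xo => /eqP h.
  by rewrite (h2 (esym h)).
have r0 := arcosh_gt0 r1; have s0 := sinh_gt0 r0; have cr := cosh_arcosh h1.
rewrite -/(ch o x) in r0 s0 cr.
exists (ch o x), ((sinh (ch o x))^-1 *: (x - cosh (ch o x) *: o)).
have s00 : sinh (ch o x) != 0 by rewrite gt_eqF.
split=> //; first by rewrite /pt scalerA divff// scale1r subrKC.
have qx : qf x = -1 by case: hx.
move=> M [ME _ [_ Mx _]]; split=> //.
- by rewrite !bilE -/(qf o) qo cr; ring.
- rewrite /qf !bilE -/(qf x) -/(qf o) qo qx (bilC x o).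
  have := cosh2 (ch o x); have -> : bil o x = - cosh (ch o x) by rewrite cr opprK.
  move: (cosh _) => c; move: (sinh _) s00 => s s00 c2.
  apply: (mulfI (expf_neq0 2 s00)).
  rewrite mulr1 [LHS](_ : _ = c ^+ 2 - 1); last by field.
  by rewrite c2; ring.
- move=> L LE; rewrite !bilE Eo// mulr0 subr0 mulr_ge0_le0 ?Ex//.
  by rewrite invr_ge0 ltW.
- by rewrite !bilE Eo// Mx; ring.
Qed.

Lemma lface_CS K xi eta : lface K xi -> lface K eta -> -1 <= bil xi eta <= 1.
Proof.
move=> [KE oxi qxi _ Kxi] [_ oeta qeta _ Keta].
have := spacelike_CS oo (NN KE) (etrans (bilC _ _) (Eo KE)) oxi Kxi oeta Keta.
by rewrite qxi qeta mulr1 => h; apply/andP; split; nra.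
Qed.

(** Broken arcs in the link of [o]. The predicate [Q] holds at every vertex; it serves to require
    that the rays in these directions stay inside the polyhedron for a given time. *)
Inductive lchain Q : V -> V -> R -> Prop :=
| lchain_nil K xi : lface K xi -> Q xi -> lchain Q xi xi 0
| lchain_cons K xi eta zeta Theta : lface K xi -> Q xi -> lface K eta ->
    lchain Q eta zeta Theta -> lchain Q xi zeta (acos (bil xi eta) + Theta).

Lemma lchain_cat Q x y z l l' : lchain Q x y l -> lchain Q y z l' ->
  lchain Q x z (l + l').
Proof.
elim=> {x y l} [K x _ _|K x y w l hx qx hy _ ih] h; first by rewrite add0r.
by rewrite -addrA; apply: (lchain_cons hx qx hy); exact: ih.
Qed.

Lemma lchain_sym Q x y l : lchain Q x y l -> lchain Q y x l.
Proof.
elim=> {x y l} [K x h q|K x y w l hx qx hy c ih]; first exact: (lchain_nil h).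
rewrite addrC; apply: (lchain_cat ih); rewrite bilC -[acos _]addr0.
apply: (lchain_cons hy _ hx); last exact: (lchain_nil hx).
by case: c.
Qed.

Lemma lchain_ge0 Q x y l : lchain Q x y l -> 0 <= l.
Proof.
elim=> {x y l} // K x y w l hx _ hy _ ih.
by rewrite addr_ge0// acos_ge0// (lface_CS hx hy).
Qed.

Lemma lchain_ends Q x y l : lchain Q x y l ->
  (exists K, lface K x) /\ (exists K, lface K y).
Proof.
elim=> {x y l} [K x h _|K x y w l hx _ hy _ [_ h]]; by split=> //; exists K.
Qed.

Lemma ch_pt r xi : bil o xi = 0 -> 0 <= r -> ch o (pt r xi) = r.
Proof.
by move=> h r0; rewrite /ch /pt !bilE -/(qf o) qo h mulr0 addr0 mulrN1 opprK arcosh_cosh.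
Qed.

Lemma pt_inj r s xi eta : bil o xi = 0 -> bil o eta = 0 -> 0 < r -> 0 < s ->
  pt r xi = pt s eta -> r = s /\ xi = eta.
Proof.
move=> h1 h2 r0 s0 h.
have rs : r = s by rewrite -(ch_pt h1 (ltW r0)) h ch_pt// ltW.
split=> //; move: h; rewrite rs /pt => /addrI/scalerI; apply.
by rewrite gt_eqF// sinh_gt0.
Qed.

(** A chain through [o] has length at least [r + s]. Any other chain is seen from [o] along the link
    chain formed by the directions of its vertices, and its triangles are added up by
    [sweep_add]. *)
Lemma chain_sweep r s xi eta l K K' : lface K xi -> lface K' eta -> 0 < r -> 0 < s ->
  chain e E (pt r xi) (pt s eta) l ->
  r + s <= l \/ exists2 Theta, lchain (fun=> True) xi eta Theta & sweep r s Theta l.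
Proof.
move=> Kxi Keta r0 s0.
move ea : (pt r xi) => a; move ep : (pt s eta) => p c.
elim: c r xi K Kxi r0 ea ep => {a p l} [x _|N x y z l fx fy c ih] r xi K Kxi r0 ea ep.
  have oxi : bil o xi = 0 by case: Kxi.
  have oeta : bil o eta = 0 by case: Keta.
  have [rs xieta] := pt_inj oxi oeta r0 s0 (etrans ea (esym ep)).
  right; exists 0; first by rewrite -xieta; apply: (lchain_nil Kxi).
  by split=> //; rewrite pi_gt0 cos0 cosine_law0 rs subrr.
have oxi : bil o xi = 0 by case: Kxi.
have Nxi : lface N xi.
  case: Kxi => KE _ qxi Exi _; split=> //; first by case: fx.
  case: fx => /Eo No _ [_ + _]; rewrite -ea /pt !bilE No mulr0 add0r => /eqP.
  by rewrite mulf_eq0 gt_eqF ?sinh_gt0// => /eqP.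
have qN : qf N = -1 by apply: (proj1 gE); case: Nxi.
have hx : hyp e N x by case: fx.
have hy : hyp e N y by case: fy.
have ho : hyp e N o by apply: hyp_center; case: Nxi.
have chx : ch x o = r by rewrite -ea chC ch_pt// ltW.
have [yo|yo] := eqVneq y o.
  left; rewrite yo chx lerD2l.
  have <- : ch o z = s by rewrite -ep ch_pt ?ltW//; case: Keta.
  have K'E : K' \in E by case: Keta.
  rewrite yo in c; apply: (chain_ge_ch e0 gE (face_center K'E) _ c).
  by rewrite -ep; apply: face_pt => //; exact: ltW.
have [t [zeta [t0 tE yE lz]]] := face_dir fy yo.
have Nz := lz _ fy.
have oz : bil o zeta = 0 by case: Nz.
have tri : r <= ch x y + t.
  by rewrite -chx tE (chC o); exact: (hyp_tri e0 qN hx hy ho).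
have [h|] := ih t zeta N Nz t0 (esym yE) ep; [by left; lra|case=> Theta cT sT].
right; exists (acos (bil xi zeta) + Theta).
  exact: (lchain_cons Nxi _ Nz).
have cs := lface_CS Nxi Nz.
apply: sweep_add sT => //; last 1 first.
- by rewrite acosK ?in_itv//= /ch -ea yE bil_pt.
- by rewrite acos_ge0// acos_lepi.
- exact: (lchain_ge0 cT).
Qed.

(** The points at distance one in the two directions are joined by a chain no longer than their
    chord. Its radial projection is a link chain, and the comparison of lengths shows that it is no
    longer than the ambient angle. *)
Lemma lchain_exists K K' xi eta : lface K xi -> lface K' eta ->
  bil xi eta <= -1 \/ exists Theta,
    [/\ lchain (fun=> True) xi eta Theta, Theta < pi & bil xi eta <= cos Theta].
Proof.
move=> Kxi Keta.
have oxi : bil o xi = 0 by case: Kxi.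
have oeta : bil o eta = 0 by case: Keta.
have fx := face_pt Kxi (@ler01 R); have fy := face_pt Keta (@ler01 R).
have [l hl c] := chain_le_ch e0 gE (ex_intro _ K fx) (ex_intro _ K' fy).
have l0 := chain_ge0 e0 gE c.
have s1 : 0 < sinh 1 :> R by exact: sinh_gt0.
have g1 := surf_ge1 e0 gE (ex_intro _ K fx) (ex_intro _ K' fy).
have hl' : cosh l <= cosine_law 1 1 (bil xi eta).
  rewrite -bil_pt// -[leRHS]cosh_arcosh// cosh_le//; exact: arcosh_ge0.
have far : 1 + 1 <= l -> bil xi eta <= -1.
  move=> h; have : cosh (1 + 1) <= cosh l by rewrite cosh_le.
  rewrite coshD => h'; have h2 := le_trans h' hl'.
  move: h2; rewrite /cosine_law => h2; rewrite -(ler_pM2l (mulr_gt0 s1 s1)); lra.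
have [/far|] := chain_sweep Kxi Keta ltr01 ltr01 c; [by left|case=> Theta cT [_ hs]].
move: hs; case: ifP => [hT h|_ /far]; last by left.
right; exists Theta; split=> //.
have := le_trans h hl'; rewrite /cosine_law => h2.
by rewrite -(ler_pM2l (mulr_gt0 s1 s1)); lra.
Qed.

Lemma lface_le1 K K' xi eta : lface K xi -> lface K' eta -> bil xi eta <= 1.
Proof.
move=> h1 h2; have [h|] := lchain_exists h1 h2; first by lra.
by case=> T [_ _ h]; apply: (le_trans h); exact: cos_le1.
Qed.

End Links.

(** * The straight segment across a sector *)

Section StraightLine.
Context {R : realType}.
Variables (tau Theta : R).
Hypotheses (tau0 : 0 < tau) (Theta0 : 0 <= Theta) (Theta_pi : Theta < pi).
Implicit Types psi : R.

Let k := sinh tau * cos (Theta / 2).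
(** The point in direction [psi] of the segment between the points at distance [tau] in the
    directions [- (Theta / 2)] and [Theta / 2]: the first two coordinates are in the constant ratio
    [cosh tau : k], so these points are on one geodesic. *)
Let mp psi := nrm (mvec (cosh tau * cos psi) (k * cos psi) (k * sin psi)).

Lemma cos_half_sector psi : - (Theta / 2) <= psi <= Theta / 2 ->
  0 < cos (Theta / 2) /\ cos (Theta / 2) <= cos psi.
Proof.
move=> /andP[p1 p2]; split.
  by rewrite cos_gt0_pihalf//; move: pi Theta_pi => p hp; lra.
have -> : cos psi = cos `|psi| by case: (ger0P psi) => // _; rewrite cosN.
have i1 : `|psi| \in `[0, pi].
  by rewrite in_itv/= normr_ge0 ler_norml; move: pi Theta_pi => p hp; lra.
have i2 : Theta / 2 \in `[0, pi].
  by rewrite in_itv/=; move: pi Theta_pi => p hp; lra.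
rewrite leNgt; apply/negP; rewrite (ltr_cos i2 i1).
by rewrite ltNge ler_norml p1 p2.
Qed.

Lemma straight_timelike psi : - (Theta / 2) <= psi <= Theta / 2 ->
  0 <= k /\ k < cosh tau * cos psi.
Proof.
move=> /cos_half_sector[c0 c1]; have s0 := sinh_gt0 tau0; split.
  by rewrite mulr_ge0// ltW.
have sc : sinh tau < cosh tau.
  by have := cosh2 tau; have := cosh_gt0 tau; move: s0; nra.
apply: (@le_lt_trans _ _ (sinh tau * cos psi)); first by rewrite ler_pM2l.
by rewrite ltr_pM2r// (lt_le_trans c0).
Qed.

Let qmv psi : qf (mvec (cosh tau * cos psi) (k * cos psi) (k * sin psi)) =
  k ^+ 2 - (cosh tau * cos psi) ^+ 2.
Proof. by rewrite /qf bil_mvec; have := cos2Dsin2 psi; rewrite /=; nra. Qed.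

Let qmv0 psi : - (Theta / 2) <= psi <= Theta / 2 ->
  qf (mvec (cosh tau * cos psi) (k * cos psi) (k * sin psi)) < 0.
Proof. by move=> /straight_timelike[k0 k1]; rewrite qmv; nra. Qed.

Let hyp_mp psi : - (Theta / 2) <= psi <= Theta / 2 -> hyp 1 mnormal (mp psi).
Proof.
move=> h; have q := qmv0 h; have k0 := nrm_coef_gt0 q; have q1 := qf_nrm q.
move: q1; rewrite /mp /nrm mvecZ => q1; apply: hyp_mvec.
  by rewrite mulr_gt0// mulr_gt0 ?cosh_gt0//; have [c c'] := cos_half_sector h; lra.
by move: q1; rewrite /qf bil_mvec => <-; ring.
Qed.

Lemma straight_add p1 p2 p3 : - (Theta / 2) <= p1 -> p1 <= p2 -> p2 <= p3 ->
  p3 <= Theta / 2 -> ch (mp p1) (mp p2) + ch (mp p2) (mp p3) = ch (mp p1) (mp p3).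
Proof.
move=> h1 h12 h23 h3.
have r1 : - (Theta / 2) <= p1 <= Theta / 2 by lra.
have r2 : - (Theta / 2) <= p2 <= Theta / 2 by lra.
have r3 : - (Theta / 2) <= p3 <= Theta / 2 by lra.
have [h13|h13] := ltP p1 p3; last first.
  have -> : p2 = p1 by lra.
  by rewrite chxx ?add0r//; case: (hyp_mp r1).
have s13 : 0 < sin (p3 - p1) by rewrite sin_gt0_pi//; move: pi Theta_pi => p hp; lra.
have s12 : 0 <= sin (p2 - p1) by rewrite sin_ge0_pi//; move: pi Theta_pi => p hp; lra.
have s23 : 0 <= sin (p3 - p2) by rewrite sin_ge0_pi//; move: pi Theta_pi => p hp; lra.
pose K p := (Num.sqrt (- qf (mvec (cosh tau * cos p) (k * cos p) (k * sin p))))^-1.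
have k1 : 0 < K p1 by exact/nrm_coef_gt0/qmv0.
have k2 : 0 < K p2 by exact/nrm_coef_gt0/qmv0.
have k3 : 0 < K p3 by exact/nrm_coef_gt0/qmv0.
apply: (ch_collinear (oner_neq0 R) qf_mnormal (hyp_mp r1) (hyp_mp r2) (hyp_mp r3)
  (al := K p2 * (sin (p3 - p2) / sin (p3 - p1)) / K p1)
  (be := K p2 * (sin (p2 - p1) / sin (p3 - p1)) / K p3)).
- by rewrite divr_ge0 ?(ltW k1)// mulr_ge0 ?(ltW k2)// divr_ge0// ltW.
- by rewrite divr_ge0 ?(ltW k3)// mulr_ge0 ?(ltW k2)// divr_ge0// ltW.
rewrite /mp /nrm -/(K p1) -/(K p2) -/(K p3) !scalerA !divfK ?gt_eqF//.
rewrite -(scalerA (K p2)) -(scalerA (K p2)) -scalerDr; congr (_ *: _).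
rewrite mvec_lin.
have c0 : sin (p3 - p1) != 0 by rewrite gt_eqF.
have ec : cos p2 = sin (p3 - p2) / sin (p3 - p1) * cos p1 + sin (p2 - p1) / sin (p3 - p1) * cos p3.
  have h : sin (p3 - p1) * cos p2 = sin (p3 - p2) * cos p1 + sin (p2 - p1) * cos p3.
    by rewrite !sinB; ring.
  by rewrite -[LHS](mulKf c0) h; field.
have es : sin p2 = sin (p3 - p2) / sin (p3 - p1) * sin p1 + sin (p2 - p1) / sin (p3 - p1) * sin p3.
  have h : sin (p3 - p1) * sin p2 = sin (p3 - p2) * sin p1 + sin (p2 - p1) * sin p3.
    by rewrite !sinB; ring.
  by rewrite -[LHS](mulKf c0) h; field.
congr mvec; [rewrite ec|rewrite ec|rewrite es]; ring.
Qed.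

Lemma straight_bil p1 p2 : bil (mvec (cosh tau * cos p1) (k * cos p1) (k * sin p1))
   (mvec (cosh tau * cos p2) (k * cos p2) (k * sin p2)) =
   - (cosh tau * cos p1 * (cosh tau * cos p2)) + k ^+ 2 * cos (p2 - p1).
Proof. by rewrite bil_mvec cosB; ring. Qed.

Lemma straight_ends : cosh (ch (mp (- (Theta / 2))) (mp (Theta / 2))) =
  cosine_law tau tau (cos Theta).
Proof.
have T0 : 0 <= Theta := Theta0.
have r1 : - (Theta / 2) <= - (Theta / 2) <= Theta / 2 by apply/andP; split; lra.
have r2 : - (Theta / 2) <= Theta / 2 <= Theta / 2 by lra.
have [h _] := hyp_ge1 (oner_neq0 R) qf_mnormal (hyp_mp r1) (hyp_mp r2).
rewrite cosh_arcosh// /mp /nrm !bilZl !bilZr straight_bil !qmv cosN opprK.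
have -> : Theta / 2 + Theta / 2 = Theta by field.
have [c0 _] := cos_half_sector r1.
have -> : - (k ^+ 2 - (cosh tau * cos (Theta / 2)) ^+ 2) = cos (Theta / 2) ^+ 2.
  rewrite /k; move: (cosh tau) (sinh tau) (cos _) (cosh2 tau) => a b c hab.
  by rewrite !exprMn hab; ring.
rewrite sqrtr_sqr gtr0_norm// /k /cosine_law; field.
by rewrite gt_eqF.
Qed.

End StraightLine.

(** * Shortcuts near a vertex *)

Section LocalGeometry.
Context {R : realType} {n : nat}.
Local Notation V := 'cV[R]_(2 + n).
Variables (e : R) (F : seq V) (o : V).
Hypotheses (e0 : e != 0) (gF : good F) (so : surf e F o).
Implicit Types (x y xi eta K N u : V) (r s t l Theta : R).

Definition active (F : seq V) o := [seq K <- F | bil K o == 0].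
Let E := active F o.

Lemma active_sub : {subset E <= F}.
Proof. by move=> K; rewrite mem_filter => /andP[]. Qed.

Lemma active_good : good E. Proof. exact: (good_sub gF active_sub). Qed.

Lemma active0 K : K \in E -> bil K o = 0.
Proof. by rewrite mem_filter => /andP[/eqP]. Qed.

Lemma active_om K : K \in E -> 0 < om e o K.
Proof.
move=> KE; have [_ _ [_ _ //]] := surf_face e0 gF so (active_sub KE) (active0 KE).
Qed.

Let qo : qf o = -1. Proof. exact: (surf_qf so). Qed.
Let gE := active_good.

Lemma active_face K x : face e F K x -> bil K o = 0 -> face e E K x.
Proof.
move=> [KF Fx hx] Ko; split=> // [|M /active_sub/Fx//].
by rewrite mem_filter Ko eqxx.
Qed.

Lemma face_inF K x : face e E K x -> inF F x -> face e F K x.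
Proof. by move=> [/active_sub KF _ hx] Fx; split. Qed.

Lemma nrm_pt (C S : R) xi : 0 < C -> 0 <= S -> S < C -> bil o xi = 0 -> qf xi = 1 ->
  exists2 r, 0 <= r & nrm (C *: o + S *: xi) = pt o r xi.
Proof.
move=> C0 S0 SC oxi qxi.
have q : - qf (C *: o + S *: xi) = C ^+ 2 - S ^+ 2.
  by rewrite /qf !bilE -/(qf o) -/(qf xi) qo qxi (bilC xi) oxi; ring.
pose m := Num.sqrt (C ^+ 2 - S ^+ 2).
have m2 : m ^+ 2 = C ^+ 2 - S ^+ 2 by rewrite sqr_sqrtr//; nra.
have m0 : 0 < m by rewrite sqrtr_gt0; nra.
have h1 : 1 <= C / m by rewrite ler_pdivlMr// mul1r; nra.
exists (arcosh (C / m)); first exact: arcosh_ge0.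
have sE : sinh (arcosh (C / m)) = S / m.
  have := cosh2 (arcosh (C / m)); rewrite cosh_arcosh// => h.
  apply/eqP; rewrite -(eqrXn2 (n := 2))// ?sinh_ge0 ?arcosh_ge0 ?divr_ge0 ?(ltW m0)//.
  apply/eqP; have -> : sinh (arcosh (C / m)) ^+ 2 = (C / m) ^+ 2 - 1 by rewrite h; ring.
  have -> : (C / m) ^+ 2 - 1 = (C ^+ 2 - m ^+ 2) / m ^+ 2 by field; rewrite gt_eqF.
  by rewrite {1}m2 expr_div_n; congr (_ / _); ring.
by rewrite /nrm q -/m /pt cosh_arcosh// sE scalerDr !scalerA ![m^-1 * _]mulrC.
Qed.

(* [t] is small enough for the ray of direction [xi] to stay in the region up to [t]. *)
Definition inside t xi := forall K, K \in F -> bil K o + t * bil K xi <= 0.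

Lemma inside_le s t xi : 0 <= s -> s <= t -> inside t xi -> inside s xi.
Proof.
move=> s0 st h K KF; have := h K KF.
have [_ [_ Fo _]] := so; have := Fo K KF.
by have [b|b] := leP (bil K xi) 0; nra.
Qed.

Lemma inside_small xi : inF E xi -> exists2 t, 0 < t & inside t xi.
Proof.
move=> Exi; rewrite /inside.
have : {subset F <= F} by [].
elim: {1 3}F => [|K L ih] sL; first by exists 1.
have [t t0 ht] := ih (fun N NL => sL N (mem_behead (NL : N \in behead (K :: L)))).
have KF : K \in F by apply: sL; rewrite mem_head.
have [_ [_ Fo _]] := so; have Ko := Fo K KF.
suff [s s0 hs] : exists2 s, 0 < s & forall r, 0 <= r <= s -> bil K o + r * bil K xi <= 0.
  exists (Num.min s t); first by rewrite lt_min s0.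
  move=> N; rewrite inE => /orP[/eqP->|NL].
    by apply: hs; rewrite ge_min lexx le_min (ltW s0) ltW.
  have Nt := ht N NL; have NF : N \in F by apply: sL; rewrite inE NL orbT.
  have := Fo N NF.
  have : 0 <= Num.min s t <= t by rewrite ge_min lexx orbT le_min (ltW s0) ltW.
  move: (Num.min s t) => r /andP[r0 rt].
  by have [b|b] := leP (bil N xi) 0; nra.
have [Ko0|Ko0] := eqVneq (bil K o) 0.
  exists 1 => // r /andP[r0 _]; rewrite Ko0 add0r mulr_ge0_le0// Exi//.
  by rewrite mem_filter Ko0 eqxx.
have Kn : 0 < - bil K o by rewrite oppr_gt0 lt_neqAle Ko0.
have d0 : 0 < 1 + `|bil K xi| by rewrite ltr_pwDl.
exists (- bil K o / (1 + `|bil K xi|)); first by rewrite divr_gt0.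
move=> r /andP[r0]; rewrite ler_pdivlMr// => h.
have := ler_norm (bil K xi); nra.
Qed.

Lemma lchain_inside xi eta Theta : lchain E o (fun=> True) xi eta Theta ->
  exists2 t, 0 < t & forall s, 0 <= s -> s <= t -> lchain E o (inside s) xi eta Theta.
Proof.
elim=> {xi eta Theta} [K xi hxi _|K xi eta zeta Theta hxi _ heta _ [t t0 ih]].
  have [t t0 ht] : exists2 t, 0 < t & inside t xi by apply: inside_small; case: hxi.
  by exists t => // s s0 st; apply: (lchain_nil hxi); exact: inside_le ht.
have [t' t'0 ht'] : exists2 t, 0 < t & inside t xi by apply: inside_small; case: hxi.
exists (Num.min t t'); first by rewrite lt_min t0.
move=> s s0; rewrite le_min => /andP[st st'].
by apply: (lchain_cons hxi _ heta (ih _ s0 st)); exact: inside_le ht'.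
Qed.

(* Development of a sector of angle less than [pi] in the hyperbolic plane. *)
Lemma shortcut tau xi eta Theta : 0 < tau -> Theta < pi ->
  lchain E o (inside (sinh tau)) xi eta Theta ->
  exists2 l, l < 2 * tau & chain e F (pt o tau xi) (pt o tau eta) l.
Proof.
move=> tau0 Tpi c; have T0 := lchain_ge0 gE qo (@active0) c.
pose k := sinh tau * cos (Theta / 2).
(* [P psi x] is the point of the polyhedron that corresponds to [mp psi] when the link direction [x]
   is developed to the angle [psi]. *)
pose P psi x := nrm ((cosh tau * cos psi) *: o + k *: x).
pose mp psi := nrm (mvec (cosh tau * cos psi) (k * cos psi) (k * sin psi)).
have [ch0 _] : 0 < cos (Theta / 2) /\ cos (Theta / 2) <= cos (Theta / 2).
  by apply: cos_half_sector => //; lra.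
have aux (q C t a b : R) : 0 < C -> q <= t * C -> a <= 0 -> 0 <= q -> a + t * b <= 0 ->
    C * a + q * b <= 0.
  move=> C0 kk Mo q0 h.
  have [b0|b0] := leP b 0; first by have := mulr_ge0_le0 q0 b0; nra.
  have : q * b <= t * C * b by rewrite ler_pM2r.
  have : C * (a + t * b) <= 0 by rewrite pmulr_rle0.
  by lra.
have fP psi K x : - (Theta / 2) <= psi <= Theta / 2 -> lface E o K x ->
    inside (sinh tau) x -> face e F K (P psi x).
  move=> hpsi Kx ix.
  have [k0 kC] := straight_timelike tau0 Tpi hpsi; rewrite -/k in k0 kC.
  have C0 := le_lt_trans k0 kC.
  have [_ ox qx _ _] := Kx.
  have [r r0 rE] := nrm_pt C0 k0 kC ox qx.
  apply: face_inF; first by rewrite /P rE; exact: (face_pt e0 gE qo (@active0) active_om Kx r0).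
  move=> M MF; rewrite /P /nrm bilZr pmulr_rle0; last first.
    apply: nrm_coef_gt0.
    by rewrite /qf !bilE -/(qf o) -/(qf x) qo qx (bilC x) ox; nra.
  rewrite !bilE; have iM := ix M MF; have [_ [_ Fo _]] := so; have Mo := Fo M MF.
  have [_ cc] := cos_half_sector Tpi hpsi.
  have kk : k <= sinh tau * (cosh tau * cos psi).
    rewrite /k ler_pM2l ?sinh_gt0// (le_trans cc)// ler_peMl ?cosh_ge1//.
    exact: le_trans (ltW ch0) cc.
  exact: (aux _ _ _ _ _ C0 kk Mo k0 iM).
have chP p1 p2 x y : bil o x = 0 -> bil o y = 0 -> qf x = 1 -> qf y = 1 ->
    bil x y = cos (p2 - p1) -> ch (P p1 x) (P p2 y) = ch (mp p1) (mp p2).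
  move=> ox oy qx qy xy; rewrite /ch /P /mp /nrm !bilZl !bilZr straight_bil.
  have qE psi z : bil o z = 0 -> qf z = 1 -> qf ((cosh tau * cos psi) *: o + k *: z) =
      qf (mvec (cosh tau * cos psi) (k * cos psi) (k * sin psi)).
    move=> oz qz; rewrite /qf straight_bil subrr cos0 !bilE -/(qf o) -/(qf z).
    by rewrite qo qz (bilC z) oz /k; ring.
  rewrite !qE//; congr (arcosh (- (_ * (_ * _)))).
  by rewrite !bilE -/(qf o) qo (bilC x) ox oy xy /k; ring.
have endP x : bil o x = 0 -> qf x = 1 -> nrm (cos (Theta / 2) *: pt o tau x) = pt o tau x.
  move=> ox qx.
  have q1 : bil (pt o tau x) (pt o tau x) = -1.
    by rewrite -[LHS]opprK (bil_pt qo)// -/(qf x) qx cosine_law0 subrr cosh0.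
  rewrite /nrm /qf bilZl bilZr q1 !mulrN mulr1 opprK -expr2 sqrtr_sqr gtr0_norm//.
  by rewrite scalerA mulVf ?scale1r// gt_eqF.
(* [phi] is the angle already swept. Consecutive vertices of the link chain cut the straight segment
   into pieces whose lengths add up by [straight_add]. *)
have main phi x y T : lchain E o (inside (sinh tau)) x y T -> 0 <= phi -> phi + T = Theta ->
    chain e F (P (phi - Theta / 2) x) (P (Theta / 2) y)
      (ch (mp (phi - Theta / 2)) (mp (Theta / 2))).
  move=> cT; elim: cT phi => {x y T} [K x Kx ix|K x z y T Kx ix Kz cT ih] phi phi0 phiT.
    have -> : phi - Theta / 2 = Theta / 2 by lra.
    have r : - (Theta / 2) <= Theta / 2 <= Theta / 2 by lra.
    have [_ ox qx _ _] := Kx.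
    rewrite -(@chP _ _ x x)//; last by rewrite subrr cos0.
    apply: (chain_edge (N := K)); exact: fP.
  have T1 := lchain_ge0 gE qo (@active0) cT.
  have b1 := lface_CS gE qo (@active0) Kx Kz.
  have a0 := acos_ge0 b1.
  have cT' := ih (phi + acos (bil x z)); rewrite -addrA phiT addr_ge0// in cT'.
  have {}cT' := cT' isT erefl.
  have r1 : - (Theta / 2) <= phi - Theta / 2 <= Theta / 2 by lra.
  have r2 : - (Theta / 2) <= phi + acos (bil x z) - Theta / 2 <= Theta / 2 by lra.
  rewrite -(straight_add tau0 Tpi (p2 := phi + acos (bil x z) - Theta / 2)) -/k; [|lra..].
  have [_ ox qx _ _] := Kx; have [_ oz qz _ _] := Kz.
  rewrite -(@chP _ _ x z)//; last first.
    by rewrite -[LHS](acosK (x := bil x z)) ?in_itv//=; congr cos; ring.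
  apply: (chain_cons (N := K)) cT'; apply: fP => //.
  by case: cT.
have := main 0 xi eta Theta c (lexx _) (add0r _); rewrite sub0r.
have [[K1 [_ ox qx _ _]] [K2 [_ oy qy _ _]]] := lchain_ends c.
have PE psi x : cos psi = cos (Theta / 2) -> bil o x = 0 -> qf x = 1 ->
    P psi x = pt o tau x.
  move=> hc hx qx'; rewrite -[RHS](endP _ hx qx') /P hc /pt scalerDr !scalerA /k.
  by rewrite (mulrC (cosh tau) (cos _)) (mulrC (sinh tau) (cos _)).
rewrite !PE ?cosN// => cc.
exists (ch (mp (- (Theta / 2))) (mp (Theta / 2))) => //.
have l0 := chain_ge0 e0 gF cc.
have cT : -1 < cos Theta.
  by rewrite -cospi ltr_cos ?in_itv/= ?pi_ge0 ?lexx ?T0 ?(ltW Tpi).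
have t2 : 0 <= 2 * tau by rewrite mulr_ge0// ltW.
rewrite -(cosh_lt l0 t2) (straight_ends tau0 T0 Tpi) mulr2n mulrDl mul1r.
rewrite -cosine_law_pi /cosine_law ltrD2l ltrN2 ltr_pM2l//.
by rewrite mulr_gt0// sinh_gt0.
Qed.

End LocalGeometry.

(** * Locally minimizing chains and comparison at a corner *)

Section Corners.
Context {R : realType} {n : nat}.
Local Notation V := 'cV[R]_(2 + n).
Variables (e : R) (F : seq V).
Hypotheses (e0 : e != 0) (gF : good F).
Implicit Types (x y z o p xi eta K N u v : V) (r s t l h L Theta : R) (A : seq V).

(* Tangent vector at time [r] of the geodesic [s |-> pt o s u]. *)
Definition pt' o r u : V := sinh r *: o + cosh r *: u.

Lemma pt_add o r s u : pt o (r + s) u = pt (pt o r u) s (pt' o r u).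
Proof.
rewrite /pt /pt' coshD sinhD !scalerDr !scalerA addrACA -!scalerDl.
by congr (_ *: _ + _ *: _); ring.
Qed.

Lemma pt_neg o r u : pt o r (- u) = pt o (- r) u.
Proof. by rewrite /pt coshN sinhN scalerN scaleNr. Qed.

Lemma pt0 o u : pt o 0 u = o.
Proof. by rewrite /pt cosh0 sinh0 scale1r scale0r addr0. Qed.

Lemma pt'_orth o r u : qf o = -1 -> bil o u = 0 -> qf u = 1 ->
  bil (pt o r u) (pt' o r u) = 0 /\ qf (pt' o r u) = 1.
Proof.
move=> qo ou qu; have := cosh2 r; rewrite /qf /pt /pt' !bilE -/(qf o) -/(qf u).
by rewrite qo qu (bilC u o) ou => h; split; [ring|lra].
Qed.

Lemma dir_lface o N h u : face e F N o -> face e F N (pt o h u) -> 0 < h ->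
  bil o u = 0 -> qf u = 1 -> lface (active F o) o N u.
Proof.
move=> [NF Fo [qo No _]] [_ Fp [_ Np _]] h0 ou qu.
have s0 := sinh_gt0 h0.
split=> //; first by rewrite mem_filter No eqxx.
- move=> K; rewrite mem_filter => /andP[/eqP Ko KF].
  by have := Fp K KF; rewrite /pt !bilE Ko mulr0 add0r pmulr_rle0.
- by move: Np; rewrite /pt !bilE No mulr0 add0r => /eqP; rewrite mulf_eq0 gt_eqF// => /eqP.
Qed.

Lemma face_between o N r s u : face e F N o -> face e F N (pt o r u) -> 0 < r ->
  bil o u = 0 -> qf u = 1 -> 0 <= s <= r -> face e F N (pt o s u).
Proof.
move=> fo fp r0 ou qu /andP[s0 sr].
have lu := dir_lface fo fp r0 ou qu.
have so : surf e F o by exists N.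
apply: face_inF.
  exact: (face_pt e0 (active_good _ gF) (surf_qf so) (@active0 _ _ F o) (active_om e0 gF so) lu s0).
move=> K KF; have [_ Fo _] := fo; have [_ Fp _] := fp.
have := Fo K KF; have := Fp K KF; rewrite /pt !bilE => h1 h2.
have : sinh r * (cosh s * bil K o + sinh s * bil K u) =
   sinh (r - s) * bil K o + sinh s * (cosh r * bil K o + sinh r * bil K u).
  by rewrite sinhB; ring.
have := mulr_ge0_le0 (sinh_ge0 (_ : 0 <= r - s)) h2; rewrite subr_ge0 => /(_ sr).
have := mulr_ge0_le0 (sinh_ge0 s0) h1 => h3 h4 h5.
by rewrite -(pmulr_rle0 _ (sinh_gt0 r0)) h5; lra.
Qed.

(** The directions of the two sides at [o] are at distance at least [pi] in the link, the
    infinitesimal form of local minimality. *)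
Definition corner o u v := forall Theta,
  lchain (active F o) o (fun=> True) u v Theta -> pi <= Theta.

(** A link chain shorter than [pi] develops into a convex sector, whose chord is a shortcut near
    [o]. *)
Lemma minimal_corner o u v d : surf e F o -> 0 < d ->
  (forall s l, 0 < s -> s <= d -> chain e F (pt o s u) (pt o s v) l -> 2 * s <= l) ->
  corner o u v.
Proof.
move=> so d0 hmin T c; rewrite leNgt; apply/negP => Tpi.
have [t t0 ht] := lchain_inside so c.
have t1 : 1 <= Num.sqrt (1 + t ^+ 2).
  by rewrite -{1}(sqrtr1 R) ler_wsqrtr// lerDl sqr_ge0.
(* The second term is the inverse hyperbolic sine of [t], so that [sinh tau <= t] and the developed
   sector stays inside the polyhedron. *)
pose tau := Num.min d (arcosh (Num.sqrt (1 + t ^+ 2))).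
have a0 : 0 < arcosh (Num.sqrt (1 + t ^+ 2)).
  apply: arcosh_gt0; rewrite -{1}(sqrtr1 R) ltr_sqrt; first by rewrite ltrDl exprn_gt0.
  by rewrite ltr_wpDr ?sqr_ge0.
have tau0 : 0 < tau by rewrite lt_min d0.
have st : sinh tau <= t.
  rewrite leNgt; apply/negP => h.
  have : tau <= arcosh (Num.sqrt (1 + t ^+ 2)) by rewrite ge_min lexx orbT.
  rewrite -cosh_le ?cosh_arcosh ?(ltW tau0) ?(ltW a0)// => h1.
  have := cosh2 tau; have := cosh_gt0 tau; have : Num.sqrt (1 + t ^+ 2) ^+ 2 = 1 + t ^+ 2.
    by rewrite sqr_sqrtr// addr_ge0// sqr_ge0.
  by move: h1 h t0 t1; nra.
have [l hl cl] := shortcut e0 gF so tau0 Tpi (ht _ (sinh_ge0 (ltW tau0)) st).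
have := hmin tau l tau0 _ cl; rewrite ge_min lexx => /(_ isT).
by move: hl; lra.
Qed.

Section Balance.
Variables (o u v N N' : V).
Hypotheses (so : surf e F o) (lu : lface (active F o) o N u).
Hypotheses (lv : lface (active F o) o N' v) (cuv : corner o u v).

Let gE := active_good o gF.
Let qo := surf_qf so.
Let Eo := @active0 _ _ F o.
Let oE := active_om e0 gF so.

Lemma corner_cos Theta1 Theta2 xi : lchain (active F o) o (fun=> True) u xi Theta1 ->
  lchain (active F o) o (fun=> True) xi v Theta2 -> Theta1 < pi -> Theta2 < pi ->
  cos Theta1 + cos Theta2 <= 0.
Proof.
move=> c1 c2 h1 h2; apply: cos_sum_le0; last exact/cuv/(lchain_cat c1 c2).
- by rewrite (lchain_ge0 gE qo Eo c1) ltW.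
- by rewrite (lchain_ge0 gE qo Eo c2) ltW.
Qed.

(** Link chains from [u] to [xi] and from [xi] to [v] have total length at least [pi], so their
    cosines have a nonpositive sum; [lchain_exists] provides chains whose cosines dominate the
    products with [xi]. *)
Lemma link_sum K xi : lface (active F o) o K xi -> bil u xi + bil v xi <= 0.
Proof.
move=> lx.
have u1 := lface_le1 e0 gE qo Eo oE lu lx.
have v1 := lface_le1 e0 gE qo Eo oE lv lx.
have [h|] := lchain_exists e0 gE qo Eo oE lu lx; [by lra|case=> T1 [c1 T1pi b1]].
have [h|] := lchain_exists e0 gE qo Eo oE lv lx; [by lra|case=> T2 [c2 T2pi b2]].
by have := corner_cos c1 (lchain_sym c2) T1pi T2pi; lra.
Qed.

Lemma seq_argmin (T : eqType) (f : T -> R) (s : seq T) : s != [::] ->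
  exists2 i, i \in s & forall j, j \in s -> f i <= f j.
Proof.
case: s => // i s _; elim: s i => [|j s ih] i; first by exists i; [rewrite inE|move=> k /[!inE]/eqP->].
have [k ks hk] := ih j.
have [ik|ki] := leP (f i) (f k).
  exists i; rewrite ?mem_head// => m; rewrite inE => /orP[/eqP->//|/hk]; exact: le_trans.
exists k; first by rewrite inE ks orbT.
by move=> m; rewrite inE => /orP[/eqP->|/hk//]; exact: ltW.
Qed.

(* The balance condition: the corner vector lies in the cone of the normals. *)
Lemma corner_balance x : (forall K, K \in active F o -> bil K x <= 0) ->
  bil u x + bil v x <= 0.
Proof.
move=> hx; pose x' := x + bil o x *: o.
have [NE ou qu Eu _] := lu; have [_ ov qv Ev _] := lv.
have ox' : bil o x' = 0 by rewrite /x' !bilE -/(qf o) qo; ring.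
have Kx' K : K \in active F o -> bil K x' = bil K x.
  by move=> KE; rewrite /x' !bilE Eo// mulr0 addr0.
have NK K : K \in active F o -> bil K N < 0.
  by move=> KE; exact: good_lt0 gE KE NE.
have E0 : active F o != [::] by apply: contraTneq NE => ->.
(* [K] is the first plane reached when [x'] is moved in the direction [- N]. The point [x''] reached
   is zero or a positive multiple of a link direction, to which [link_sum] applies. *)
have [K KE Kmin] := seq_argmin (fun K => bil K x' / bil K N) E0.
pose s := bil K x' / bil K N.
have s0 : 0 <= s.
  by rewrite /s mulr_le0// ?Kx' ?hx// invr_le0 ltW// NK.
pose x'' := x' - s *: N.
have uN : bil u N <= 0 by rewrite bilC Eu.
have vN : bil v N <= 0 by rewrite bilC Ev.
suff h : bil u x'' + bil v x'' <= 0.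
  have -> : bil u x + bil v x = bil u x'' + bil v x'' + s * (bil u N + bil v N).
    by rewrite /x'' /x' !bilE (bilC u o) (bilC v o) ou ov; ring.
  by have := mulr_ge0_le0 s0 (_ : bil u N + bil v N <= 0); lra.
have ox'' : bil o x'' = 0 by rewrite /x'' bilDr bilNr bilZr ox' (bilC o) Eo// mulr0 subr0.
have Kx'' : bil K x'' = 0.
  by rewrite /x'' bilDr bilNr bilZr /s divfK ?subrr// lt_eqF// NK.
have Ex'' : inF (active F o) x''.
  move=> M ME; rewrite /x'' bilDr bilNr bilZr subr_le0.
  by have := Kmin M ME; rewrite -/s ler_ndivlMr ?NK.
have oo : qf o < 0 by rewrite qo oppr_lt0.
have KK : qf K < 0 by rewrite (proj1 gE)// oppr_lt0.
have [q0 q1] := neg_orth_pos oo KK (etrans (bilC _ _) (Eo KE)) ox'' Kx''.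
have [x0|x0] := eqVneq x'' 0; first by rewrite x0 !bilE addr0.
have qp : 0 < qf x''.
  by rewrite lt_neqAle q0 andbT eq_sym; apply: contra x0 => /eqP/q1 ->.
pose c := (Num.sqrt (qf x''))^-1.
have c0 : 0 < c by rewrite invr_gt0 sqrtr_gt0.
have lx : lface (active F o) o K (c *: x'').
  split=> //.
  - by rewrite bilZr ox'' mulr0.
  - rewrite /qf bilZl bilZr -/(qf x'') mulrA -expr2 exprVn sqr_sqrtr//.
    by rewrite mulVf// gt_eqF.
  - by move=> M ME; rewrite bilZr pmulr_rle0// Ex''.
  - by rewrite bilZr Kx'' mulr0.
by have := link_sum lx; rewrite !bilZr -mulrDr pmulr_rle0.
Qed.

End Balance.

(* Locally minimizing chains; [u] is the initial direction at [z] and [N] the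
   first face. *)
Inductive geochain : V -> V -> V -> V -> R -> Prop :=
| geo_one N z u L : 0 < L -> bil z u = 0 -> qf u = 1 ->
    face e F N z -> face e F N (pt z L u) -> geochain N z (pt z L u) u L
| geo_cons N N1 z u r p u1 L1 : 0 < r -> bil z u = 0 -> qf u = 1 ->
    face e F N z -> face e F N (pt z r u) -> geochain N1 (pt z r u) p u1 L1 ->
    corner (pt z r u) (- pt' z r u) u1 -> geochain N z p u (r + L1).

Lemma geochain_start N z p u L : geochain N z p u L ->
  [/\ 0 < L, bil z u = 0, qf u = 1, face e F N z & lface (active F z) z N u].
Proof.
elim=> {N z p u L} [N z u L L0 zu qu fz fp|N N1 z u r p u1 L1 r0 zu qu fz fo _ [L10 _ _ _ _] _].
  by split=> //; exact: dir_lface fz fp L0 zu qu.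
by split=> //; [rewrite addr_gt0|exact: dir_lface fz fo r0 zu qu].
Qed.

Lemma ch_pt2 z u s t : qf z = -1 -> bil z u = 0 -> qf u = 1 -> s <= t ->
  ch (pt z s u) (pt z t u) = t - s.
Proof.
move=> qz zu qu st; rewrite /ch (bil_pt qz)// -/(qf u) qu cosine_law0 -opprB coshN.
by rewrite arcosh_cosh// subr_ge0.
Qed.

Lemma geochain_initial N z p u L : geochain N z p u L ->
  exists2 d, 0 < d & forall s, 0 <= s -> s <= d ->
    face e F N (pt z s u) /\ chain e F (pt z s u) p (L - s).
Proof.
elim=> {N z p u L} [N z u L L0 zu qu fz fp|N N1 z u r p u1 L1 r0 zu qu fz fo g [d d0 ih] _].
  exists L => // s s0 sL; have fs : face e F N (pt z s u).
    by apply: (face_between fz fp) => //; rewrite s0.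
  have qz : qf z = -1 by case: fz => _ _ [].
  by split=> //; rewrite -(ch_pt2 qz zu qu sL); exact: chain_edge fs fp.
exists r => // s s0 sr; have fs : face e F N (pt z s u).
  by apply: (face_between fz fo) => //; rewrite s0.
split=> //; have qz : qf z = -1 by case: fz => _ _ [].
rewrite addrAC -(ch_pt2 qz zu qu sr); apply: (chain_cons fs fo).
by have [_] := ih 0 (lexx _) (ltW d0); rewrite pt0 subr0.
Qed.

Lemma face_to_pt N x y : face e F N x -> face e F N y -> x != y ->
  exists r u, [/\ 0 < r, bil x u = 0, qf u = 1, y = pt x r u & r = ch x y].
Proof.
move=> fx fy xy; have sx : surf e F x by exists N.
have Nx : bil N x = 0 by case: fx => _ _ [].
have [|r [u [r0 rE yE h]]] := face_dir e0 (active_good x gF) (surf_qf sx) (@active0 _ _ F x)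
  (active_om e0 gF sx) (active_face fy Nx).
  by rewrite eq_sym.
by have [_ ou qu _ _] := h _ (active_face fy Nx); exists r, u.
Qed.

(** Tails of a minimal chain are minimal, and a shortcut at one of its vertices would shorten the
    whole chain. Edges of length zero are dropped. *)
Lemma minimal_geochain z p L : chain e F z p L ->
  (forall l, chain e F z p l -> L <= l) -> z != p -> exists N u, geochain N z p u L.
Proof.
elim=> {z p L} [x _ _|N x y z l fx fy cyz ih hmin xz]; first by rewrite eqxx.
have [exy|xy] := eqVneq x y.
  move: hmin xz; rewrite exy chxx ?add0r; last by case: fy => _ _ [].
  exact: ih.
have [r [u [r0 xu qu yE rE]]] := face_to_pt fx fy xy.
have minyz l' : chain e F y z l' -> l <= l'.
  by move=> c; have := hmin _ (chain_cons fx fy c); rewrite lerD2l.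
have [yz|yz] := eqVneq y z.
  have l0 : l = 0.
    apply/eqP; rewrite eq_le (chain_ge0 e0 gF cyz) andbT.
    by apply: minyz; rewrite yz; apply: chain_nil; have [] := chain_surf cyz.
  exists N, u; rewrite l0 addr0 -rE -yz yE; apply: geo_one => //.
  by rewrite -yE.
have [N1 [u1 g]] := ih minyz yz.
exists N, u; rewrite -rE; apply: (@geo_cons N N1 _ _ _ _ u1) => //; rewrite -?yE//.
have [d d0 hd] := geochain_initial g.
have qx : qf x = -1 by case: fx => _ _ [].
apply: (@minimal_corner y _ _ (Num.min r d)); [by exists N|by rewrite lt_min r0|].
move=> s l' s0; rewrite le_min => /andP[sr sd] c.
have [_ c2] := hd s (ltW s0) sd.
have E1 : pt y s (- pt' x r u) = pt x (r - s) u by rewrite pt_neg yE -pt_add.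
rewrite E1 in c.
have f1 : face e F N (pt x (r - s) u).
  by apply: (@face_between _ _ r) => //; [rewrite -yE|lra].
have c1 : chain e F x (pt x (r - s) u) (r - s).
  have chv : ch x (pt x (r - s) u) = r - s by rewrite ch_pt//; lra.
  by rewrite -{2}chv; exact: chain_edge fx f1.
have := hmin _ (chain_cat c1 (chain_cat c c2)); rewrite -rE; lra.
Qed.

(* A chain issued from the star of [A] dominates the chain obtained by
   straightening the locally minimizing chain in its initial direction. *)
Lemma geochain_unfold N z p u L : geochain N z p u L ->
  forall A y l, {subset A <= F} -> N \in A -> (forall K, K \in A -> bil K u <= 0) ->
  surf e F y -> surf e A y -> chain e F y p l ->
  exists2 l', l' <= l & chain e A y (pt z L u) l'.
Proof.
have endA N' z' u' L' A : face e F N' z' -> bil z' u' = 0 -> qf u' = 1 -> 0 < L' ->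
    lface (active F z') z' N' u' -> {subset A <= F} -> N' \in A ->
    (forall K, K \in A -> bil K u' <= 0) -> surf e A (pt z' L' u').
  move=> fz zu qu L0 lu sA NA Au.
  have sz : surf e F z' by exists N'.
  have [_ _ h] := face_pt e0 (active_good z' gF) (surf_qf sz) (@active0 _ _ F z')
    (active_om e0 gF sz) lu (ltW L0).
  exists N'; split=> // K KA; rewrite /pt !bilE.
  have [_ Fz _] := fz; have Kz := Fz K (sA K KA).
  by have := mulr_ge0_le0 (ltW (cosh_gt0 L')) Kz; have := mulr_ge0_le0 (sinh_ge0 (ltW L0)) (Au K KA); lra.
elim=> {N z p u L} [N z u L L0 zu qu fz fp|N N1 z u r p u1 L1 r0 zu qu fz fo g ih cor] A y l sA NA Au sy sAy c.
  apply: (chain_restrict e0 gF sA c sAy).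
  by apply: (endA _ _ _ _ _ fz zu qu L0 _ sA NA Au); exact: dir_lface fz fp L0 zu qu.
set o := pt z r u in fo g ih cor; set w := pt' z r u in cor.
have qz : qf z = -1 by case: fz => _ _ [].
have so : surf e F o by exists N.
have [L10 ou1 qu1 fo1 lu1] := geochain_start g.
have [ow qw] := pt'_orth r qz zu qu; rewrite -/o -/w in ow qw.
have lw : lface (active F o) o N (- w).
  apply: (@dir_lface o N r) => //; last first.
  - by rewrite /qf bilNl bilNr opprK.
  - by rewrite bilNr ow oppr0.
  by rewrite pt_neg /o /w -pt_add subrr pt0.
have QE : pt z (r + L1) u = pt o L1 w by rewrite pt_add.
have gE := active_good o gF; have qo := surf_qf so; have Eo := @active0 _ _ F o.
have oE := active_om e0 gF so.
have gA := good_sub gF sA.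
(* The tail starting at [o] is straightened by induction, in the polyhedron of [A] and of the planes
   through [o]. *)
pose A1 := A ++ active F o.
have sA1 : {subset A1 <= F}.
  by move=> K; rewrite mem_cat => /orP[/sA//|/active_sub].
have gA1 := good_sub gF sA1.
have sAA1 : {subset A <= A1} by move=> K h; rewrite mem_cat h.
have sEA1 : {subset active F o <= A1} by move=> K h; rewrite mem_cat h orbT.
have N1E : N1 \in active F o by case: lu1.
have wA K : K \in A -> bil K w <= 0.
  move=> KA; rewrite /w /pt' !bilE.
  have [_ Fz _] := fz; have Kz := Fz K (sA K KA).
  by have := mulr_ge0_le0 (sinh_ge0 (ltW r0)) Kz; have := mulr_ge0_le0 (ltW (cosh_gt0 r)) (Au K KA); lra.
(* A normal [K] of [A] has nonpositive products with the normals through [o], so the balance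
   condition gives [bil K u1 <= bil K w]; the sign of the right side is inherited from [z] and
   [u]. *)
have A1u K : K \in A1 -> bil K u1 <= 0.
  rewrite mem_cat => /orP[KA|]; last by case: lu1 => _ _ _ + _; apply.
  have hK M : M \in active F o -> bil M K <= 0.
    by move=> /active_sub MF; apply/ltW/(good_lt0 gF MF (sA K KA)).
  have := corner_balance so lw lu1 cor hK; rewrite bilNl !(bilC _ K).
  by have := wA K KA; lra.
have [l1 hl1 c1] := ih A1 y l sA1 (sEA1 _ N1E) A1u sy
  (surf_sub sAA1 sAy (fun K KA => let: ex_intro _ (And3 _ Fy _) := sy in Fy K (sA1 K KA))) c.
have sQ : surf e A (pt z (r + L1) u).
  apply: (endA _ _ _ _ _ fz zu qu _ _ sA NA Au); first by rewrite addr_gt0.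
  exact: dir_lface fz fo r0 zu qu.
have fQ1 : face e (active F o) N1 (pt o L1 u1).
  exact: (face_pt e0 gE qo Eo oE lu1 (ltW L10)).
(* The last leg may be turned from [u1] to the continuation [w] of the first one. Since [- w] and
   [u1] are at link distance at least [pi], a direction at angle [T'] from [- w] is at angle at
   least [pi - T'] from [u1]. *)
have claim a m : chain e (active F o) a (pt o L1 u1) m -> surf e A a ->
    exists2 l', l' <= m & chain e A a (pt z (r + L1) u) l'.
  move=> cm sa; have m0 := chain_ge0 e0 gE cm.
  suff h : ch a (pt z (r + L1) u) <= m.
    by have [l' hl' c'] := chain_le_ch e0 gA sa sQ; exists l' => //; exact: le_trans h.
  have g1 := surf_ge1 e0 gA sa sQ.
  have [ao|ao] := eqVneq a o.
    rewrite ao in cm *; rewrite QE ch_pt ?(ltW L10)//.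
    have chQ : ch o (pt o L1 u1) = L1 by rewrite ch_pt// ltW.
    rewrite -[leLHS]chQ.
    exact: (chain_ge_ch e0 gE (face_center qo Eo oE N1E) fQ1 cm).
  have [[K fK] _] := chain_surf cm.
  have [al [xi [al0 _ aE hxi]]] := face_dir e0 gE qo Eo oE fK ao.
  have lx := hxi _ fK; have ox : bil o xi = 0 by case: lx.
  apply: arcosh_le_cosh => //; rewrite QE aE (bil_pt qo)//.
  have b1 := lface_le1 e0 gE qo Eo oE lw lx.
  rewrite bilNl (bilC w) in b1.
  have far : al + L1 <= m -> cosine_law al L1 (bil xi w) <= cosh m.
    move=> hm; apply: (@le_trans _ _ (cosh (al + L1))).
      by rewrite -cosine_law_pi; apply: cosine_law_mono; [exact: ltW|exact: ltW|lra].
    by rewrite cosh_le// addr_ge0// ltW.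
  rewrite aE in cm; have [/far//|] := chain_sweep e0 gE qo Eo oE lx lu1 al0 L10 cm.
  case=> T cT [_]; case: ltP => hT; last exact: far.
  apply: le_trans; apply: cosine_law_mono; [exact: ltW..|].
  have [h|] := lchain_exists e0 gE qo Eo oE lw lx.
    by have := cos_le1 T; move: h; rewrite bilNl (bilC w); lra.
  case=> T' [cT' T'pi]; rewrite bilNl (bilC w) => h.
  by have := corner_cos so cor cT' cT T'pi hT; lra.
(* The chain is cut after its last edge in a plane that does not contain [o]. The cut point is on
   the surface of [A], and the rest lies in the star of [o], where [claim] applies. *)
have main a m : chain e A1 a (pt o L1 u1) m ->
    chain e (active F o) a (pt o L1 u1) m \/
    exists b la lb, [/\ surf e A b, chain e A1 a b la, chain e A b (pt z (r + L1) u) lb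
      & la + lb <= m].
  move eq1 : (pt o L1 u1) => q cm.
  elim: cm eq1 => {a q m} [x _ eq1|K x x' q m fx fx' cx' ihm eq1].
    by left; rewrite -eq1; apply: chain_nil; exists N1.
  case: (ihm eq1) => [cE|[b [la [lb [sb ca cb hab]]]]]; last first.
    right; exists b, (ch x x' + la), lb; split=> //; first exact: chain_cons fx fx' ca.
    by rewrite -addrA lerD2l.
  have [KE|KE] := boolP (K \in active F o).
    left; apply: (chain_cons (N := K)) cE.
      by case: fx => _ h1 h2; split=> // M /sEA1/h1.
    by case: fx' => _ h1 h2; split=> // M /sEA1/h1.
  have KA : K \in A by case: fx; rewrite mem_cat (negbTE KE) orbF.
  have sx' : surf e A x'.
    by case: fx' => _ h1 h2; exists K; split=> // M /sAA1/h1.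
  rewrite -eq1 in cE; have [lb hlb cb] := claim _ _ cE sx'.
  right; exists x', (ch x x'), lb; split=> //; first exact: chain_edge fx fx'.
  by rewrite lerD2l.
have [cE|[b [la [lb [sb ca cb hab]]]]] := main _ _ c1.
  by have [l' h1 h2] := claim _ _ cE sAy; exists l' => //; exact: le_trans hl1.
have [l' h1 h2] := chain_restrict e0 gA1 sAA1 ca sAy sb.
exists (l' + lb); last exact: chain_cat h2 cb.
by apply: le_trans hl1; apply: le_trans hab; rewrite lerD2r.
Qed.

(** Both chains are unfolded into the polyhedron of the planes through [z], with the common end
    [pt z L u]. The angles they sweep at [z] add up to at least [pi], so the laws of cosines bound
    both lengths below with cosines of nonpositive sum. *)
Lemma corner_convex N N' z v v' h p l l' K u L : corner z v v' ->
  lface (active F z) z N v -> lface (active F z) z N' v' -> 0 < h ->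
  surf e F (pt z h v) -> surf e F (pt z h v') -> geochain K z p u L ->
  chain e F (pt z h v) p l -> chain e F (pt z h v') p l' ->
  2 * cosh h * cosh L <= cosh l + cosh l'.
Proof.
move=> cor lv lv' h0 sv sv' g c c'.
have [L0 zu qu fz lu] := geochain_start g.
have sz : surf e F z by exists K.
have gE := active_good z gF; have qz := surf_qf sz; have Ez := @active0 _ _ F z.
have zE := active_om e0 gF sz.
have KE : K \in active F z by case: lu.
have Eu : forall M, M \in active F z -> bil M u <= 0 by case: lu.
have side M w m : lface (active F z) z M w -> surf e F (pt z h w) ->
    chain e F (pt z h w) p m ->
    exists2 k, cosine_law h L k <= cosh m & k = -1 \/
      exists2 T, lchain (active F z) z (fun=> True) w u T & k = cos T /\ T < pi.
  move=> lw sw cm; have fw := face_pt e0 gE qz Ez zE lw (ltW h0).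
  have [m' hm' cm'] := geochain_unfold g (@active_sub _ _ F z) KE Eu sw (ex_intro _ M fw) cm.
  have m'0 := chain_ge0 e0 gE cm'.
  have mm : cosh m' <= cosh m by rewrite cosh_le// (le_trans m'0).
  have far : h + L <= m' -> exists2 k, cosine_law h L k <= cosh m & k = -1 \/
      exists2 T, lchain (active F z) z (fun=> True) w u T & k = cos T /\ T < pi.
    move=> hf; exists (-1); last by left.
    rewrite cosine_law_pi; apply: le_trans mm; rewrite cosh_le//.
    by rewrite addr_ge0// ltW.
  have [/far//|] := chain_sweep e0 gE qz Ez zE lw lu h0 L0 cm'.
  case=> T cT [_]; case: ltP => [hT hs|_ /far//].
  by exists (cos T); [exact: le_trans hs mm|right; exists T].
have [k hk k1] := side _ _ _ lv sv c.
have [k' hk' k1'] := side _ _ _ lv' sv' c'.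
apply: (cosh_sum_coslaw (ltW h0) (ltW L0) hk hk').
case: k1 => [->|[T cT [kE Tpi]]].
  case: k1' => [->|[T' _ [-> _]]]; first by lra.
  by have := cos_le1 T'; lra.
case: k1' => [->|[T' cT' [kE' Tpi']]]; first by rewrite kE; have := cos_le1 T; lra.
by rewrite kE kE'; exact: (corner_cos sz cor cT (lchain_sym cT') Tpi Tpi').
Qed.

End Corners.

(** * Limits along ultrafilters *)

Section UltraFilters.
Context {R : realType}.

Lemma ultra_dichotomy T (F : set_system T) : ProperFilter F ->
  (forall A, F A \/ F (~` A)) -> UltraFilter F.
Proof.
move=> PF h; split=> // G PG FG; apply/seteqP; split=> [A GA|//].
have [//|FA] := h A; exfalso.
apply: (@filter_not_empty _ G); rewrite -(setICr A).
by apply: filterI => //; exact: FG.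
Qed.

Lemma fmap_ultra T T' (f : T -> T') (F : set_system T) :
  UltraFilter F -> UltraFilter (f @ F).
Proof.
move=> UF; apply: ultra_dichotomy => A.
exact: (in_ultra_setVsetC (f @^-1` A) UF).
Qed.

Lemma ultra_seq I (U : set_system I) (T : eqType) (g : I -> T) (s : seq T) :
  UltraFilter U -> (\forall i \near U, g i \in s) ->
  exists2 x, x \in s & \forall i \near U, g i = x.
Proof.
move=> UU; elim: s => [|x s ih] h.
  by have [] := filter_ex (F := U) h.
have [hx|hx] := in_ultra_setVsetC [set i | g i = x] UU.
  by exists x => //; rewrite mem_head.
have [|y ys hy] := ih; last by exists y; rewrite // inE ys orbT.
near=> i; have : g i \in x :: s by near: i.
by rewrite inE => /orP[/eqP e|//]; exfalso; move: e; near: i.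
Unshelve. all: by end_near. Qed.

Lemma ultra_bounded_real I (U : set_system I) (f : I -> R) (M : R) :
  UltraFilter U -> (\forall i \near U, `|f i| <= M) -> exists l : R, f @ U --> l.
Proof.
move=> UU h; have := @segment_compact R (- M) M; rewrite compact_ultra.
move=> /(_ _ (fmap_ultra f UU)) [|l [_ hl]]; last by exists l.
by apply: filterS h => i; rewrite ler_norml /= in_itv.
Qed.

Lemma cvg_col m I (U : set_system I) (Y : I -> 'cV[R]_m) (y : 'cV[R]_m) {FU : Filter U} :
  (forall j, (fun i => Y i j 0) @ U --> y j 0) -> Y @ U --> y.
Proof.
move=> h A [P hP sPA].
have : \forall i \near U, forall j, P j 0 (Y i j 0).
  by apply: filter_forall => j; exact: h (hP j 0).
by apply: filterS => i hi; apply: sPA => j k; rewrite ord1.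
Qed.

Lemma cvg_coord m I (U : set_system I) (Y : I -> 'cV[R]_m) (y : 'cV[R]_m) j {FU : Filter U} :
  Y @ U --> y -> (fun i => Y i j 0) @ U --> y j 0.
Proof.
move=> h; apply: (@cvg_comp _ _ _ Y (fun M : 'cV[R]_m => M j 0) U (nbhs y)) => //.
exact: coord_continuous.
Qed.

Lemma ultra_bounded_col m I (U : set_system I) (Y : I -> 'cV[R]_m) :
  UltraFilter U -> (forall j, exists M : R, \forall i \near U, `|Y i j 0| <= M) ->
  exists y : 'cV[R]_m, Y @ U --> y.
Proof.
move=> UU h.
have /choice[y hy] : forall j, exists l : R, (fun i => Y i j 0) @ U --> l.
  by move=> j; have [M hM] := h j; exact: ultra_bounded_real hM.
by exists (\col_j y j); apply: cvg_col => j; rewrite mxE; exact: hy.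
Qed.

Lemma cvg_big_sum I (U : set_system I) (J : Type) (s : seq J) (f : J -> I -> R) (l : J -> R) {FU : Filter U} :
  (forall j, f j @ U --> l j) ->
  (fun i => \sum_(j <- s) f j i) @ U --> \sum_(j <- s) l j.
Proof.
move=> h; elim: s => [|j s ih].
  by under eq_fun do rewrite big_nil; rewrite big_nil; exact: cvg_cst.
by under eq_fun do rewrite big_cons; rewrite big_cons; exact: cvgD.
Qed.

Lemma col_norm_le m (x : 'cV[R]_m) (M : R) : 0 <= M -> (forall j, `|x j 0| <= M) -> `|x| <= M.
Proof.
move=> M0 h; rewrite [leLHS]/Num.Def.normr /= mx_normrE; apply/bigmax_leP; split=> // -[i j] _ /=.
by rewrite ord1.
Qed.

Lemma col_norm_ge m (x : 'cV[R]_m) j : `|x j 0| <= `|x|.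
Proof.
rewrite [leRHS]/Num.Def.normr /= mx_normrE; apply/bigmax_geP; right.
by exists (j, 0).
Qed.

End UltraFilters.

Section FormLimits.
Context {R : realType} {n : nat}.
Local Notation V := 'cV[R]_(2 + n).
Variables (I : Type) (U : set_system I).
Context {FU : Filter U}.
Implicit Types (X Y : I -> V) (x y : V).

Lemma cvg_bil X Y x y : X @ U --> x -> Y @ U --> y ->
  (fun i => bil (X i) (Y i)) @ U --> bil x y.
Proof.
move=> hX hY; under eq_fun do rewrite bil_coord /sp; rewrite bil_coord.
apply: cvgD; last by apply: cvg_big_sum => j; apply: cvgM; exact: cvg_coord.
by apply: cvgN; apply: cvgD; apply: cvgM; exact: cvg_coord.
Qed.

Lemma cvg_om e X Y x y : X @ U --> x -> Y @ U --> y ->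
  (fun i => om e (X i) (Y i)) @ U --> om e x y.
Proof.
move=> hX hY; apply: cvgM; first exact: cvg_cst.
by apply: cvgB; apply: cvgM; exact: cvg_coord.
Qed.

Lemma cvg_ch X Y x y : 1 <= - bil x y -> X @ U --> x -> Y @ U --> y ->
  (fun i => ch (X i) (Y i)) @ U --> ch x y.
Proof.
move=> h hX hY.
apply: (@cvg_comp _ _ _ (fun i => - bil (X i) (Y i)) (@arcosh R) U (nbhs (- bil x y))).
  by apply: cvgN; exact: cvg_bil.
exact: continuous_arcosh.
Qed.

End FormLimits.

(** * Coordinate bounds inside a face *)

Section HyperbolicBounds.
Context {R : realType} {n : nat}.
Local Notation V := 'cV[R]_(2 + n).
Implicit Types (x y b N : V).

(** Lagrange's identity for the negative coordinates, whose scalar product equals [sp y N] by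
    orthogonality, followed by Cauchy-Schwarz for the space parts. *)
Lemma om_time_bound e N y : qf N = -1 -> qf y = -1 -> bil y N = 0 ->
  e ^+ 2 * (tu y ^+ 2 + tv y ^+ 2) <= (om e y N) ^+ 2.
Proof.
rewrite /qf !bil_coord /om => hN hy hyN.
have := sp_CS y N; have := sp_ge0 y; have := sp_ge0 N.
move: (sp y y) (sp N N) (sp y N) (tu y) (tv y) (tu N) (tv N) hN hy hyN.
move=> s t c a b a' b' hN hy hyN t0 s0 cs.
rewrite exprMn ler_wpM2l ?sqr_ge0//.
have -> : (a * b' - b * a') ^+ 2 = (a ^+ 2 + b ^+ 2) * (a' ^+ 2 + b' ^+ 2) - c ^+ 2.
  by rewrite (_ : c = a * a' + b * b'); [ring|lra].
rewrite (_ : a ^+ 2 + b ^+ 2 = 1 + s); last by lra.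
rewrite (_ : a' ^+ 2 + b' ^+ 2 = 1 + t); last by lra.
nra.
Qed.

(* [2 beta b - y] is the reflection of [y] in [b], a point of the same sheet. *)
Lemma om_growth e N b y : e != 0 -> qf N = -1 -> hyp e N b -> hyp e N y ->
  om e y N < 2 * (- bil b y) * om e b N.
Proof.
move=> e0 hN hb hy; have [h1 _] := hyp_ge1 e0 hN hb hy.
case: hb hy => qb Nb ob [qy Ny oy].
pose z := (2 * (- bil b y)) *: b - y.
have NN : qf N < 0 by rewrite hN oppr_lt0.
have qz : qf z = -1.
  by rewrite /z /qf !bilE -/(qf b) -/(qf y) qb qy (bilC y b); ring.
have bz : bil b z < 0 by rewrite /z !bilE -/(qf b) qb; lra.
have zN : bil z N = 0 by rewrite bilC /z !bilE Nb Ny; ring.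
have bN : bil b N = 0 by rewrite bilC.
have bb : qf b < 0 by rewrite qb oppr_lt0.
have zz : qf z <= 0 by rewrite qz lerN10.
have := same_sheet e0 NN bN zN bb zz bz.
by rewrite pmulr_rgt0// /z !omE subr_gt0.
Qed.

Lemma coord_bound x (M : R) : 0 <= M -> qf x = -1 -> tu x ^+ 2 + tv x ^+ 2 <= M ^+ 2 ->
  forall j, `|x j 0| <= M.
Proof.
move=> M0; rewrite /qf bil_coord => q h.
have small (r : R) : r ^+ 2 <= M ^+ 2 -> `|r| <= M.
  by move=> hr; rewrite ler_norml; apply/andP; split; nra.
have s1 : sp x x <= M ^+ 2 by lra.
move=> j; apply: small; case: (split_ordP j) => k ->; last first.
  apply: le_trans s1; rewrite /sp (bigD1 k)//= -expr2 lerDl.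
  by apply: sumr_ge0 => i _; rewrite -expr2 sqr_ge0.
have := sqr_ge0 (tu x); have := sqr_ge0 (tv x).
case: k => [[|[|k]] hk] //.
  by rewrite (_ : Ordinal hk = 0) -/(tu x); [lra|exact: val_inj].
by rewrite (_ : Ordinal hk = 1) -/(tv x); [lra|exact: val_inj].
Qed.

End HyperbolicBounds.

(** * Existence of minimal chains *)

Section MinimalChains.
Context {R : realType} {n : nat}.
Local Notation V := 'cV[R]_(2 + n).
Variables (e : R) (F : seq V).
Hypotheses (e0 : e != 0) (gF : good F).
Implicit Types (x y z a b N K : V) (l c : R) (D : seq V).

(** The strict sign of [om] survives the limit, since [om] cannot vanish on orthogonal timelike
    vectors. *)
Lemma face_closed I (U : set_system I) (X : I -> V) N x {PU : ProperFilter U} :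
  X @ U --> x -> (\forall i \near U, face e F N (X i)) -> face e F N x.
Proof.
move=> hX h.
have [i0 [NF _ _]] := filter_ex h.
have lim0 M (c : R) : (\forall i \near U, bil M (X i) = c) -> bil M x = c.
  move=> hM; apply/eqP; rewrite eq_le; apply/andP; split.
    apply: (cvgr_to_le (cvg_bil (cvg_cst M) hX)); apply: filterS hM => i ->.
    by rewrite lexx.
  apply: (cvgr_to_ge (cvg_bil (cvg_cst M) hX)); apply: filterS hM => i ->.
  by rewrite lexx.
have qx : qf x = -1.
  apply/eqP; rewrite eq_le; apply/andP; split.
    apply: (cvgr_to_le (cvg_bil hX hX)); apply: filterS h => i [_ _ [q _ _]].
    by rewrite -/(qf _) q lexx.
  apply: (cvgr_to_ge (cvg_bil hX hX)); apply: filterS h => i [_ _ [q _ _]].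
  by rewrite -/(qf _) q lexx.
have Nx : bil N x = 0 by apply: lim0; apply: filterS h => i [_ _ []].
split=> // [M MF|].
  apply: (cvgr_to_le (cvg_bil (cvg_cst M) hX)); apply: filterS h => i [_ Fi _].
  exact: Fi.
split=> //; rewrite lt0r; apply/andP; split; last first.
  apply: (cvgr_to_ge (cvg_om hX (cvg_cst N))); apply: filterS h => i [_ _ [_ _ /ltW]] //.
have qN : qf N = -1 by exact: (proj1 gF).
apply: om_neq0 => //; rewrite ?qx ?qN ?oppr_lt0 ?lerN10 ?ltr01//; last by rewrite bilC.
by apply/eqP => N0; move: qN; rewrite N0 /qf bil0l => /eqP; rewrite eq_sym oppr_eq0 oner_eq0.
Qed.

Inductive dchain D : V -> V -> R -> Prop :=
| dchain_nil x : surf e F x -> dchain D x x 0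
| dchain_cons N x y z l : N \in D -> face e F N x -> face e F N y -> dchain D y z l ->
    dchain D x z (ch x y + l).

Lemma dchain_chain D x y l : dchain D x y l -> chain e F x y l.
Proof.
by elim=> {x y l} [x /chain_nil//|N x y z l _ hx hy _ h]; exact: (chain_cons hx hy h).
Qed.

Lemma chain_dchain x y l : chain e F x y l -> dchain F x y l.
Proof.
elim=> {x y l} [x /dchain_nil//|N x y z l hx hy _ h]; apply: (dchain_cons _ hx hy h).
by case: hx.
Qed.

(** The chain is cut at the end of its last edge in the plane of [N]. *)
Lemma dchain_split D N x z l : dchain D x z l ->
  dchain [seq K <- D | K != N] x z l \/
  exists y l1 l2, [/\ bil N y = 0, dchain D x y l1,
    dchain [seq K <- D | K != N] y z l2 & l = l1 + l2].
Proof.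
elim=> {x z l} [x sx|K x y z l KD fx fy c ih]; first by left; exact: dchain_nil.
case: ih => [c'|[w [l1 [l2 [Nw c1 c2 ->]]]]]; last first.
  right; exists w, (ch x y + l1), l2; rewrite addrA; split=> //.
  exact: (dchain_cons KD fx fy c1).
have [KN|KN] := eqVneq K N; last first.
  by left; apply: (dchain_cons _ fx fy c'); rewrite mem_filter KN.
right; exists y, (ch x y + 0), l; rewrite addr0; split=> //.
  by rewrite -KN; case: fy => _ _ [].
by rewrite -[ch x y]addr0; apply: (dchain_cons KD fx fy); apply: dchain_nil; exists K.
Qed.

Inductive nchain b : nat -> V -> R -> Prop :=
| nchain0 : surf e F b -> nchain b 0 b 0
| nchainS N k x y l : face e F N x -> face e F N y -> nchain b k y l ->
    nchain b k.+1 x (ch x y + l).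

Lemma nchain_chain b k x l : nchain b k x l -> chain e F x b l.
Proof.
by elim=> {k x l} [/chain_nil//|N k x y l hx hy _ h]; exact: (chain_cons hx hy h).
Qed.

Lemma nchain_pad b k m x l : (k <= m)%N -> nchain b k x l -> nchain b m x l.
Proof.
move=> /subnK <-; elim: (m - k)%N => [//|j ih] h; rewrite addSn.
have c := nchain_chain h; have [[N fx] _] := chain_surf c.
rewrite -[l]add0r -(chxx (surf_qf (ex_intro _ N fx))).
exact: (nchainS fx fx (ih h)).
Qed.

(* A face need be used once only, as faces are totally geodesic and convex. *)
Lemma dchain_nchain b m D x l : (size D <= m)%N -> {subset D <= F} -> dchain D x b l ->
  exists2 l', l' <= l & nchain b m x l'.
Proof.
elim: m b D x l => [|m ih] b D x l hD sD c.
  move: c; move: hD; rewrite leqn0 size_eq0 => /eqP ->.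
  move eD : [::] => D' c; elim: c eD => {b x l} [x sx _|N x y z l + _ _ _ _ eD].
    by exists 0 => //; exact: nchain0.
  by rewrite -eD.
case: c hD => {b x l} [x sx|N x y z l ND fx fy c] hD.
  by exists 0 => //; apply: (@nchain_pad _ 0) => //; exact: nchain0.
have hD' : (size [seq K <- D | K != N] <= m)%N.
  rewrite -ltnS; apply: leq_trans hD; rewrite size_filter -(count_predC (pred1 N) D).
  have -> : count (fun K => K != N) D = count (predC (pred1 N)) D by [].
  rewrite -[X in (X < _)%N]add0n ltn_add2r -has_count.
  by apply/hasP; exists N => //=; rewrite eqxx.
have sD' : {subset [seq K <- D | K != N] <= F} by move=> K; rewrite mem_filter => /andP[_ /sD].
case: (dchain_split N (dchain_cons ND fx fy c)) => [c'|[w [l1 [l2 [Nw c1 c2 ->]]]]].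
  have [l' h1 h2] := ih _ _ _ _ hD' sD' c'.
  by exists l' => //; exact: nchain_pad h2.
have [l' h1 h2] := ih _ _ _ _ hD' sD' c2.
have [sw _] := chain_surf (nchain_chain h2).
have fw := surf_face e0 gF sw (sD _ ND) Nw.
exists (ch x w + l'); last exact: (nchainS fx fw h2).
by rewrite lerD//; exact: (chain_ge_ch e0 gF fx fw (dchain_chain c1)).
Qed.

Lemma nchain_ge0 b k x l : nchain b k x l -> 0 <= l.
Proof. by move=> /nchain_chain; exact: chain_ge0. Qed.

(** Along the ultrafilter the first edges lie in one fixed face. [om_growth] bounds the second
    vertex by the first one and the length, so it has a limit, and the remaining chain has one edge
    less. *)
Lemma nchain_lsc I (U : set_system I) b k (X : I -> V) (L : I -> R) x c :
  UltraFilter U -> X @ U --> x -> (\forall i \near U, nchain b k (X i) (L i)) ->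
  (forall eps, 0 < eps -> \forall i \near U, L i <= c + eps) ->
  exists2 l, l <= c & nchain b k x l.
Proof.
move=> UU; elim: k X L x c => [|k ih] X L x c hX hc hL.
  have hXb : \forall i \near U, X i = b /\ L i = 0.
    by apply: filterS hc => i; move eX : (X i) => y; move eL : (L i) => l h; inversion h.
  have xb : x = b.
    apply/matrixP => j k; rewrite ord1; apply/eqP; rewrite eq_le; apply/andP; split.
      by apply: (cvgr_to_le (cvg_coord (j := j) hX)); apply: filterS hXb => i [-> _].
    by apply: (cvgr_to_ge (cvg_coord (j := j) hX)); apply: filterS hXb => i [-> _].
  exists 0; last by have [i] := filter_ex hc; move=> h; rewrite xb; inversion h; exact: nchain0.
  rewrite leNgt; apply/negP => c0.
  have c2 : 0 < - c / 2 by lra.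
  have [i [h1 [_ h2]]] := filter_ex (filterI (hL _ c2) hXb).
  by move: h1; rewrite h2; lra.
pose P i (t : V * V * R) := [/\ face e F t.1.1 (X i), face e F t.1.1 t.1.2,
  nchain b k t.1.2 t.2 & L i = ch (X i) t.1.2 + t.2].
have /choice[g hg] : forall i, exists t, nchain b k.+1 (X i) (L i) -> P i t.
  move=> i; have [h|h] := pselect (nchain b k.+1 (X i) (L i)); last by exists (0, 0, 0) => /h.
  inversion h as [|N k' x' y l fx fy cy ek ex el]; exists (N, y, l) => _.
  by split=> //=; rewrite -el.
have hP : \forall i \near U, P i (g i) by apply: filterS hc => i; exact: hg.
have [N NF hN] : exists2 N, N \in F & \forall i \near U, (g i).1.1 = N.
  by apply: (@ultra_seq _ U) => //; apply: filterS hP => i [[]].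
have fX : \forall i \near U, face e F N (X i).
  by apply: filterS2 hP hN => i [h _ _ _] <-.
have fx : face e F N x by exact: face_closed hX fX.
have [_ _ hx] := fx; have [qx Nx ox] := hx.
have qN := proj1 gF _ NF.
pose C := cosh (c + 1).
pose K := 2 * C * (om e x N + 1).
have C0 : 0 < C by exact: cosh_gt0.
have hK : \forall i \near U, om e (g i).1.2 N <= K.
  have hL1 := hL 1 ltr01.
  have hom : \forall i \near U, om e (X i) N < om e x N + 1.
    by apply: (cvgr_lt _ (cvg_om (e := e) hX (cvg_cst N))); rewrite ltrDl.
  near=> i.
  have [fi fi' ci eL] : P i (g i) by near: i.
  have eN : (g i).1.1 = N by near: i.
  have h1 : L i <= c + 1 by near: i.
  have h2 : om e (X i) N < om e x N + 1 by near: i.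
  rewrite eN in fi fi'.
  have [_ _ hi] := fi; have [_ _ hi'] := fi'.
  have h3 := om_growth e0 qN hi hi'.
  have [g1 _] := hyp_ge1 e0 qN hi hi'.
  have l0 := nchain_ge0 ci.
  have bC : - bil (X i) (g i).1.2 <= C.
    rewrite -(cosh_arcosh g1) /C cosh_le ?arcosh_ge0//; first by rewrite -/(ch _ _); lra.
    by have := arcosh_ge0 g1; rewrite -/(ch _ _); lra.
  have oi : 0 < om e (X i) N by case: hi.
  apply: (le_trans (ltW h3)); rewrite /K.
  apply: ler_pM; [lra|exact: ltW|lra|exact: ltW].
have [y hy] : exists y : V, (fun i => (g i).1.2) @ U --> y.
  apply: ultra_bounded_col => j; exists (`|K| / `|e|).
  near=> i.
  have [_ fi' _ _] : P i (g i) by near: i.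
  have eN : (g i).1.1 = N by near: i.
  have oK : om e (g i).1.2 N <= K by near: i.
  rewrite eN in fi'; have [_ _ [qi Ni oi]] := fi'.
  have M0 : 0 <= `|K| / `|e| by rewrite divr_ge0.
  apply: (coord_bound M0 qi).
  have := om_time_bound e qN qi (etrans (bilC _ _) Ni) => h.
  have e2 : 0 < e ^+ 2 by rewrite exprn_even_gt0.
  rewrite -(ler_pM2l e2) (le_trans h)// expr_div_n.
  have -> : e ^+ 2 * (`|K| ^+ 2 / `|e| ^+ 2) = K ^+ 2.
    by rewrite !real_normK ?num_real// mulrCA divff ?mulr1// gt_eqF.
  have : 0 <= om e (g i).1.2 N by exact: ltW.
  by move: oK; nra.
have fY : \forall i \near U, face e F N (g i).1.2.
  by apply: filterS2 hP hN => i [_ h _ _] <-.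
have fy : face e F N y by exact: face_closed hy fY.
have [g1 _] : 1 <= - bil x y /\ (- bil x y = 1 -> x = y).
  by apply: (hyp_ge1 e0 qN); [case: fx|case: fy].
have hch : (fun i => ch (X i) (g i).1.2) @ U --> ch x y by exact: cvg_ch g1 hX hy.
have [||l hl cl] := ih _ (fun i => (g i).2) y (c - ch x y) hy.
- by apply: filterS hP => i [].
- move=> eps eps0; have e20 : 0 < eps / 2 by rewrite divr_gt0.
  have h1 := hL _ e20.
  have h2 : \forall i \near U, ch x y - eps / 2 < ch (X i) (g i).1.2.
    by apply: (cvgr_gt _ hch); lra.
  near=> i.
  have [_ _ _ eL] : P i (g i) by near: i.
  have k1 : L i <= c + eps / 2 by near: i.
  have k2 : ch x y - eps / 2 < ch (X i) (g i).1.2 by near: i.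
  lra.
exists (ch x y + l); first by lra.
exact: (nchainS fx fy cl).
Unshelve. all: by end_near. Qed.

(** By [dchain_nchain] it is enough to consider chains with [size F] edges, possibly degenerate; on
    these the infimum is attained by semicontinuity. *)
Lemma minchain_exists a b : surf e F a -> surf e F b ->
  exists2 l, chain e F a b l & forall l', chain e F a b l' -> l <= l'.
Proof.
move=> sa sb; pose m := size F.
pose A := [set l | nchain b m a l].
have toA l : chain e F a b l -> exists2 l', l' <= l & A l'.
  by move=> /chain_dchain; exact: dchain_nchain.
have A0 : A !=set0.
  by have [l _ /toA[l' _ h]] := chain_le_ch e0 gF sa sb; exists l'.
have Alb : has_lbound A by exists 0 => l /nchain_ge0.
have hinf : has_inf A by [].
have /choice[L hL] : forall j : nat, exists l, A l /\ l < inf A + j.+1%:R^-1.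
  move=> j; have j0 : 0 < j.+1%:R^-1 :> R by rewrite invr_gt0.
  by have [l h1 h2] := inf_adherent j0 hinf; exists l.
have [U [UU sU]] := @ultraFilterLemma nat \oo _.
have [|||l hl cl] := @nchain_lsc nat U b m (fun=> a) L a (inf A) UU.
- exact: cvg_cst.
- by apply: filterE => j; have [] := hL j.
- move=> eps eps0; apply: sU; near=> j.
  have [_ /ltW h] := hL j; apply: (le_trans h); rewrite lerD2l ltW//.
  by near: j; exact: near_infty_natSinv_lt (PosNum eps0).
exists l; first exact: nchain_chain cl.
move=> l' /toA[l'' h1 h2]; apply: le_trans h1; apply: (le_trans hl).
exact: ge_inf.
Unshelve. all: by end_near. Qed.

End MinimalChains.

(** * Sinh-convex functions *)

Section SinhConvexity.
Context {R : realType}.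
Implicit Types (f g P Q : R -> R) (s t l h d : R).

(** The retraction of the line to [[0, l]], by which functions on a segment become continuous on the
    whole line. *)
Definition clamp l s : R := Num.max 0 (Num.min l s).

Lemma clamp_id l s : 0 <= s <= l -> clamp l s = s.
Proof. by move=> /andP[s0 sl]; rewrite /clamp (min_idPr sl) (max_idPr s0). Qed.

Lemma clamp_itv l s : 0 <= l -> 0 <= clamp l s <= l.
Proof. by move=> l0; rewrite /clamp le_max lexx ge_max l0 ge_min lexx. Qed.

Lemma clamp_lip l s t : 0 <= l -> `|clamp l s - clamp l t| <= `|s - t|.
Proof.
move=> l0.
have c0 r : r <= 0 -> clamp l r = 0.
  by move=> r0; rewrite /clamp; apply/max_idPl; rewrite ge_min r0 orbT.
have c2 r : l <= r -> clamp l r = l.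
  by move=> r0; rewrite /clamp (min_idPl r0) (max_idPr l0).
wlog st : s t / s <= t.
  move=> h; have [/h//|/ltW/h] := leP s t.
  by rewrite distrC => h1; rewrite (le_trans h1)// distrC.
rewrite distrC [leRHS]distrC [leRHS]ger0_norm ?subr_ge0// ler_norml.
have c1 r : 0 < r -> r < l -> clamp l r = r.
  by move=> h1 h2; rewrite clamp_id// !ltW.
have [s0|s0] := leP s 0.
  rewrite (c0 _ s0); have [t0|t0] := leP t 0; first by rewrite c0//; lra.
  by have [lt|lt] := leP l t; [rewrite c2//; lra|rewrite c1//; lra].
have t0 : 0 < t by lra.
have [ls|ls] := leP l s; first by rewrite !c2//; lra.
by rewrite (c1 s)//; have [lt|lt] := leP l t; [rewrite c2//; lra|rewrite c1//; lra].
Qed.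

Lemma continuous_glue g P Q s d : 0 < d -> {for 0, continuous P} -> {for 0, continuous Q} ->
  P 0 = g s -> Q 0 = g s -> (forall h, 0 <= h <= d -> g (s + h) = P h) ->
  (forall h, 0 <= h <= d -> g (s - h) = Q h) -> {for s, continuous g}.
Proof.
move=> d0 cP cQ P0 Q0 hP hQ; apply/cvgrPdist_lt => eps eps0.
have /cvgrPdist_lt/(_ _ eps0)/nbhs_ballP[d1 /= d10 h1] := cP.
have /cvgrPdist_lt/(_ _ eps0)/nbhs_ballP[d2 /= d20 h2] := cQ.
rewrite P0 in h1; rewrite Q0 in h2.
apply/nbhs_ballP; exists (Num.min d (Num.min d1 d2)) => /=; first by rewrite !lt_min d0 d10.
move=> t; rewrite /ball/= !lt_min => /and3P[t0 t1 t2].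
have [st|st] := leP s t.
  have -> : t = s + (t - s) by ring.
  rewrite hP; last by rewrite subr_ge0 st/=; apply: ltW; move: t0; rewrite distrC ger0_norm// subr_ge0.
  by apply: h1; rewrite /ball/= sub0r normrN -distrC.
have -> : t = s - (s - t) by ring.
rewrite hQ; last by rewrite subr_ge0 (ltW st)/=; apply: ltW; move: t0; rewrite ger0_norm// subr_ge0 ltW.
by apply: h2; rewrite /ball/= sub0r normrN.
Qed.

(** The local midpoint form of the differential inequality [f'' >= f], meaningful without
    smoothness. *)
Definition sinh_convex_at f s := exists2 d, 0 < d &
  forall h, 0 < h -> h <= d -> 2 * cosh h * f s <= f (s - h) + f (s + h).

(* Maximum principle for the difference with the solution of [g'' = g] with the
   same end values. *)
Lemma sinh_convex_le f l s : 0 < l -> continuous f ->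
  (forall t, 0 < t < l -> sinh_convex_at f t) -> 0 <= s <= l ->
  sinh l * f s <= sinh (l - s) * f 0 + sinh s * f l.
Proof.
move=> l0 cf hf sl; have sl0 := sinh_gt0 l0.
pose g t := sinh l * f t - (sinh (l - t) * f 0 + sinh t * f l).
have cg : continuous g.
  move=> t; apply: cvgB; first by apply: cvgM; [exact: cvg_cst|exact: cf].
  apply: cvgD; apply: cvgM; try exact: cvg_cst; last exact: continuous_sinh.
  apply: (continuous_comp (f := fun t => l - t)); last exact: continuous_sinh.
  by apply: cvgB; [exact: cvg_cst|exact: cvg_id].
have [c] : exists2 c, c \in `[0, l] & forall t, t \in `[0, l] -> g t <= g c.
  by apply: EVT_max; [exact: ltW|exact: continuous_subspaceT].
rewrite in_itv/= => /andP[c0 cl] hc.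
have g0 : g 0 = 0 by rewrite /g subr0 sinh0; ring.
have gl : g l = 0 by rewrite /g subrr sinh0; ring.
suff gc : g c <= 0.
  have : g s <= 0 by apply: (le_trans _ gc); apply: hc; rewrite in_itv.
  by rewrite /g subr_le0.
have [ec|c00] := eqVneq c 0; first by rewrite ec g0.
have [ec|cll] := eqVneq c l; first by rewrite ec gl.
have c0l : 0 < c < l by rewrite !lt_neqAle c0 cl eq_sym c00 cll.
have [d d0 hd] := hf c c0l; rewrite leNgt; apply/negP => gc0.
pose h := Num.min d (Num.min c (l - c)).
have h0 : 0 < h by rewrite !lt_min d0/= subr_gt0.
have hdd : h <= d by rewrite ge_min lexx.
have hcc : h <= c by rewrite !ge_min lexx orbT.
have hll : h <= l - c by rewrite !ge_min lexx !orbT.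
have b1 : g (c - h) <= g c by apply: hc; rewrite in_itv/=; lra.
have b2 : g (c + h) <= g c by apply: hc; rewrite in_itv/=; lra.
have gh : 2 * cosh h * g c <= g (c - h) + g (c + h).
  have := ler_wpM2l (ltW sl0) (hd h h0 hdd); rewrite /g !opprD !opprK !addrA.
  rewrite (sinhD (l - c) h) (sinhB (l - c) h) (sinhD c h) (sinhB c h).
  by rewrite mulrA; lra.
have ch1 : 1 < cosh h by rewrite -(@cosh0 R) cosh_lt// ltW.
by move: gh b1 b2 gc0 ch1; move: (cosh h) (g c) (g _) (g _) => k a b b'; nra.
Qed.

End SinhConvexity.

(** * The distance of a polyhedral surface *)

Section PolyhedralDistance.
Context {R : realType} {n : nat}.
Local Notation V := 'cV[R]_(2 + n).
Variables (e : R) (F : seq V).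
Hypotheses (e0 : e != 0) (gF : good F).
Implicit Types (x y z a b p k N v : V) (l s t h : R).

Definition pdist x y : R := inf [set l | chain e F x y l].

Lemma pdistP x y : surf e F x -> surf e F y ->
  chain e F x y (pdist x y) /\ forall l, chain e F x y l -> pdist x y <= l.
Proof.
move=> sx sy; have [l cl hl] := minchain_exists e0 gF sx sy.
suff -> : pdist x y = l by [].
apply/eqP; rewrite eq_le; apply/andP; split.
  by apply: ge_inf => //; exists 0 => l'; exact: chain_ge0.
by apply: lb_le_inf; [exists l|move=> l' /hl].
Qed.

Lemma pdist_ge0 x y : surf e F x -> surf e F y -> 0 <= pdist x y.
Proof. by move=> sx sy; have [c _] := pdistP sx sy; exact: (chain_ge0 e0 gF c). Qed.

Lemma pdistC x y : surf e F x -> surf e F y -> pdist x y = pdist y x.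
Proof.
move=> sx sy; have [c h] := pdistP sx sy; have [c' h'] := pdistP sy sx.
by apply/eqP; rewrite eq_le h ?h'//; exact: chain_sym.
Qed.

Lemma pdist_tri x y z : surf e F x -> surf e F y -> surf e F z ->
  pdist x z <= pdist x y + pdist y z.
Proof.
move=> sx sy sz; have [c _] := pdistP sx sy; have [c' _] := pdistP sy sz.
by have [_] := pdistP sx sz; apply; exact: chain_cat c c'.
Qed.

Lemma pdist_le_ch x y : surf e F x -> surf e F y -> pdist x y <= ch x y.
Proof.
move=> sx sy; have [l hl c] := chain_le_ch e0 gF sx sy.
by apply: le_trans hl; have [_] := pdistP sx sy; apply.
Qed.

Lemma pdist_xx x : surf e F x -> pdist x x = 0.
Proof.
move=> sx; apply/eqP; rewrite eq_le pdist_ge0// andbT.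
by have [_] := pdistP sx sx; apply; exact: chain_nil.
Qed.

Definition direction (g : R -> V) s (sg : R) (d : R) N v :=
  [/\ 0 < d, lface (active F (g s)) (g s) N v &
      forall h, 0 <= h <= d -> g (s + sg * h) = pt (g s) h v].

Lemma chain_param a b l : chain e F a b l -> exists g : R -> V, [/\ g 0 = a, g l = b,
  forall s t, 0 <= s -> s <= t -> t <= l -> chain e F (g s) (g t) (t - s),
  forall s, 0 <= s < l -> exists d N v, direction g s 1 d N v &
  forall s, 0 < s <= l -> exists d N v, direction g s (-1) d N v].
Proof.
elim=> {a b l} [x sx|N x y z l fx fy cyz [g [g0 gl gc gf gb]]].
  exists (fun=> x); split=> //.
  - move=> s t s0 st t0; rewrite (_ : t - s = 0); last by lra.
    exact: chain_nil.
  - by move=> s /andP[s0 s1]; exfalso; lra.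
  - by move=> s /andP[s0 s1]; exfalso; lra.
have [exy|xy] := eqVneq x y.
  have -> : ch x y = 0 by rewrite exy chxx//; case: fy => _ _ [].
  by rewrite add0r exy; exists g.
have [r [u [r0 xu qu yE rE]]] := face_to_pt e0 gF fx fy xy; rewrite -rE.
have l0 := chain_ge0 e0 gF cyz.
have qx : qf x = -1 by case: fx => _ _ [].
have fp : face e F N (pt x r u) by rewrite -yE.
have fs s : 0 <= s <= r -> face e F N (pt x s u).
  by move=> h; exact: (face_between e0 gF fx fp r0 xu qu h).
pose G s := if s <= r then pt x s u else g (s - r).
have G1 s : s <= r -> G s = pt x s u by rewrite /G => ->.
have G2 s : r <= s -> G s = g (s - r).
  rewrite /G le_eqVlt => /orP[/eqP<-|]; first by rewrite lexx subrr g0 -yE.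
  by move=> h; rewrite leNgt h.
have chG s t : 0 <= s -> s <= t -> t <= r -> chain e F (G s) (G t) (t - s).
  move=> s0 st tr; rewrite !G1//; last exact: le_trans tr.
  rewrite -(ch_pt2 qx xu qu st); apply: (chain_edge (N := N)); apply: fs.
    by rewrite s0 (le_trans st).
  by rewrite tr (le_trans s0).
have dir (s sg d : R) : 0 <= s <= r -> 0 < d -> sg = 1 \/ sg = -1 -> 0 <= s + sg * d <= r ->
    lface (active F (pt x s u)) (pt x s u) N (sg *: pt' x s u).
  move=> sr d0 hsg hd; have [ow qw] := pt'_orth s qx xu qu.
  apply: (dir_lface (h := d) (fs _ sr) _ d0).
  - suff -> : pt (pt x s u) d (sg *: pt' x s u) = pt x (s + sg * d) u by exact: fs.
    case: hsg => ->; first by rewrite scale1r mul1r pt_add.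
    by rewrite scaleN1r mulN1r pt_neg pt_add.
  - by rewrite bilZr ow mulr0.
  - by rewrite /qf bilZl bilZr -/(qf _) qw; case: hsg => ->; ring.
exists G; split.
- by rewrite G1 ?pt0// ltW.
- by rewrite G2 ?lerDl// addrC addKr.
- move=> s t s0 st tl.
  have [tr|tr] := leP t r; first exact: chG.
  have [sr|sr] := leP s r; last first.
    rewrite !G2 ?ltW// (_ : t - s = (t - r) - (s - r)); last by ring.
    by apply: gc; lra.
  rewrite (_ : t - s = (r - s) + (t - r)); last by ring.
  apply: (chain_cat (chG s r s0 sr (lexx _))).
  rewrite !G2 ?(ltW tr)// subrr -[X in chain _ _ _ _ X]subr0.
  by apply: gc; lra.
- move=> s /andP[s0 sl].
  have [sr|sr] := ltP s r.
    exists (r - s), N, (1 *: pt' x s u); rewrite /direction G1 ?(ltW sr)//.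
    have d0 : 0 < r - s by rewrite subr_gt0.
    split=> //; first by apply: (dir s 1 (r - s)) => //; [lra|by left|lra].
    by move=> h hh; rewrite mul1r G1; [rewrite scale1r pt_add|lra].
  have [|d [K [v [d0 lv hv]]]] := gf (s - r); first by lra.
  exists d, K, v; rewrite /direction (G2 s)//; split=> // h /andP[h0 hd].
  by rewrite G2; [rewrite -hv ?h0//; congr g; ring|lra].
- move=> s /andP[s0 sl].
  have [sr|sr] := leP s r.
    exists s, N, ((-1) *: pt' x s u); rewrite /direction G1//.
    split=> //; first by apply: (dir s (-1) s) => //; [lra|by right|lra].
    by move=> h hh; rewrite mulN1r G1; [rewrite scaleN1r pt_neg pt_add|lra].
  have [|d [K [v [d0 lv hv]]]] := gb (s - r); first by lra.
  exists (Num.min d (s - r)), K, v; rewrite /direction (G2 s) ?ltW//; split=> //.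
    by rewrite lt_min d0 subr_gt0.
  move=> h; rewrite le_min => /and3P[h0 hd hr].
  by rewrite G2; [rewrite -hv ?h0//; congr g; ring|lra].
Qed.

Lemma continuous_pt_bil o v k : {for 0, continuous (fun h : R => - bil (pt o h v) k)}.
Proof.
have -> : (fun h : R => - bil (pt o h v) k) = fun h => - (cosh h * bil o k + sinh h * bil v k).
  by apply/funext => h; rewrite /pt !bilE.
apply: cvgN; apply: cvgD; apply: cvgM; try exact: cvg_cst.
  exact: continuous_cosh.
exact: continuous_sinh.
Qed.

(** [z] is the point at distance [s] on a minimal chain. Along it [cosh] of the distance to [p] is
    sinh-convex by [corner_convex], and [- bil z k] by [corner_balance]; the second statement later
    confines [z] to a bounded set that does not depend on the family. *)
Lemma polyhedral_CAT a b s : surf e F a -> surf e F b -> 0 <= s <= pdist a b ->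
  exists z, [/\ surf e F z, pdist a z = s, pdist z b = pdist a b - s,
    forall p, surf e F p -> sinh (pdist a b) * cosh (pdist p z) <=
      sinh (pdist a b - s) * cosh (pdist p a) + sinh s * cosh (pdist p b) &
    forall k, (forall K, K \in F -> bil K k <= 0) ->
      sinh (pdist a b) * (- bil z k) <=
      sinh (pdist a b - s) * (- bil a k) + sinh s * (- bil b k)].
Proof.
move=> sa sb; have [c hmin] := pdistP sa sb; set l := pdist a b in c hmin *.
move=> /andP[s0 sl].
have [g [g0 gl gc gf gb]] := chain_param c.
have l0 : 0 <= l := le_trans s0 sl.
have sg t : 0 <= t <= l -> surf e F (g t).
  by move=> /andP[t0 tl]; have [h _] := chain_surf (gc t t t0 (lexx _) tl).
have gmin t t' m : 0 <= t -> t <= t' -> t' <= l -> chain e F (g t) (g t') m -> t' - t <= m.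
  move=> t0 tt tl cm.
  have c1 := gc 0 t (lexx _) t0 (le_trans tt tl); rewrite g0 subr0 in c1.
  have c2 := gc t' l (le_trans t0 tt) tl (lexx _); rewrite gl in c2.
  by have := hmin _ (chain_cat c1 (chain_cat cm c2)); lra.
have gdist t t' : 0 <= t -> t <= t' -> t' <= l -> pdist (g t) (g t') = t' - t.
  move=> t0 tt tl.
  have st : surf e F (g t) by apply: sg; rewrite t0 (le_trans tt).
  have st' : surf e F (g t') by apply: sg; rewrite tl (le_trans t0).
  have [c1 h1] := pdistP st st'.
  by apply/eqP; rewrite eq_le (h1 _ (gc _ _ t0 tt tl)) (gmin _ _ _ t0 tt tl c1).
have [l00|lp] := eqVneq l 0.
  have s00 : s = 0 by lra.
  have ab : a = b by rewrite -g0 -gl l00.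
  exists a; split=> //.
  - by rewrite pdist_xx.
  - by rewrite s00 subr0.
  - by move=> p sp; rewrite l00 s00 subrr sinh0 !mul0r addr0.
  - by move=> k _; rewrite l00 s00 subrr sinh0 !mul0r addr0.
have lp0 : 0 < l by rewrite lt_neqAle eq_sym lp.
have local t : 0 < t < l -> exists d N N' v v', (0 < d /\ d <= t /\ d <= l - t) /\ [/\
    lface (active F (g t)) (g t) N v, lface (active F (g t)) (g t) N' v',
    corner F (g t) v v' &
    forall h, 0 <= h <= d -> g (t - h) = pt (g t) h v /\ g (t + h) = pt (g t) h v'].
  move=> /andP[t0 tl].
  have [|d [N' [v' [d0 lv' hv']]]] := gf t; first by rewrite ltW.
  have [|d' [N [v [d'0 lv hv]]]] := gb t; first by rewrite t0 ltW.
  have hd h : 0 <= h <= Num.min (Num.min d d') (Num.min t (l - t)) ->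
      g (t - h) = pt (g t) h v /\ g (t + h) = pt (g t) h v'.
    rewrite !le_min => /andP[h0 /andP[/andP[hd hd'] _]].
    by rewrite -(hv h) ?h0// -(hv' h) ?h0// mulN1r mul1r.
  have D0 : 0 < Num.min (Num.min d d') (Num.min t (l - t)).
    by rewrite !lt_min d0 d'0 t0 subr_gt0 tl.
  exists (Num.min (Num.min d d') (Num.min t (l - t))), N, N', v, v'; split.
    by rewrite !ge_min !lexx !orbT.
  split=> //.
  apply: (@minimal_corner _ _ e F e0 gF _ _ _ (Num.min (Num.min d d') (Num.min t (l - t)))) => //.
    by apply: sg; rewrite !ltW.
  move=> h m h0 hh; have [|<- <-] := hd h; first by rewrite ltW.
  move: hh; rewrite !le_min => /andP[_ /andP[ht hl]] cm.
  by have := gmin _ _ _ _ _ _ cm; lra.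
exists (g s); split.
- by apply: sg; rewrite s0.
- by rewrite -g0 gdist ?subr0.
- by rewrite -gl gdist.
- move=> p sp; pose f t := cosh (pdist p (g (clamp l t))).
  have clampi t : 0 <= clamp l t <= l by exact: clamp_itv.
  have fE t : 0 <= t <= l -> f t = cosh (pdist p (g t)) by move=> h; rewrite /f clamp_id.
  have cf : continuous f.
    move=> t; apply: (continuous_comp (f := fun t => pdist p (g (clamp l t))));
      last exact: continuous_cosh.
    apply/cvgrPdist_lt => eps eps0; apply/nbhs_ballP; exists eps => //= t'.
    rewrite /ball/=; apply: le_lt_trans; apply: le_trans (clamp_lip _ _ l0).
    have key u u' : 0 <= u <= l -> 0 <= u' <= l -> pdist p (g u) - pdist p (g u') <= `|u - u'|.
      move=> hu hu'; have := pdist_tri sp (sg _ hu') (sg _ hu).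
      have [uu|uu] := leP u u'.
        rewrite (pdistC (sg _ hu') (sg _ hu)) gdist//; [|by case/andP: hu|by case/andP: hu'].
        by rewrite distrC ger0_norm ?subr_ge0//; lra.
      rewrite gdist ?(ltW uu)//; [|by case/andP: hu'|by case/andP: hu].
      by rewrite ger0_norm ?subr_ge0 ?(ltW uu)//; lra.
    rewrite ler_norml; apply/andP; split; last exact: key.
    by rewrite lerNl opprB distrC key.
  have hf t : 0 < t < l -> sinh_convex_at f t.
    move=> /[dup] t0l /andP[t0 tl]; have [d [N [N' [v [v' [[d0 [dt dl]] [lv lv' cor hd]]]]]]] := local t t0l.
    have st : surf e F (g t) by apply: sg; rewrite !ltW.
    exists d => // h h0 hhd.
    have h1 : 0 <= t - h <= l by lra.
    have h2 : 0 <= t + h <= l by lra.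
    rewrite !fE//; last by rewrite !ltW.
    have [e1 e2] : g (t - h) = pt (g t) h v /\ g (t + h) = pt (g t) h v'.
      by apply: hd; rewrite ltW.
    have s1 := sg _ h1; have s2 := sg _ h2.
    have [gp|gp] := eqVneq (g t) p.
      rewrite -gp pdist_xx// (pdistC st s1) !gdist//; try lra.
      rewrite cosh0 (_ : t - (t - h) = h); last by ring.
      rewrite (_ : t + h - t = h); last by ring.
      by lra.
    have [cp hp] := pdistP st sp.
    have [K [u gu]] := minimal_geochain e0 gF cp hp gp.
    have [c1 _] := pdistP s1 sp; have [c2 _] := pdistP s2 sp.
    rewrite (pdistC sp st) (pdistC sp s1) (pdistC sp s2).
    rewrite e1 in s1 c1 *; rewrite e2 in s2 c2 *.
    exact: (corner_convex e0 gF cor lv lv' h0 s1 s2 gu c1 c2).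
  have s0l : 0 <= s <= l by rewrite s0.
  have := sinh_convex_le lp0 cf hf s0l.
  by rewrite !fE ?lexx ?l0// g0 gl.
move=> k hk; pose f t := - bil (g (clamp l t)) k.
have fE t : 0 <= t <= l -> f t = - bil (g t) k by move=> h; rewrite /f clamp_id.
have cf : continuous f.
  move=> t.
  have fwd : exists d P, [/\ 0 < d, {for 0, continuous P}, P 0 = f t &
      forall h, 0 <= h <= d -> f (t + h) = P h].
    have [tn|tn] := ltP t 0.
      exists (- t), (fun=> f t); split=> //; [by lra|exact: cvg_cst|].
      move=> h /andP[h0 ht]; rewrite /f /clamp.
      rewrite (_ : Num.max 0 (Num.min l (t + h)) = 0).
        rewrite (_ : Num.max 0 (Num.min l t) = 0)//.
        by apply/max_idPl; rewrite ge_min (ltW tn) orbT.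
      by apply/max_idPl; rewrite ge_min; apply/orP; right; lra.
    have [tl|tl] := ltP t l; last first.
      exists 1, (fun=> f t); split=> //; first exact: cvg_cst.
      move=> h /andP[h0 ht]; rewrite /f /clamp.
      rewrite (_ : Num.min l (t + h) = l); last by apply/min_idPl; lra.
      by rewrite (_ : Num.min l t = l)//; apply/min_idPl.
    have [|d [N [v [d0 _ hv]]]] := gf t; first by rewrite tn.
    exists (Num.min d (l - t)), (fun h => - bil (pt (g t) h v) k); split.
    - by rewrite lt_min d0 subr_gt0.
    - exact: continuous_pt_bil.
    - by rewrite pt0 fE// tn ltW.
    - move=> h; rewrite le_min => /and3P[h0 hd hl]; rewrite fE; last by lra.
      by rewrite -hv ?h0// mul1r.
  have bwd : exists d P, [/\ 0 < d, {for 0, continuous P}, P 0 = f t &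
      forall h, 0 <= h <= d -> f (t - h) = P h].
    have [tn|tn] := leP t 0.
      exists 1, (fun=> f t); split=> //; first exact: cvg_cst.
      move=> h /andP[h0 ht]; rewrite /f /clamp.
      rewrite (_ : Num.max 0 (Num.min l (t - h)) = 0).
        rewrite (_ : Num.max 0 (Num.min l t) = 0)//.
        by apply/max_idPl; rewrite ge_min tn orbT.
      by apply/max_idPl; rewrite ge_min; apply/orP; right; lra.
    have [tl|tl] := leP t l; last first.
      exists (t - l), (fun=> f t); split=> //; [by lra|exact: cvg_cst|].
      move=> h /andP[h0 ht]; rewrite /f /clamp.
      rewrite (_ : Num.min l (t - h) = l); last by apply/min_idPl; lra.
      by rewrite (_ : Num.min l t = l)//; apply/min_idPl; exact: ltW.
    have [|d [N [v [d0 _ hv]]]] := gb t; first by rewrite tn.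
    exists (Num.min d t), (fun h => - bil (pt (g t) h v) k); split.
    - by rewrite lt_min d0.
    - exact: continuous_pt_bil.
    - by rewrite pt0 fE// tl ltW.
    - move=> h; rewrite le_min => /and3P[h0 hd hl]; rewrite fE; last by lra.
      by rewrite -hv ?h0// mulN1r.
  have [d [P [d0 cP P0 hP]]] := fwd; have [d' [Q [d'0 cQ Q0 hQ]]] := bwd.
  apply: (@continuous_glue _ f P Q t (Num.min d d')) => //; first by rewrite lt_min d0.
    by move=> h; rewrite le_min => /and3P[h0 hd _]; apply: hP; rewrite h0.
  by move=> h; rewrite le_min => /and3P[h0 _ hd]; apply: hQ; rewrite h0.
have hf t : 0 < t < l -> sinh_convex_at f t.
  move=> /[dup] t0l /andP[t0 tl]; have [d [N [N' [v [v' [[d0 [dt dl]] [lv lv' cor hd]]]]]]] := local t t0l.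
  have st : surf e F (g t) by apply: sg; rewrite !ltW.
  exists d => // h h0 hhd.
  have h1 : 0 <= t - h <= l by lra.
  have h2 : 0 <= t + h <= l by lra.
  rewrite !fE//; last by rewrite !ltW.
  have [e1 e2] : g (t - h) = pt (g t) h v /\ g (t + h) = pt (g t) h v'.
    by apply: hd; rewrite ltW.
  rewrite e1 e2.
  have := corner_balance e0 gF st lv lv' cor (fun K KA => hk K (active_sub KA)).
  have := sinh_gt0 h0; rewrite /pt !bilE; move: (sinh h) (bil v k) (bil v' k) => S A B S0 AB.
  by have := mulr_ge0_le0 (ltW S0) AB; lra.
have s0l : 0 <= s <= l by rewrite s0.
have := sinh_convex_le lp0 cf hf s0l.
by rewrite !fE ?lexx ?l0// g0 gl.
Qed.

End PolyhedralDistance.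

(** * Segments of the comparison plane *)

Section ComparisonPlane.
Context {R : realType}.
Local Notation W := 'cV[R]_(1 + 2).
Implicit Types (u v w p q : W) (l s t : R).

Definition embed_H2 u := mvec (u (lshift 2 0) 0) (u (rshift 1 0) 0) (u (rshift 1 1) 0).

Lemma form_embed u v : form u v = bil (embed_H2 u) (embed_H2 v).
Proof.
rewrite bil_mvec /form !big_ord_recl !big_ord0 !addr0 addrA.
by rewrite (_ : lift ord0 ord0 = 1)//; apply: val_inj.
Qed.

Lemma hyp_embed u : H2 u -> hyp 1 mnormal (embed_H2 u).
Proof.
by move=> [q u0]; apply: hyp_mvec => //; rewrite -q form_embed bil_mvec; ring.
Qed.

Lemma dH2_ge1 u v : H2 u -> H2 v -> 1 <= - form u v.
Proof.
move=> /hyp_embed hu /hyp_embed hv; rewrite form_embed.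
by have [] := hyp_ge1 (oner_neq0 R) qf_mnormal hu hv.
Qed.

Lemma cosh_dH2 u v : H2 u -> H2 v -> cosh (dH2 u v) = - form u v.
Proof. by move=> hu hv; rewrite cosh_arcosh// dH2_ge1. Qed.

Lemma dH2_ge0 u v : H2 u -> H2 v -> 0 <= dH2 u v.
Proof. by move=> hu hv; rewrite arcosh_ge0// dH2_ge1. Qed.

Lemma dH2C u v : dH2 u v = dH2 v u.
Proof. by rewrite /dH2 !form_embed bilC. Qed.

Lemma dH2_eq0 u v w : H2 u -> H2 v -> H2 w -> dH2 u v = 0 -> dH2 u w = dH2 v w.
Proof.
move=> hu hv hw h; have := cosh_dH2 hu hv; rewrite h cosh0 form_embed => e1.
have [_ /(_ (esym e1)) e2] := hyp_ge1 (oner_neq0 R) qf_mnormal (hyp_embed hu) (hyp_embed hv).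
by rewrite /dH2 !form_embed e2.
Qed.

(** By the equality case of [hyp_ge1], [q] is the combination of [u] and [w] with coefficients
    [sinh (l - t) / sinh l] and [sinh t / sinh l]; the product with [p] is linear in it. *)
Lemma dH2_segment u w q p l t : H2 u -> H2 w -> H2 q -> H2 p -> 0 < l -> 0 <= t <= l ->
  dH2 u w = l -> dH2 u q = t -> dH2 q w = l - t ->
  sinh l * cosh (dH2 p q) = sinh (l - t) * cosh (dH2 p u) + sinh t * cosh (dH2 p w).
Proof.
move=> hu hw hq hp l0 /andP[t0 tl] uw uq qw; have sl := sinh_gt0 l0.
have sl0 : sinh l != 0 by rewrite gt_eqF.
have s1 := sinh_ge0 t0; have s2 : 0 <= sinh (l - t) by rewrite sinh_ge0 // subr_ge0.
have {}uw : bil (embed_H2 u) (embed_H2 w) = - cosh l.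
  by rewrite -uw cosh_dH2// opprK form_embed.
have {}uq : bil (embed_H2 u) (embed_H2 q) = - cosh t.
  by rewrite -uq cosh_dH2// opprK form_embed.
have {}qw : bil (embed_H2 q) (embed_H2 w) = - cosh (l - t).
  by rewrite -qw cosh_dH2// opprK form_embed.
have [qu Nu ou] := hyp_embed hu; have [qw' Nw ow] := hyp_embed hw.
pose al := sinh (l - t) / sinh l; pose be := sinh t / sinh l.
have al0 : 0 <= al by rewrite divr_ge0// ltW.
have be0 : 0 <= be by rewrite divr_ge0// ltW.
have id1 : al * cosh t + be * cosh (l - t) = 1.
  transitivity ((sinh (l - t) * cosh t + cosh (l - t) * sinh t) / sinh l).
    by rewrite /al /be; ring.
  by rewrite -sinhD subrK divff.
have id2 : al + be * cosh l = cosh t.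
  rewrite /al /be sinhB; have := cosh2 l.
  move: (sinh l) (cosh l) sl0 (sinh t) (cosh t) => S C S0 S' C' h.
  apply: (mulfI S0); rewrite [LHS](_ : _ = S * C'); first by [].
  by field.
have id3 : al * cosh l + be = cosh (l - t).
  rewrite /al /be sinhB coshB; have := cosh2 l.
  move: (sinh l) (cosh l) sl0 (sinh t) (cosh t) => S C S0 S' C' h.
  apply: (mulfI S0); rewrite [LHS](_ : _ = S * C' * C - S' * (C ^+ 2 - 1)); last by field.
  by rewrite h; ring.
set U := embed_H2 u in uw uq qu Nu ou; set Z := embed_H2 w in uw qw qw' Nw ow.
have hq' : hyp 1 mnormal (al *: U + be *: Z).
  split.
  - rewrite /qf !bilE -/(qf U) -/(qf Z) qu qw' (bilC Z U) uw.
    transitivity (- (al * (al + be * cosh l) + be * (al * cosh l + be))); first by ring.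
    by rewrite id2 id3 id1.
  - by rewrite !bilE Nu Nw !mulr0 addr0.
  - have h1 := mulr_ge0 al0 (ltW ou); have h2 := mulr_ge0 be0 (ltW ow).
    rewrite !omE lt0r addr_ge0// andbT; apply/eqP => h.
    have a0 : al = 0.
      have /eqP : al * om 1 U mnormal = 0 by lra.
      by rewrite mulf_eq0 (gt_eqF ou) orbF => /eqP.
    have b0 : be = 0.
      have /eqP : be * om 1 Z mnormal = 0 by lra.
      by rewrite mulf_eq0 (gt_eqF ow) orbF => /eqP.
    by move: id1; rewrite a0 b0 !mul0r addr0 => /eqP; rewrite eq_sym oner_eq0.
have [_ eqq] := hyp_ge1 (oner_neq0 R) qf_mnormal (hyp_embed hq) hq'.
have qE : embed_H2 q = al *: U + be *: Z.
  apply: eqq; rewrite !bilE (bilC _ U) uq qw.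
  transitivity (al * cosh t + be * cosh (l - t)); first by ring.
  exact: id1.
rewrite !cosh_dH2// !form_embed qE -/U -/Z !bilE /al /be; field.
exact: sl0.
Qed.

End ComparisonPlane.

(** * From comparison with a vertex to CAT(-1) *)

Section VertexComparison.
Context {R : realType} {T : Type}.
Variables (X : set T) (d : T -> T -> R).
Implicit Types (x y z a b p : T) (s t : R) (c : R -> T).

Definition vertex_CAT := forall a b s, X a -> X b -> 0 <= s <= d a b ->
  exists z, [/\ X z, d a z = s, d z b = d a b - s & forall p, X p ->
    sinh (d a b) * cosh (d p z) <=
    sinh (d a b - s) * cosh (d p a) + sinh s * cosh (d p b)].

Hypotheses (md : is_metric X d) (vC : vertex_CAT).

Let d_ge0 x y : X x -> X y -> 0 <= d x y. Proof. by case: md => h _ _ _; exact: h. Qed.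
Let d_eq0 x y : X x -> X y -> d x y = 0 <-> x = y.
Proof. by case: md => _ h _ _; exact: h. Qed.
Let dC x y : X x -> X y -> d x y = d y x. Proof. by case: md => _ _ h _; exact: h. Qed.
Let d_tri x y z : X x -> X y -> X z -> d x z <= d x y + d y z.
Proof. by case: md => _ _ _ h; exact: h. Qed.

Let sinh_three l s t : sinh (l - s) * cosh t + sinh s * cosh (l - t) = sinh l * cosh (t - s) :> R.
Proof.
by rewrite sinhB !coshB; ring.
Qed.

(** The points [g s] are chosen independently, and still form a geodesic: the inequality with
    [p := g t] bounds their distance above by the difference of the parameters, the triangle
    inequality bounds it below. *)
Lemma vertex_geodesic_space : geodesic_space X d.
Proof.
move=> x y Xx Xy; set l := d x y.
have /choice[g hg] : forall s, exists z, 0 <= s <= l -> [/\ X z, d x z = s, d z y = l - s &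
    forall p, X p -> sinh l * cosh (d p z) <=
      sinh (l - s) * cosh (d p x) + sinh s * cosh (d p y)].
  move=> s; have [h|h] := boolP (0 <= s <= l); last by exists x.
  by have [z hz] := vC Xx Xy h; exists z.
have l0 : 0 <= l by exact: d_ge0.
have r0 : 0 <= (0 : R) <= l by rewrite lexx.
have rl : 0 <= l <= l by rewrite l0 lexx.
exists g; split.
- by have [Xg h _ _] := hg 0 r0; apply/esym/d_eq0.
- by have [Xg _ h _] := hg l rl; apply/d_eq0; rewrite ?h ?subrr.
- by move=> s /hg[].
move=> s t hs ht; have [Xs xs sy hS] := hg s hs; have [Xt xt ty _] := hg t ht.
have [s0 sl] := andP hs; have [t0 tl] := andP ht; rewrite -/l in sl tl.
apply/eqP; rewrite eq_le; apply/andP; split; last first.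
  have h1 := d_tri Xx Xs Xt; have h2 := d_tri Xx Xt Xs.
  rewrite xs xt in h1; rewrite xs xt (dC Xt Xs) in h2.
  by rewrite ler_norml; apply/andP; split; lra.
have [l00|lp] := eqVneq l 0.
  rewrite l00 in sl tl.
  have -> : s = t by apply: (@le_anti _ R); rewrite (le_trans sl t0) (le_trans tl s0).
  by rewrite subrr normr0 (proj2 (d_eq0 Xt Xt)).
have lp0 : 0 < l by rewrite lt_neqAle eq_sym lp.
have := hS _ Xt; rewrite (dC Xt Xx) xt ty sinh_three ler_pM2l ?sinh_gt0//.
by rewrite -(cosh_abs (t - s)) cosh_le// ?d_ge0// (dC Xs Xt) distrC.
Qed.

(** The inequality applied to the point [c s] itself gives [cosh (d (c s) z) <= 1], so every
    geodesic passes through the point provided by [vertex_CAT]. *)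
Lemma geodesic_vertex x y c s p : X x -> X y -> is_geodesic X d x y c -> 0 <= s <= d x y ->
  X p -> sinh (d x y) * cosh (d p (c s)) <=
    sinh (d x y - s) * cosh (d p x) + sinh s * cosh (d p y).
Proof.
move=> Xx Xy [c0 cl Xc cd] hs Xp; have [s0 sl] := andP hs.
have l0 := d_ge0 Xx Xy.
have r0 : 0 <= (0 : R) <= d x y by rewrite lexx.
have rl : 0 <= d x y <= d x y by rewrite l0 lexx.
have [l00|lp] := eqVneq (d x y) 0.
  have s00 : s = 0 by lra.
  by rewrite s00 subr0 l00 sinh0 !mul0r addr0.
have lp0 : 0 < d x y by rewrite lt_neqAle eq_sym lp.
have [z [Xz xz zy hz]] := vC Xx Xy hs.
have Xcs := Xc s hs.
suff -> : c s = z by exact: hz.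
have e1 : d (c s) x = s by rewrite -[in LHS]c0 cd// subr0 ger0_norm.
have e2 : d (c s) y = d x y - s.
  by rewrite -[in LHS]cl cd// distrC ger0_norm ?subr_ge0.
have := hz _ Xcs; rewrite e1 e2 sinh_three subrr ler_pM2l ?sinh_gt0// cosh0 => h.
apply/d_eq0 => //; apply: cosh_inj; rewrite ?d_ge0// cosh0.
by apply/eqP; rewrite eq_le h cosh_ge1.
Qed.

(** The inequality is used twice: on the side [[x, y]] for the distance to [z], then on [[x, z]] for
    the distance to [c1 s]. In the comparison plane both are equalities. *)
Lemma vertex_CATm1 : CATm1 X d.
Proof.
split=> //; first exact: vertex_geodesic_space.
move=> x y z c1 c2 c3 Xx Xy Xz g1 g2 _ u v w hu hv hw uv uw vw s t hs ht p q hp hq up pv uq qw.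
have [s0 sl] := andP hs; have [t0 tl] := andP ht.
have [c10 c1l Xc1 cd1] := g1; have [c20 c2l Xc2 cd2] := g2.
have Xp := Xc1 s hs; have Xq := Xc2 t ht.
have r1 : 0 <= (0 : R) <= d x y by rewrite lexx d_ge0.
have r2 : 0 <= (0 : R) <= d x z by rewrite lexx d_ge0.
have dp : d (c1 s) x = s by rewrite -[in LHS]c10 (cd1 _ _ hs r1) subr0 ger0_norm.
have dq : d x (c2 t) = t by rewrite -[in LHS]c20 (cd2 _ _ r2 ht) sub0r normrN ger0_norm.
have [l20|l2] := eqVneq (d x z) 0.
  have t00 : t = 0 by lra.
  rewrite t00 c20 dp -up (dH2C p) (@dH2_eq0 _ u q p)//; by rewrite uq t00.
have [l10|l1] := eqVneq (d x y) 0.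
  have s00 : s = 0 by lra.
  by rewrite s00 c10 dq -(@dH2_eq0 _ u p q)// ?up ?s00// uq.
have l20 : 0 < d x z by rewrite lt_neqAle eq_sym l2 d_ge0.
have l10 : 0 < d x y by rewrite lt_neqAle eq_sym l1 d_ge0.
have s10 := sinh_gt0 l10; have s20 := sinh_gt0 l20.
have step1 : cosh (d z (c1 s)) <= cosh (dH2 w p).
  rewrite -(ler_pM2l s10) (le_trans (geodesic_vertex Xx Xy g1 hs Xz))//.
  rewrite (@dH2_segment _ u v p w _ s)// (dH2C w u) uw (dH2C w v) vw.
  by rewrite (dC Xz Xx) (dC Xz Xy).
rewrite -cosh_le ?d_ge0 ?dH2_ge0// -(ler_pM2l s20).
apply: (le_trans (geodesic_vertex Xx Xz g2 ht Xp)).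
rewrite (@dH2_segment _ u w q p _ t)// dp (dH2C p u) up lerD2l.
by rewrite ler_wpM2l ?sinh_ge0// (dC Xp Xz) (dH2C p w).
Qed.

End VertexComparison.

(** * Unrolling two planes *)

Section TwoPlanes.
Context {R : realType} {n : nat}.
Local Notation V := 'cV[R]_(2 + n).
Variables (e : R) (N M : V).
Hypotheses (e0 : e != 0) (gF : good [:: N; M]).
Implicit Types (x y z w : V).

Let F := [:: N; M].
Let b := bil N M.
Let NF : N \in F. Proof. by rewrite inE eqxx. Qed.
Let MF : M \in F. Proof. by rewrite !inE eqxx orbT. Qed.
Let qN : qf N = -1. Proof. exact: (proj1 gF). Qed.
Let qM : qf M = -1. Proof. exact: (proj1 gF). Qed.
Let b1 : b <= -1.
Proof.
have [h|] := proj2 gF N M NF MF; last exact: ltW.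
by rewrite /b -h -/(qf N) qN.
Qed.

(* Rotation of the plane of [M] onto the plane of [N], extended by the identity. *)
Definition unroll z : V := z + (bil N z / (1 - bil N M)) *: (N + M).

Let b10 : 1 - b != 0. Proof. by rewrite gt_eqF//; move: b1; lra. Qed.

Let unrollN z : bil N z = 0 -> unroll z = z.
Proof. by rewrite /unroll => ->; rewrite mul0r scale0r addr0. Qed.

Let unroll_bil z w : bil M z = 0 -> bil M w = 0 -> bil (unroll z) (unroll w) = bil z w.
Proof.
move=> Mz Mw; rewrite /unroll !bilE -/(qf N) -/(qf M) qN qM (bilC z N) (bilC z M) Mz Mw.
by rewrite (bilC M N) -/b; move: b b10 => c c0; field.
Qed.

Let hyp_unroll z : surf e F z -> hyp e N (unroll z).
Proof.
move=> sz; have [Nz|Nz] := eqVneq (bil N z) 0.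
  by rewrite unrollN//; have [_ _] := surf_face e0 gF sz NF Nz.
have [K [+ Fz [qz Kz oz]]] := sz; rewrite !inE => /orP[/eqP KN|/eqP KM].
  by rewrite KN in Kz; rewrite Kz eqxx in Nz.
rewrite KM in Kz oz; have Nz0 : bil N z < 0 by rewrite lt_neqAle Nz Fz.
have bb : 0 < b ^+ 2 - 1.
  have [NM|h] := proj2 gF N M NF MF; first by rewrite NM Kz eqxx in Nz.
  by rewrite -/b in h; nra.
have b2 : b ^+ 2 - 1 != 0 by rewrite gt_eqF.
(* The projection of [z] to the intersection of the two planes. It transfers the side: [z] and [p]
   share a sheet in the orthogonal of [M], [M] and [N] one in the orthogonal of [p], and [p] and
   [unroll z] one in the orthogonal of [N]. *)
pose p := z - (bil N z / (b ^+ 2 - 1)) *: (N + b *: M).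
have Np : bil N p = 0.
  by rewrite /p !bilE -/(qf N) qN -/b; move: b b2 => c c2; field.
have Mp : bil M p = 0.
  by rewrite /p !bilE -/(qf M) qM (bilC M N) -/b Kz; ring.
have zp : bil z p = -1 - (bil N z) ^+ 2 / (b ^+ 2 - 1).
  rewrite /p !bilE -/(qf z) qz (bilC z N) (bilC z M) Kz.
  by move: b b2 => c c2; field.
have zp0 : bil z p < 0.
  by rewrite zp; have := divr_ge0 (sqr_ge0 (bil N z)) (ltW bb); lra.
have qp : qf p = bil z p.
  by rewrite /qf {1}/p bilDl bilNl bilZl bilDl bilZl Np Mp; ring.
have MM : qf M < 0 by rewrite qM oppr_lt0.
have NN : qf N < 0 by rewrite qN oppr_lt0.
have zz : qf z < 0 by rewrite qz oppr_lt0.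
have pp : qf p < 0 by rewrite qp.
have opM : 0 < om e p M.
  have := same_sheet e0 MM (etrans (bilC _ _) Kz) (etrans (bilC _ _) Mp) zz (ltW pp) zp0.
  by rewrite pmulr_rgt0.
have opN : 0 < om e p N.
  have MN0 : bil M N < 0 by rewrite bilC -/b; move: b1; lra.
  have := same_sheet e0 pp Mp Np MM (ltW NN) MN0.
  by rewrite (omC e M) (omC e N) mulrNN pmulr_rgt0.
have qu : qf (unroll z) = -1 by rewrite /qf unroll_bil.
have Nu : bil N (unroll z) = 0.
  by rewrite /unroll !bilE -/(qf N) qN -/b; move: b b10 => c c0; field.
split=> //.
have up : bil p (unroll z) < 0.
  by rewrite /unroll bilDr bilZr bilDr (bilC p z) (bilC p N) (bilC p M) Np Mp addr0 mulr0 addr0.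
have uu : qf (unroll z) <= 0 by rewrite qu lerN10.
have := same_sheet e0 NN (etrans (bilC _ _) Np) (etrans (bilC _ _) Nu) pp uu up.
by rewrite pmulr_rgt0.
Qed.

(** Unrolling fixes the plane of [N] and is isometric on that of [M], so a chain becomes a chain of
    equal length in one hyperbolic space. *)
Lemma two_plane_bound x y l : face e F N x -> face e F M y -> chain e F x y l ->
  hyp e N (unroll y) /\ ch x (unroll y) <= l.
Proof.
move=> fx fy c; split; first by apply: hyp_unroll; exists M.
have xE : unroll x = x by apply: unrollN; case: fx => _ _ [].
rewrite -xE; elim: c {fx fy xE} => {x y l} [x sx|K x y z l fx fy c ih].
  by rewrite chxx//; have [] := hyp_unroll sx.
have hx := hyp_unroll (ex_intro _ K fx); have hy := hyp_unroll (ex_intro _ K fy).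
have [_ sz] := chain_surf c; have hz := hyp_unroll sz.
apply: (le_trans (hyp_tri e0 qN hx hy hz)); apply: lerD ih.
rewrite le_eqVlt; apply/orP; left; apply/eqP; rewrite /ch.
case: fx fy => + _ [_ Kx _] [_ _ [_ Ky _]].
rewrite !inE => /orP[/eqP KN|/eqP KM]; first by rewrite KN in Kx Ky; rewrite !unrollN.
by rewrite KM in Kx Ky; rewrite unroll_bil.
Qed.

End TwoPlanes.

(** * Convex surfaces and their intrinsic distance *)

Section ConvexSurfaces.
Context {R : realType} {n : nat}.
Local Notation V := 'cV[R]_(2 + n).
Implicit Types (x y z a b k N M : V) (F : seq V) (S : set V) (C s l : R).

Definition support e S N x :=
  [/\ qf N = -1, bil N x = 0, 0 < om e x N & forall y, S y -> bil N y <= 0].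

(** What the limit of polyhedra requires. [cs_maximal] puts limits of polyhedral points back on [S];
    [cs_span] bounds a point by its products with finitely many points of [S]; [cs_bound] bounds the
    support normals over bounded parts, which makes the distance comparable with the Euclidean
    one. *)
Record convex_surface (e : R) (S : set V) : Prop := ConvexSurface {
  cs_neq0 : e != 0;
  cs_AdS : forall x, S x -> qf x = -1;
  cs_lt0 : forall x y, S x -> S y -> bil x y < 0;
  cs_support : forall x, S x -> exists N, support e S N x;
  cs_maximal : forall z, qf z = -1 -> (forall k, S k -> 1 <= - bil z k) -> S z;
  cs_span : exists ks : seq V, (forall k, k \in ks -> S k) /\
    exists C, forall x j, `|x j 0| <= C * \sum_(k <- ks) `|bil x k|;
  cs_bound : forall B : R, exists C, forall x N, S x -> support e S N x ->
    (forall j, `|x j 0| <= B) -> forall j, `|N j 0| <= C }.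

Variables (e : R) (S : set V).
Hypothesis cS : convex_surface e S.
Let e0 := cs_neq0 cS.

Definition family F := forall N, N \in F -> exists2 x, S x & support e S N x.

(** [support_acausal] with points and normals exchanged and [e] replaced by [- e]. *)
Lemma family_good F : family F -> good F.
Proof.
move=> fF; split=> [N /fF[x _ []]//|N M /fF[x Sx [qN Nx ox hN]] /fF[y Sy [qM My oy hM]]].
apply: (@support_acausal _ _ (- e) x y) => //.
- by rewrite oppr_eq0.
- exact: (cs_AdS cS).
- exact: (cs_AdS cS).
- exact: hM.
- exact: hN.
- exact: (cs_lt0 cS).
- by rewrite omC /om mulNr opprK.
- by rewrite omC /om mulNr opprK.
Qed.

Lemma family_cons F x N : family F -> S x -> support e S N x -> family (N :: F).
Proof. by move=> fF Sx sN M; rewrite inE => /orP[/eqP->|/fF//]; exists x. Qed.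

Lemma family_face F x N : family F -> S x -> support e S N x -> N \in F -> face e F N x.
Proof.
move=> fF Sx [qN Nx ox hN] NF; split=> //.
  by move=> M /fF[y _ [_ _ _]]; apply.
by split=> //; exact: (cs_AdS cS).
Qed.

Lemma surf_mono F F' x : family F' -> S x -> {subset F <= F'} -> surf e F x -> surf e F' x.
Proof.
move=> fF Sx s sx; apply: (surf_sub s sx) => M /fF[y _ [_ _ _]]; exact.
Qed.

Lemma pdist_mono F F' a b : family F' -> S a -> S b -> {subset F <= F'} ->
  surf e F a -> surf e F b -> pdist e F a b <= pdist e F' a b.
Proof.
move=> fF Sa Sb s sa sb; have gF' := family_good fF; have gF := good_sub gF' s.
have [c _] := pdistP e0 gF' (surf_mono fF Sa s sa) (surf_mono fF Sb s sb).
have [l hl c'] := chain_restrict e0 gF' s c sa sb.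
by apply: le_trans hl; have [_] := pdistP e0 gF sa sb; apply.
Qed.

Definition admissible a b F := [/\ family F, surf e F a & surf e F b].

Definition idist a b : R := sup [set pdist e F a b | F in admissible a b].

Lemma admissible_ex F a b : S a -> S b -> family F ->
  exists2 F', admissible a b F' & {subset F <= F'}.
Proof.
move=> Sa Sb fF; have [N sN] := cs_support cS Sa; have [M sM] := cs_support cS Sb.
have f1 := family_cons (family_cons fF Sa sN) Sb sM.
exists [:: M, N & F]; last by move=> K KF; rewrite !inE KF !orbT.
split=> //; [exists N|exists M]; apply: family_face => //.
  by rewrite !inE eqxx orbT.
by rewrite inE eqxx.
Qed.

Lemma family_nil : family [::]. Proof. by []. Qed.

Lemma idist_has_sup a b : S a -> S b -> has_sup [set pdist e F a b | F in admissible a b].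
Proof.
move=> Sa Sb; split.
  have [F aF _] := admissible_ex Sa Sb family_nil.
  by exists (pdist e F a b); exists F.
exists (ch a b) => _ [F [fF sa sb] <-].
exact: (pdist_le_ch e0 (family_good fF)).
Qed.

Lemma pdist_le_idist F a b : S a -> S b -> admissible a b F -> pdist e F a b <= idist a b.
Proof.
move=> Sa Sb aF; apply: sup_upper_bound; [exact: idist_has_sup|by exists F].
Qed.

Lemma idist_le a b C : S a -> S b ->
  (forall F, admissible a b F -> pdist e F a b <= C) -> idist a b <= C.
Proof.
move=> Sa Sb h; apply: ge_sup; first by have [] := idist_has_sup Sa Sb.
by move=> _ [F aF <-]; exact: h.
Qed.

Lemma idist_le_ch a b : S a -> S b -> idist a b <= ch a b.
Proof.
move=> Sa Sb; apply: idist_le => // F [fF sa sb].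
exact: (pdist_le_ch e0 (family_good fF)).
Qed.

Lemma idist_ge0 a b : S a -> S b -> 0 <= idist a b.
Proof.
move=> Sa Sb; have [F aF _] := admissible_ex Sa Sb family_nil.
apply: le_trans (pdist_le_idist Sa Sb aF); have [fF sa sb] := aF.
exact: (pdist_ge0 e0 (family_good fF)).
Qed.

Lemma idist_leC a b : S a -> S b -> idist a b <= idist b a.
Proof.
move=> Sa Sb; apply: idist_le => // F [fF sa sb].
rewrite (pdistC e0 (family_good fF))//; exact: pdist_le_idist.
Qed.

Lemma idistC a b : S a -> S b -> idist a b = idist b a.
Proof. by move=> Sa Sb; apply/eqP; rewrite eq_le !idist_leC. Qed.

Lemma idist_xx a : S a -> idist a a = 0.
Proof.
move=> Sa; apply/eqP; rewrite eq_le idist_ge0// andbT.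
by apply: (le_trans (idist_le_ch Sa Sa)); rewrite chxx//; exact: (cs_AdS cS).
Qed.

(** The point [y] may lie off the polyhedron. A support normal at [y] is added to the family, which
    does not decrease the left side. *)
Lemma idist_tri x y z : S x -> S y -> S z -> idist x z <= idist x y + idist y z.
Proof.
move=> Sx Sy Sz; apply: idist_le => // F [fF sx sz].
have [N sN] := cs_support cS Sy; have fF' := family_cons fF Sy sN.
have sub : {subset F <= N :: F} by move=> K KF; rewrite inE KF orbT.
have sx' := surf_mono fF' Sx sub sx; have sz' := surf_mono fF' Sz sub sz.
have sy' : surf e (N :: F) y by exists N; apply: family_face => //; rewrite mem_head.
apply: (le_trans (pdist_mono fF' Sx Sz sub sx sz)).
apply: (le_trans (pdist_tri e0 (family_good fF') sx' sy' sz')).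
by apply: lerD; apply: pdist_le_idist.
Qed.

Lemma support_unroll a b N M : S a -> S b -> support e S N a -> support e S M b ->
  hyp e N (unroll N M b) /\ ch a (unroll N M b) <= idist a b.
Proof.
move=> Sa Sb sN sM.
have fF : family [:: N; M] by apply: (family_cons _ Sa sN); exact: (family_cons family_nil Sb sM).
have gF := family_good fF.
have fa : face e [:: N; M] N a by apply: family_face => //; rewrite mem_head.
have fb : face e [:: N; M] M b by apply: family_face => //; rewrite !inE eqxx orbT.
have [c _] := pdistP e0 gF (ex_intro _ N fa) (ex_intro _ M fb).
have [h1 h2] := two_plane_bound e0 gF fa fb c; split=> //.
by apply: (le_trans h2); apply: pdist_le_idist => //; split=> //; [exists N|exists M].
Qed.

Lemma support_lt0 a b N M : S a -> S b -> support e S N a -> support e S M b -> bil N M <= -1.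
Proof.
move=> Sa Sb sN sM.
have fF : family [:: N; M] by apply: (family_cons _ Sa sN); exact: (family_cons family_nil Sb sM).
have NF : N \in [:: N; M] by rewrite inE eqxx.
have MF : M \in [:: N; M] by rewrite !inE eqxx orbT.
have [->|] := proj2 (family_good fF) N M NF MF; last exact: ltW.
by case: sM => qM _ _ _; rewrite -/(qf M) qM.
Qed.

(** The coordinate is, up to sign, the product with a basis vector [x]. The projection [t] of [x] to
    the orthogonal of [a] and [N] has norm at most the second factor, and Cauchy-Schwarz holds
    there. *)
Lemma coord_CS a N u j : qf a = -1 -> qf N = -1 -> bil a N = 0 -> bil a u = 0 ->
  bil N u = 0 -> (u j 0) ^+ 2 <= qf u * (1 + a j 0 ^+ 2 + N j 0 ^+ 2).
Proof.
move=> qa qN aN au Nu.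
have [x [sx [sx2 [qx hx]]]] : exists x : V, exists sx : R, sx ^+ 2 = 1 /\ qf x <= 1 /\
    forall y, bil x y = sx * y j 0.
  exists (\col_i (i == j)%:R).
  have bE y : bil (\col_i (i == j)%:R) y = (if (j < 2)%N then -1 else 1) * y j 0.
    rewrite /bil /form; case: (split_ordP j) => i ->.
      rewrite [X in _ + X]big1 => [|k _]; last first.
        by rewrite mxE eq_rlshift mul0r.
      rewrite (bigD1 i)//= mxE eqxx mul1r big1 => [|k ki]; first by ring.
      by rewrite mxE (inj_eq (@lshift_inj _ _)) (negbTE ki) mul0r.
    rewrite [X in - X]big1 => [|k _]; last first.
      by rewrite mxE eq_lrshift mul0r.
    rewrite (bigD1 i)//= mxE eqxx mul1r big1 => [|k ki]; first by ring.
    by rewrite mxE (inj_eq (@rshift_inj _ _)) (negbTE ki) mul0r.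
  exists (if (j < 2)%N then -1 else 1); split; first by case: ifP; rewrite ?sqrrN expr1n.
  by split=> //; rewrite /qf bE mxE eqxx mulr1; case: ifP => // _; rewrite lerNl lerN10.
pose t := x + bil x a *: a + bil x N *: N.
have aa : qf a < 0 by rewrite qa oppr_lt0.
have NN : qf N < 0 by rewrite qN oppr_lt0.
have at0 : bil a t = 0 by rewrite /t !bilE -/(qf a) qa aN (bilC a x); ring.
have Nt0 : bil N t = 0 by rewrite /t !bilE -/(qf N) qN (bilC N a) aN (bilC N x); ring.
have ut : bil u t = bil x u.
  by rewrite /t !bilE (bilC u a) (bilC u N) au Nu !mulr0 !addr0 bilC.
have qt : qf t = qf x + (bil x a) ^+ 2 + (bil x N) ^+ 2.
  by rewrite /qf /t !bilE -/(qf a) -/(qf N) qa qN (bilC N a) aN (bilC N x) (bilC a x); ring.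
have := spacelike_CS aa NN aN au Nu at0 Nt0.
have [u0 _] := neg_orth_pos aa NN aN au Nu.
rewrite ut qt !hx !exprMn sx2 !mul1r => h; apply: (le_trans h).
by rewrite ler_wpM2l// !lerD2r.
Qed.

Lemma sinh_le_mul (s : R) : 0 <= s -> sinh s <= s * expR s.
Proof.
move=> s0; rewrite /sinh.
have -> : expR (- s) = expR s * expR (- (2 * s)) by rewrite -expRD; congr expR; ring.
have := expR_ge1Dx (- (2 * s)); have := expR_gt0 s; nra.
Qed.

Lemma cosh_subr1_le (s : R) : 0 <= s -> cosh s - 1 <= sinh s.
Proof.
move=> s0; have : expR (- s) <= 1 by rewrite -expR0 ler_expR oppr_le0.
by rewrite /cosh /sinh; lra.
Qed.

Lemma bil_bound x y (B C : R) : (forall j, `|x j 0| <= B) -> (forall j, `|y j 0| <= C) ->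
  `|bil x y| <= (2 + n)%:R * (B * C).
Proof.
move=> hx hy; rewrite /bil /form natrD mulrDl.
have h i : `|x i 0 * y i 0| <= B * C by rewrite normrM ler_pM.
apply: (le_trans (ler_normD _ _)); rewrite normrN; apply: lerD.
  apply: (le_trans (ler_norm_sum _ _ _)); apply: (le_trans (ler_sum _ (fun i _ => h _))).
  by rewrite sumr_const card_ord mulr_natl.
apply: (le_trans (ler_norm_sum _ _ _)); apply: (le_trans (ler_sum _ (fun i _ => h _))).
by rewrite sumr_const card_ord mulr_natl.
Qed.

(* On bounded parts the intrinsic distance dominates the Euclidean one: unroll [b]
   to [b'] in the support plane at [a]; then [b' - a] is controlled by the hyperbolic
   distance, and [b - b'] by [bil N b <= bil M (b' - a)]. *)
Lemma idist_ge_coord (B : R) : exists2 C, 0 < C & forall a b, S a -> S b ->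
  (forall j, `|a j 0| <= B) -> (forall j, `|b j 0| <= B) ->
  forall j, `|b j 0 - a j 0| <= C * idist a b.
Proof.
have [Q0 hQ0] := cs_bound cS B.
(* [Q] bounds points and normals, and [D0] bounds [ch a b], whence [sinh dl <= dl * expR D0]. Then
   [C1] controls [b' - a], and [C2] adds the displacement of [b] by unrolling. *)
pose Q := 1 + `|Q0| + `|B|.
have Q1 : 1 <= Q by rewrite /Q; have := normr_ge0 Q0; have := normr_ge0 B; lra.
pose D0 := arcosh (1 + (2 + n)%:R * (Q * Q)).
pose C1 := expR D0 * (3 * Q + Q).
pose C2 := C1 + (2 + n)%:R * (Q * C1) * (2 * Q).
have E0 := expR_gt0 D0.
have C10 : 0 < C1 by rewrite mulr_gt0//; lra.
have n0 : 0 <= (2 + n)%:R :> R by [].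
have C20 : 0 < C2 by rewrite /C2 ltr_pwDl// !mulr_ge0//; lra.
exists C2 => // a b Sa Sb ha hb j.
have ha' i : `|a i 0| <= Q by apply: (le_trans (ha i)); rewrite /Q; have := ler_norm B; have := normr_ge0 Q0; lra.
have hb' i : `|b i 0| <= Q by apply: (le_trans (hb i)); rewrite /Q; have := ler_norm B; have := normr_ge0 Q0; lra.
have [N sN] := cs_support cS Sa; have [M sM] := cs_support cS Sb.
have hN i : `|N i 0| <= Q.
  by apply: (le_trans (hQ0 _ _ Sa sN ha i)); rewrite /Q; have := ler_norm Q0; have := normr_ge0 B; lra.
have hM i : `|M i 0| <= Q.
  by apply: (le_trans (hQ0 _ _ Sb sM hb i)); rewrite /Q; have := ler_norm Q0; have := normr_ge0 B; lra.
have [hb'' hD] := support_unroll Sa Sb sN sM.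
have NM := support_lt0 Sa Sb sN sM.
have [qN Na oa Nle] := sN; have [qM Mb ob Mle] := sM.
have qa := cs_AdS cS Sa.
have hypa : hyp e N a by [].
move: hb'' hD; move b'E : (unroll N M b) => b' hb'' hD.
have [g1 _] := hyp_ge1 e0 qN hypa hb''.
set dl := ch a b' in hD.
have dl0 : 0 <= dl by exact: arcosh_ge0.
have D00 : 0 <= D0 by apply: arcosh_ge0; rewrite lerDl !mulr_ge0//; lra.
have dlD : dl <= D0.
  apply: (le_trans hD); apply: (le_trans (idist_le_ch Sa Sb)).
  apply: arcosh_le.
    have [N1 sN1] := cs_support cS Sa; have [F [fF sa sb] _] := admissible_ex Sa Sb family_nil.
    exact: (surf_ge1 e0 (family_good fF) sa sb).
  have := bil_bound ha' hb'; have := ler_norm (- bil a b); rewrite normrN; lra.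
have cdl : cosh dl = - bil a b' by rewrite /dl cosh_arcosh.
have [w wE] : exists w, w = b' - a by exists (b' - a).
have [qb' Nb' _] := hb''.
have wa : bil w a = 1 - cosh dl.
  by rewrite wE !bilE (bilC b' a) -/(qf a) qa cdl; ring.
have hw i : `|w i 0| <= C1 * dl.
  (* The part of [b' - a] orthogonal to [a]. It is also orthogonal to [N], and its norm is
     [sinh dl ^+ 2]. *)
  have [t tE] : exists t, t = w + bil w a *: a by exists (w + bil w a *: a).
  have at0 : bil a t = 0 by rewrite tE !bilE -/(qf a) qa (bilC a w); ring.
  have Nt0 : bil N t = 0 by rewrite tE !bilE {1}wE !bilE Nb' Na; ring.
  have qt : qf t = sinh dl ^+ 2.
    have -> : qf t = qf w + (bil w a) ^+ 2 by rewrite /qf tE !bilE -/(qf a) qa (bilC a w); ring.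
    rewrite wa (_ : qf w = 2 * (cosh dl - 1)); first by have := cosh2 dl; lra.
    by rewrite wE /qf !bilE -/(qf a) -/(qf b') qa qb' (bilC b' a) cdl; ring.
  have := coord_CS i qa qN (etrans (bilC _ _) Na) at0 Nt0; rewrite qt => ht.
  have sq (r : R) : `|r| <= Q -> r ^+ 2 <= Q ^+ 2.
    by rewrite ler_norml => /andP[r1 r2]; nra.
  have h3 : `|t i 0| <= sinh dl * (3 * Q).
    have s0 := sinh_ge0 dl0.
    have h3 : t i 0 ^+ 2 <= (sinh dl * (3 * Q)) ^+ 2.
      apply: (le_trans ht); rewrite [leRHS]exprMn ler_wpM2l ?sqr_ge0//.
      by have := sq _ (ha' i); have := sq _ (hN i); nra.
    have h4 : 0 <= sinh dl * (3 * Q) by apply: mulr_ge0 => //; lra.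
    move: (sinh dl * (3 * Q)) (t i 0) h3 h4 => r r' h3 h4.
    by rewrite ler_norml; apply/andP; split; nra.
  have wi : w i 0 = t i 0 + (cosh dl - 1) * a i 0.
    by rewrite tE wa [in RHS]mxE [in RHS]mxE; ring.
  rewrite wi; apply: (le_trans (ler_normD _ _)); rewrite normrM.
  have c0 : 0 <= cosh dl - 1 by rewrite subr_ge0 cosh_ge1.
  rewrite (ger0_norm c0).
  have k1 := sinh_le_mul dl0; have k2 := cosh_subr1_le dl0.
  have k3 : expR dl <= expR D0 by rewrite ler_expR.
  have k4 : sinh dl <= dl * expR D0 by apply: (le_trans k1); rewrite ler_wpM2l.
  have k5 : (cosh dl - 1) * `|a i 0| <= (dl * expR D0) * Q.
    by apply: ler_pM => //; exact: le_trans k4.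
  have k6 : sinh dl * (3 * Q) <= (dl * expR D0) * (3 * Q) by rewrite ler_wpM2r//; lra.
  rewrite /C1 (_ : _ * dl = (dl * expR D0) * (3 * Q) + (dl * expR D0) * Q); last by ring.
  by apply: lerD => //; exact: le_trans k6.
have hC : 0 <= C1 * dl by rewrite mulr_ge0// ltW.
have Mw : `|bil N b| <= (2 + n)%:R * (Q * (C1 * dl)).
  have Nb : bil N b <= 0 by exact: Nle.
  have nb1 : 1 - bil N M != 0 by rewrite gt_eqF//; lra.
  have Mb' : bil M b' = - bil N b.
    rewrite -b'E /unroll !bilE -/(qf M) qM Mb (bilC M N); field.
    exact: nb1.
  have Ma : bil M a <= 0 by exact: Mle.
  rewrite ler0_norm// -Mb'; apply: (@le_trans _ _ (bil M w)); first by rewrite wE !bilE; lra.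
  by apply: (le_trans (ler_norm _)); exact: bil_bound.
have bE : b j 0 - a j 0 = w j 0 - (bil N b / (1 - bil N M)) * (N j 0 + M j 0).
  by rewrite wE -b'E /unroll !mxE; ring.
rewrite bE; apply: (le_trans (ler_normB _ _)).
have h1 : `|bil N b / (1 - bil N M) * (N j 0 + M j 0)| <= (2 + n)%:R * (Q * (C1 * dl)) * (2 * Q).
  rewrite normrM; apply: ler_pM => //.
    rewrite normrM normfV -[leRHS]mulr1; apply: ler_pM => //.
    by rewrite ger0_norm; [rewrite invf_le1; lra|lra].
  by apply: (le_trans (ler_normD _ _)); have := hN j; have := hM j; lra.
apply: (le_trans (lerD (hw j) h1)).
rewrite (_ : _ + _ = C2 * dl); last by rewrite /C2; ring.
by rewrite ler_pM2l.
Qed.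

Lemma idist_metric : is_metric S idist.
Proof.
split; [exact: idist_ge0| |exact: idistC|by move=> *; exact: idist_tri].
move=> a b Sa Sb; split=> [h|<-]; last exact: idist_xx.
have [C _ hC] := idist_ge_coord (`|a| + `|b|).
apply/matrixP => j i; rewrite ord1; apply/eqP; rewrite eq_sym -subr_eq0 -normr_le0.
have := hC a b Sa Sb; rewrite h mulr0; apply.
- by move=> k; apply: (le_trans (col_norm_ge a k)); rewrite lerDl.
- by move=> k; apply: (le_trans (col_norm_ge b k)); rewrite lerDr.
Qed.

End ConvexSurfaces.

(** * Passage to the limit of polyhedra *)

Section LimitOfPolyhedra.
Context {R : realType} {n : nat}.
Local Notation V := 'cV[R]_(2 + n).
Implicit Types (x y z a b p k N M : V) (F G : seq V) (s l C : R).
Variables (e : R) (S : set V).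
Hypothesis cS : convex_surface e S.
Let e0 := cs_neq0 cS.

(** Families directed by inclusion: [idist] becomes a limit, and points chosen on each polyhedron
    acquire a limit along a finer ultrafilter. *)
Definition families : set_system (seq V) :=
  filter_from (family e S) (fun F => [set G | family e S G /\ {subset F <= G}]).

Lemma families_proper : ProperFilter families.
Proof.
apply: filter_from_proper; last by move=> F fF; exists F; split.
apply: filter_from_filter; first by exists [::].
move=> F G fF fG; exists (F ++ G).
  by move=> N; rewrite mem_cat => /orP[/fF|/fG].
by move=> H [fH s]; split; split=> // N NF; apply: s; rewrite mem_cat NF ?orbT.
Qed.

Lemma families_near F (P : seq V -> Prop) : family e S F ->
  (forall G, family e S G -> {subset F <= G} -> P G) -> families P.
Proof. by move=> fF h; exists F => // G [fG s]; exact: h. Qed.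

Lemma pdist_cvg (U : set_system (seq V)) a b {FU : Filter U} :
  families `<=` U -> S a -> S b -> (fun F => pdist e F a b) @ U --> idist e S a b.
Proof.
move=> sU Sa Sb; apply/cvgrPdist_lt => eps eps0.
have [_ [F0 [f0 sa sb] <-] h0] := sup_adherent eps0 (idist_has_sup cS Sa Sb).
apply: sU; apply: (families_near f0) => F fF s0.
have sa' := surf_mono fF Sa s0 sa; have sb' := surf_mono fF Sb s0 sb.
have h1 := pdist_mono cS fF Sa Sb s0 sa sb.
have h2 := pdist_le_idist cS Sa Sb (And3 fF sa' sb').
by rewrite ger0_norm ?subr_ge0// ltrBlDr; move: h0; rewrite -/(idist e S a b); lra.
Qed.

(** The polyhedral distance [l] may be smaller than a prescribed [s <= idist], hence the truncation
    [t]. The last bound follows from sinh-convexity, since the weights [sinh (l - t)] and [sinh t]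
    add up to at most [sinh l]; its right side does not depend on [F]. *)
Lemma polyhedral_point F a b s : admissible e S a b F -> 0 <= s -> S a -> S b ->
  let l := pdist e F a b in let t := Num.min s l in
  exists z, [/\ surf e F z, pdist e F a z = t, pdist e F z b = l - t,
    forall p, surf e F p -> sinh l * cosh (pdist e F p z) <=
      sinh (l - t) * cosh (pdist e F p a) + sinh t * cosh (pdist e F p b) &
    forall k, bil a k <= 0 -> (forall K, K \in F -> bil K k <= 0) ->
      - bil z k <= Num.max (- bil a k) (- bil b k)].
Proof.
move=> [fF sa sb] s0 Sa Sb l t; have gF := family_good cS fF.
have l0 : 0 <= l by exact: pdist_ge0.
have t0 : 0 <= t by rewrite le_min s0.
have tl : t <= l by rewrite ge_min lexx orbT.
have [l00|lp] := eqVneq l 0.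
  have t00 : t = 0 by apply/eqP; rewrite eq_le t0 andbT -l00.
  exists a; split=> //.
  - by rewrite pdist_xx// t00.
  - by rewrite t00 subr0.
  - by move=> p sp; rewrite t00 l00 subrr sinh0 !mul0r addr0.
  - by move=> k _ _; rewrite le_max lexx.
have lp0 : 0 < l by rewrite lt_neqAle eq_sym lp.
have [|z [sz az zb hp hk]] := polyhedral_CAT (s := t) e0 gF sa sb; first by rewrite t0.
exists z; split=> // k ak kF; rewrite -(ler_pM2l (sinh_gt0 lp0)); apply: (le_trans (hk k kF)).
set m := Num.max _ _.
have ma : - bil a k <= m by rewrite le_max lexx.
have mb : - bil b k <= m by rewrite le_max lexx orbT.
have s1 : 0 <= sinh t by exact: sinh_ge0.
have s2 : 0 <= sinh (l - t) by apply: sinh_ge0; rewrite subr_ge0.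
have [sum m0] : sinh (l - t) + sinh t <= sinh l /\ 0 <= m.
  split; last first.
    by apply: le_trans ma; rewrite oppr_ge0.
  rewrite (_ : sinh l = sinh ((l - t) + t)); last by congr sinh; ring.
  by rewrite (sinhD (l - t) t); apply: lerD; [rewrite ler_peMr|rewrite ler_peMl]; rewrite ?cosh_ge1.
apply: (@le_trans _ _ ((sinh (l - t) + sinh t) * m)).
  by rewrite mulrDl; apply: lerD; rewrite ler_wpM2l.
by rewrite ler_wpM2r.
Qed.

(** [z0] is a limit of points [z F] of the polyhedra. The bounds on their products keep them in a
    bounded set by [cs_span], and maximality puts [z0] on [S]. Since [ch (z F) z0] tends to 0, the
    inequalities at [z F] pass to [z0]. *)
Lemma idist_point a b s : S a -> S b -> 0 <= s <= idist e S a b -> exists z,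
  [/\ S z, idist e S a z = s, idist e S z b = idist e S a b - s &
    forall p, S p -> sinh (idist e S a b) * cosh (idist e S p z) <=
      sinh (idist e S a b - s) * cosh (idist e S p a) + sinh s * cosh (idist e S p b)] /\
  forall k, S k -> - bil z k <= Num.max (- bil a k) (- bil b k).
Proof.
move=> Sa Sb /andP[s0 sl].
set l := idist e S a b in sl *.
pose lF F := pdist e F a b; pose tF F := Num.min s (lF F).
have /choice[z hz] : forall F, exists z, admissible e S a b F ->
    [/\ surf e F z, pdist e F a z = tF F, pdist e F z b = lF F - tF F,
    forall p, surf e F p -> sinh (lF F) * cosh (pdist e F p z) <=
      sinh (lF F - tF F) * cosh (pdist e F p a) + sinh (tF F) * cosh (pdist e F p b) &
    forall k, bil a k <= 0 -> (forall K, K \in F -> bil K k <= 0) ->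
      - bil z k <= Num.max (- bil a k) (- bil b k)].
  move=> F; have [h|h] := pselect (admissible e S a b F); last by exists a => /h.
  by have [z hz] := polyhedral_point h s0 Sa Sb; exists z.
have [U [UU sU]] := ultraFilterLemma families_proper.
have fam0 : family e S [::] by [].
have admU : \forall F \near U, admissible e S a b F.
  have [F0 [f0 sa sb] _] := admissible_ex cS Sa Sb fam0.
  apply: sU; apply: (families_near f0) => F fF s'.
  by split=> //; [exact: (surf_mono fF Sa s' sa)|exact: (surf_mono fF Sb s' sb)].
have surfU k : S k -> \forall F \near U, family e S F /\ surf e F k.
  move=> Sk; have [F0 [f0 sk _] _] := admissible_ex cS Sk Sk fam0.
  apply: sU; apply: (families_near f0) => F fF s'.
  by split=> //; exact: (surf_mono fF Sk s' sk).
have lowU k : S k -> \forall F \near U, 1 <= - bil (z F) k.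
  move=> Sk; apply: filterS2 admU (surfU k Sk) => F aF [fF sk].
  have [sz _ _ _ _] := hz F aF.
  exact: (surf_ge1 e0 (family_good cS fF) sz sk).
have upU k : S k -> \forall F \near U, - bil (z F) k <= Num.max (- bil a k) (- bil b k).
  move=> Sk; apply: filterS admU => F aF.
  have [_ _ _ _ h] := hz F aF; apply: h; first exact/ltW/(cs_lt0 cS).
  by have [fF _ _] := aF; move=> K /fF[x _ [_ _ _]]; apply.
have [z0 hz0] : exists z0 : V, z @ U --> z0.
  have [ks [Sks [C hC]]] := cs_span cS.
  pose m k := Num.max (- bil a k) (- bil b k).
  have near_ks ks1 : {subset ks1 <= ks} ->
      \forall F \near U, \sum_(k <- ks1) `|bil (z F) k| <= \sum_(k <- ks1) m k.
    elim: ks1 => [|k ks' ih] sub.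
      by apply: filterE => F; rewrite !big_nil.
    have Sk : S k by apply: Sks; apply: sub; rewrite mem_head.
    have ih' := ih (fun x h => sub x (mem_behead (h : x \in behead (k :: ks')))).
    apply: filterS3 ih' (lowU k Sk) (upU k Sk) => F h1 h2 h3.
    rewrite !big_cons; apply: lerD h1; rewrite ler0_norm//; lra.
  apply: ultra_bounded_col => j; exists (`|C| * \sum_(k <- ks) m k).
  apply: filterS (near_ks ks (fun k h => h)) => F h; apply: (le_trans (hC (z F) j)).
  apply: (@le_trans _ _ (`|C| * \sum_(k <- ks) `|bil (z F) k|)).
    by apply: ler_wpM2r; [apply: sumr_ge0|exact: ler_norm].
  by rewrite ler_wpM2l.
have qz0 : qf z0 = -1.
  have hq : \forall F \near U, bil (z F) (z F) = -1.
    by apply: filterS admU => F aF; have [sz _ _ _ _] := hz F aF; exact: (surf_qf sz).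
  apply/eqP; rewrite eq_le; apply/andP; split.
    by apply: (cvgr_to_le (cvg_bil hz0 hz0)); apply: filterS hq => F ->.
  by apply: (cvgr_to_ge (cvg_bil hz0 hz0)); apply: filterS hq => F ->.
have Sz : S z0.
  apply: (cs_maximal cS) => // k Sk.
  by apply: (cvgr_to_ge (cvgN (cvg_bil hz0 (cvg_cst k)))); exact: lowU.
have chz : (fun F => ch (z F) z0) @ U --> (0 : R).
  rewrite -(chxx qz0); apply: cvg_ch => //; last exact: cvg_cst.
  by rewrite -/(qf z0) qz0 opprK.
have lU : lF @ U --> l by apply: pdist_cvg.
have tU : tF @ U --> s.
  rewrite -[X in _ --> X](min_idPl sl).
  have -> : tF = (fun F => (s + lF F - `|s - lF F|) / 2).
    by apply/funext => F; rewrite /tF; rewrite minr_absE.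
  rewrite minr_absE; apply: cvgM; last exact: cvg_cst.
  apply: cvgB; first by apply: cvgD => //; exact: cvg_cst.
  by apply: cvg_norm; apply: cvgB => //; exact: cvg_cst.
(* [pdist e F z0 p] and [pdist e F (z F) p] differ by at most [ch (z F) z0] *)
have cmp F0 p : S p -> admissible e S p z0 F0 -> \forall F \near U,
    admissible e S a b F /\ surf e F p /\ pdist e F0 p z0 <= pdist e F p (z F) + ch (z F) z0.
  move=> Sp [f0 sp sz].
  have sub : \forall F \near U, family e S F /\ {subset F0 <= F}.
    by apply: sU; exact: (families_near f0).
  apply: filterS2 admU sub => F aF [fF s']; split=> //.
  have gF := family_good cS fF.
  have sp' := surf_mono fF Sp s' sp; have sz' := surf_mono fF Sz s' sz.
  have [szF _ _ _ _] := hz F aF; split=> //.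
  apply: (le_trans (pdist_mono cS fF Sp Sz s' sp sz)).
  apply: (le_trans (pdist_tri e0 gF sp' szF sz')).
  by rewrite lerD2l; exact: pdist_le_ch.
have az : idist e S a z0 <= s.
  apply: (idist_le cS Sa Sz) => F0 aF0.
  have h : (fun F => tF F + ch (z F) z0) @ U --> s + 0 by exact: cvgD.
  rewrite addr0 in h; apply: (cvgr_to_ge h).
  apply: filterS (cmp F0 a Sa aF0) => F [aF [_ hF]].
  by have [_ <- _ _ _] := hz F aF.
have zb : idist e S z0 b <= l - s.
  rewrite (idistC cS Sz Sb); apply: (idist_le cS Sb Sz) => F0 aF0.
  have h : (fun F => lF F - tF F + ch (z F) z0) @ U --> l - s + 0.
    by apply: cvgD => //; exact: cvgB.
  rewrite addr0 in h; apply: (cvgr_to_ge h).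
  apply: filterS (cmp F0 b Sb aF0) => F [aF [sb hF]].
  have [szF _ <- _ _] := hz F aF; have [fF _ _] := aF.
  by rewrite (pdistC e0 (family_good cS fF) szF sb).
have tri := idist_tri cS Sa Sz Sb; rewrite -/l in tri.
exists z0; split; last first.
  move=> k Sk; apply: (cvgr_to_le (cvgN (cvg_bil hz0 (cvg_cst k)))); exact: upU.
split=> //; [lra|lra|].
move=> p Sp; set K := _ + _.
have main c : (exists2 F0, admissible e S p z0 F0 & c = pdist e F0 p z0) ->
    sinh l * cosh c <= K.
  move=> [F0 aF0 ->]; set c0 := pdist e F0 p z0.
  have c00 : 0 <= c0.
    by have [f0 sp sz] := aF0; exact: (pdist_ge0 e0 (family_good cS f0)).
  (* A lower bound of [pdist e F p (z F)] that tends to [c0]; the maximum keeps it in the range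
     where [cosh] is increasing. *)
  pose h F := Num.max 0 (c0 - ch (z F) z0).
  have hU : h @ U --> c0.
    have -> : h = (fun F => (c0 - ch (z F) z0 + `|c0 - ch (z F) z0|) / 2).
      by apply/funext => F; rewrite /h maxr_absE sub0r normrN add0r.
    rewrite [X in _ --> X](_ : c0 = (c0 - 0 + `|c0 - 0|) / 2); last first.
      by rewrite subr0 ger0_norm//; field.
    apply: cvgM; last exact: cvg_cst.
    have cv : (fun F => c0 - ch (z F) z0) @ U --> c0 - 0 by apply: cvgB => //; exact: cvg_cst.
    by apply: cvgD => //; exact: cvg_norm.
  have ccv (f : seq V -> R) (r : R) : f @ U --> r -> (fun F => cosh (f F)) @ U --> cosh r.
    by move=> hf; apply: (@cvg_comp _ _ _ f (@cosh R) U (nbhs r)) => //; exact: continuous_cosh.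
  have scv (f : seq V -> R) (r : R) : f @ U --> r -> (fun F => sinh (f F)) @ U --> sinh r.
    by move=> hf; apply: (@cvg_comp _ _ _ f (@sinh R) U (nbhs r)) => //; exact: continuous_sinh.
  pose g F := sinh (lF F - tF F) * cosh (idist e S p a) + sinh (tF F) * cosh (idist e S p b)
    - sinh (lF F) * cosh (h F).
  rewrite -subr_ge0; have gU : g @ U --> K - sinh l * cosh c0.
    apply: cvgB; last by apply: cvgM; [exact: scv|exact: ccv].
    apply: cvgD; apply: cvgM; try exact: cvg_cst; last exact: scv.
    by apply: scv; exact: cvgB.
  apply: (cvgr_to_ge gU); apply: filterS (cmp F0 p Sp aF0) => F [aF [sp hF]].
  have [fF sa sb] := aF; have gF := family_good cS fF.
  have [szF az' _ hp _] := hz F aF.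
  have lF0 : 0 <= lF F by exact: pdist_ge0.
  have tF0 : 0 <= tF F by rewrite -az'; exact: pdist_ge0.
  have tFl : tF F <= lF F by rewrite ge_min lexx orbT.
  rewrite /g subr_ge0; apply: (@le_trans _ _ (sinh (lF F) * cosh (pdist e F p (z F)))).
    rewrite ler_wpM2l ?sinh_ge0// cosh_le ?pdist_ge0//; last by rewrite le_max lexx.
    by rewrite ge_max pdist_ge0// lerBlDr.
  apply: (le_trans (hp p sp)); apply: lerD; apply: ler_wpM2l.
  - by apply: sinh_ge0; rewrite subr_ge0.
  - rewrite cosh_le ?pdist_ge0 ?(idist_ge0 cS)//; exact: pdist_le_idist.
  - exact: sinh_ge0.
  - rewrite cosh_le ?pdist_ge0 ?(idist_ge0 cS)//; exact: pdist_le_idist.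
have l0 : 0 <= l := le_trans s0 sl.
have [F1 aF1 _] := admissible_ex cS Sp Sz fam0.
have [l00|lp] := eqVneq l 0.
  have := main _ (ex_intro2 _ _ F1 aF1 erefl).
  by rewrite l00 sinh0 !mul0r.
have lp0 : 0 < sinh l by rewrite sinh_gt0// lt_neqAle eq_sym lp.
have K1 : 1 <= K / sinh l.
  rewrite ler_pdivlMr// mul1r; have := main _ (ex_intro2 _ _ F1 aF1 erefl).
  by apply: le_trans; rewrite ler_peMr ?(ltW lp0)// cosh_ge1.
have : idist e S p z0 <= arcosh (K / sinh l).
  apply: (idist_le cS Sp Sz) => F0 aF0.
  have c00 : 0 <= pdist e F0 p z0.
    by have [f0 sp sz] := aF0; exact: (pdist_ge0 e0 (family_good cS f0)).
  apply: cosh_le_arcosh => //; rewrite ler_pdivlMr// mulrC.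
  by apply: main; exists F0.
rewrite -cosh_le ?(idist_ge0 cS)// ?arcosh_ge0// cosh_arcosh// ler_pdivlMr//.
by rewrite mulrC.
Qed.

Lemma idist_vertex_CAT : vertex_CAT S (idist e S).
Proof. by move=> a b s Sa Sb h; have [z [hz _]] := idist_point Sa Sb h; exists z. Qed.

Lemma idist_CATm1 : CATm1 S (idist e S).
Proof. exact: (vertex_CATm1 (idist_metric cS) idist_vertex_CAT). Qed.

End LimitOfPolyhedra.

(** * Lipschitz functions as integrals of their derivatives *)

Section LipschitzFTC.
Context {R : realType}.
Local Notation mu := (@lebesgue_measure R).
Local Notation mR := (measurableTypeR R).
Implicit Types (a b s t : R) (g f : R -> R).

Lemma stieltjes_itv (F : cumulative R R) s t : s <= t ->
  lebesgue_stieltjes_measure F `]s, t]%classic = (F t - F s)%:E.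
Proof.
move=> st; rewrite /lebesgue_stieltjes_measure /measure_extension.
by rewrite measurable_mu_extE/=; [rewrite wlength_itv_bnd|exact: is_ocitv].
Qed.

(* When [g] is 1/2-Lipschitz, the Stieltjes measures of [t/2 + g] and [t/2 - g]
   add up to the Lebesgue measure, which therefore dominates them. *)
Lemma half_lipschitz_FTC g a b : a < b ->
  (forall s t, `|g s - g t| <= 2^-1 * `|s - t|) ->
  exists G : R -> R, [/\ mu.-integrable `[a, b] (EFin \o G),
    {ae mu, forall t, a < t < b -> derivable g t 1 /\ derive1 g t = G t} &
    (\int[mu]_(t in `[a, b]) (G t)%:E = (g b - g a)%:E)%E].
Proof.
move=> ab lg.
have cg : continuous g.
  move=> t; apply/cvgrPdist_lt => eps eps0; apply/nbhs_ballP; exists eps => //= t'.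
  by rewrite /ball/= => h; have := lg t t'; have := normr_ge0 (t - t'); lra.
have lg' s t : s <= t -> - (2^-1 * (t - s)) <= g t - g s <= 2^-1 * (t - s).
  by move=> st; rewrite -ler_norml; have := lg t s; rewrite (ger0_norm (x := t - s)) ?subr_ge0.
pose f1 t := 2^-1 * t + g t; pose f2 t := 2^-1 * t - g t.
have nd1 : nondecreasing f1.
  by move=> s t /lg'/andP[h1 h2]; rewrite /f1; lra.
have nd2 : nondecreasing f2.
  by move=> s t /lg'/andP[h1 h2]; rewrite /f2; lra.
have cl : continuous (fun t : R => 2^-1 * t).
  by move=> t; apply: cvgM; [exact: cvg_cst|exact: cvg_id].
have rc1 : right_continuous f1.
  by apply: right_continuousW => t; apply: cvgD; [exact: cl|exact: cg].
have rc2 : right_continuous f2.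
  by apply: right_continuousW => t; apply: cvgB; [exact: cl|exact: cg].
pose F1 : cumulative R R := HB.pack f1 (isCumulative.Build R _ R f1 nd1 rc1).
pose F2 : cumulative R R := HB.pack f2 (isCumulative.Build R _ R f2 nd2 rc2).
pose m1 := lebesgue_stieltjes_measure F1; pose m2 := lebesgue_stieltjes_measure F2.
have sumE : forall A : set mR, measurable A -> mu A = measure_add m1 m2 A.
  apply: lebesgue_measure_unique => X /ocitvP[->|[[s t] /= st ->]]; first by rewrite !measure0.
  have -> : lebesgue_measure `]s, t]%classic = (t - s)%:E.
    by rewrite lebesgue_measure_itv/= lte_fin st EFinB.
  transitivity (m1 `]s, t]%classic + m2 `]s, t]%classic)%E; last exact: (esym (measure_addE m1 m2 _)).
  have -> : m1 `]s, t]%classic = (f1 t - f1 s)%:E by exact: (stieltjes_itv F1 (ltW st)).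
  have -> : m2 `]s, t]%classic = (f2 t - f2 s)%:E by exact: (stieltjes_itv F2 (ltW st)).
  by rewrite -EFinD /f1 /f2; congr EFin; field.
have le1 (A : set mR) : measurable A -> (m1 A <= mu A)%E.
  by move=> mA; rewrite sumE// (measure_addE m1 m2) leeDl// measure_ge0.
have mD : measurable (`]a, b]%classic : set mR) by exact: measurable_itv.
have fin : (m1 `]a, b]%classic < +oo)%E by rewrite /m1 (stieltjes_itv F1 (ltW ab)) ltry.
pose nu := mfrestr mD fin.
have dom : nu `<< mu.
  apply/null_content_dominatesP => A mA A0; apply/eqP; rewrite eq_le measure_ge0 andbT.
  rewrite -A0 /nu /mfrestr /mrestr (le_trans (le1 _ _))//; first exact: measurableI.
  by apply: le_measure; rewrite ?inE//; exact: measurableI.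
(* The density of [m1] is the derivative of [f1], so that of [g] is obtained by subtracting one
   half. *)
have [h [h0 hfin hint hE]] := radon_nikodym_sigma_finite dom.
pose G t := fine (h t).
have GE t : (G t)%:E = h t by rewrite /G fineK.
have hG : (EFin \o G) = h by apply/funext => t /=.
have GI : mu.-integrable setT (EFin \o G) by rewrite hG.
have IG t : a <= t -> t <= b -> (\int[mu]_(x in `]a, t]) G x)%R = f1 t - f1 a.
  move=> at0 tb; have mt : measurable (`]a, t]%classic : set mR) by exact: measurable_itv.
  rewrite /Rintegral (_ : (\int[mu]_(x in `]a, t]) (G x)%:E)%E = nu `]a, t]%classic).
    rewrite /nu /mfrestr /mrestr (_ : `]a, t]%classic `&` `]a, b]%classic = `]a, t]%classic).
      by rewrite (_ : m1 _ = (f1 t - f1 a)%:E)//; exact: (stieltjes_itv F1 at0).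
    apply/setIidPl => x /=; rewrite !in_itv/= => /andP[-> xt] /=; exact: le_trans tb.
  apply: esym; apply: etrans (hE _ mt) _.
  by apply: eq_integral => x _; rewrite GE.
have := @FTC1 R G (BRight a) _ _.
have H1 : forall y, mu.-integrable [set` Interval (BRight a) (BRight y)] (EFin \o G).
  by move=> y; apply: integrableS GI => //; exact: measurable_itv.
have H2 : locally_integrable setT G.
  by apply: open_integrable_locally => //; exact: openT.
move=> /(_ H1 H2) ftc.
have Iab : mu.-integrable `[a, b] (EFin \o G) by exact: (integrableS measurableT).
have Ic : mu.-integrable `[a, b] (EFin \o (cst 2^-1 : R -> R)).
  apply: continuous_compact_integrable; first exact: segment_compact.
  by apply: continuous_subspaceT => ?; exact: cvg_cst.
exists (fun t => G t - 2^-1); split.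
- exact: (integrableB _ Iab Ic).
- apply: filterS; [exact: (ae_filter_ringOfSetsType mu)| |exact: ftc].
  move=> t ht /andP[at0 tb].
  pose Fi x := (\int[mu]_(y in `]a, x]) G y)%R.
  have [d1 d2] : derivable Fi t 1 /\ derive1 Fi t = G t by apply: ht; exact: at0.
  have near_eq : {near t, Fi =1 (fun x => g x + (2^-1 * x - f1 a))}.
    have : \forall x \near t, x \in `]a, b[ by apply: near_in_itvoo; rewrite in_itv/= at0.
    apply: filterS => x; rewrite in_itv/= => /andP[ax xb].
    by rewrite /Fi IG ?ltW// /f1; ring.
  have near_eq' : {near t, (fun x => Fi x - (2^-1 * x - f1 a)) =1 g}.
    by apply: filterS near_eq => x ->; ring.
  have [dg gE] : is_derive t 1 g (G t - 2^-1).
    apply: near_eq_is_derive near_eq' _.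
    have D1 : is_derive t 1 Fi (G t) by split; rewrite -?derive1E.
    have D2 : is_derive t 1 (fun x : R => 2^-1 * x - f1 a) 2^-1.
      by apply: is_derive_eq; rewrite ?scaler0 ?addr0 ?subr0 /GRing.scale/= ?mulr1 ?subr0.
    exact: is_deriveB.
  by split => //; rewrite derive1E.
have IabG : (\int[mu]_(x in `[a, b]) G x)%R = f1 b - f1 a.
  by rewrite -Rintegral_itv_obnd_cbnd ?(IG b (ltW ab) (lexx b))//; exact: H1.
have E : (\int[mu]_(x in `[a, b]) (G x - 2^-1))%R = g b - g a.
  rewrite RintegralB// IabG Rintegral_cst//= lebesgue_measure_itv/= lte_fin ab /=.
  by rewrite /f1; field.
rewrite -E /Rintegral fineK// integrable_fin_num//.
exact: (integrableB _ Iab Ic).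
Qed.

(** The function is extended by constants beyond [[a, b]] and divided by [2 * L] to reduce to the
    Lipschitz constant one half. *)
Lemma lipschitz_FTC f a b (L : R) : a < b -> 0 < L ->
  (forall s t, a <= s <= b -> a <= t <= b -> `|f s - f t| <= L * `|s - t|) ->
  exists G : R -> R, [/\ mu.-integrable `[a, b] (EFin \o G),
    {ae mu, forall t, a < t < b -> derivable f t 1 /\ derive1 f t = G t} &
    (\int[mu]_(t in `[a, b]) (G t)%:E = (f b - f a)%:E)%E].
Proof.
move=> ab L0 lf.
pose r t := Num.max a (Num.min b t).
have rE t : a <= t <= b -> r t = t.
  by move=> /andP[h1 h2]; rewrite /r (min_idPr _)// (max_idPr _).
have rab t : a <= r t <= b.
  by rewrite /r le_max lexx/= ge_max ge_min lexx (ltW ab).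
have r1 s t : `|r s - r t| <= `|s - t|.
  have := ler_norm (s - t); have := ler_norm (- (s - t)); rewrite normrN => h1 h2.
  rewrite /r /Num.max /Num.min ler_norml.
  by case: (ltP b s) => ?; case: (ltP b t) => ?; do ![case: ltP => ?]; apply/andP; split; lra.
pose g t := (2 * L)^-1 * f (r t).
have [|G [GI Gd GE]] := @half_lipschitz_FTC g a b ab.
  move=> s t; rewrite -mulrBr normrM (gtr0_norm (x := _^-1)) ?invr_gt0 ?mulr_gt0//.
  rewrite invfM -mulrA ler_pM2l ?invr_gt0// mulrC ler_pdivrMr// mulrC.
  by apply: le_trans (lf _ _ (rab s) (rab t)) _; rewrite ler_pM2l.
exists (fun t => 2 * L * G t); split.
- have mab : measurable (`[a, b]%classic : set mR) by exact: measurable_itv.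
  exact: (integrableZl mab (2 * L) GI).
- apply: filterS; [exact: (ae_filter_ringOfSetsType mu)| |exact: Gd].
  move=> t ht tab; have [gd gE] := ht tab.
  have near_eq : {near t, (fun x => (2 * L) * g x) =1 f}.
    have : \forall x \near t, x \in `]a, b[ by apply: near_in_itvoo; rewrite in_itv.
    apply: filterS => x; rewrite in_itv/= => /andP[ax xb].
    by rewrite /g rE ?ltW// mulrA divff ?mul1r// gt_eqF// mulr_gt0.
  have [df fE] : is_derive t 1 f (2 * L * G t).
    apply: near_eq_is_derive near_eq _.
    have D1 : is_derive t 1 g (G t) by split; rewrite -?derive1E.
    by apply: is_derive_eq.
  by split => //; rewrite derive1E.
- under eq_integral do rewrite EFinM.
  have mab : measurable (`[a, b]%classic : set mR) by exact: measurable_itv.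
  rewrite (integralZl mab GI) GE -EFinM /g !rE ?lexx ?ltW//; congr EFin.
  by field; rewrite gt_eqF.
Qed.

(** The integral of a nonnegative function is a supremum over simple functions below it. In this
    form monotonicity can be used for the speed of a curve, whose measurability is not at hand. *)
Lemma nneg_integral_le (A D : set R) (f1 f2 : R -> \bar R) : A `<=` D ->
  (forall t, A t -> (0 <= f1 t)%E) -> (forall t, D t -> (0 <= f2 t)%E) ->
  (forall t, A t -> (f1 t <= f2 t)%E) ->
  (\int[mu]_(t in A) f1 t <= \int[mu]_(t in D) f2 t)%E.
Proof.
move=> AD f10 f20 f12; rewrite !ge0_integralE//.
apply: ereal_sup_le => _ [h hf <-]; exists h => // t.
apply: le_trans (hf t) _; rewrite !patchE; case: ifPn => [/set_mem At|_].
  by rewrite mem_set ?f12//; exact: AD.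
by case: ifPn => // /set_mem/f20.
Qed.

(** Outside a null set that contains the endpoints, the density of [f] is at most [w]; its negative
    part is dropped and the integrals of nonnegative functions are compared. *)
Lemma lipschitz_variation_le f (w : R -> R) a b (L : R) : a < b -> 0 < L ->
  (forall s t, a <= s <= b -> a <= t <= b -> `|f s - f t| <= L * `|s - t|) ->
  (forall t, 0 <= w t) ->
  {ae mu, forall t, a < t < b -> derivable f t 1 -> derive1 f t <= w t} ->
  ((f b - f a)%:E <= \int[mu]_(t in `[a, b]) (w t)%:E)%E.
Proof.
move=> ab L0 lf w0 fw.
have [G [GI Gd <-]] := lipschitz_FTC ab L0 lf.
have [N [mN N0 NP]] : {ae mu, forall t, a < t < b -> G t <= w t}.
  apply: filterS2; [exact: (ae_filter_ringOfSetsType mu)| |exact: fw|exact: Gd].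
  by move=> t h1 h2 tab; have [d <-] := h2 tab; exact: h1.
pose E := N `|` [set a; b] : set R.
have mab : measurable ([set a; b] : set mR).
  by apply: measurableU; exact: measurable_set1.
have mE : measurable (E : set mR) by apply: measurableU.
have E0 : mu E = 0%E.
  have mab0 : mu [set a; b] = 0%E.
    by apply: countable_lebesgue_measure0; apply/finite_set_countable/finite_set2.
  have : (mu E <= mu N + mu [set a; b])%E by exact: measureU2.
  have -> : mu N = 0%E by exact: N0.
  by rewrite mab0 adde0 => h; apply/eqP; rewrite eq_le h measure_ge0.
rewrite (negligible_integral mE _ GI E0); last exact: measurable_itv.
rewrite integralE; set I1 := (X in (X - _)%E).
have : (I1 - \int[mu]_(x in `[a, b] `\` E) ((fun t => (G t)%:E)^\-) x <= I1 - 0)%E.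
  by apply: leeB => //; apply: integral_ge0 => t _; exact: funeneg_ge0.
move/le_trans; apply; rewrite sube0.
apply: nneg_integral_le => [t []//|t _|t _|t [tab nE]]; [exact: funepos_ge0|by rewrite lee_fin|].
rewrite funeposE -EFin_max lee_fin ge_max w0 andbT leNgt; apply/negP => h.
apply: (nE); left; apply: NP => /= h'; move: h; rewrite ltNge h'//.
move: tab; rewrite /= in_itv/= => /andP[ta tb]; rewrite !lt_neqAle ta tb !andbT.
by apply/andP; split; apply/eqP => tE; apply: nE; right; [left|right]; rewrite /= tE.
Qed.

End LipschitzFTC.

(** * Quadratic bounds for [cosh] *)

Section SinhBounds.
Context {R : realType}.
Implicit Types s t : R.

Lemma sinh_ge s : 0 <= s -> s <= sinh s.
Proof.
rewrite le_eqVlt => /orP[/eqP<-|s0]; first by rewrite sinh0.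
have d (r : R) : is_derive r 1 (@sinh R) (cosh r).
  have D1 : is_derive r 1 (fun u : R => expR (- u)) (- expR (- r)).
    by apply: is_derive_eq; rewrite /GRing.scale/=; ring.
  have D2 : is_derive r 1 (fun u : R => expR u) (expR r) by exact: is_derive_expR.
  rewrite (_ : @sinh R = (fun u => 2^-1 *: ((expR : R -> R) u - expR (- u)))); last first.
    by apply/funext => u; rewrite /sinh /GRing.scale/= mulrC.
  rewrite (_ : cosh r = 2^-1 *: (expR r - - expR (- r))); last first.
    by rewrite /cosh /GRing.scale/= opprK mulrC.
  by apply: is_deriveZ; exact: is_deriveB.
have [|c] := @MVT R (@sinh R) (@cosh R) 0 s s0 (fun x _ => d x).
  by apply: continuous_subspaceT => x; exact: continuous_sinh.
rewrite in_itv/= sinh0 !subr0 => /andP[c0 _] ->.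
by rewrite ler_peMl ?cosh_ge1// ltW.
Qed.

Lemma cosh_half s : cosh s = 1 + 2 * sinh (s / 2) ^+ 2.
Proof.
rewrite {1}(_ : s = s / 2 + s / 2); last by field.
by rewrite (coshD (s / 2) (s / 2)); have := cosh2 (s / 2); move: (cosh _) (sinh _) => a b h; nra.
Qed.

Lemma cosh_ge_sqr s : 0 <= s -> 1 + s ^+ 2 / 2 <= cosh s.
Proof.
move=> s0; rewrite cosh_half; have h : s / 2 <= sinh (s / 2) by apply: sinh_ge; rewrite divr_ge0.
have h0 : 0 <= s / 2 by rewrite divr_ge0.
by move: (sinh _) h => y h; nra.
Qed.

Lemma cosh_le_sqr s : 0 <= s -> cosh s - 1 <= s ^+ 2 / 2 * expR s.
Proof.
move=> s0; rewrite cosh_half; have h0 : 0 <= s / 2 by rewrite divr_ge0.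
have h1 := sinh_le_mul h0; have h2 := sinh_ge0 h0.
have h3 : expR s = expR (s / 2) ^+ 2 by rewrite -expRM_natl; congr expR; field.
by rewrite h3; move: (sinh _) (expR (s / 2)) h1 h2 => y E h1 h2; nra.
Qed.

End SinhBounds.

(** * Speed of curves on the surface *)

Section SpeedOfCurves.
Context {R : realType} {n : nat}.
Local Notation V := 'cV[R]_(2 + n).
Local Notation mu := (@lebesgue_measure R).
Implicit Types (x y z a b p k N M v : V) (s t h l C : R) (c : R -> V).

Definition diffq c t h : V := h^-1 *: (c (h + t) - c t).

Lemma diffq_cvg c t : derivable c t 1 -> diffq c t @ 0^' --> derive1 c t.
Proof.
rewrite /derivable => d; rewrite /derive1 /diffq.
rewrite (_ : (fun h => h^-1 *: (c (h + t) - c t)) =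
  (fun h => h^-1 *: ((c \o shift t) (h *: 1) - c t))) => [//|].
by apply/funext => h /=; rewrite /GRing.scale/= mulr1.
Qed.

Lemma near_dnbhs0 (P : R -> Prop) (d : R) : 0 < d -> (forall h, h != 0 -> `|h| < d -> P h) ->
  \forall h \near 0^', P h.
Proof.
move=> d0 hP; apply/nbhs_ballP; exists d => //= h; rewrite /ball/= sub0r normrN => hd h0.
exact: hP.
Qed.

Lemma qf_diffq c t h : qf (diffq c t h) = qf (c (h + t) - c t) / h ^+ 2.
Proof. by rewrite /qf /diffq bilZl bilZr mulrA -invfM -expr2 mulrC. Qed.

Lemma cvg_sign_eq0 (f : R -> R) l : f @ 0^' --> l -> (forall h, h * f h <= 0) -> l = 0.
Proof.
move=> fl fh; apply/eqP/negPn/negP => l0.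
have : \forall h \near 0^', `|l - f h| < `|l|.
  by move/cvgrPdist_lt: fl; apply; rewrite normr_gt0.
move=> /nbhs_ballP[d /= d0 hd].
have hd' (r : R) : r != 0 -> `|r| < d -> `|l - f r| < `|l|.
  by move=> r0 rd; apply: hd => //; rewrite /ball/= sub0r normrN.
have d2 : 0 < d / 2 by rewrite divr_gt0.
have d3 : d / 2 < d by lra.
have [hp|hn] : 0 < l \/ l < 0 by apply/orP; rewrite orbC -neq_lt.
  have := hd' (d / 2); rewrite gt_eqF// gtr0_norm// => /(_ isT d3).
  by rewrite (gtr0_norm hp) ltr_norml => /andP[_ h1]; have := fh (d / 2); nra.
have := hd' (- (d / 2)); rewrite oppr_eq0 normrN gt_eqF// gtr0_norm// => /(_ isT d3).
by rewrite (ltr0_norm hn) ltr_norml => /andP[h1 _]; have := fh (- (d / 2)); nra.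
Qed.

Variables (e : R) (S : set V).
Hypothesis cS : convex_surface e S.
Let e0 := cs_neq0 cS.

Lemma surface_ge1 a b : S a -> S b -> 1 <= - bil a b.
Proof.
move=> Sa Sb; have fam0 : family e S [::] by [].
have [F [fF sa sb] _] := admissible_ex cS Sa Sb fam0.
exact: (surf_ge1 e0 (family_good cS fF) sa sb).
Qed.

Lemma qf_sub a b : S a -> S b -> qf (b - a) = 2 * (- bil a b - 1).
Proof.
move=> /(cs_AdS cS) qa /(cs_AdS cS) qb.
by rewrite /qf !bilE -/(qf a) -/(qf b) qa qb (bilC b a); ring.
Qed.

Lemma qf_sub_ge0 a b : S a -> S b -> 0 <= qf (b - a).
Proof. by move=> Sa Sb; rewrite qf_sub//; have := surface_ge1 Sa Sb; lra. Qed.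

Lemma idist_le_qf a b : S a -> S b -> idist e S a b <= Num.sqrt (qf (b - a)).
Proof.
move=> Sa Sb; apply: (le_trans (idist_le_ch cS Sa Sb)).
have h1 := surface_ge1 Sa Sb.
rewrite -cosh_le ?sqrtr_ge0// ?arcosh_ge0// cosh_arcosh//.
apply: le_trans (cosh_ge_sqr (sqrtr_ge0 _)).
by rewrite sqr_sqrtr ?qf_sub_ge0// qf_sub//; lra.
Qed.

Lemma derive1_spacelike c t (d : R) : 0 < d -> (forall s, `|s - t| < d -> S (c s)) ->
  derivable c t 1 -> 0 <= qf (derive1 c t).
Proof.
move=> d0 Sc /diffq_cvg h; have St : S (c t) by apply: Sc; rewrite subrr normr0.
apply: (cvgr_to_ge (cvg_bil h h)); apply: (near_dnbhs0 d0) => r r0 rd.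
rewrite -/(qf _) qf_diffq divr_ge0 ?sqr_ge0// qf_sub_ge0//.
by apply: Sc; rewrite addrK.
Qed.

(** By the triangle inequality the difference quotient of the distance to [x] is at most the
    Lorentzian norm of that of [c]. *)
Lemma derive1_idist_le c x t (d : R) : 0 < d -> (forall s, `|s - t| < d -> S (c s)) -> S x ->
  derivable c t 1 -> derivable (fun s => idist e S x (c s)) t 1 ->
  derive1 (fun s => idist e S x (c s)) t <= lorentz_norm (derive1 c t).
Proof.
move=> d0 Sc Sx dc dh; have St : S (c t) by apply: Sc; rewrite subrr normr0.
have q0 := derive1_spacelike d0 Sc dc.
rewrite /lorentz_norm ger0_norm//.
have hc := diffq_cvg dc.
set f := fun s => idist e S x (c s) in dh *.
have hf : (fun h => h^-1 * (f (h + t) - f t)) @ 0^' --> derive1 f t.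
  rewrite /derivable in dh; rewrite /derive1.
  rewrite (_ : (fun h => _) = (fun h => h^-1 *: ((f \o shift t) (h *: 1) - f t))) => [//|].
  by apply/funext => h /=; rewrite /GRing.scale/= mulr1.
have hq : (fun h => Num.sqrt (qf (diffq c t h)) - h^-1 * (f (h + t) - f t)) @ 0^' -->
    Num.sqrt (qf (derive1 c t)) - derive1 f t.
  apply: cvgB => //; apply: (@cvg_comp _ _ _ (fun h => qf (diffq c t h)) _ _ (nbhs (qf (derive1 c t)))).
    exact: cvg_bil.
  exact: sqrt_continuous.
rewrite -subr_ge0; apply: (cvgr_to_ge hq); apply: (near_dnbhs0 d0) => r r0 rd.
have Sr : S (c (r + t)) by apply: Sc; rewrite addrK.
rewrite subr_ge0 qf_diffq sqrtrM ?qf_sub_ge0// sqrtrV ?sqr_ge0// sqrtr_sqr mulrC.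
apply: (le_trans (ler_norm _)); rewrite normrM normfV; apply: ler_wpM2r; first by rewrite invr_ge0.
apply: le_trans (idist_le_qf St Sr).
have := idist_tri cS Sx St Sr; have := idist_tri cS Sx Sr St; rewrite (idistC cS Sr St) -/(f t) -/(f (r + t)).
by rewrite ler_norml => *; apply/andP; split; lra.
Qed.

(* Unrolling [c s] to the support plane at [c t] shows that, up to o((s - t)^2),
   [qf (c s - c t)] is at most the square of the distance. *)
Lemma derive1_speed_le c t : (forall s, S (c s)) ->
  (forall s, idist e S (c t) (c s) <= `|s - t|) ->
  derivable c t 1 -> lorentz_norm (derive1 c t) <= 1.
Proof.
move=> Sc hc dc; have hd := diffq_cvg dc.
have q0 : 0 <= qf (derive1 c t) by apply: (derive1_spacelike ltr01) => // s _; exact: Sc.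
rewrite /lorentz_norm ger0_norm// -sqrtr1 ler_wsqrtr//.
have [N sN] := cs_support cS (Sc t); have [qN Nt oN Nle] := sN.
have Nv h : bil N (diffq c t h) = h^-1 * bil N (c (h + t)).
  by rewrite /diffq bilZr bilDr bilNr Nt subr0.
(* The function [bil N (c s)] has its maximum 0 at [t], so its derivative vanishes there and
   [bil N (c (h + t))] is [o(h)]. *)
have N0 : bil N (derive1 c t) = 0.
  have hN : (fun h => bil N (diffq c t h)) @ 0^' --> bil N (derive1 c t).
    by apply: cvg_bil => //; exact: cvg_cst.
  apply: (cvg_sign_eq0 hN) => h; have [->|h0] := eqVneq h 0; first by rewrite mul0r.
  by rewrite Nv mulrA divff// mul1r; apply: Nle.
pose D := `|derive1 c t| + 1; pose B := `|c t| + D.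
have [C hC] := cs_bound cS B.
pose K := (2 + n)%:R * (`|C| * D).
have qlim : (fun h => qf (diffq c t h)) @ 0^' --> qf (derive1 c t) by exact: cvg_bil.
have blim : (fun h => expR `|h| + K * `|bil N (diffq c t h)|) @ 0^' --> (1 : R) + K * 0.
  apply: cvgD.
    have h2 : (fun h : R => expR `|h|) @ 0^' --> expR `|0 : R|.
      apply: (@cvg_comp _ _ _ (fun h : R => `|h|) (@expR R) 0^' (nbhs `|0 : R|)).
        by apply: cvg_norm; exact: cvg_within.
      exact: continuous_expR.
    by rewrite normr0 expR0 in h2.
  apply: cvgM; first exact: cvg_cst.
  have h2 : (fun h => `|bil N (diffq c t h)|) @ 0^' --> `|bil N (derive1 c t)|.
    by apply: cvg_norm; apply: cvg_bil => //; exact: cvg_cst.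
  by rewrite N0 normr0 in h2.
have Dnear : \forall h \near 0^', forall j, `|diffq c t h j 0| <= D.
  have : \forall h \near 0^', `|derive1 c t - diffq c t h| < 1.
    by move/cvgrPdist_lt: hd; apply.
  apply: filterS => h hh j; apply: (le_trans (col_norm_ge _ j)).
  rewrite (_ : diffq c t h = derive1 c t - (derive1 c t - diffq c t h)); last by rewrite opprB addrC subrK.
  by apply: (le_trans (ler_normB _ _)); rewrite /D lerD2l ltW.
rewrite mulr0 addr0 in blim.
rewrite -subr_ge0; apply: (cvgr_to_ge (cvgB blim qlim)).
have n1 : \forall h \near 0^', h != 0 :> R by apply: (near_dnbhs0 ltr01).
have n2 : \forall h \near 0^', `|h : R| < 1.
  by apply: (near_dnbhs0 (d := 1)) => // r _.
apply: filterS3 Dnear n1 n2 => h Dh h0 h1.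
rewrite subr_ge0; set b := c (h + t); have Sb : S b by exact: Sc.
have bE : b - c t = h *: diffq c t h by rewrite /diffq scalerA divff// scale1r.
have hp : 0 < `|h| by rewrite normr_gt0.
have [M sM] := cs_support cS Sb; have [qM Mb oM Mle] := sM.
have Bb j : `|b j 0| <= B.
  have -> : b j 0 = c t j 0 + h * diffq c t h j 0.
    by have := congr1 (fun v : V => v j 0) bE; rewrite !mxE => <-; ring.
  apply: (le_trans (ler_normD _ _)); apply: lerD; first exact: col_norm_ge.
  rewrite normrM -[leRHS]mul1r; apply: ler_pM => //; exact: ltW.
have MC j : `|M j 0| <= `|C| by apply: (le_trans (hC _ _ Sb sM Bb j)); exact: ler_norm.
have hM : `|bil M (diffq c t h)| <= K by apply: bil_bound.
have [hb'' hD] := support_unroll cS (Sc t) Sb sN sM.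
have NM := support_lt0 cS (Sc t) Sb sN sM.
have qa := cs_AdS cS (Sc t).
have hypa : hyp e N (c t) by [].
have [g1 _] := hyp_ge1 e0 qN hypa hb''.
have : - bil (c t) (unroll N M b) <= cosh `|h|.
  rewrite -(cosh_arcosh g1) -/(ch _ _) cosh_le//; last exact: arcosh_ge0.
  by apply: (le_trans hD); apply: (le_trans (hc _)); rewrite addrK.
have -> : - bil (c t) (unroll N M b) =
    1 + qf (b - c t) / 2 - (bil N b / (1 - bil N M)) * bil M (c t).
  rewrite qf_sub// /unroll bilDr bilZr bilDr (bilC (c t) N) Nt (bilC (c t) M); field.
  by rewrite gt_eqF//; lra.
move=> hcosh; have := cosh_le_sqr (normr_ge0 h).
have qE : qf (b - c t) = h ^+ 2 * qf (diffq c t h) by rewrite bE /qf bilZl bilZr; ring.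
have NbE : bil N b = h * bil N (diffq c t h) by rewrite Nv mulrA divff// mul1r.
have MaE : bil M (c t) = - (h * bil M (diffq c t h)).
  by rewrite -bilZr -bE bilDr bilNr Mb; ring.
(* The correction caused by unrolling is a product of [bil N b], which is [o(h)], and of
   [bil M (c t)], which is [O(h)] because the normals near [c t] are bounded. *)
have prod : bil N b / (1 - bil N M) * bil M (c t) <= h ^+ 2 * (K * `|bil N (diffq c t h)|) / 2.
  apply: (le_trans (ler_norm _)); rewrite !normrM NbE MaE normrN !normrM.
  rewrite normfV (ger0_norm (x := 1 - _)); last lra.
  have i2 : (1 - bil N M)^-1 <= 2^-1 by rewrite lef_pV2 ?posrE; lra.
  have i0 : 0 <= (1 - bil N M)^-1 by rewrite invr_ge0; lra.
  rewrite -(real_normK (num_real h)).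
  move: (`|bil N _|) (normr_ge0 (bil N (diffq c t h))) => u u0.
  move: (`|bil M _|) (normr_ge0 (bil M (diffq c t h))) hM => w w0 wK.
  move: (_^-1) i2 i0 => i i2 i0.
  rewrite (_ : _ * u * i * _ = `|h| ^+ 2 * (u * (i * w))); last by ring.
  rewrite -mulrA ler_wpM2l ?sqr_ge0// (mulrC K) -mulrA ler_wpM2l//.
  by rewrite [leRHS]mulrC; apply: ler_pM.
move: hcosh prod; rewrite qE (real_normK (num_real h)).
have h20 : 0 < h ^+ 2 by rewrite -(real_normK (num_real h)) exprn_gt0.
move: (cosh _) (_ * bil M (c t)) (K * _) (expR _) (qf _) => Ch P W E Q hcosh prod hexp.
by rewrite -(ler_pM2l h20); nra.
Qed.

End SpeedOfCurves.

(** * The intrinsic distance is the length distance *)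

Section LengthDistance.
Context {R : realType} {n : nat}.
Local Notation V := 'cV[R]_(2 + n).
Local Notation mu := (@lebesgue_measure R).
Implicit Types (x y z a b p k N M v : V) (s t h l C : R) (c : R -> V).
Variables (e : R) (S : set V).
Hypothesis cS : convex_surface e S.
Let e0 := cs_neq0 cS.

(** The point of [idist_point] carries the bound, and its vertex inequality, applied to [c s],
    identifies it with [c s]. *)
Lemma geodesic_bil_le a b c s k : S a -> S b -> is_geodesic S (idist e S) a b c ->
  0 <= s <= idist e S a b -> S k -> - bil (c s) k <= Num.max (- bil a k) (- bil b k).
Proof.
move=> Sa Sb [c0 cl Sc cd] hs Sk; have [s0 sl] := andP hs.
set l := idist e S a b in hs sl cl Sc cd.
have l0 : 0 <= l := idist_ge0 cS Sa Sb.
have h0 : 0 <= (0 : R) <= l by rewrite lexx.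
have hl : 0 <= l <= l by rewrite l0 lexx.
have [z [[Sz az zb hz] hk]] := idist_point cS Sa Sb hs.
have [l00|lp] := eqVneq l 0.
  have -> : s = 0 by apply/eqP; rewrite eq_le s0 andbT -l00.
  by rewrite c0 le_max lexx.
have lp0 : 0 < l by rewrite lt_neqAle eq_sym lp.
have Scs := Sc s hs.
suff -> : c s = z by exact: hk.
have e1 : idist e S (c s) a = s by rewrite -[in LHS]c0 cd// subr0 ger0_norm.
have e2 : idist e S (c s) b = l - s by rewrite -[in LHS]cl cd// distrC ger0_norm ?subr_ge0.
have [_ eq0 _ _] := idist_metric cS.
have sl' : sinh (l - s) * cosh s + sinh s * cosh (l - s) = sinh l.
  by rewrite -[in RHS](subrK s l) (sinhD (l - s) s); ring.
have := hz _ Scs; rewrite e1 e2 -/l sl' -[leRHS]mulr1 ler_pM2l ?sinh_gt0// => h.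
apply/eq0 => //; apply: cosh_inj; rewrite ?(idist_ge0 cS)// cosh0.
by apply/eqP; rewrite eq_le h cosh_ge1.
Qed.

Lemma geodesic_bounded a b c : S a -> S b -> is_geodesic S (idist e S) a b c ->
  exists B, forall s, 0 <= s <= idist e S a b -> forall j, `|c s j 0| <= B.
Proof.
move=> Sa Sb gc; have [ks [Sks [C hC]]] := cs_span cS.
pose m k := Num.max (- bil a k) (- bil b k).
exists (`|C| * \sum_(k <- ks) m k) => s hs j.
apply: (le_trans (hC _ j)).
apply: (@le_trans _ _ (`|C| * \sum_(k <- ks) `|bil (c s) k|)).
  by apply: ler_wpM2r; [apply: sumr_ge0|exact: ler_norm].
rewrite ler_wpM2l// !big_seq; apply: ler_sum => k /Sks Sk.
have [_ _ Sc _] := gc.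
by rewrite ltr0_norm ?(cs_lt0 cS)//; [exact: geodesic_bil_le|exact: Sc].
Qed.

Lemma geodesic_lipschitz a b c : S a -> S b -> is_geodesic S (idist e S) a b c ->
  exists2 C, 0 < C & forall s t, 0 <= s <= idist e S a b -> 0 <= t <= idist e S a b ->
    `|c s - c t| <= C * `|s - t|.
Proof.
move=> Sa Sb gc; have [B hB] := geodesic_bounded Sa Sb gc.
have [C C0 hC] := idist_ge_coord cS B; exists C => // s t hs ht.
have [_ _ Sc cd] := gc.
apply: col_norm_le => [|j]; first by rewrite mulr_ge0// ltW.
by rewrite !mxE -(cd _ _ hs ht) (idistC cS)//; try exact: Sc; apply: hC; try exact: Sc; exact: hB.
Qed.

Lemma idist_geodesic a b : S a -> S b -> exists c, is_geodesic S (idist e S) a b c.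
Proof. by move=> Sa Sb; have [_ g _] := idist_CATm1 cS; exact: g. Qed.

Lemma qf_le_norm v : qf v <= (2 + n)%:R * `|v| ^+ 2.
Proof.
apply: (le_trans (ler_norm _)); rewrite expr2; apply: bil_bound => j; exact: col_norm_ge.
Qed.

Lemma curve_length_ge0 c s t : (0 <= curve_length c s t)%E.
Proof. by apply: integral_ge0 => r _; rewrite lee_fin sqrtr_ge0. Qed.

Lemma derive1_junk c t : ~ derivable c t 1 -> derive1 c t = 0.
Proof.
move=> h; rewrite derive1E /derive dvgP//.
by apply/matrixP => i j; rewrite !mxE.
Qed.

(** The distance to the initial point is Lipschitz along the curve, and where both it and the curve
    are differentiable its derivative is at most the speed. The curve is differentiable almost
    everywhere, coordinate by coordinate. *)
Lemma idist_le_curve_length c s t : s <= t -> [lipschitz c r | r in `[s, t]%classic] ->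
  (forall r, s <= r <= t -> S (c r)) -> ((idist e S (c s) (c t))%:E <= curve_length c s t)%E.
Proof.
move=> st lc Sc.
have Ss : S (c s) by apply: Sc; rewrite lexx.
have St : S (c t) by apply: Sc; rewrite lexx andbT.
have [stE|nst] := eqVneq s t.
  by rewrite stE (idist_xx cS)// curve_length_ge0.
have {nst}st' : s < t by rewrite lt_neqAle nst.
have [L L0 hL] : exists2 L, 0 < L & forall r r', s <= r <= t -> s <= r' <= t ->
    `|c r - c r'| <= L * `|r - r'|.
  move: lc; rewrite /lipschitz_on => lc.
  have [L [L0 hL]] : exists L : R, 0 < L /\ L.-lipschitz_on c (globally (`[s, t]%classic `*` `[s, t]%classic)).
    near (pinfty_nbhs R) => L; exists L; split; [near: L; exact: nbhs_pinfty_gt|near: L; exact: lc].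
  by exists L => // r r' hr hr'; apply: (hL (r, r')); split; rewrite /= in_itv.
pose h r := idist e S (c s) (c r).
pose K := Num.sqrt ((2 + n)%:R) * L.
have K0 : 0 < K by rewrite mulr_gt0 ?sqrtr_gt0.
have hK r r' : s <= r <= t -> s <= r' <= t -> `|h r - h r'| <= K * `|r - r'|.
  move=> hr hr'; have Sr := Sc _ hr; have Sr' := Sc _ hr'.
  apply: (@le_trans _ _ (idist e S (c r) (c r'))).
    have := idist_tri cS Ss Sr Sr'; have := idist_tri cS Ss Sr' Sr.
    by rewrite (idistC cS Sr' Sr) -/(h r) -/(h r') ler_norml => *; apply/andP; split; lra.
  apply: (le_trans (idist_le_qf cS Sr Sr')).
  apply: (le_trans (ler_wsqrtr (qf_le_norm _))).
  rewrite sqrtrM// sqrtr_sqr normr_id -mulrA ler_wpM2l ?sqrtr_ge0//.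
  by rewrite distrC; exact: hL.
have cd : {ae mu, forall r, s < r < t -> derivable c r 1}.
  have : \forall r \near almost_everywhere mu, forall j : 'I_(2 + n), s < r < t ->
      derivable (fun r => c r j 0) r 1.
    apply: filter_forall => j.
    have [|G [_ Gd _]] := @lipschitz_FTC R (fun r => c r j 0) s t L st' L0.
      move=> r r' hr hr'; apply: le_trans (hL r r' hr hr').
      by have := col_norm_ge (c r - c r') j; rewrite !mxE.
    apply: (@filterS _ (almost_everywhere mu) (ae_filter_ringOfSetsType mu) _ _ _ Gd).
    by move=> r hr /hr[].
  apply: filterS; first exact: (ae_filter_ringOfSetsType mu).
  by move=> r hr srt; apply/derivable_mxP => i j; rewrite ord1; exact: hr.
have := @lipschitz_variation_le R h (fun r => lorentz_norm (derive1 c r)) s t K st' K0 hK.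
rewrite /h (idist_xx cS)// subr0; apply => [r|]; first exact: sqrtr_ge0.
apply: filterS; [exact: (ae_filter_ringOfSetsType mu)| |exact: cd].
move=> r hr srt dh; have [sr rt] := andP srt.
pose d := Num.min (r - s) (t - r).
apply: (derive1_idist_le cS (d := d)) => //; [by rewrite lt_min !subr_gt0 sr| |exact: hr].
move=> r'; rewrite lt_min !ltr_norml => /andP[/andP[h1 _] /andP[_ h2]].
by apply: Sc; apply/andP; split; lra.
Unshelve. all: by end_near. Qed.

Lemma geodesic_curve a b : S a -> S b -> exists c, [/\ [lipschitz c r | r in `[0, idist e S a b]%classic],
  forall r, S (c r), c 0 = a /\ c (idist e S a b) = b &
  (curve_length c 0 (idist e S a b) <= (idist e S a b)%:E)%E].
Proof.
move=> Sa Sb; have [c gc] := idist_geodesic Sa Sb; set l := idist e S a b in gc *.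
have l0 : 0 <= l := idist_ge0 cS Sa Sb.
have [C C0 hC] := geodesic_lipschitz Sa Sb gc.
have [c0 cl Sc cd] := gc.
pose g r := c (clamp l r).
have ci r : 0 <= clamp l r <= l by exact: clamp_itv.
have Sg r : S (g r) by exact: Sc.
have gd r r' : idist e S (g r) (g r') <= `|r - r'|.
  by rewrite cd//; exact: clamp_lip.
exists g; split=> //.
- rewrite /lipschitz_on; near=> L => -[r r'] _ /=. apply: (le_trans (hC _ _ (ci _) (ci _))).
  apply: (@le_trans _ _ (C * `|r - r'|)); first by rewrite ler_wpM2l ?(ltW C0)//; exact: clamp_lip.
  by rewrite ler_wpM2r//; near: L; exact: nbhs_pinfty_ge.
- by rewrite /g !clamp_id ?lexx ?l0.
- have h : (curve_length g 0 l <= \int[mu]_(t in `[0%R, l]) (1 : R)%:E)%E.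
    apply: nneg_integral_le => // t _; first by rewrite lee_fin sqrtr_ge0.
    (* Where [g] is not differentiable, [derive1] has the default value 0, which also obeys the
       bound. *)
    rewrite lee_fin; have [d|nd] := pselect (derivable g t 1); last first.
      by rewrite derive1_junk// /lorentz_norm /qf -[X in bil X X](scale0r 0) bilZl mul0r normr0 sqrtr0.
    apply: (derive1_speed_le cS) => // r; rewrite distrC; exact: gd.
  apply: (le_trans h); rewrite integral_cst//= lebesgue_measure_itv/= lte_fin; case: ifPn => [_|].
    by rewrite mul1e sube0.
  by rewrite -leNgt mule0 => _; rewrite lee_fin.
Unshelve. all: by end_near. Qed.

Lemma length_distE a b : S a -> S b -> length_dist S a b = idist e S a b.
Proof.
move=> Sa Sb; rewrite /length_dist; set L := [set _ | _].
suff -> : ereal_inf L = (idist e S a b)%:E by [].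
apply/eqP; rewrite eq_le; apply/andP; split.
  have [c [lc Sc [c0 c1] hc]] := geodesic_curve Sa Sb.
  apply: le_trans hc; apply: ereal_inf_lbound.
  exists c, 0, (idist e S a b); split=> //; exact: (idist_ge0 cS).
apply: le_ereal_inf_tmp => _ [c [s [t [st lc Sc [<- <-] ->]]]].
exact: idist_le_curve_length.
Qed.

End LengthDistance.

Lemma complete_CATm1_eq (R : realType) (T : Type) (X : set T) (d d' : T -> T -> R) :
  (forall x y, X x -> X y -> d x y = d' x y) -> complete_CATm1 X d -> complete_CATm1 X d'.
Proof.
move=> dd [cpl [[m1 m2 m3 m4] gs cat]].
have geo x y c : X x -> X y -> is_geodesic X d' x y c -> is_geodesic X d x y c.
  move=> Xx Xy; rewrite /is_geodesic -!dd// => -[c0 c1 Xc cd]; split=> // s t hs ht.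
  by rewrite dd ?cd//; exact: Xc.
split.
  move=> u Xu cu; have [|l Xl ul] := cpl u Xu.
    by move=> eps /cu[N hN]; exists N => i j hi hj; rewrite dd//; exact: hN.
  by exists l => //; rewrite (_ : (fun k => _) = (fun k => d (u k) l))//; apply/funext => k; rewrite dd.
split.
- split=> [x y Xx Xy|x y Xx Xy|x y Xx Xy|x y z Xx Xy Xz]; rewrite -!dd//.
  + exact: m1.
  + exact: m2.
  + exact: m3.
  + exact: m4.
- move=> x y Xx Xy; have [c [c0 c1 Xc cd]] := gs x y Xx Xy; exists c.
  by split; rewrite -?dd// => s t hs ht; rewrite -dd ?cd//; exact: Xc.
- move=> x y z c1 c2 c3 Xx Xy Xz g1 g2 g3 u v w hu hv hw uv uw vw s t hs ht p q hp hq up pv uq qw.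
  have [_ _ Xc1 _] := g1; have [_ _ Xc2 _] := g2.
  rewrite -dd; [|exact: Xc1|exact: Xc2].
  apply: (cat x y z c1 c2 c3 Xx Xy Xz (geo _ _ _ Xx Xy g1) (geo _ _ _ Xx Xz g2) (geo _ _ _ Xy Xz g3)
    u v w hu hv hw); rewrite ?dd//.
Qed.

(** * Completeness from cocompactness *)

Section Completeness.
Context {R : realType} {n : nat}.
Local Notation V := 'cV[R]_(2 + n).
Implicit Types (x y z a b p k N M v : V) (s t h l C : R) (c : R -> V) (F : seq V) (A B : 'M[R]_(2 + n)).
Variables (e : R) (S : set V).
Hypothesis cS : convex_surface e S.
Let e0 := cs_neq0 cS.

(** An isometry need not preserve [om]; the preservation of its sign on orthogonal timelike pairs is
    what carries faces to faces. *)
Definition surface_symmetry A := [/\ isometries A,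
  forall x N, qf x = -1 -> qf N = -1 -> bil x N = 0 -> 0 < om e x N -> 0 < om e (A *m x) (A *m N) &
  forall x, S x -> S (A *m x)].

Lemma chain_mulmx A F a b l : surface_symmetry A -> good F -> chain e F a b l ->
  chain e [seq A *m N | N <- F] (A *m a) (A *m b) l.
Proof.
move=> [iA oA SA] [gF _].
have hface N x : face e F N x -> face e [seq A *m N | N <- F] (A *m N) (A *m x).
  case=> NF inx [qx Nx ox]; split; first exact: map_f.
    by move=> _ /mapP[K KF ->]; rewrite iA; exact: inx.
  by split; rewrite /qf ?iA//; apply: oA => //; [exact: gF|rewrite bilC].
elim=> {a b l} [x [N sx]|N x y z l hx hy _ ih]; first by apply: chain_nil; exists (A *m N); exact: hface.
have -> : ch x y = ch (A *m x) (A *m y) by rewrite /ch iA.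
exact: (chain_cons (hface _ _ hx) (hface _ _ hy) ih).
Qed.

(** [B] carries a family admissible for the image points to one admissible for [a] and [b], and [A]
    carries a minimal chain of the latter forward. *)
Lemma idist_symmetry A B a b : surface_symmetry A -> surface_symmetry B ->
  A *m B = 1%:M -> B *m A = 1%:M -> S a -> S b ->
  idist e S (A *m a) (A *m b) <= idist e S a b.
Proof.
move=> sA sB AB BA Sa Sb; have [iA oA SA] := sA; have [iB oB SB] := sB.
have K1 x : A *m (B *m x) = x by rewrite mulmxA AB mul1mx.
have K2 x : B *m (A *m x) = x by rewrite mulmxA BA mul1mx.
apply: (idist_le cS (SA _ Sa) (SA _ Sb)) => F [fF sa sb].
have gF := family_good cS fF.
pose F' := [seq B *m N | N <- F].
have fF' : family e S F'.
  move=> _ /mapP[N /fF[x Sx [qN Nx ox hN]] ->]; exists (B *m x); first exact: SB.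
  split; rewrite /qf ?iB//.
    by apply: oB => //; [exact: (cs_AdS cS)|rewrite bilC].
  by move=> y Sy; rewrite -(K2 y) iB; exact/hN/SA.
have surfB x : surf e F (A *m x) -> surf e F' x.
  case=> N [NF inx [qx Nx ox]]; exists (B *m N); split; first exact: map_f.
    by move=> _ /mapP[K KF ->]; rewrite -(K2 x) iB; exact: inx.
  have qN : qf N = -1 by exact: gF.1.
  rewrite /hyp -(K2 x) /qf !iB; split=> //; apply: oB => //; by rewrite bilC.
have gF' := family_good cS fF'.
have [c _] := pdistP e0 gF' (surfB _ sa) (surfB _ sb).
have := chain_mulmx sA gF' c; rewrite /F' -map_comp (eq_map (g := id)) ?map_id => [c'|x]; last exact: K1.
have [_ m] := pdistP e0 gF sa sb.
apply: (le_trans (m _ c')); apply: pdist_le_idist => //; split; [by []|exact: surfB|exact: surfB].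
Qed.

(** [idist_ge_coord] concerns points that are bounded beforehand. If [y] had norm above the bound,
    the geodesic from [x] would reach norm [|Q| + 1] at a point where the comparison applies: it
    would be within one half of [x], although the norms differ by at least 1. *)
Lemma idist_ball_bounded (Q : R) : exists2 r, 0 < r & forall x y, S x -> S y ->
  (forall j, `|x j 0| <= Q) -> idist e S x y < r -> forall j, `|y j 0| <= `|Q| + 1.
Proof.
have [C C0 hC] := idist_ge_coord cS (`|Q| + 1).
have C2 : 0 < (2 * C)^-1 by rewrite invr_gt0 mulr_gt0.
exists (2 * C)^-1 => // x y Sx Sy xQ xy.
suff : `|y| <= `|Q| + 1 by move=> h j; exact: le_trans (col_norm_ge y j) h.
rewrite leNgt; apply/negP => yQ.
have xQ' : `|x| <= `|Q| by apply: col_norm_le => // j; apply: le_trans (xQ j) (ler_norm _).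
have [c gc] := idist_geodesic cS Sx Sy; have [L L0 hL] := geodesic_lipschitz cS Sx Sy gc.
have [c0 c1 Sc cd] := gc; set l := idist e S x y in xy gc hL c1 Sc cd *.
have l0 : 0 <= l := idist_ge0 cS Sx Sy.
pose g t := `|c (clamp l t)|.
have ci r : 0 <= clamp l r <= l by exact: clamp_itv.
have gcont : continuous g.
  move=> t; apply/cvgrPdist_lt => eps eps0; apply/nbhs_ballP.
  exists (eps / L); first by rewrite /= divr_gt0.
  move=> t'; rewrite /ball/= ltr_pdivlMr// mulrC => h.
  apply: le_lt_trans h; apply: (le_trans (ler_dist_dist _ _)).
  by apply: (le_trans (hL _ _ (ci _) (ci _))); rewrite ler_wpM2l ?(ltW L0)//; exact: clamp_lip.
have [||t tl gt] := @IVT R g 0 l (`|Q| + 1) l0.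
- exact: continuous_subspaceT.
- rewrite /g !clamp_id ?lexx ?l0// c0 c1 ge_min le_max (ltW yQ) orbT andbT.
  by rewrite (le_trans xQ')// lerDl.
rewrite in_itv/= in tl; rewrite /g clamp_id// in gt.
have := hC x (c t) Sx (Sc _ tl); rewrite -[X in idist e S X _]c0 cd// ?lexx// sub0r normrN => h.
have : `|c t - x| <= 2^-1.
  apply: col_norm_le => // j; rewrite !mxE; apply: le_trans (h _ _ j) _.
  - by move=> i; apply: le_trans (col_norm_ge x i) _; rewrite (le_trans xQ')// lerDl.
  - by move=> i; rewrite -gt; exact: col_norm_ge.
  - have [t0 tl'] := andP tl; rewrite ger0_norm//.
    apply: (@le_trans _ _ (C * (2 * C)^-1)); first by rewrite ler_pM2l// (le_trans tl') ?ltW.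
    by rewrite invfM mulrCA divff ?mulr1// gt_eqF.
have := ler_normD (c t - x) x; rewrite subrK gt; have := normr_ge0 Q.
by move: xQ'; lra.
Qed.

Hypothesis cocompact : exists Q : R, forall x, S x -> exists A B,
  [/\ surface_symmetry A, surface_symmetry B, A *m B = 1%:M, B *m A = 1%:M &
      forall j, `|(A *m x) j 0| <= Q].

(** A symmetry moves one term of the Cauchy sequence into the bounded set, and the later terms stay
    near it. They have a limit along an ultrafilter, on [S] by maximality, and [ch] to the limit
    tends to 0, hence so does the distance. *)
Lemma idist_complete : is_complete S (idist e S).
Proof.
move=> u Su cu; have [Q hQ] := cocompact.
have [r r0 hr] := idist_ball_bounded Q.
have [m0 hm0] := cu _ r0.
have [A [B [sA sB AB BA uQ]]] := hQ _ (Su m0).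
have [_ _ SA] := sA; have [_ _ SB] := sB.
pose v i := A *m u i.
have Sv i : S (v i) by exact: SA.
have vd i j : idist e S (v i) (v j) <= idist e S (u i) (u j) by apply: (idist_symmetry sA sB AB BA).
have vb i : (m0 <= i)%N -> forall j, `|v i j 0| <= `|Q| + 1.
  by move=> hi; apply: (hr (v m0)) => //; exact: le_lt_trans (vd _ _) (hm0 _ _ (leqnn _) hi).
have [U [UU sU]] := ultraFilterLemma eventually_filter.
have [z vz] : exists z, v @ U --> z.
  apply: ultra_bounded_col => j; exists (`|Q| + 1); apply: sU; exists m0 => // i /= hi; exact: vb.
have qz : qf z = -1.
  have hq i : bil (v i) (v i) = -1 by exact: (cs_AdS cS).
  apply/eqP; rewrite eq_le; apply/andP; split.
    by apply: (cvgr_to_le (cvg_bil vz vz)); apply: filterE => i; rewrite hq.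
  by apply: (cvgr_to_ge (cvg_bil vz vz)); apply: filterE => i; rewrite hq.
have Sz : S z.
  apply: (cs_maximal cS) => // k Sk.
  apply: (cvgr_to_ge (cvgN (cvg_bil vz (cvg_cst k)))); apply: filterE => i; exact: (surface_ge1 cS).
have chz : (fun i => ch (v i) z) @ U --> (0 : R).
  rewrite -(chxx qz); apply: cvg_ch => //; last exact: cvg_cst.
  by rewrite -/(qf z) qz opprK.
exists (B *m z); first exact: SB.
apply/cvgrPdist_lt => eps eps0; have e2 : 0 < eps / 2 by rewrite divr_gt0.
have [m1 hm1] := cu _ e2; exists m1 => // i /= hi; rewrite sub0r normrN.
have uE j : u j = B *m v j by rewrite /v mulmxA BA mul1mx.
have Sz' := SB _ Sz.
have Ui : \forall j \near U, (m1 <= j)%N by apply: sU; exists m1.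
have Uc : \forall j \near U, ch (v j) z < eps / 2 by exact: (cvgr_lt _ chz).
have [j [mj cj]] := filter_ex (filterI Ui Uc).
rewrite ger0_norm ?(idist_ge0 cS)//.
have h1 := hm1 _ _ hi mj.
have h2 : idist e S (u j) (B *m z) <= ch (v j) z.
  by rewrite uE; apply: (le_trans (idist_symmetry sB sA BA AB (Sv j) Sz)); exact: (idist_le_ch cS).
have := idist_tri cS (Su i) (Su j) Sz'; lra.
Qed.

Lemma surface_complete_CATm1 : complete_CATm1 S (length_dist S).
Proof.
apply: (@complete_CATm1_eq _ _ S (idist e S)); first by move=> a b Sa Sb; rewrite (length_distE cS).
by split; [exact: idist_complete|exact: idist_CATm1].
Qed.

End Completeness.

(** * The limit sphere and its dual cones *)

Section LightlikeSphere.
Context {R : realType} {n : nat}.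
Local Notation V := 'cV[R]_(2 + n).
Implicit Types (x y z a b p N M v w g : V) (s t r l C : R).

Lemma nat_ultra : exists U : set_system nat, UltraFilter U /\ \oo `<=` U.
Proof. by have [U [UU sU]] := ultraFilterLemma eventually_filter; exists U. Qed.

Lemma ultra_cvg_near (U : set_system nat) (f : nat -> R) (l : R) :
  \oo `<=` U -> f @ \oo --> l -> f @ U --> l.
Proof. by move=> sU fl A /fl; exact: sU. Qed.

Lemma cvg_shift_cst (x : V) (w : nat -> V) (U : set_system nat) {FU : Filter U} :
  \oo `<=` U -> (forall k, `|w k| <= k.+1%:R^-1) -> (fun k => x + w k) @ U --> x.
Proof.
move=> sU hw; apply: cvg_col => j; apply/cvgrPdist_le => eps eps0.
have h0 : (fun k => k.+1%:R^-1 : R) @ U --> (0 : R) by apply: ultra_cvg_near => //; exact: cvg_harmonic.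
have : \forall k \near U, (k.+1%:R^-1 : R) < eps by exact: (cvgr_lt _ h0).
apply: filterS => k hk; rewrite mxE opprD addrA subrr add0r normrN.
by apply: le_trans (col_norm_ge _ _) (le_trans (hw k) (ltW hk)).
Qed.

(** The change of sign of the negative coordinates, for which [bil x (refl x)] is the Euclidean
    square norm. *)
Definition refl x : V := \col_i (if (i < 2)%N then - x i 0 else x i 0).

Lemma bil_refl x : bil x (refl x) = tu x ^+ 2 + tv x ^+ 2 + sp x x.
Proof.
have hs : sp x (refl x) = sp x x by apply: eq_bigr => i _; rewrite mxE.
by rewrite bil_coord hs /tu /tv !mxE /=; ring.
Qed.

Lemma bil_refl_gt0 x : x != 0 -> 0 < bil x (refl x).
Proof.
move=> x0; rewrite bil_refl lt_neqAle !addr_ge0 ?sqr_ge0 ?sp_ge0// andbT eq_sym.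
apply: contra x0 => /eqP h; have := sp_ge0 x; have := sqr_ge0 (tu x); have := sqr_ge0 (tv x) => h1 h2 h3.
by apply/eqP; apply: sp_eq0; [lra|apply/eqP; rewrite -sqrf_eq0; apply/eqP; lra ..].
Qed.

Lemma norm_refl x : `|refl x| <= `|x|.
Proof.
apply: col_norm_le => // j; rewrite mxE; have := col_norm_ge x j.
by case: ifP; rewrite ?normrN.
Qed.

(** Moving [z] a little in the direction of [refl v] strictly increases the product with [v]. *)
Lemma bil_lt0_interior v z (d : R) : v != 0 -> 0 < d ->
  (forall w, `|w| <= d -> bil v (z + w) <= 0) -> bil v z < 0.
Proof.
move=> v0 d0 h; have vn : 0 < `|v| by rewrite normr_gt0.
have nr : `|(d / `|v|) *: refl v| <= d.
  rewrite normrZ ger0_norm ?divr_ge0 ?(ltW d0)//.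
  by rewrite mulrAC ler_pdivrMr// ler_wpM2l ?(ltW d0)// norm_refl.
have := h _ nr; rewrite bilDr bilZr.
by have := mulr_gt0 (divr_gt0 d0 vn) (bil_refl_gt0 v0); lra.
Qed.

(** Isotropic representatives whose negative and space parts both have norm one. [ls_surj] says that
    the sphere lies over every space direction, and [ls_lt0] is acausality. *)
Record lightlike_sphere (P : set V) : Prop := LightlikeSphere {
  ls_unit : forall p, P p -> tu p ^+ 2 + tv p ^+ 2 = 1 /\ sp p p = 1;
  ls_surj : forall x, exists p r, [/\ P p, 0 <= r & forall i, x (rshift 2 i) 0 = r * p (rshift 2 i) 0];
  ls_lt0 : forall p p', P p -> P p' -> p <> p' -> bil p p' < 0 }.

Variable P : set V.
Hypothesis lP : lightlike_sphere P.

Definition dual_cone (A : set V) : set V := [set v | forall p, A p -> bil v p <= 0].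
Local Notation Cs := (dual_cone P).
Local Notation Cc := (dual_cone Cs).

Lemma sphere_qf p : P p -> qf p = 0.
Proof. by move=> /(ls_unit lP)[h1 h2]; rewrite /qf bil_coord h2 -!expr2 h1; ring. Qed.

Lemma sphere_le0 p p' : P p -> P p' -> bil p p' <= 0.
Proof.
move=> Pp Pp'; have [<-|h] := pselect (p = p'); first by rewrite -/(qf p) sphere_qf.
exact/ltW/(ls_lt0 lP).
Qed.

Lemma sphere_neq0 p : P p -> p != 0.
Proof.
move=> Pp; apply/eqP => p0; have [h _] := ls_unit lP Pp; move: h.
by rewrite p0 /tu /tv !mxE expr0n /= addr0 => /eqP; rewrite eq_sym oner_eq0.
Qed.

Lemma sphere_dual p : P p -> Cs p. Proof. by move=> Pp p' Pp'; exact: sphere_le0. Qed.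
Lemma sphere_bidual p : P p -> Cc p. Proof. by move=> Pp v hv; rewrite bilC; exact: hv. Qed.
Lemma bidual_dual x : Cc x -> Cs x. Proof. by move=> Cx p /sphere_dual; exact: Cx. Qed.

Lemma dual_coneD A x y : dual_cone A x -> dual_cone A y -> dual_cone A (x + y).
Proof. by move=> hx hy p Ap; rewrite bilDl; have := hx p Ap; have := hy p Ap; lra. Qed.

Lemma dual_coneZ A x r : 0 <= r -> dual_cone A x -> dual_cone A (r *: x).
Proof. by move=> r0 hx p Ap; rewrite bilZl mulr_ge0_le0// hx. Qed.

Lemma dual_cone_lim A I (U : set_system I) (X : I -> V) x {PU : ProperFilter U} :
  X @ U --> x -> (forall i, dual_cone A (X i)) -> dual_cone A x.
Proof.
move=> hX h p Ap; apply: (cvgr_to_le (cvg_bil hX (cvg_cst p))).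
by apply: filterE => i; exact: h.
Qed.

Lemma sp_scale x p r w : (forall i, x (rshift 2 i) 0 = r * p (rshift 2 i) 0) -> sp x w = r * sp p w.
Proof. by move=> h; rewrite /sp mulr_sumr; apply: eq_bigr => i _; rewrite h mulrA. Qed.

(** The point [p] over the space direction of [v] serves as a test point: [- qf v] is at least the
    squared distance from [v] to [r *: p]. *)
Lemma dual_vertex v p r : P p -> 0 <= r -> (forall i, v (rshift 2 i) 0 = r * p (rshift 2 i) 0) ->
  Cs v -> [/\ r <= tu v * tu p + tv v * tv p, sp v v = r ^+ 2 &
   (tu v - r * tu p) ^+ 2 + (tv v - r * tv p) ^+ 2 <= - qf v].
Proof.
move=> Pp r0 hr /(_ p Pp); have [u1 s1] := ls_unit lP Pp.
have svp : sp v p = r by rewrite (sp_scale _ hr) s1 mulr1.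
have svv : sp v v = r ^+ 2 by rewrite (sp_scale _ hr) spC svp expr2.
rewrite bil_coord svp => h; split=> //; first lra.
rewrite /qf bil_coord svv; nra.
Qed.

Lemma dual_qf v : Cs v -> qf v <= 0.
Proof.
move=> hv; have [p [r [Pp r0 hr]]] := ls_surj lP v.
have [_ _ h] := dual_vertex Pp r0 hr hv.
by have := sqr_ge0 (tu v - r * tu p); have := sqr_ge0 (tv v - r * tv p); lra.
Qed.

Lemma dual_null v : Cs v -> qf v = 0 -> exists p r, [/\ P p, 0 <= r & v = r *: p].
Proof.
move=> hv q0; have [p [r [Pp r0 hr]]] := ls_surj lP v.
have [_ _ h] := dual_vertex Pp r0 hr hv; exists p, r; split=> //.
have := sqr_ge0 (tu v - r * tu p); have := sqr_ge0 (tv v - r * tv p) => h1 h2.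
have z (s t : R) : (s - t) ^+ 2 = 0 -> s = t.
  by move=> /eqP; rewrite sqrf_eq0 subr_eq0 => /eqP.
apply: col_ext => [||i]; last by rewrite mxE hr.
- by rewrite {2}/tu mxE -/(tu p); apply: z; lra.
- by rewrite {2}/tv mxE -/(tv p); apply: z; lra.
Qed.

Lemma coord_le_sum x (C : R) j : 0 <= C -> tu x ^+ 2 + tv x ^+ 2 + sp x x <= C ^+ 2 -> `|x j 0| <= C.
Proof.
move=> C0 h; have sq (r : R) : r ^+ 2 <= C ^+ 2 -> `|r| <= C.
  by move=> h'; rewrite ler_norml; apply/andP; split; nra.
apply: sq; apply: le_trans h; have := sp_ge0 x; have := sqr_ge0 (tv x); have := sqr_ge0 (tu x).
case: (split_ordP j) => i -> h1 h2 h3.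
  case: i => [[|[|//]] hi].
  - by rewrite (_ : Ordinal hi = 0); [rewrite -/(tu x); lra|exact: val_inj].
  - by rewrite (_ : Ordinal hi = 1); [rewrite -/(tv x); lra|exact: val_inj].
suff : x (rshift 2 i) 0 ^+ 2 <= sp x x by lra.
by rewrite /sp (bigD1 i)//= -expr2 lerDl; apply: sumr_ge0 => k _; exact: sqr_ge0.
Qed.

Lemma sphere_coord p j : P p -> `|p j 0| <= 2.
Proof.
by move=> Pp; have [h1 h2] := ls_unit lP Pp; apply: coord_le_sum => //; rewrite h1 h2; lra.
Qed.

(* The limit [y] is compared with the point of [P] which has the same space part. *)
Lemma sphere_closed I (U : set_system I) (Y : I -> V) y {PU : ProperFilter U} :
  (forall i, P (Y i)) -> Y @ U --> y -> P y.
Proof.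
move=> PY hY; have Cy : Cs y by apply: (dual_cone_lim hY) => i; exact: sphere_dual.
have cst (f : I -> R) l m : f @ U --> l -> (forall i, f i = m) -> l = m.
  move=> fl fm; apply/eqP; rewrite eq_le; apply/andP; split.
    by apply: (cvgr_to_le fl); apply: filterE => i; rewrite fm.
  by apply: (cvgr_to_ge fl); apply: filterE => i; rewrite fm.
have qy : qf y = 0.
  by apply: (cst (fun i => bil (Y i) (Y i))); [exact: cvg_bil|move=> i; exact: sphere_qf].
have uy : tu y * tu y + tv y * tv y = 1.
  apply: (cst (fun i => tu (Y i) * tu (Y i) + tv (Y i) * tv (Y i))).
    by apply: cvgD; apply: cvgM; exact: cvg_coord.
  by move=> i; have [h _] := ls_unit lP (PY i); rewrite -!expr2.
have [p [r [Pp r0 E]]] := dual_null Cy qy.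
have [h _] := ls_unit lP Pp; move: uy; rewrite E /tu /tv !mxE -/(tu p) -/(tv p) => uy.
have r1 : r = 1 by nra.
by rewrite r1 scale1r.
Qed.

Lemma sphere_limit (U : set_system nat) (p : nat -> V) : UltraFilter U -> (forall k, P (p k)) ->
  exists2 q, P q & p @ U --> q.
Proof.
move=> UU Pp; have [q hq] : exists q : V, p @ U --> q.
  by apply: ultra_bounded_col => j; exists 2; apply: filterE => k; exact: sphere_coord.
by exists q; [exact: (sphere_closed Pp hq)|exact: hq].
Qed.

(** Otherwise there are points [q k] of [P] with [k * bil p (q k) + bil g (q k) > 0]. Since [bil p]
    is negative away from [p], they can only accumulate at [p], where [bil g] is negative. *)
Lemma dual_push p g : P p -> bil g p < 0 -> exists2 k : R, 0 <= k & Cs (k *: p + g).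
Proof.
move=> Pp gp; apply/not_exists2P => h.
have /choice[q hq] : forall k : nat, exists q, P q /\ 0 < k%:R * bil p q + bil g q.
  move=> k; have [//|h'] := h k%:R.
  by move/existsNP: h' => [q /not_implyP[Pq /negP]]; rewrite bilDl bilZl -ltNge => ?; exists q.
have [U [UU sU]] := nat_ultra.
have [q0 Pq0 hq0] := sphere_limit UU (fun k => (hq k).1).
have hb : (fun k => bil p (q k)) @ U --> bil p q0 by apply: cvg_bil => //; exact: cvg_cst.
have hg : (fun k => bil g (q k)) @ U --> bil g q0 by apply: cvg_bil => //; exact: cvg_cst.
have q0p : p = q0.
  apply: contrapT => /(ls_lt0 lP Pp Pq0) lt0.
  have n1 : \forall k \near U, bil p (q k) < bil p q0 / 2 by apply: (cvgr_lt _ hb); lra.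
  have n2 : \forall k \near U, bil g (q k) < bil g q0 + 1 by apply: (cvgr_lt _ hg); lra.
  have n3 : \forall k \near U, 2 * (`|bil g q0| + 1) / (- bil p q0) < k%:R.
    by apply: sU; exact: nbhs_infty_gtr.
  have [k [[k1 k2] k3]] := filter_ex (filterI (filterI n1 n2) n3).
  move: k3; rewrite ltr_pdivrMr ?oppr_gt0// => k3.
  by have := (hq k).2; have := ler_norm (bil g q0); have : 0 <= k%:R :> R by []; nra.
have : 0 <= bil g q0.
  apply: (cvgr_to_ge hg); apply: filterE => k.
  by have := (hq k).2; have := sphere_le0 Pp (hq k).1; have : 0 <= k%:R :> R by []; nra.
by rewrite -q0p leNgt gp.
Qed.

Lemma dual_open x : (forall p, P p -> bil x p < 0) ->
  exists2 d : R, 0 < d & forall w, `|w| <= d -> Cs (x + w).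
Proof.
move=> hx; apply/not_exists2P => h.
have /choice[wq hwq] : forall k : nat, exists wq : V * V,
    [/\ `|wq.1| <= k.+1%:R^-1, P wq.2 & 0 < bil (x + wq.1) wq.2].
  move=> k; have [|h'] := h k.+1%:R^-1; first by rewrite invr_gt0.
  move/existsNP: h' => [w /not_implyP[hw /existsNP[q /not_implyP[Pq /negP]]]].
  by rewrite -ltNge => ?; exists (w, q).
have [U [UU sU]] := nat_ultra.
have [q Pq hq] : exists2 q, P q & (fun k => (wq k).2) @ U --> q.
  by apply: sphere_limit => k; have [] := hwq k.
have hw : (fun k => x + (wq k).1) @ U --> x by apply: cvg_shift_cst => // k; have [] := hwq k.
have : 0 <= bil x q.
  by apply: (cvgr_to_ge (cvg_bil hw hq)); apply: filterE => k; have [_ _ /ltW] := hwq k.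
by rewrite leNgt hx.
Qed.

(** If [bil x p] vanished, [dual_push] would give a dual vector [k *: p + (- x + r *: w)]. Its
    product with [x] is [1 + r * bil x w], which is positive by the choice of [r]. *)
Lemma bidual_strict x p : Cc x -> qf x = -1 -> P p -> bil x p < 0.
Proof.
move=> Cx qx Pp; rewrite lt_neqAle bidual_dual// andbT; apply/eqP => xp.
have [u1 s1] := ls_unit lP Pp.
have [w wp] : exists w, bil w p < 0.
  by exists (- refl p); rewrite bilNl bilC oppr_lt0 bil_refl_gt0// sphere_neq0.
pose r := (2 * (`|bil x w| + 1))^-1.
have d0 : 0 < 2 * (`|bil x w| + 1) by have := normr_ge0 (bil x w); lra.
have r0 : 0 < r by rewrite invr_gt0.
have [|k k0 hk] := @dual_push p (- x + r *: w) Pp; first by rewrite bilDl bilNl bilZl xp; nra.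
have := Cx _ hk; rewrite bilDr bilZr xp bilDr bilNr bilZr -/(qf x) qx.
have : `|r * bil x w| <= 2^-1.
  rewrite normrM (gtr0_norm r0) /r invfM -mulrA ler_piMr//.
  by rewrite mulrC ler_pdivrMr; have := normr_ge0 (bil x w); lra.
by rewrite ler_norml => /andP[]; lra.
Qed.

(** As [y] is strictly negative on the compact set [P], a neighbourhood of [y] lies in the dual
    cone, on which [x] is nonpositive. *)
Lemma bidual_lt0 x y : Cc x -> qf x = -1 -> Cc y -> qf y = -1 -> bil x y < 0.
Proof.
move=> Cx qx Cy qy; have [d d0 hd] := dual_open (fun p Pp => bidual_strict Cy qy Pp).
have x0 : x != 0 by apply/eqP => x0; move: qx; rewrite x0 /qf bil0l; lra.
by apply: (bil_lt0_interior x0 d0) => w /hd; exact: Cx.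
Qed.

Lemma normal_timelike x v : Cc x -> qf x = -1 -> Cs v -> v != 0 -> bil x v = 0 -> qf v < 0.
Proof.
move=> Cx qx hv v0 xv; rewrite lt_neqAle dual_qf// andbT; apply/eqP => q0.
have [p [r [Pp r0 E]]] := dual_null hv q0.
have := bidual_strict Cx qx Pp; move: xv; rewrite E bilZr => /eqP; rewrite mulf_eq0 => /orP[/eqP r00|/eqP->]; last by rewrite ltxx.
by move: v0; rewrite E r00 scale0r eqxx.
Qed.

End LightlikeSphere.
Notation bidual_cone P := (dual_cone (dual_cone P)).

(** * Rotations of the negative coordinates *)

Section Rotations.
Context {R : realType} {n : nat}.
Local Notation V := 'cV[R]_(2 + n).
Implicit Types (x y z v w : V) (s t : R).

Definition rot t z : V := \col_i (if i == lshift n 0 then cos t * tu z - sin t * tv z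
  else if i == lshift n 1 then sin t * tu z + cos t * tv z else z i 0).

Lemma tu_rot t z : tu (rot t z) = cos t * tu z - sin t * tv z.
Proof. by rewrite {1}/tu mxE eqxx. Qed.

Lemma tv_rot t z : tv (rot t z) = sin t * tu z + cos t * tv z.
Proof. by rewrite {1}/tv mxE (inj_eq (@lshift_inj _ _)) eqxx. Qed.

Lemma rot_space t z i : rot t z (rshift 2 i) 0 = z (rshift 2 i) 0.
Proof. by rewrite mxE !eq_rlshift. Qed.

Lemma sp_rotl t z w : sp (rot t z) w = sp z w.
Proof. by apply: eq_bigr => i _; rewrite rot_space. Qed.

Lemma sp_rotr t z w : sp w (rot t z) = sp w z. Proof. by rewrite spC sp_rotl spC. Qed.

Definition rotE := (tu_rot, tv_rot, sp_rotl, sp_rotr).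

Lemma rot_norm t z : tu (rot t z) ^+ 2 + tv (rot t z) ^+ 2 = tu z ^+ 2 + tv z ^+ 2.
Proof.
rewrite !rotE; have := cos2Dsin2 t; move: (cos t) (sin t) => c s h.
rewrite (_ : _ + _ = (c ^+ 2 + s ^+ 2) * (tu z ^+ 2 + tv z ^+ 2)); last by ring.
by rewrite h mul1r.
Qed.

Lemma qf_rot t z : qf (rot t z) = qf z.
Proof. by rewrite /qf !bil_coord -!expr2 rot_norm !rotE. Qed.

Lemma rot0 z : rot 0 z = z.
Proof. by apply: col_ext => [||i]; rewrite ?rotE ?rot_space// cos0 sin0; ring. Qed.

Lemma rotD s t z : rot (s + t) z = rot s (rot t z).
Proof. by apply: col_ext => [||i]; rewrite ?rotE ?rot_space// cosD sinD; ring. Qed.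

Lemma bil_rot_self t z : bil (rot t z) z = - ((tu z ^+ 2 + tv z ^+ 2) * cos t) + sp z z.
Proof. by rewrite bil_coord !rotE; congr (- _ + _); ring. Qed.

Lemma bil_rot t z v : bil (rot t z) v = bil z v + (1 - cos t) * (tu z * tu v + tv z * tv v)
  - sin t * (tu z * tv v - tv z * tu v).
Proof. by rewrite !bil_coord !rotE; ring. Qed.

Lemma rot_continuous z : continuous (fun t => rot t z).
Proof.
move=> t; apply: cvg_col => j; under eq_fun do rewrite mxE; rewrite mxE.
have cc : cos @ t --> cos t by exact: continuous_cos.
have cs : sin @ t --> sin t by exact: continuous_sin.
case: ifP => _; first by apply: cvgB; apply: cvgM => //; exact: cvg_cst.
case: ifP => _; first by apply: cvgD; apply: cvgM => //; exact: cvg_cst.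
exact: cvg_cst.
Qed.

Lemma angle_ex (c s : R) : c ^+ 2 + s ^+ 2 = 1 -> exists t, cos t = c /\ sin t = s.
Proof.
move=> h; have hc : -1 <= c <= 1 by apply/andP; split; nra.
have hs : Num.sqrt (1 - c ^+ 2) = `|s| by rewrite -h addrAC subrr add0r sqrtr_sqr.
have [s0|s0] := leP 0 s.
  by exists (acos c); rewrite acosK ?in_itv// sin_acos// hs ger0_norm.
by exists (- acos c); rewrite cosN sinN acosK ?in_itv// sin_acos// hs ltr0_norm// opprK.
Qed.

Lemma rot_ex z x : tu x ^+ 2 + tv x ^+ 2 = tu z ^+ 2 + tv z ^+ 2 ->
  0 < tu z ^+ 2 + tv z ^+ 2 -> (forall i, x (rshift 2 i) 0 = z (rshift 2 i) 0) ->
  exists t, rot t z = x.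
Proof.
move=> h r0 hi; set r := tu z ^+ 2 + tv z ^+ 2 in h r0 *; have r0' : r != 0 by rewrite gt_eqF.
have [|t [ct st]] := @angle_ex ((tu z * tu x + tv z * tv x) / r) ((tu z * tv x - tv z * tu x) / r).
  have hi2 : (tu z * tu x + tv z * tv x) ^+ 2 + (tu z * tv x - tv z * tu x) ^+ 2 = r * r.
    by rewrite -[X in _ = _ * X]h /r; ring.
  by rewrite 2![in LHS]exprMn -[LHS]mulrDl hi2 -expr2 -exprMn divff// expr1n.
exists t; apply: col_ext => [||i]; last by rewrite rot_space hi.
- by rewrite tu_rot ct st; apply: (mulfI r0'); rewrite /r; field.
- by rewrite tv_rot ct st; apply: (mulfI r0'); rewrite /r; field.
Qed.

End Rotations.

(** * Boundary points on rotation circles *)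

Section Boundary.
Context {R : realType} {n : nat}.
Local Notation V := 'cV[R]_(2 + n).
Implicit Types (x y z a b p N M v w g : V) (s t r l C : R).
Variable P : set V.
Hypothesis lP : lightlike_sphere P.
Local Notation Cs := (dual_cone P).
Local Notation Cc := (bidual_cone P).

(* For [e = 1] the past boundary and for [e = -1] the future boundary, in AdS, of the
   convex hull of [P]. *)
Definition hull_boundary (e : R) : set V :=
  [set x | [/\ qf x = -1, Cc x & exists v, [/\ Cs v, bil x v = 0 & 0 < om e x v]]].

Lemma AdS_norm z : qf z = -1 -> tu z ^+ 2 + tv z ^+ 2 = 1 + sp z z.
Proof. by rewrite /qf bil_coord => h; lra. Qed.

(* The points [r p + t (p + p')] of the cone, with [p'] opposite to [p] in space. *)
Lemma circle_bidual z : qf z = -1 -> exists t, Cc (rot t z).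
Proof.
move=> qz; have [p [r [Pp r0 hr]]] := ls_surj lP z.
have [p' [r' [Pp' r0' hr']]] := ls_surj lP (- p).
have [u1 s1] := ls_unit lP Pp; have [u1' s1'] := ls_unit lP Pp'.
have spN a b : sp (- a) b = - sp a b by rewrite -scaleN1r spZl mulN1r.
have spp' : sp (- p) p' = r' by rewrite (sp_scale _ hr') s1' mulr1.
have r'1 : r' = 1.
  have : sp (- p) (- p) = r' ^+ 2 by rewrite (sp_scale _ hr') spC spp' expr2.
  by rewrite spN spC spN s1 => h; nra.
have hp' i : p' (rshift 2 i) 0 = - p (rshift 2 i) 0 by rewrite -[LHS]mul1r -r'1 -hr' mxE.
have spp : sp p p' = -1.
  by move: spp'; rewrite spN r'1; lra.
have pp' : bil p p' < 0.
  by apply: (ls_lt0 lP) => // pE; move: spp; rewrite -pE s1; lra.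
pose k := 1 + (tu p * tu p' + tv p * tv p').
have k0 : 0 < k by move: pp'; rewrite bil_coord spp /k; lra.
(* The nonnegative root of [k * (2 * t ^+ 2 + 2 * r * t) = 1], which gives [x] the norm -1. *)
pose t := (Num.sqrt (r ^+ 2 + 2 / k) - r) / 2.
have d0 : 0 <= r ^+ 2 + 2 / k by rewrite addr_ge0 ?sqr_ge0// divr_ge0// ltW.
have d1 : r <= Num.sqrt (r ^+ 2 + 2 / k).
  by rewrite -[leLHS](ger0_norm r0) -sqrtr_sqr ler_wsqrtr// lerDl divr_ge0// ltW.
have t0 : 0 <= t by rewrite divr_ge0// subr_ge0.
have tE : 2 * t ^+ 2 + 2 * r * t = 1 / k.
  have -> : 2 * t ^+ 2 + 2 * r * t = (Num.sqrt (r ^+ 2 + 2 / k) ^+ 2 - r ^+ 2) / 2 by rewrite /t; field.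
  by rewrite sqr_sqrtr//; field; rewrite gt_eqF.
have {}tE : k * (2 * t ^+ 2 + 2 * r * t) = 1 by rewrite tE mulrC divfK// gt_eqF.
pose x := r *: p + t *: (p + p').
have Cx : Cc x.
  by apply: dual_coneD; apply: dual_coneZ => //; [|apply: dual_coneD]; exact: sphere_bidual.
have hx i : x (rshift 2 i) 0 = z (rshift 2 i) 0 by rewrite !mxE hp' hr; ring.
have ux : tu x = r * tu p + t * (tu p + tu p') by rewrite /tu !mxE.
have vx : tv x = r * tv p + t * (tv p + tv p') by rewrite /tv !mxE.
have sz : sp z z = r ^+ 2 by rewrite (sp_scale _ hr) spC (sp_scale _ hr) s1; ring.
have zn := AdS_norm qz.
have [|||s sE] := @rot_ex _ _ z x.
- rewrite zn sz ux vx -tE /k; move: (tu p) (tv p) (tu p') (tv p') u1 u1' => a b c d h1 h2.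
  rewrite (_ : _ + _ = r ^+ 2 * (a ^+ 2 + b ^+ 2) + 2 * r * t * ((a ^+ 2 + b ^+ 2) + (a * c + b * d))
    + t ^+ 2 * ((a ^+ 2 + b ^+ 2) + (c ^+ 2 + d ^+ 2) + 2 * (a * c + b * d))); last by ring.
  by rewrite h1 h2; ring.
- by rewrite zn; have := sp_ge0 z; lra.
- exact: hx.
by exists s; rewrite sE.
Qed.

Variable e : R.
Hypothesis e2 : e ^+ 2 = 1.

Let e0 : e != 0. Proof. by apply: contra_eq_neq e2 => ->; rewrite expr0n /= eq_sym oner_eq0. Qed.

Let e_cases : e = 1 \/ e = -1.
Proof. by move: e2 => /eqP; rewrite sqrf_eq1 => /orP[/eqP|/eqP]; [left|right]. Qed.

Lemma cos_sgn s : cos (e * s) = cos s.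
Proof. by have [->|->] := e_cases; [rewrite mul1r|rewrite mulN1r cosN]. Qed.

Lemma sin_sgn s : sin (e * s) = e * sin s.
Proof. by have [->|->] := e_cases; [rewrite !mul1r|rewrite !mulN1r sinN]. Qed.

(* The last point of the cone on a circle moved in the direction of [- e]. *)
Lemma circle_boundary z : qf z = -1 -> exists t, hull_boundary e (rot t z).
Proof.
move=> qz; have [t0 Ct0] := circle_bidual qz.
pose h s := rot (- (e * s)) (rot t0 z).
have hE s : h s = rot (- (e * s) + t0) z by rewrite rotD.
have qh s : qf (h s) = -1 by rewrite !qf_rot.
have hcont : continuous h.
  move=> s; rewrite /h; apply: (@cvg_comp _ _ _ (fun s => - (e * s)) (fun t => rot t (rot t0 z)) _ (nbhs (- (e * s)))).
    by apply: cvgN; apply: cvgM; [exact: cvg_cst|exact: cvg_id].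
  exact: rot_continuous.
pose pi2 : R := pi / 2; have pi20 : 0 < pi2 by rewrite divr_gt0// pi_gt0.
pose A := [set s : R | 0 <= s <= pi2 /\ Cc (h s)].
have A0 : A 0 by split; [rewrite lexx ltW|rewrite /h mulr0 oppr0 rot0].
have hA : has_sup A by split; [exists 0|exists pi2 => s [/andP[]]].
set s1 := sup A; have s1ge : 0 <= s1 by apply: sup_upper_bound.
have s1le : s1 <= pi2 by apply: ge_sup; [exists 0|move=> s [/andP[]]].
have C1 : Cc (h s1).
  move=> v hv; rewrite leNgt; apply/negP => lt0.
  have c1 : (fun s => bil (h s) v) @ s1 --> bil (h s1) v by apply: cvg_bil; [exact: hcont|exact: cvg_cst].
  have : \forall s \near s1, 0 < bil (h s) v by exact: (cvgr_gt _ c1).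
  move=> /nbhs_ballP[d /= d0 hd].
  have [s As s1s] := sup_adherent d0 hA; have [_ Cs'] := As.
  have ss1 : s <= s1 by exact: (sup_upper_bound hA).
  have := hd s; rewrite /ball/= ger0_norm ?subr_ge0// => /(_ _); rewrite -/s1 in s1s.
  have -> : s1 - s < d by lra.
  by move=> /(_ isT); rewrite ltNge Cs'.
(* After a quarter turn the product with the starting point is a value of [sp], hence nonnegative,
   whereas two points of the cone have a negative product. *)
have s1lt : s1 < pi2.
  rewrite lt_neqAle s1le andbT; apply/eqP => s1E.
  have := bidual_lt0 lP C1 (qh s1) Ct0; rewrite qf_rot => /(_ qz).
  by rewrite /h bil_rot_self cosN cos_sgn s1E cos_pihalf mulr0 oppr0 add0r ltNge sp_ge0.
pose D k : R := (pi2 - s1) / k.+1%:R.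
have D0 k : 0 < D k by rewrite divr_gt0// subr_gt0.
have Dle k : D k <= pi2 - s1.
  by rewrite ler_pdivrMr// ler_peMr ?subr_ge0// ler1n.
set x := h s1 in C1.
(* A unit dual vector that excludes a point just beyond [x]. Expanding its product along the
   rotation, the first-order term bounds [om e x v] below by a multiple of [- sin (D k)]. *)
have /choice[v hv] : forall k : nat, exists v : V, [/\ Cs v, `|v| = 1, 0 <= bil (h (s1 + D k)) v &
    - (sin (D k) * (2 * `|x|)) <= om e x v].
  move=> k; have nC : ~ Cc (h (s1 + D k)).
    move=> Ck; have : s1 + D k <= s1.
      apply: sup_upper_bound => //; split=> //; apply/andP; split; first by rewrite addr_ge0// ltW.
      by rewrite addrC -lerBrDr.
    by have := D0 k; lra.
  move/existsNP: nC => [v /not_implyP[hv /negP]]; rewrite -ltNge => bv.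
  have v0 : v != 0 by apply/eqP => v0; move: bv; rewrite v0 bil0r ltxx.
  have vn : 0 < `|v| by rewrite normr_gt0.
  have [w [wE wn hw bw]] : exists w, [/\ w = `|v|^-1 *: v, `|w| = 1, Cs w & 0 < bil (h (s1 + D k)) w].
    exists (`|v|^-1 *: v); split=> //.
    - by rewrite normrZ normfV normr_id mulVf// gt_eqF.
    - by apply: dual_coneZ => //; rewrite invr_ge0.
    - by rewrite bilZr mulr_gt0// invr_gt0.
  exists w; split=> //; first exact: ltW.
  move: bw; have -> : h (s1 + D k) = rot (- (e * D k)) x.
    by rewrite hE /x hE -rotD; congr rot; ring.
  rewrite bil_rot cosN sinN cos_sgn sin_sgn.
  set m := _ + _ * tv w; have xw : bil x w <= 0 by exact: C1.
  have sD : 0 < sin (D k).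
    by apply: sin_gt0_pi; rewrite D0 /=; have := Dle k; have := pi_gt0 R; rewrite /pi2; lra.
  have cD : 0 <= cos (D k).
    by apply: cos_ge0_pihalf; rewrite -/pi2; have := Dle k; have := D0 k => ??; apply/andP; split; lra.
  have mb : `|m| <= 2 * `|x|.
    have c1 : `|tu x * tu w| <= `|x|.
      by rewrite normrM -[leRHS]mulr1; apply: ler_pM => //; rewrite -?wn; exact: col_norm_ge.
    have c2 : `|tv x * tv w| <= `|x|.
      by rewrite normrM -[leRHS]mulr1; apply: ler_pM => //; rewrite -?wn; exact: col_norm_ge.
    by apply: (le_trans (ler_normD _ _)); lra.
  have := cos2Dsin2 (D k); rewrite /om; set q := tu x * tv w - _.
  move: (sin (D k)) sD (cos (D k)) cD => sn sn0 cs cs0 h2 hb.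
  have h3 : (1 - cs) <= sn ^+ 2 by nra.
  have h4 : (1 - cs) * m <= sn ^+ 2 * (2 * `|x|).
    apply: (@le_trans _ _ ((1 - cs) * `|m|)); last by apply: ler_pM => //; nra.
    by apply: ler_wpM2l; [nra|exact: ler_norm].
  rewrite -(ler_pM2l sn0); nra.
have [U [UU sU]] := nat_ultra.
have [v0 hv0] : exists v0, v @ U --> v0.
  by apply: ultra_bounded_col => j; exists 1; apply: filterE => k; have [_ <- _ _] := hv k; exact: col_norm_ge.
have DU : D @ U --> (0 : R).
  rewrite -(mulr0 (pi2 - s1)); apply: cvgM; first exact: cvg_cst.
  by apply: ultra_cvg_near => //; exact: cvg_harmonic.
have Cv0 : Cs v0 by apply: (dual_cone_lim hv0) => k; have [] := hv k.
have v0n : v0 != 0.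
  apply/eqP => E0; have hn : (fun k => `|v k|) @ U --> (0 : R) by rewrite -(@normr0 R V) -E0; exact: cvg_norm.
  have n1 : \forall k \near U, (`|v k| : R) < 1 by exact: (cvgr_lt (0 : R) hn).
  by have [k] := filter_ex n1; have [_ -> _ _] := hv k; rewrite ltxx.
have xv0 : bil x v0 = 0.
  apply/eqP; rewrite eq_le C1//=.
  have hx : (fun k => h (s1 + D k)) @ U --> x.
    apply: (@cvg_comp _ _ _ (fun k => s1 + D k) h U (nbhs s1)); last exact: hcont.
    have h1 : (fun k => s1 + D k) @ U --> s1 + 0 by apply: cvgD => //; exact: cvg_cst.
    by rewrite addr0 in h1.
  by apply: (cvgr_to_ge (cvg_bil hx hv0)); apply: filterE => k; have [] := hv k.
have om0 : 0 <= om e x v0.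
  have sU0 : (fun k => - (sin (D k) * (2 * `|x|))) @ U --> - ((0 : R) * (2 * `|x|)).
    apply: cvgN; apply: cvgM; last exact: cvg_cst.
    have sin0' : (@sin R) @ (0 : R) --> (0 : R) by have := @continuous_sin R 0; rewrite /continuous_at sin0.
    exact: (@cvg_comp _ _ _ D (@sin R) U (nbhs (0 : R)) _ DU sin0').
  have ho : (fun k => om e x (v k) - (- (sin (D k) * (2 * `|x|)))) @ U --> om e x v0 - (- (0 * (2 * `|x|))).
    by apply: cvgB => //; apply: cvg_om => //; exact: cvg_cst.
  rewrite mul0r !oppr0 addr0 in ho; apply: (cvgr_to_ge ho).
  by apply: filterE => k; have [_ _ _] := hv k; rewrite subr_ge0.
exists (- (e * s1) + t0); rewrite -hE -/x; split=> //; first exact: qh.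
exists v0; split=> //; rewrite lt_neqAle om0 andbT eq_sym.
apply: om_neq0 => //; [by rewrite qh; lra|exact: (dual_qf lP)].
Qed.

End Boundary.

(** * The boundary as a convex surface *)

Section BoundarySurface.
Context {R : realType} {n : nat}.
Local Notation V := 'cV[R]_(2 + n).
Implicit Types (x y z a b p N M v w g : V) (s t r l C : R).
Variable P : set V.
Hypothesis lP : lightlike_sphere P.
Local Notation Cs := (dual_cone P).
Local Notation Cc := (bidual_cone P).
Variable e : R.
Hypothesis e2 : e ^+ 2 = 1.
Local Notation S := (hull_boundary P e).

Let e0 : e != 0. Proof. by apply: contra_eq_neq e2 => ->; rewrite expr0n /= eq_sym oner_eq0. Qed.

(* The points of [S] over [m p] in space, divided by [m], tend to [p]. *)
Lemma dual_of_surface N : (forall y, S y -> bil N y <= 0) -> Cs N.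
Proof.
move=> hN p Pp; have [u1 s1] := ls_unit lP Pp.
have /choice[y hy] : forall k : nat, exists y, [/\ Cs y, bil N y <= 0,
    forall i, y (rshift 2 i) 0 = p (rshift 2 i) 0 & qf y = - k.+1%:R^-1 ^+ 2].
  move=> k; set m : R := k.+1%:R; have m0 : 0 < m by rewrite /m ltr0n.
  pose z : V := \col_i (if i == lshift n 0 then Num.sqrt (1 + m ^+ 2)
    else if i == lshift n 1 then 0 else m * p i 0).
  have uz : tu z = Num.sqrt (1 + m ^+ 2) by rewrite /tu mxE eqxx.
  have vz : tv z = 0 by rewrite /tv mxE (inj_eq (@lshift_inj _ _)) eqxx.
  have hz i : z (rshift 2 i) 0 = m * p (rshift 2 i) 0 by rewrite mxE !eq_rlshift.
  have szz : sp z z = m ^+ 2 by rewrite (sp_scale _ hz) spC (sp_scale _ hz) s1; ring.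
  have qz : qf z = -1.
    rewrite /qf bil_coord szz uz vz -expr2 sqr_sqrtr ?addr_ge0 ?sqr_ge0//; ring.
  have [t St] := circle_boundary lP e2 qz; have [q1 C1 _] := St.
  exists (m^-1 *: rot t z); split.
  - by apply: dual_coneZ; [rewrite invr_ge0 ltW|exact: (bidual_dual lP)].
  - by rewrite bilZr mulr_ge0_le0 ?hN// invr_ge0 ltW.
  - by move=> i; rewrite mxE rot_space hz mulKf// gt_eqF.
  - by rewrite /qf bilZl bilZr -/(qf _) q1; ring.
have ysp k : sp (y k) (y k) = 1.
  have [_ _ hi _] := hy k; have hi1 i : y k (rshift 2 i) 0 = 1 * p (rshift 2 i) 0 by rewrite mul1r hi.
  by rewrite (sp_scale _ hi1) spC (sp_scale _ hi1) s1; ring.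
have yb k j : `|y k j 0| <= 2.
  apply: coord_le_sum => //; have [_ _ _ q] := hy k; move: q.
  rewrite /qf bil_coord ysp => q.
  have : k.+1%:R^-1 <= 1 :> R by rewrite invf_le1 ?ltr0n// ler1n.
  have : 0 <= k.+1%:R^-1 :> R by rewrite invr_ge0.
  by move: (_^-1) q => i q i0 i1; nra.
have [U [UU sU]] := nat_ultra.
have [y0 hy0] : exists y0, y @ U --> y0.
  by apply: ultra_bounded_col => j; exists 2; apply: filterE => k; exact: yb.
have Cy0 : Cs y0 by apply: (dual_cone_lim hy0) => k; have [] := hy k.
have y0i i : y0 (rshift 2 i) 0 = 1 * p (rshift 2 i) 0.
  have h : (fun k => y k (rshift 2 i) 0) @ U --> y0 (rshift 2 i) 0 by exact: cvg_coord.
  rewrite mul1r; apply/eqP; rewrite eq_le.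
  apply/andP; split; [apply: (cvgr_to_le h)|apply: (cvgr_to_ge h)]; apply: filterE => k;
    by have [_ _ -> _] := hy k.
have qy0 : 0 <= qf y0.
  have hh : (fun k => k.+1%:R^-1 : R) @ U --> (0 : R) by apply: ultra_cvg_near => //; exact: cvg_harmonic.
  have hq : (fun k => bil (y k) (y k) + k.+1%:R^-1 * k.+1%:R^-1) @ U --> bil y0 y0 + 0 * 0.
    by apply: cvgD; [exact: cvg_bil|exact: cvgM].
  have : 0 <= bil y0 y0 + 0 * 0; last by rewrite mulr0 addr0.
  apply: (cvgr_to_ge hq); apply: filterE => k; have [_ _ _ q] := hy k.
  by rewrite -/(qf _) q expr2 addNr.
have [_ _ h] := dual_vertex lP Pp ler01 y0i Cy0.
have y0p : y0 = p.
  have z0 (s t : R) : (s - t) ^+ 2 = 0 -> s = t by move=> /eqP; rewrite sqrf_eq0 subr_eq0 => /eqP.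
  have h1 := sqr_ge0 (tu y0 - 1 * tu p); have h2 := sqr_ge0 (tv y0 - 1 * tv p).
  apply: col_ext => [||i]; last by rewrite y0i mul1r.
  - by rewrite -[RHS]mul1r; apply: z0; lra.
  - by rewrite -[RHS]mul1r; apply: z0; lra.
rewrite -y0p; apply: (cvgr_to_le (cvg_bil (cvg_cst N) hy0)).
by apply: filterE => k; have [] := hy k.
Qed.

(** By compactness: products tending to 0 would produce a limit pair that contradicts
    [bidual_strict]. *)
Lemma bidual_uniform (B : R) : exists2 c : R, 0 < c &
  forall x p, Cc x -> qf x = -1 -> (forall j, `|x j 0| <= B) -> P p -> bil x p <= - c.
Proof.
apply/not_exists2P => h.
have /choice[xp hxp] : forall k : nat, exists xp : V * V, [/\ Cc xp.1, qf xp.1 = -1,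
    forall j, `|xp.1 j 0| <= B, P xp.2 & - k.+1%:R^-1 <= bil xp.1 xp.2].
  move=> k; have [|h'] := h k.+1%:R^-1; first by rewrite invr_gt0.
  move/existsNP: h' => [x /existsNP[p /not_implyP[Cx /not_implyP[qx /not_implyP[Bx /not_implyP[Pp /negP]]]]]].
  by rewrite -ltNge => /ltW ?; exists (x, p).
have [U [UU sU]] := nat_ultra.
have [p Pp hp] : exists2 p, P p & (fun k => (xp k).2) @ U --> p.
  by apply: (sphere_limit lP) => k; have [] := hxp k.
have [x hx] : exists x, (fun k => (xp k).1) @ U --> x.
  by apply: ultra_bounded_col => j; exists B; apply: filterE => k; have [] := hxp k.
have Cx : Cc x by apply: (dual_cone_lim hx) => k; have [] := hxp k.
have qx : qf x = -1.
  apply/eqP; rewrite eq_le; apply/andP; split;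
    [apply: (cvgr_to_le (cvg_bil hx hx))|apply: (cvgr_to_ge (cvg_bil hx hx))];
    by apply: filterE => k; have [_ qk _ _ _] := hxp k; rewrite -/(qf _) qk.
have hh : (fun k => k.+1%:R^-1 : R) @ U --> (0 : R) by apply: ultra_cvg_near => //; exact: cvg_harmonic.
have hb : (fun k => bil (xp k).1 (xp k).2 + k.+1%:R^-1) @ U --> bil x p + 0.
  by apply: cvgD => //; exact: cvg_bil.
have : 0 <= bil x p + 0.
  by apply: (cvgr_to_ge hb); apply: filterE => k; have [_ _ _ _ hk] := hxp k; rewrite -lerBlDr sub0r.
by have := bidual_strict lP Cx qx Pp; lra.
Qed.

Hypothesis interior : exists z, forall v, Cs v -> v != 0 -> bil v z < 0.

(** A vector orthogonal to [S] belongs to the dual cone together with its opposite, by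
    [dual_of_surface], which the interior point forbids. Compactness of the unit sphere then gives a
    finite list of points, and once more the constant. *)
Lemma surface_span : exists ks : seq V, (forall k, k \in ks -> S k) /\
  exists C, forall x j, `|x j 0| <= C * \sum_(k <- ks) `|bil x k|.
Proof.
have unit_limit I (U : set_system I) (X : I -> V) : UltraFilter U -> (forall i, `|X i| = 1) ->
    exists2 x : V, x != 0 & X @ U --> x.
  move=> UU X1; have [x hx] : exists x, X @ U --> x.
    by apply: ultra_bounded_col => j; exists 1; apply: filterE => k; rewrite -(X1 k); exact: col_norm_ge.
  exists x => //; apply/eqP => x0.
  have hn : (fun k => `|X k|) @ U --> (0 : R) by rewrite -(@normr0 R V) -x0; exact: cvg_norm.
  have n1 : \forall k \near U, (`|X k| : R) < 1 by exact: (cvgr_lt (0 : R) hn).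
  by have [k] := filter_ex n1; rewrite X1 ltxx.
have normalize x : x != 0 -> `|(`|x|^-1 *: x)| = 1.
  by move=> x0; rewrite normrZ normfV normr_id mulVf// normr_eq0.
have [ks Sks hks] : exists2 ks : seq V, (forall k, k \in ks -> S k) &
    forall x, (forall k, k \in ks -> bil x k = 0) -> x = 0.
  apply/not_exists2P => h.
  have /choice[X hX] : forall ks : seq V, exists x, `|x| = 1 /\
      ((forall k, k \in ks -> S k) -> forall k, k \in ks -> bil x k = 0).
    move=> ks; have [Sks|nS] := pselect (forall k, k \in ks -> S k).
      have [//|h'] := h ks; move/existsNP: h' => [x /not_implyP[hx /eqP x0]].
      exists (`|x|^-1 *: x); split; first exact: normalize.
      by move=> _ k kk; rewrite bilZl hx// mulr0.
    exists (`|const_mx 1 : V|^-1 *: const_mx 1); split=> //; apply: normalize.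
    by apply/eqP => /matrixP/(_ (lshift n 0) 0); rewrite !mxE => /eqP; rewrite oner_eq0.
  pose lists : set_system (seq V) := filter_from (fun F : seq V => forall k, k \in F -> S k)
    (fun F : seq V => [set G : seq V | (forall k, k \in G -> S k) /\ {subset F <= G}]).
  have plists : ProperFilter lists.
    apply: filter_from_proper; last by move=> F fF; exists F; split.
    apply: filter_from_filter; first by exists [::].
    move=> F G fF fG; exists (F ++ G); first by move=> N; rewrite mem_cat => /orP[/fF|/fG].
    by move=> H [fH s]; split; split=> // N NF; apply: s; rewrite mem_cat NF ?orbT.
  have [U [UU sU]] := ultraFilterLemma plists.
  have [x x0 hx] := unit_limit _ U X UU (fun ks => (hX ks).1).
  have xS k : S k -> bil x k = 0.
    move=> Sk; have : \forall ks \near U, bil (X ks) k = 0.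
      apply: sU; exists [:: k] => [k'|ks [Sks sub]]; first by rewrite inE => /eqP->.
      by have [_ /(_ Sks)] := hX ks; apply; apply: sub; rewrite mem_head.
    have hb : (fun ks => bil (X ks) k) @ U --> bil x k by apply: cvg_bil => //; exact: cvg_cst.
    move=> hU.
    by apply/eqP; rewrite eq_le; apply/andP; split;
      [apply: (cvgr_to_le hb)|apply: (cvgr_to_ge hb)]; apply: filterS hU => ks ->.
  have [z hz] := interior.
  have C1 : Cs x by apply: dual_of_surface => k /xS->.
  have C2 : Cs (- x) by apply: dual_of_surface => k /xS h'; rewrite bilNl h' oppr0.
  have := hz _ C1 x0; have := hz _ C2; rewrite oppr_eq0 bilNl => /(_ x0); lra.
exists ks; split=> //; apply: contrapT => /forallNP h.
have /choice[X hX] : forall m : nat, exists x, `|x| = 1 /\ \sum_(k <- ks) `|bil x k| <= m.+1%:R^-1.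
  move=> m; move/existsNP: (h m.+1%:R) => [x /existsNP[j /negP]]; rewrite -ltNge => hx.
  have x0 : x != 0.
    apply/eqP => x0; move: hx; rewrite x0 mxE normr0 big1 ?mulr0 ?ltxx// => k _.
    by rewrite bil0l normr0.
  have xn : 0 < `|x| by rewrite normr_gt0.
  exists (`|x|^-1 *: x); split; first exact: normalize.
  rewrite (eq_bigr (fun k => `|x|^-1 * `|bil x k|)); last first.
    by move=> k _; rewrite bilZl normrM normfV normr_id.
  rewrite -mulr_sumr mulrC ler_pdivrMr// ler_pdivlMl ?ltr0n//.
  by apply: ltW; apply: lt_le_trans hx _; exact: col_norm_ge.
have [U [UU sU]] := nat_ultra.
have [x x0 hx] := unit_limit _ U X UU (fun m => (hX m).1).
move/eqP: x0; apply; apply: hks => k kks.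
have hb : (fun m => `|bil (X m) k|) @ U --> `|bil x k|.
  by apply: cvg_norm; apply: cvg_bil => //; exact: cvg_cst.
have hh : (fun m => m.+1%:R^-1 : R) @ U --> (0 : R) by apply: ultra_cvg_near => //; exact: cvg_harmonic.
have : 0 <= 0 - `|bil x k|.
  apply: (cvgr_to_ge (cvgB hh hb)); apply: filterE => m; rewrite subr_ge0.
  apply: le_trans (hX m).2; rewrite (big_rem k)//= lerDl; exact: sumr_ge0.
by rewrite sub0r oppr_ge0 normr_le0 => /eqP.
Qed.

Lemma hull_boundary_convex : convex_surface e S.
Proof.
split=> //.
- by move=> x [].
- by move=> x y [q1 C1 _] [q2 C2 _]; exact: (bidual_lt0 lP).
- move=> x [qx Cx [v [hv xv ov]]].
  have v0 : v != 0 by apply/eqP => v0; move: ov; rewrite v0 /om /tu /tv !mxE; lra.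
  have qv := normal_timelike lP Cx qx hv v0 xv.
  have r0 : 0 < Num.sqrt (- qf v) by rewrite sqrtr_gt0 oppr_gt0.
  exists ((Num.sqrt (- qf v))^-1 *: v); split.
  - rewrite /qf bilZl bilZr -/(qf v) mulrA -expr2 exprVn sqr_sqrtr ?oppr_ge0 ?ltW//.
    by rewrite invrN mulNr mulVf// lt_eqF.
  - by rewrite bilZl bilC xv mulr0.
  - by rewrite omZr mulr_gt0 ?invr_gt0.
  - by move=> y [_ Cy _]; rewrite bilZl mulr_ge0_le0 ?invr_ge0 ?(ltW r0)// bilC; exact: Cy.
(* [z] is compared with the point of [S] on its own circle: [(1 + sp z z) * cos t - sp z z >= 1]
   forces [cos t = 1]. *)
- move=> z qz hz; have [t St] := circle_boundary lP e2 qz.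
  have := hz _ St; rewrite bilC bil_rot_self opprD opprK AdS_norm// => h.
  have c1 : cos t = 1 by have := cos_le1 t; have := sp_ge0 z; nra.
  have s1 : sin t = 0 by have := cos2Dsin2 t; rewrite c1 => hh; apply/eqP; rewrite -sqrf_eq0; apply/eqP; lra.
  suff <- : rot t z = z by [].
  by apply: col_ext => [||i]; rewrite ?rotE ?rot_space// c1 s1; ring.
- exact: surface_span.
(* By [dual_vertex] a normal is [r *: p + M] with [M] bounded; orthogonality to [x] and
   [bil x p <= - c] bound [r]. *)
- move=> B; have [c c0 hc] := bidual_uniform B.
  exists (2 * `|B| / c * 2 + 1) => x N [qx Cx _] [qN Nx _ Nle] hx j.
  have CN := dual_of_surface Nle.
  have [p [r [Pp r0 hr]]] := ls_surj lP N.
  have [_ _ hM] := dual_vertex lP Pp r0 hr CN; rewrite qN opprK in hM.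
  have [M ME] : exists M, M = N - r *: p by exists (N - r *: p).
  have uM : tu M = tu N - r * tu p by rewrite ME /tu !mxE.
  have vM : tv M = tv N - r * tv p by rewrite ME /tv !mxE.
  have hMi i : M (rshift 2 i) 0 = 0 * M (rshift 2 i) 0 by rewrite mul0r ME !mxE hr subrr.
  have sM w : sp M w = 0 by rewrite (sp_scale _ hMi) mul0r.
  have Mj i : `|M i 0| <= 1 by apply: coord_le_sum => //; rewrite sM uM vM addr0 expr1n.
  have NE : N = r *: p + M by rewrite ME addrC subrK.
  have pc := hc x p Cx qx hx Pp.
  have B0 : 0 <= `|B| by [].
  have xB i : `|x i 0| <= `|B| by apply: le_trans (hx i) (ler_norm B).
  have Mx : `|bil M x| <= 2 * `|B|.
    rewrite bil_coord sM addr0 normrN; apply: (le_trans (ler_normD _ _)).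
    rewrite !normrM (_ : 2 * `|B| = 1 * `|B| + 1 * `|B|); last by ring.
    by apply: lerD; apply: ler_pM => //; [exact: Mj|exact: xB|exact: Mj|exact: xB].
  have rb : r <= 2 * `|B| / c.
    rewrite ler_pdivlMr//; move: Nx; rewrite NE bilDl bilZl (bilC p) => Nx.
    by have := ler_norm (bil M x); nra.
  rewrite NE mxE; apply: (le_trans (ler_normD _ _)); apply: lerD; last exact: Mj.
  rewrite mxE normrM (ger0_norm r0); apply: ler_pM => //; exact: (sphere_coord lP).
Qed.

End BoundarySurface.

(** * Separation by dual vectors *)

Section Separation.
Context {R : realType} {n : nat}.
Local Notation V := 'cV[R]_(2 + n).
Implicit Types (x y z a b p N M v w g f : V) (s t r l C : R) (L : seq V).

Lemma small_perturbation (L : seq V) (A B : V -> R) : (forall f, f \in L -> A f < 0) ->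
  exists2 d : R, 0 < d & forall f, f \in L -> A f + d * B f < 0.
Proof.
elim: L => [_|g L ih h]; first by exists 1.
have [d d0 hd] := ih (fun f hf => h f (mem_behead (hf : f \in behead (g :: L)))).
have Ag : A g < 0 by apply: h; rewrite mem_head.
have b0 : 0 < 2 * (`|B g| + 1) by have := normr_ge0 (B g); lra.
have c0 : 0 < - A g / (2 * (`|B g| + 1)) by rewrite divr_gt0// oppr_gt0.
exists (Num.min d (- A g / (2 * (`|B g| + 1)))); first by rewrite lt_min d0.
move=> f; rewrite inE => /orP[/eqP->|fL].
  set m := Num.min _ _; have m0 : 0 < m by rewrite lt_min d0.
  have : m * (2 * (`|B g| + 1)) <= - A g by rewrite -ler_pdivlMr// ge_min lexx orbT.
  by have := ler_norm (B g); nra.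
have := hd f fL; have Af : A f < 0 by apply: h; rewrite inE fL orbT.
set m := Num.min _ _; have m0 : 0 < m by rewrite lt_min d0.
have md : m <= d by rewrite ge_min lexx.
by have [Bf|Bf] := ltP (B f) 0; nra.
Qed.

(** Gordan's alternative, by induction. If [v], negative on [L], is nonnegative on [g], each [f] is
    replaced by the combination [f' f] of [f] and [g] orthogonal to [v]; a functional [u] for these
    is corrected by a multiple of [v], with a small margin [d]. *)
Lemma gordan (K : set V) L : (forall x y, K x -> K y -> K (x + y)) ->
  (forall t x, 0 < t -> K x -> K (t *: x)) -> ~ K 0 -> (forall f, f \in L -> K f) ->
  exists v, forall f, f \in L -> bil v f < 0.
Proof.
move=> KD KZ K0; move: {2}(size L) (erefl (size L)) => m; elim: m L => [|m ih] L.
  by move=> /size0nil -> _; exists 0.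
case: L => // g L [sL] KL; have Kg : K g by apply: KL; rewrite mem_head.
have KL' f : f \in L -> K f by move=> fL; apply: KL; rewrite inE fL orbT.
have [v hv] := ih L sL KL'.
have cons w : bil w g < 0 -> (forall f, f \in L -> bil w f < 0) ->
    exists v, forall f, f \in g :: L -> bil v f < 0.
  by move=> h1 h2; exists w => f; rewrite inE => /orP[/eqP->|/h2].
have [vg|vg] := ltP (bil v g) 0; first exact: (cons v).
pose f' f := bil v g *: f + (- bil v f) *: g.
have Kf' f : f \in L -> K (f' f).
  move=> fL; have h1 : K ((- bil v f) *: g) by apply: KZ; rewrite ?oppr_gt0//; exact: hv.
  rewrite /f'; move: vg; rewrite le_eqVlt => /orP[/eqP<-|vg]; first by rewrite scale0r add0r.
  by apply: KD => //; apply: KZ => //; exact: KL'.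
have [|_ /mapP[f fL ->]|u hu] := ih [seq f' f | f <- L]; first by rewrite size_map.
  exact: Kf'.
have {}hu f : f \in L -> bil v g * bil u f - bil v f * bil u g < 0.
  by move=> fL; have := hu _ (map_f f' fL); rewrite /f' bilDr !bilZr mulNr.
move: vg; rewrite le_eqVlt => /orP[/eqP vg|vg].
  case: L sL KL KL' hv cons Kf' hu => [|f0 L] sL KL KL' hv cons Kf' hu.
    apply: (cons (- refl g)) => //; rewrite bilNl bilC oppr_lt0 bil_refl_gt0//.
    by apply/eqP => g0; apply: K0; rewrite -g0.
  have ug : bil u g < 0.
    by have := hu f0 (mem_head _ _); have := hv f0 (mem_head _ _); rewrite -vg mul0r; nra.
  have [d d0 hd] := small_perturbation (fun f => bil u f) hv.
  apply: (cons (v + d *: u)) => [|f fL]; rewrite bilDl bilZl; last exact: hd.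
  by rewrite -vg; nra.
have [d d0 hd] := small_perturbation (fun f => - bil v f) hu.
apply: (cons (u - ((bil u g + d) / bil v g) *: v)) => [|f fL]; rewrite bilDl bilNl bilZl.
  by rewrite divfK ?gt_eqF//; lra.
rewrite -(pmulr_rlt0 _ vg) [X in X < 0](_ : _ = bil v g * bil u f - bil v f * bil u g + d * - bil v f); first exact: (hd _ fL).
by field; rewrite gt_eqF.
Qed.

(** A unit vector is chosen for each finite list, and the closed conditions pass to its limit along
    an ultrafilter on the lists. *)
Lemma dual_cone_finite (A : set V) :
  (forall L, (forall g, g \in L -> A g) -> exists2 v, v != 0 & forall g, g \in L -> bil v g <= 0) ->
  exists2 v, v != 0 & dual_cone A v.
Proof.
move=> h; pose lists : set_system (seq V) := filter_from (fun F : seq V => forall k, k \in F -> A k)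
  (fun F : seq V => [set G : seq V | (forall k, k \in G -> A k) /\ {subset F <= G}]).
have plists : ProperFilter lists.
  apply: filter_from_proper; last by move=> F fF; exists F; split.
  apply: filter_from_filter; first by exists [::].
  move=> F G fF fG; exists (F ++ G); first by move=> N; rewrite mem_cat => /orP[/fF|/fG].
  by move=> H [fH s]; split; split=> // N NF; apply: s; rewrite mem_cat NF ?orbT.
have /choice[X hX] : forall L : seq V, exists v, (forall g, g \in L -> A g) ->
    `|v| = 1 /\ forall g, g \in L -> bil v g <= 0.
  move=> L; have [LA|nL] := pselect (forall g, g \in L -> A g); last by exists 0 => /nL.
  have [v v0 hv] := h L LA; exists (`|v|^-1 *: v) => _; split.
    by rewrite normrZ normfV normr_id mulVf// normr_eq0.
  by move=> g /hv hg; rewrite bilZl mulr_ge0_le0// invr_ge0.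
have [U [UU sU]] := ultraFilterLemma plists.
have hU : \forall L \near U, forall g, g \in L -> A g.
  by apply: sU; exists [::] => // L [].
have [v hv] : exists v, X @ U --> v.
  apply: ultra_bounded_col => j; exists 1; apply: filterS hU => L hL.
  by have [<- _] := hX L hL; exact: col_norm_ge.
exists v => [|g Ag].
  apply/eqP => v0; have hn : (fun L => `|X L|) @ U --> (0 : R).
    by rewrite -(@normr0 R V) -v0; exact: cvg_norm.
  have n1 : \forall L \near U, (`|X L| : R) < 1 by exact: (cvgr_lt (0 : R) hn).
  by have [L [l1 hL]] := filter_ex (filterI n1 hU); move: l1; have [-> _] := hX L hL; rewrite ltxx.
have : \forall L \near U, (forall g, g \in L -> A g) /\ g \in L.
  apply: sU; exists [:: g] => [k|L [LA sub]]; first by rewrite inE => /eqP->.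
  by split=> //; apply: sub; rewrite mem_head.
move=> gU; have hb : (fun L => bil (X L) g) @ U --> bil v g by apply: cvg_bil => //; exact: cvg_cst.
apply: (cvgr_to_le hb); apply: filterS gU => L [LA gL].
by have [_] := hX L LA; apply.
Qed.

Lemma open_by_sequences (A : set V) :
  (forall (U : set_system nat) (X : nat -> V) w, UltraFilter U -> \oo `<=` U -> A w ->
    X @ U --> w -> exists k, A (X k)) -> open A.
Proof.
move=> h; rewrite openE => w Aw; apply: contrapT => nA.
have /choice[X hX] : forall k : nat, exists x : V, `|x| <= k.+1%:R^-1 /\ ~ A (w + x).
  move=> k; apply: contrapT => /forallNP hk; apply: nA.
  apply/nbhs_ballP; exists k.+1%:R^-1; first by rewrite /= invr_gt0.
  move=> y; rewrite /= => yk; apply: contrapT => nAy; apply: (hk (y - w)).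
  rewrite (addrC w) subrK; split=> //; move: yk; rewrite -ball_normE /= distrC; exact: ltW.
have [U [UU sU]] := nat_ultra.
have cX : (fun k => w + X k) @ U --> w by apply: cvg_shift_cst => // k; have [] := hX k.
by have [k] := h U _ w UU sU Aw cX; have [_] := hX k.
Qed.

Definition pos_hull (A : set V) : set V := [set x | exists L, [/\ L != [::],
  forall g, g \in L -> exists2 t, 0 < t & A (t *: g) & x = \sum_(g <- L) g]].

Lemma pos_hullD A x y : pos_hull A x -> pos_hull A y -> pos_hull A (x + y).
Proof.
move=> [L [L0 LA ->]] [M [M0 MA ->]]; exists (L ++ M); rewrite big_cat; split=> //.
  by case: L L0 LA.
by move=> g; rewrite mem_cat => /orP[/LA|/MA].
Qed.

Lemma pos_hullZ A s x : 0 < s -> pos_hull A x -> pos_hull A (s *: x).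
Proof.
move=> s0 [L [L0 LA ->]]; exists [seq s *: g | g <- L]; split.
- by case: L L0 LA.
- move=> _ /mapP[g /LA[t t0 Ag] ->]; exists (t / s); first exact: divr_gt0.
  by rewrite scalerA divfK// gt_eqF.
- by rewrite big_map scaler_sumr.
Qed.

Lemma pos_hull1 A x : A x -> pos_hull A x.
Proof.
move=> Ax; exists [:: x]; rewrite big_seq1; split=> // g; rewrite inE => /eqP->.
by exists 1; rewrite ?scale1r.
Qed.

Lemma pos_hull_bil A v x : (forall p, A p -> bil v p < 0) -> pos_hull A x -> bil v x < 0.
Proof.
move=> hv [L [L0 LA ->]]; elim: L L0 LA => // g L ih _ LA.
have [t t0 Ag] := LA g (mem_head _ _).
have vg : bil v g < 0 by have := hv _ Ag; rewrite bilZr pmulr_rlt0.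
rewrite big_cons bilDr; have [->|L0] := eqVneq L [::]; first by rewrite big_nil bil0r addr0.
have := ih L0 (fun f fL => LA f (mem_behead (fL : f \in behead (g :: L)))); lra.
Qed.

Variable P : set V.
Hypothesis lP : lightlike_sphere P.
Local Notation Cs := (dual_cone P).
Local Notation Cc := (bidual_cone P).

Definition bidual_interior : set V := [set w | w != 0 /\ forall v, Cs v -> v != 0 -> bil v w < 0].

Hypothesis interior : bidual_interior !=set0.

Lemma pos_hull_separation x : x != 0 -> ~ pos_hull P x -> exists v, [/\ Cs v, v != 0 & 0 <= bil v x].
Proof.
move=> x0 nx; have [zeta [z0 hz]] := interior.
have h0 y : pos_hull P y -> y != 0.
  move=> hy; apply/eqP => y0; suff : bil zeta y < 0 by rewrite y0 bil0r ltxx.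
  by apply: pos_hull_bil hy => p Pp; rewrite bilC; apply: hz; [exact: sphere_dual|exact: (sphere_neq0 lP)].
pose K z := exists y s, [/\ 0 <= s, z = y - s *: x & pos_hull P y \/ y = 0 /\ 0 < s].
have K0 : ~ K 0.
  move=> [y [s [s0 E hy]]]; have {E}E : y = s *: x by apply/eqP; rewrite -subr_eq0 -E.
  case: hy => [hy|[y0 s0']].
    move: s0; rewrite le_eqVlt => /orP[/eqP s00|s0].
      by have := h0 _ hy; rewrite E -s00 scale0r eqxx.
    apply: nx; rewrite -[x]scale1r -(mulVf (lt0r_neq0 s0)) -scalerA -E.
    by apply: pos_hullZ => //; rewrite invr_gt0.
  by move/eqP: E; rewrite y0 eq_sym scaler_eq0 (negbTE x0) orbF gt_eqF.
have KD y z : K y -> K z -> K (y + z).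
  move=> [a [s [s0 -> ha]]] [b [t [t0 -> hb]]]; exists (a + b), (s + t); split.
  - exact: addr_ge0.
  - by rewrite scalerDl opprD addrACA.
  - case: ha => [ha|[-> s1]]; case: hb => [hb|[-> t1]]; rewrite ?addr0 ?add0r.
    + by left; exact: pos_hullD.
    + by left.
    + by left.
    + by right; split=> //; exact: addr_gt0.
have KZ t y : 0 < t -> K y -> K (t *: y).
  move=> t0 [a [s [s0 -> ha]]]; exists (t *: a), (t * s); split.
  - by rewrite mulr_ge0// ltW.
  - by rewrite scalerBr scalerA.
  - case: ha => [ha|[-> s1]]; first by left; exact: pos_hullZ.
    by right; rewrite scaler0; split=> //; exact: mulr_gt0.
have [|v v0 hv] := @dual_cone_finite (P `|` [set - x]).
  move=> L LA; have KL g : g \in - x :: L -> K g.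
    have Kx : K (- x) by exists 0, 1; rewrite scale1r sub0r; split=> //; right; split=> //.
    rewrite inE => /orP[/eqP->//|/LA[Pg|->//]].
    by exists g, 0; rewrite scale0r subr0; split=> //; left; exact: pos_hull1.
  have [v hv] := gordan KD KZ K0 KL.
  exists v => [|g gL]; last by apply/ltW/hv; rewrite inE gL orbT.
  by apply/eqP => v0; have := hv _ (mem_head _ _); rewrite v0 bil0l ltxx.
exists v; split=> // [p Pp|]; first by apply: hv; left.
by have := hv (- x) (or_intror erefl); rewrite bilNr oppr_le0.
Qed.

Lemma bidual_interior_pos_hull w : bidual_interior w -> pos_hull P w.
Proof.
move=> [w0 hw]; apply: contrapT => /(pos_hull_separation w0)[v [Cv v0]].
by rewrite leNgt hw.
Qed.

Lemma bidual_interior_open : open bidual_interior.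
Proof.
apply: open_by_sequences => U X w UU sU [w0 hw] Xw; apply: contrapT => /forallNP h.
have [v v0 Cv] : exists2 v, v != 0 & Cs v.
  have [z _] := interior; have [p [r [Pp _ _]]] := ls_surj lP z.
  by exists p; [exact: (sphere_neq0 lP)|exact: sphere_dual].
have /choice[v' hv'] : forall k, exists v : V, [/\ Cs v, `|v| = 1 & 0 <= bil v (X k)].
  move=> k; have [u [Cu u0 hu]] : exists u, [/\ Cs u, u != 0 & 0 <= bil u (X k)].
    have [X0|X0] := eqVneq (X k) 0; first by exists v; rewrite X0 bil0r.
    apply: contrapT => /forallNP h'; apply: (h k); split=> // u Cu u0.
    by rewrite ltNge; apply/negP => hu; apply: (h' u).
  exists (`|u|^-1 *: u); split.
  - by apply: dual_coneZ => //; rewrite invr_ge0.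
  - by rewrite normrZ normfV normr_id mulVf// normr_eq0.
  - by rewrite bilZl mulr_ge0// invr_ge0.
have [u hu] : exists u : V, v' @ U --> u.
  by apply: ultra_bounded_col => j; exists 1; apply: filterE => k; have [_ <- _] := hv' k; exact: col_norm_ge.
have u0 : u != 0.
  apply/eqP => u0; have hn : (fun k => `|v' k|) @ U --> (0 : R).
    by rewrite -(@normr0 R V) -u0; exact: cvg_norm.
  have n1 : \forall k \near U, (`|v' k| : R) < 1 by exact: (cvgr_lt (0 : R) hn).
  by have [k] := filter_ex n1; have [_ -> _] := hv' k; rewrite ltxx.
have Cu : Cs u by apply: (dual_cone_lim hu) => k; have [] := hv' k.
have : 0 <= bil u w by apply: (cvgr_to_ge (cvg_bil hu Xw)); apply: filterE => k; have [] := hv' k.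
by rewrite leNgt hw.
Qed.

(** The dual vectors at a common point would have opposite time orientations. Their positive
    combination [u] with [om 1 x u = 0] must vanish, although it is strictly negative on an interior
    vector. *)
Lemma hull_boundary_disjoint x : hull_boundary P 1 x -> hull_boundary P (-1) x -> False.
Proof.
move=> [qx Cx [v [Cv xv ov]]] [_ _ [w [Cw xw ow]]]; have [z [z0 hz]] := interior.
have neq0 e u : 0 < om e x u -> u != 0.
  by move=> h; apply/eqP => u0; move: h; rewrite u0 /om /tu /tv !mxE; lra.
have ow' : om 1 x w = - om (-1) x w by rewrite /om; ring.
pose u := om (-1) x w *: v + om 1 x v *: w.
have Cu : Cs u by apply: dual_coneD; apply: dual_coneZ => //; exact: ltW.
have u0 : u = 0.
  apply/eqP/negPn/negP => u0; have xu : bil x u = 0 by rewrite bilDr !bilZr xv xw; ring.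
  have := @om_neq0 _ _ 1 x u (oner_neq0 R) _ (dual_qf lP Cu) u0 xu.
  by rewrite qx oppr_lt0 ltr01 => /(_ isT)/eqP; apply; rewrite omDr !omZr ow'; ring.
have := hz _ Cv (neq0 _ _ ov); have := hz _ Cw (neq0 _ _ ow).
have : bil u z = 0 by rewrite u0 bil0l.
by rewrite bilDl !bilZl; nra.
Qed.

Lemma hull_boundary_closed e (U : set_system nat) (X : nat -> V) x : e ^+ 2 = 1 -> UltraFilter U ->
  X @ U --> x -> (forall k, hull_boundary P e (X k)) -> hull_boundary P e x.
Proof.
move=> e2 UU Xx hX.
have e0 : e != 0 by apply: contra_eq_neq e2 => ->; rewrite expr0n /= eq_sym oner_eq0.
have qx : qf x = -1.
  apply/eqP; rewrite eq_le; apply/andP; split;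
    [apply: (cvgr_to_le (cvg_bil Xx Xx))|apply: (cvgr_to_ge (cvg_bil Xx Xx))];
    by apply: filterE => k; have [qk _ _] := hX k; rewrite -/(qf _) qk.
have Cx : Cc x by apply: (dual_cone_lim Xx) => k; have [] := hX k.
have /choice[v hv] : forall k, exists v : V, [/\ Cs v, `|v| = 1, bil (X k) v = 0 & 0 <= om e (X k) v].
  move=> k; have [_ _ [u [Cu xu ou]]] := hX k.
  have u0 : u != 0 by apply/eqP => u0; move: ou; rewrite u0 /om /tu /tv !mxE; lra.
  exists (`|u|^-1 *: u); split.
  - by apply: dual_coneZ => //; rewrite invr_ge0.
  - by rewrite normrZ normfV normr_id mulVf// normr_eq0.
  - by rewrite bilZr xu mulr0.
  - by rewrite omZr mulr_ge0 ?invr_ge0// ltW.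
have [u hu] : exists u : V, v @ U --> u.
  by apply: ultra_bounded_col => j; exists 1; apply: filterE => k; have [_ <- _ _] := hv k; exact: col_norm_ge.
have u0 : u != 0.
  apply/eqP => u0; have hn : (fun k => `|v k|) @ U --> (0 : R).
    by rewrite -(@normr0 R V) -u0; exact: cvg_norm.
  have n1 : \forall k \near U, (`|v k| : R) < 1 by exact: (cvgr_lt (0 : R) hn).
  by have [k] := filter_ex n1; have [_ -> _ _] := hv k; rewrite ltxx.
have Cu : Cs u by apply: (dual_cone_lim hu) => k; have [] := hv k.
have xu : bil x u = 0.
  apply/eqP; rewrite eq_le; apply/andP; split;
    [apply: (cvgr_to_le (cvg_bil Xx hu))|apply: (cvgr_to_ge (cvg_bil Xx hu))];
    by apply: filterE => k; have [_ _ -> _] := hv k.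
have ou : 0 <= om e x u.
  have ho : (fun k => om e (X k) (v k)) @ U --> om e x u by exact: cvg_om.
  by apply: (cvgr_to_ge ho); apply: filterE => k; have [] := hv k.
split=> //; exists u; split=> //; rewrite lt_neqAle ou andbT eq_sym.
apply: om_neq0 => //; [by rewrite qx; lra|exact: (dual_qf lP)].
Qed.

Definition off_boundary e : set V := [set w | qf w < 0 /\ forall t, 0 < t -> ~ hull_boundary P e (t *: w)].

Lemma off_boundary_open e : e ^+ 2 = 1 -> open (off_boundary e).
Proof.
move=> e2; apply: open_by_sequences => U X w UU sU [qw hw] Xw; apply: contrapT => /forallNP h.
have qX : (fun k => qf (X k)) @ U --> qf w by exact: cvg_bil.
pose c k := (Num.sqrt (- qf (X k)))^-1.
have cc : c @ U --> (Num.sqrt (- qf w))^-1.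
  apply: cvgV; first by rewrite gt_eqF// sqrtr_gt0 oppr_gt0.
  apply: (@cvg_comp _ _ _ (fun k => - qf (X k)) (@Num.sqrt R) U (nbhs (- qf w))); first exact: cvgN.
  exact: sqrt_continuous.
have n1 : \forall k \near U, qf (X k) < 0 by exact: (cvgr_lt _ qX).
have n2 k : qf (X k) < 0 -> hull_boundary P e (c k *: X k).
  move=> qk; have [t t0 St] : exists2 t, 0 < t & hull_boundary P e (t *: X k).
    apply/not_exists2P => h'; apply: (h k); split=> // t t0 St; by case: (h' t).
  suff <- : t = c k by [].
  have [q1 _ _] := St; move: q1; rewrite /qf bilZl bilZr -/(qf (X k)) => q1.
  have tq : (t^-1) ^+ 2 = - qf (X k).
    by rewrite exprVn; apply: (mulfI (x := t ^+ 2)); [rewrite expf_neq0// gt_eqF|rewrite mulfV ?expf_neq0 ?gt_eqF//; lra].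
  by rewrite /c -tq sqrtr_sqr ger0_norm ?invrK// invr_ge0 ltW.
have [k0 hk0] := filter_ex n1.
pose Y k := if qf (X k) < 0 then c k *: X k else c k0 *: X k0.
have YU : Y @ U --> (Num.sqrt (- qf w))^-1 *: w.
  have h1 : (fun k => c k *: X k) @ U --> (Num.sqrt (- qf w))^-1 *: w by exact: cvgZ.
  by apply: cvg_trans h1; apply: near_eq_cvg; apply: filterS n1 => k; rewrite /Y => ->.
apply: (hw (Num.sqrt (- qf w))^-1); first by rewrite invr_gt0 sqrtr_gt0 oppr_gt0.
apply: (hull_boundary_closed e2 UU YU) => k; rewrite /Y; case: ifPn => [|_]; exact: n2.
Qed.

End Separation.

(** * The graph in the Einstein universe *)

Section EinSphere.
Context {R : realType} {n : nat}.
Local Notation V := 'cV[R]_(2 + n).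
Variable f : 'cV[R]_n -> R.
Hypothesis n0 : (0 < n)%N.
Hypothesis lf : forall y z : 'cV[R]_n, unit_sphere y -> unit_sphere z -> y <> z ->
  `|f y - f z| < dround y z.

Let ein_space t (y : 'cV[R]_n) i : ein_point t y (rshift 2 i) 0 = y i 0.
Proof. by rewrite /ein_point col_mxEd. Qed.

Let sp_ein s t (y z : 'cV[R]_n) : sp (ein_point s y) (ein_point t z) = dotR y z.
Proof. by apply: eq_bigr => i _; rewrite !ein_space. Qed.

Let tu_ein t (y : 'cV[R]_n) : tu (ein_point t y) = cos t.
Proof. by rewrite /tu /ein_point col_mxEu mxE eqxx. Qed.

Let tv_ein t (y : 'cV[R]_n) : tv (ein_point t y) = sin t.
Proof. by rewrite /tv /ein_point col_mxEu mxE. Qed.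

(** The product of two points is [dotR y z - cos (f y - f z)]. Its sign follows from
    [|f y - f z| < acos (dotR y z) <= pi], as [cos] decreases on this range. *)
Lemma ein_lightlike : lightlike_sphere [set ein_point (f y) y | y in unit_sphere].
Proof.
split.
- move=> _ [y uy <-]; rewrite tu_ein tv_ein sp_ein; split; [exact: cos2Dsin2|exact: uy].
- move=> x; pose y : 'cV[R]_n := dsubmx x.
  have yi i : y i 0 = x (rshift 2 i) 0 by rewrite mxE.
  have yy : dotR y y = sp x x by apply: eq_bigr => i _; rewrite yi.
  have [s0|s0] := eqVneq (sp x x) 0.
    pose d : 'cV[R]_n := delta_mx (Ordinal n0) 0.
    have ud : unit_sphere d.
      rewrite /unit_sphere /= /dotR (bigD1 (Ordinal n0))//= big1 => [|i ni].
        by rewrite !mxE !eqxx mulr1 addr0.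
      by rewrite !mxE (negbTE ni) mul0r.
    exists (ein_point (f d) d), 0; split=> //; first by exists d.
    move=> i; rewrite mul0r; move/eqP: s0; rewrite /sp psumr_eq0 => [/allP/(_ i (mem_index_enum _))|j _].
      by rewrite mulf_eq0 orbb => /eqP.
    by rewrite -expr2 sqr_ge0.
  have r0 : 0 < Num.sqrt (sp x x) by rewrite sqrtr_gt0 lt_neqAle eq_sym s0 sp_ge0.
  set r := Num.sqrt _ in r0; pose z := r^-1 *: y.
  have uz : unit_sphere z.
    rewrite /unit_sphere /= /dotR (eq_bigr (fun i => r^-1 ^+ 2 * (y i 0 * y i 0))) => [|i _].
      by rewrite -mulr_sumr -/(dotR y y) yy exprVn sqr_sqrtr ?sp_ge0// mulVf.
    by rewrite !mxE; ring.
  exists (ein_point (f z) z), r; split; [by exists z|exact: ltW|].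
  by move=> i; rewrite ein_space mxE mulrA divff ?mul1r ?yi// gt_eqF.
- move=> _ _ [y uy <-] [z uz <-] yz; have {}yz : y <> z by move=> E; apply: yz; rewrite E.
  have := lf uy uz yz; rewrite bil_coord !tu_ein !tv_ein sp_ein -cosB.
  have hd : -1 <= dotR y z <= 1.
    have := sp_CS (ein_point 0 y) (ein_point 0 z); rewrite !sp_ein uy uz mulr1.
    by move=> h; apply/andP; split; nra.
  rewrite /dround => h; have [h1 h2] := andP hd.
  have a1 : acos (dotR y z) \in `[0, pi] by rewrite in_itv/= acos_ge0// acos_lepi.
  have a2 : `|f y - f z| \in `[0, pi] by rewrite in_itv/= normr_ge0 ltW// (lt_le_trans h)// acos_lepi.
  have : cos (acos (dotR y z)) < cos `|f y - f z| by rewrite ltr_cos.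
  rewrite acosK ?in_itv//; case: (ger0P (f y - f z)) => _; rewrite ?cosN; lra.
Qed.

End EinSphere.

(** * Topology of the sphere of rays *)

Section RayTopology.
Context {R : realType} {n : nat}.
Local Notation V := 'cV[R]_(2 + n).
Implicit Types (x y z p v w : V) (A O : set V) (u : nzvec (R := R) (n := n)) (t : R).

Lemma nzvec_ex v : v != 0 -> exists u, set_val u = v.
Proof. by move=> v0; exists (exist _ v (mem_set v0)). Qed.

Lemma nzvec_neq0 u : set_val u != 0.
Proof. by case: u => v hv; exact: (set_mem hv). Qed.

Lemma pi_rays_eq u u' : (\pi_(rays R n) u = \pi_(rays R n) u') <-> exists2 t, 0 < t & set_val u' = t *: set_val u.
Proof.
split=> [/eqmodP/asboolP//|h]; apply/eqmodP; exact/asboolP.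
Qed.

Lemma rays_surj (r : rays R n) : exists u, \pi_(rays R n) u = r.
Proof. by exists (repr r); rewrite reprK. Qed.

Lemma rays_throughP A u : rays_through A (\pi_(rays R n) u) <-> exists2 t, 0 < t & A (t *: set_val u).
Proof.
split=> [[w Aw /pi_rays_eq[t t0 E]]|[t t0 At]].
  by exists t^-1; rewrite ?invr_gt0// E scalerA mulVf ?gt_eqF// scale1r.
have [|w wE] := @nzvec_ex (t *: set_val u); first by rewrite scaler_eq0 negb_or gt_eqF// nzvec_neq0.
exists w; first by rewrite /= wE.
by apply/pi_rays_eq; exists t^-1; rewrite ?invr_gt0// wE scalerA mulVf ?gt_eqF// scale1r.
Qed.

Lemma coneP (X : set (rays R n)) u : cone X (set_val u) <-> X (\pi_(rays R n) u).
Proof.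
split=> [[w Xw E]|]; last by move=> h; exists u.
by rewrite (_ : u = w) //; apply: val_inj.
Qed.

Lemma pi_rays_continuous (B : set (rays R n)) u : nbhs (\pi_(rays R n) u) B ->
  \forall w \near (set_val u : V), forall u', set_val u' = w -> B (\pi_(rays R n) u').
Proof.
move=> hB; have : nbhs u ((\pi_(rays R n) : nzvec -> rays R n) @^-1` B).
  exact: (@pi_continuous _ {eq_quot ray_equiv} u).
move=> [W [[Q oQ QW] Wu] WB].
have : nbhs (set_val u : V) Q by apply: open_nbhs_nbhs; split=> //; move: Wu; rewrite -QW.
apply: filterS => w Ow u' uw; apply: WB; rewrite -QW /preimage/=.
by move: uw => ->.
Qed.

Lemma rays_through_open A : open A -> (forall t x, 0 < t -> A (t *: x) -> A x) ->
  open (rays_through A : set (rays R n)).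
Proof.
move=> oA hA.
have E : (\pi_(rays R n) : nzvec -> rays R n) @^-1` rays_through A = set_val @^-1` A.
  apply/seteqP; split=> u /=; first by move=> /rays_throughP[t t0]; exact: hA.
  by move=> Au; apply/rays_throughP; exists 1; rewrite ?scale1r.
have : open (set_val @^-1` A : set nzvec).
  by apply: open_comp => // u _; exact: (@initial_continuous _ _ (set_val : nzvec -> V)).
by rewrite -E.
Qed.

End RayTopology.

(** * The two components of the boundary *)

Section BoundaryComponents.
Context {R : realType} {n : nat}.
Local Notation V := 'cV[R]_(2 + n).
Implicit Types (x y z p v w g : V) (u : nzvec (R := R) (n := n)) (t r s : R).

Lemma surface_path e (S : set V) a b : convex_surface e S -> S a -> S b ->
  exists g : R -> V, [/\ continuous g, forall r, S (g r), g 0 = a & exists l, g l = b].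
Proof.
move=> cS Sa Sb; have [c gc] := idist_geodesic cS Sa Sb.
have [C C0 hC] := geodesic_lipschitz cS Sa Sb gc.
have [c0 c1 Sc _] := gc; have l0 := idist_ge0 cS Sa Sb; move: (idist e S a b) l0 hC c1 Sc {gc} => l l0 hC c1 Sc.
have ci r : 0 <= clamp l r <= l by exact: clamp_itv.
exists (fun r => c (clamp l r)); split.
- move=> t; apply/cvgrPdist_lt => eps eps0; apply/nbhs_ballP.
  exists (eps / C); first by rewrite /= divr_gt0.
  move=> t'; rewrite /ball/= ltr_pdivlMr// mulrC => h.
  apply: le_lt_trans h; apply: (le_trans (hC _ _ (ci _) (ci _))).
  by rewrite ler_wpM2l ?(ltW C0)//; exact: clamp_lip.
- by move=> r; exact: Sc.
- by rewrite clamp_id// lexx.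
- by exists l; rewrite clamp_id// l0 lexx.
Qed.

Variable P : set V.
Hypothesis lP : lightlike_sphere P.
Local Notation Cs := (dual_cone P).
Local Notation Cc := (bidual_cone P).
Let Lambda : set (rays R n) := rays_through P.
Local Notation piR := (\pi_(rays R n)).

Lemma cone_sphere u : cone Lambda (set_val u) <-> exists2 t, 0 < t & P (t *: set_val u).
Proof. by rewrite coneP; exact: rays_throughP. Qed.

Lemma Conv_bidual u : Conv Lambda (piR u) -> Cc (set_val u).
Proof.
move=> /rays_throughP[t t0 [k [c [p [c0 _ hp E]]]]] v Cv.
rewrite -(pmulr_rle0 _ t0) -bilZl E bil_suml; apply: sumr_le0 => i _.
apply: mulr_ge0_le0; first exact/ltW/c0.
have [_ [w Lw wE]] := hp i; have [s s0 Ps] := (cone_sphere w).1 (proj2 (coneP _ _) Lw).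
by rewrite -wE -(pmulr_rle0 _ s0) -bilZl bilC; exact: Cv.
Qed.

Lemma pos_hull_Conv u : pos_hull P (set_val u) -> Conv Lambda (piR u).
Proof.
move=> [L [L0 LP E]]; apply/rays_throughP; exists 1 => //; rewrite scale1r.
have k0 : (0 < size L)%N by case: L L0 {LP E}.
have kR : 0 < (size L)%:R :> R by rewrite ltr0n.
exists (size L), (fun _ => (size L)%:R^-1), (fun i => (size L)%:R *: nth 0 L i); split.
- by move=> i; rewrite invr_gt0.
- by rewrite sumr_const card_ord -[LHS]mulr_natr mulVf// gt_eqF.
- move=> i; have [t t0 Pt] := LP _ (mem_nth 0 (ltn_ord i)); set g := nth 0 L i in Pt *.
  have g0 : g != 0 by apply: contra_neq (sphere_neq0 lP Pt) => ->; rewrite scaler0.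
  split.
    have := sphere_qf lP Pt; rewrite /qf !bilZl !bilZr => /eqP.
    by rewrite !mulf_eq0 (gt_eqF t0)/= => /eqP->; rewrite !mulr0.
  have [|w wE] := @nzvec_ex _ _ ((size L)%:R *: g); first by rewrite scaler_eq0 negb_or gt_eqF.
  rewrite -wE; apply/cone_sphere; exists (t / (size L)%:R); first exact: divr_gt0.
  by rewrite wE scalerA divfK// gt_eqF.
- rewrite E (big_nth 0) big_mkord; apply: eq_bigr => i _.
  by rewrite scalerA mulVf ?scale1r// gt_eqF.
Qed.

Lemma bidual_interiorZ t w : 0 < t -> bidual_interior P (t *: w) -> bidual_interior P w.
Proof.
move=> t0 [w0 hw]; split; first by apply: contra_neq w0 => ->; rewrite scaler0.
by move=> v Cv v0; have := hw v Cv v0; rewrite bilZr pmulr_rlt0.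
Qed.

Lemma near_bidual_interior u :
  (\forall w \near (set_val u : V), forall u', set_val u' = w -> Cc w) ->
  bidual_interior P (set_val u).
Proof.
move=> /nbhs_ballP[d /= d0 hd]; split; first exact: nzvec_neq0.
move=> v Cv v0; have d2 : 0 < d / 2 by rewrite divr_gt0.
apply: (bil_lt0_interior v0 d2) => w wd.
have [E|nz] := eqVneq (set_val u + w) 0; first by rewrite E bil0r.
have [u' uE] := nzvec_ex nz; rewrite bilC; apply: (hd (set_val u + w) _ u' uE v Cv).
rewrite -ball_normE /= opprD addrA subrr add0r normrN; apply: le_lt_trans wd _; lra.
Qed.

(** The hull lies between the interior of the bidual cone and the bidual cone, and a ray interior to
    the latter is strictly negative on the dual cone. *)
Lemma Conv_interior u : (Conv Lambda)° (piR u) <-> bidual_interior P (set_val u).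
Proof.
split=> [h|hu].
  apply: near_bidual_interior; apply: filterS (pi_rays_continuous h) => w hw u' uw.
  by rewrite -uw; apply/Conv_bidual/hw.
have int0 : bidual_interior P !=set0 by exists (set_val u).
have oI : open (rays_through (bidual_interior P) : set (rays R n)).
  by apply: rays_through_open; [exact: (bidual_interior_open lP)|exact: bidual_interiorZ].
have : nbhs (piR u) (rays_through (bidual_interior P)).
  by apply: open_nbhs_nbhs; split=> //; apply/rays_throughP; exists 1; rewrite ?scale1r.
apply: filterS => r; case: (rays_surj r) => u' <- h; apply: pos_hull_Conv.
apply: (bidual_interior_pos_hull lP int0).
by have [t t0 ht] := (rays_throughP _ _).1 h; exact: bidual_interiorZ ht.
Qed.

Hypothesis interior : bidual_interior P !=set0.
Local Notation S e := (hull_boundary P e).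
Local Notation X e := (rays_through (S e) : set (rays R n)).

Lemma off_boundary_rays_open e : e ^+ 2 = 1 -> open (rays_through (off_boundary P e) : set (rays R n)).
Proof.
move=> e2; apply: rays_through_open; first exact: off_boundary_open.
move=> t x t0 [qx hx]; split.
  by move: qx; rewrite /qf bilZl bilZr mulrA pmulr_rlt0 ?mulr_gt0.
move=> s s0; have := hx (s / t); rewrite divr_gt0// scalerA divfK ?gt_eqF//; exact.
Qed.

(** A boundary ray outside [Lambda] is timelike by [dual_null] and orthogonal to a dual vector; the
    sign of [om] on this pair tells the part. Conversely, a point of [S e] becomes interior when a
    small multiple of an interior vector is added. *)
Lemma boundaryE : boundary_Conv Lambda `\` Lambda = X 1 `|` X (-1).
Proof.
apply/seteqP; split=> [r [[cr ir] nL]|r].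
  move: cr ir nL; case: (rays_surj r) => u <- cr ir nL.
  have Cu : Cc (set_val u).
    move=> v Cv; rewrite leNgt; apply/negP => lt0.
    pose A := [set w : V | 0 < bil w v].
    have oA : open A.
      apply: open_by_sequences => U Y w UU _ Aw Yw.
      have hb : (fun k => bil (Y k) v) @ U --> bil w v by apply: cvg_bil => //; exact: cvg_cst.
      have n1 : \forall k \near U, 0 < bil (Y k) v by exact: (cvgr_gt _ hb).
      exact: filter_ex n1.
    have oX : open (rays_through A : set (rays R n)).
      by apply: rays_through_open => // t x t0; rewrite /A /= bilZl pmulr_rgt0.
    have [|r' [Cr']] := cr (rays_through A).
      by apply: open_nbhs_nbhs; split=> //; apply/rays_throughP; exists 1; rewrite ?scale1r.
    move: Cr'; case: (rays_surj r') => u' <- /Conv_bidual Cu' /rays_throughP[t t0].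
    by rewrite /A /= bilZl pmulr_rgt0// ltNge Cu'.
  have qu : qf (set_val u) < 0.
    rewrite lt_neqAle (dual_qf lP (bidual_dual lP Cu)) andbT; apply/eqP => q0.
    have [p [s [Pp s0 E]]] := dual_null lP (bidual_dual lP Cu) q0.
    have s1 : s != 0 by apply: contra_neq (nzvec_neq0 u) => s00; rewrite E s00 scale0r.
    apply: nL; apply/rays_throughP; exists s^-1; first by rewrite invr_gt0 lt_neqAle eq_sym s1.
    by rewrite E scalerA mulVf// scale1r.
  have [v [Cv v0 uv]] : exists v, [/\ Cs v, v != 0 & 0 <= bil v (set_val u)].
    apply: contrapT => /forallNP h; apply: ir; apply/Conv_interior; split; first exact: nzvec_neq0.
    by move=> v Cv v0; rewrite ltNge; apply/negP => hv; apply: (h v).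
  have {}uv : bil (set_val u) v = 0 by apply/eqP; rewrite eq_le Cu//= bilC.
  pose t := (Num.sqrt (- qf (set_val u)))^-1.
  have t0 : 0 < t by rewrite invr_gt0 sqrtr_gt0 oppr_gt0.
  have qt : qf (t *: set_val u) = -1.
    rewrite /qf bilZl bilZr -/(qf _) mulrA -expr2 exprVn sqr_sqrtr ?oppr_ge0 ?ltW//.
    by rewrite invrN mulNr mulVf// lt_eqF.
  have Ct : Cc (t *: set_val u) by apply: dual_coneZ => //; exact: ltW.
  have tv0 : bil (t *: set_val u) v = 0 by rewrite bilZl uv mulr0.
  have := @om_neq0 _ _ 1 (t *: set_val u) v (oner_neq0 R) _ (dual_qf lP Cv) v0 tv0.
  rewrite qt oppr_lt0 ltr01 => /(_ isT); rewrite neq_lt => /orP[ov|ov].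
    right; apply/rays_throughP; exists t => //; split=> //; exists v; split=> //.
    by move: ov; rewrite /om; lra.
  by left; apply/rays_throughP; exists t => //; split=> //; exists v.
have main e : e ^+ 2 = 1 -> X e `<=` boundary_Conv Lambda `\` Lambda.
  move=> e2 {}r; case: (rays_surj r) => u <- /rays_throughP[t t0 [qt Ct [v [Cv tv0 ov]]]].
  have v0 : v != 0 by apply/eqP => v0; move: ov; rewrite v0 /om /tu /tv !mxE; lra.
  have qu : qf (set_val u) < 0.
    by move: qt; rewrite /qf bilZl bilZr mulrA => qt; have := mulr_gt0 t0 t0; nra.
  have Cu : Cc (set_val u).
    rewrite -[set_val u]scale1r -(mulVf (lt0r_neq0 t0)) -scalerA; apply: dual_coneZ => //.
    by rewrite invr_ge0 ltW.
  split; last first.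
    move=> /rays_throughP[s s0 Ps]; have := sphere_qf lP Ps; rewrite /qf bilZl bilZr mulrA.
    by have := mulr_gt0 s0 s0; move: qu; rewrite /qf; nra.
  split.
    move=> B hB; have [zeta [z0 hz]] := interior.
    have [d d0 hd] := (nbhs_ballP _ _).1 (pi_rays_continuous hB).
    have zn : 0 < `|zeta| by rewrite normr_gt0.
    pose w := set_val u + (d / 2 / `|zeta|) *: zeta.
    have s0 : 0 < d / 2 / `|zeta| by rewrite !divr_gt0.
    have w1 v' : Cs v' -> v' != 0 -> bil v' w < 0.
      move=> Cv' v0'; rewrite bilDr bilZr (bilC v' (set_val u)).
      by have := Cu v' Cv'; have := hz v' Cv' v0'; nra.
    have w0 : w != 0 by apply/eqP => w0; have := w1 v Cv v0; rewrite w0 bil0r ltxx.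
    have [u' uE] := nzvec_ex w0.
    exists (piR u'); split.
      by apply: pos_hull_Conv; rewrite uE; apply: (bidual_interior_pos_hull lP interior); split.
    apply: (hd w) uE; rewrite -ball_normE /= opprD addrA subrr add0r normrN normrZ gtr0_norm//.
    by rewrite divfK ?gt_eqF//; move: d0 => /=; lra.
  move=> /Conv_interior[_ /(_ v Cv v0)]; rewrite bilC.
  by move: tv0; rewrite bilZl => /eqP; rewrite mulf_eq0 gt_eqF//= => /eqP->; rewrite ltxx.
by case; apply: main; rewrite ?sqrrN expr1n.
Qed.

Lemma X_separated e : e ^+ 2 = 1 -> closure (X e) `&` X (- e) = set0.
Proof.
move=> e2; apply/seteqP; split=> // r [cr Xr]; move: cr Xr; case: (rays_surj r) => u <- cr.
move=> /rays_throughP[t t0 St].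
have [|r' [Xr']] := cr (rays_through (off_boundary P e)).
  apply: open_nbhs_nbhs; split; first exact: off_boundary_rays_open.
  apply/rays_throughP; exists t => //; have [qt _ _] := St; split; first by rewrite qt; lra.
  move=> s s0 Ss; have s1 : s = 1.
    by have [qs _ _] := Ss; move: qs; rewrite /qf bilZl bilZr -/(qf _) qt; nra.
  rewrite s1 scale1r in Ss.
  have [e1|e1] : e = 1 \/ e = -1 by move: e2 => /eqP; rewrite sqrf_eq1 => /orP[/eqP|/eqP]; [left|right].
    by rewrite e1 in Ss St; exact: (hull_boundary_disjoint lP interior Ss St).
  by rewrite e1 opprK in Ss St; exact: (hull_boundary_disjoint lP interior St Ss).
move: Xr'; case: (rays_surj r') => u' <- /rays_throughP[s s0 Ss] /rays_throughP[s' s0' [_ h]].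
by apply: (h (s / s')); rewrite ?divr_gt0// scalerA divfK ?gt_eqF.
Qed.

(** Geodesics of the convex surface make each part connected, and the two parts are separated. *)
Lemma X_component e u : e ^+ 2 = 1 -> X e (piR u) ->
  connected_component (boundary_Conv Lambda `\` Lambda) (piR u) = X e.
Proof.
move=> e2 Xu; have ne2 : (- e) ^+ 2 = 1 by rewrite sqrrN.
have BE : boundary_Conv Lambda `\` Lambda = X e `|` X (- e).
  have [->|->] : e = 1 \/ e = -1 by move: e2 => /eqP; rewrite sqrf_eq1 => /orP[/eqP|/eqP]; [left|right].
    exact: boundaryE.
  by rewrite opprK setUC; exact: boundaryE.
rewrite BE; apply/seteqP; split=> [r [C [Cu CB cC] Cr]|r Xr].
  have sep : separated (X e) (X (- e)).
    split; first exact: X_separated.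
    by have := X_separated ne2; rewrite opprK setIC.
  have [h|h] := connected_subset sep CB cC; first exact: h.
  have : (closure (X e) `&` X (- e)) (piR u) by split; [exact: subset_closure|exact: h].
  by rewrite X_separated.
have cS := hull_boundary_convex lP e2 (let: ex_intro z (conj _ hz) := interior in ex_intro _ z hz).
move: Xr; case: (rays_surj r) => u' <- Xr.
have [t t0 St] := (rays_throughP _ _).1 Xu; have [t' t0' St'] := (rays_throughP _ _).1 Xr.
have [g [cg Sg g0 [l gl]]] := surface_path cS St St'.
have gn s : g s != 0 by apply/eqP => E; have [q _ _] := Sg s; move: q; rewrite E /qf bil0l; lra.
pose G s : nzvec := exist _ (g s) (mem_set (gn s)).
have GE s : set_val (G s) = g s by [].
have cG : continuous G.
  by apply: (@continuous_comp_initial _ _ _ (set_val : nzvec -> V) G).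
pose H s := piR (G s).
have cH : continuous H.
  by move=> s; apply: (@continuous_comp _ _ _ G (piR : nzvec -> rays R n)); [exact: cG|exact: (@pi_continuous _ {eq_quot ray_equiv})].
have Hu : H 0 = piR u.
  by apply/pi_rays_eq; exists t^-1; rewrite ?invr_gt0// GE g0 scalerA mulVf ?scale1r// gt_eqF.
have Hu' : H l = piR u'.
  by apply/pi_rays_eq; exists t'^-1; rewrite ?invr_gt0// GE gl scalerA mulVf ?scale1r// gt_eqF.
exists (H @` setT); last by exists l.
split; first by exists 0.
  by move=> _ [s _ <-]; left; apply/rays_throughP; exists 1; rewrite ?scale1r// GE; exact: Sg.
apply: connected_continuous_connected; last exact: continuous_subspaceT.
by apply/connected_intervalP => x y _ _ z _.
Qed.

Lemma AdS_lift_X e : AdS_lift (X e) = S e.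
Proof.
apply/seteqP; split=> [x [qx [u Xu ux]]|x Sx].
  have [t t0 St] := (rays_throughP _ _).1 Xu; rewrite ux in St.
  suff t1 : t = 1 by rewrite t1 scale1r in St.
  have [qt _ _] := St; move: qt; rewrite /qf bilZl bilZr; move: qx; rewrite /AdS /= /qf => ->; nra.
have [qx _ _] := Sx; split=> //.
have [|u ux] := @nzvec_ex _ _ x; first by apply/eqP => x0; move: qx; rewrite x0 /qf bil0l; lra.
by exists u => //; apply/rays_throughP; exists 1; rewrite ?scale1r ?ux.
Qed.

Lemma boundary_component_lift (Sp : set (rays R n)) : boundary_components Lambda Sp ->
  exists2 e, e ^+ 2 = 1 & AdS_lift Sp = S e.
Proof.
move=> [r Br <-]; move: (Br); rewrite {1}boundaryE; case: (rays_surj r) => u <- [] Xu.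
  by exists 1; rewrite ?expr1n// (X_component _ Xu) ?expr1n// AdS_lift_X.
by exists (-1); rewrite ?sqrrN ?expr1n// (X_component _ Xu) ?sqrrN ?expr1n// AdS_lift_X.
Qed.

End BoundaryComponents.

(** * Time orientation under isometries *)

Section Isometries.
Context {R : realType} {n : nat}.
Local Notation V := 'cV[R]_(2 + n).
Implicit Types (x y z p v w N : V) (A : 'M[R]_(2 + n)) (t r s d : R).

Lemma mulmx_cvg I (U : set_system I) A (X : I -> V) x {FU : Filter U} :
  X @ U --> x -> (fun i => A *m X i) @ U --> A *m x.
Proof.
move=> h; apply: cvg_col => j; under eq_fun do rewrite mxE; rewrite mxE.
by apply: cvg_big_sum => k; apply: cvgM; [exact: cvg_cst|exact: cvg_coord].
Qed.

Lemma mulmx_cont A : continuous (fun x : V => A *m x).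
Proof. by move=> x; apply: (@mulmx_cvg V (nbhs x) A id x); exact: cvg_id. Qed.

Lemma mulmxl_cont x : continuous (fun A : 'M[R]_(2 + n) => A *m x).
Proof.
move=> A; have FA : Filter (nbhs A) by exact: nbhs_filter.
apply: (@cvg_col _ _ _ (nbhs A) (fun B => B *m x)) => j.
under eq_fun do rewrite mxE; rewrite mxE.
apply: (@cvg_big_sum _ _ (nbhs A)) => k; apply: cvgM; last exact: cvg_cst.
exact: coord_continuous.
Qed.

Lemma SO0_isometry A : SO0 A -> isometries A.
Proof. by move=> [C [_ CI _] CA]; exact: CI. Qed.

(* [om e] does not vanish on a pair of orthogonal timelike vectors, hence keeps its
   sign along a connected set of isometries. *)
Lemma SO0_om e A x N : e != 0 -> SO0 A -> qf x < 0 -> qf N < 0 -> bil x N = 0 ->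
  0 < om e x N -> 0 < om e (A *m x) (A *m N).
Proof.
move=> e0 [C [C1 CI cC] CA] qx qN xN ox.
pose F (B : 'M[R]_(2 + n)) := om e (B *m x) (B *m N).
have F0 B : C B -> F B != 0.
  move=> /CI iB; have N0 : B *m N != 0.
    by apply/eqP => E; have := iB N N; rewrite E bil0l => h; move: qN; rewrite /qf -h ltxx.
  by apply: om_neq0 => //; rewrite /qf iB//; exact: ltW.
have cF : {within C, continuous F}.
  apply: continuous_subspaceT => B; have FB : Filter (nbhs B) by exact: nbhs_filter.
  have h y : (fun B : 'M[R]_(2 + n) => B *m y) @ nbhs B --> B *m y by exact: mulmxl_cont.
  exact: (cvg_om (h x) (h N)).
have /connected_intervalP hI := connected_continuous_connected cC cF.
have F1 : F 1%:M = om e x N by rewrite /F !mul1mx.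
rewrite -/(F A) ltNge; apply/negP => FA.
have [|||B CB B0] := hI (F A) (F 1%:M) _ _ 0.
- by exists A.
- by exists 1%:M.
- by rewrite FA F1 ltW.
by have := F0 B CB; rewrite B0 eqxx.
Qed.

End Isometries.

(** * The group action on the regular domain *)

Section GroupAction.
Context {R : realType} {n : nat} {Gamma : groupType}.
Local Notation V := 'cV[R]_(2 + n).
Variable rho : representation Gamma R n.
Implicit Types (x y z p v w N : V) (g h : Gamma) (t r s d : R).

Lemma rhoK g x : rho g *m (rho g^-1%g *m x) = x.
Proof. by rewrite mulmxA -repM mulgV rep1 mul1mx. Qed.

Lemma rhoVK g x : rho g^-1%g *m (rho g *m x) = x.
Proof. by rewrite mulmxA -repM mulVg rep1 mul1mx. Qed.

Lemma rho_bil g x y : bil (rho g *m x) (rho g *m y) = bil x y.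
Proof. exact: (SO0_isometry (rep_SO0 rho g)). Qed.

Lemma pi_orbit_eq x y : (\pi_(orbit_space rho) x = \pi_(orbit_space rho) y) <->
  exists g, y = rho g *m x.
Proof. by split=> [/eqmodP/asboolP//|h]; apply/eqmodP; exact/asboolP. Qed.

Lemma quotient_of_open (A : set V) : open A -> open (quotient_of (rho := rho) A).
Proof.
move=> oA.
have E : (\pi_(orbit_space rho) : V -> orbit_space rho) @^-1` quotient_of (rho := rho) A =
    \bigcup_(g in setT) ((fun x : V => rho g *m x) @^-1` A).
  apply/seteqP; split=> x /=.
    by move=> [y Ay /esym/pi_orbit_eq[g yE]]; exists g; rewrite //= -yE.
  by move=> [g _ Ag]; exists (rho g *m x) => //; apply/esym/pi_orbit_eq; exists g.
have : open ((\pi_(orbit_space rho) : V -> orbit_space rho) @^-1` quotient_of (rho := rho) A).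
  rewrite E; apply: bigcup_open => g _; apply: open_comp => // x _; exact: mulmx_cont.
by [].
Qed.

Variable P : set V.
Hypothesis lP : lightlike_sphere P.
Local Notation Cs := (dual_cone P).
Local Notation Cc := (bidual_cone P).
Local Notation Lambda := (rays_through P : set (rays R n)).
Hypothesis invL : forall g, [set rho g *m x | x in cone Lambda] = cone Lambda.

Lemma dual_rho g v : Cs v -> Cs (rho g *m v).
Proof.
move=> Cv p Pp.
have : cone Lambda p.
  have [u uE] := nzvec_ex (sphere_neq0 lP Pp).
  by rewrite -uE; apply/cone_sphere; exists 1; rewrite ?scale1r ?uE.
rewrite -(invL g) => -[q [u Lu uq] <-]; rewrite rho_bil.
have [t t0 Pt] := (cone_sphere P u).1 (proj2 (coneP _ _) Lu).
by rewrite -uq -(pmulr_rle0 _ t0) -bilZr; exact: Cv.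
Qed.

Lemma bidual_rho g x : Cc x -> Cc (rho g *m x).
Proof. by move=> Cx v Cv; rewrite -(rhoK g v) rho_bil; apply: Cx; exact: dual_rho. Qed.

Local Notation E := (regular_domain Lambda).

Lemma regular_domainE x : E x <-> qf x = -1 /\ forall p, P p -> bil x p < 0.
Proof.
split=> -[qx hx]; split=> //.
  move=> p Pp; apply: hx; have [u uE] := nzvec_ex (sphere_neq0 lP Pp).
  by rewrite -uE; apply/cone_sphere; exists 1; rewrite ?scale1r ?uE.
move=> y [u Lu <-]; have [t t0 Pt] := (cone_sphere P u).1 (proj2 (coneP _ _) Lu).
by rewrite -(pmulr_rlt0 _ t0) -bilZr; exact: hx.
Qed.

Lemma regular_domain_rho g x : E x -> E (rho g *m x).
Proof.
move=> [qx hx]; split; first by rewrite /AdS /= /qf rho_bil.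
by move=> y; rewrite -(invL g) => -[z Lz <-]; rewrite rho_bil; exact: hx.
Qed.

Lemma bidual_regular x : Cc x -> qf x = -1 -> E x.
Proof. by move=> Cx qx; apply/regular_domainE; split=> // p Pp; exact: (bidual_strict lP). Qed.

Lemma regular_domain_near x : E x -> exists2 d : R, 0 < d &
  forall y, qf y = -1 -> `|y - x| <= d -> E y.
Proof.
move=> /regular_domainE[qx hx]; have [d d0 hd] := dual_open lP hx.
have d2 : 0 < d / 2 by rewrite divr_gt0.
exists (d / 2) => // y qy yx; apply/regular_domainE; split=> // p Pp; rewrite bilC.
apply: (bil_lt0_interior (sphere_neq0 lP Pp) d2) => w wd; rewrite bilC.
rewrite (_ : y + w = x + (y - x + w)); last by rewrite addrA (addrC x) subrK.
by apply: hd => //; apply: (le_trans (ler_normD _ _)); lra.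
Qed.

Lemma hull_boundary_symmetry e g : e ^+ 2 = 1 ->
  surface_symmetry e (hull_boundary P e) (rho g).
Proof.
move=> e2; have e0 : e != 0 by apply: contra_eq_neq e2 => ->; rewrite expr0n /= eq_sym oner_eq0.
have omr x N : qf x = -1 -> qf N < 0 -> bil x N = 0 -> 0 < om e x N ->
    0 < om e (rho g *m x) (rho g *m N).
  by move=> qx qN xN; apply: SO0_om => //; [exact: rep_SO0|rewrite qx; lra].
split; first by move=> x y; exact: rho_bil.
  by move=> x N qx qN; apply: omr => //; rewrite qN; lra.
move=> x [qx Cx [v [Cv xv ov]]]; split; [by rewrite /qf rho_bil|exact: bidual_rho|].
have v0 : v != 0 by apply/eqP => v0; move: ov; rewrite v0 /om /tu /tv !mxE; lra.
exists (rho g *m v); split; [exact: dual_rho|by rewrite rho_bil|].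
by apply: omr => //; exact: (normal_timelike lP Cx).
Qed.

Hypothesis freeE : acts_freely rho E.
Hypothesis pdE : acts_properly_discontinuously rho E.

(** On a compact neighbourhood only finitely many elements return points. If slices of radii tending
    to 0 all failed, one of these elements other than the identity would fix [z] in the limit,
    against freeness. *)
Lemma slice z : E z -> exists2 d : R, 0 < d &
  (forall y, qf y = -1 -> `|y - z| <= d -> E y) /\
  forall g x, qf x = -1 -> `|x - z| <= d -> `|rho g *m x - z| <= d -> g = 1%g.
Proof.
move=> Ez; have [d d0 hd] := regular_domain_near Ez.
pose K : set V := [set y | qf y = -1 /\ `|y - z| <= d].
have KE : K `<=` E by move=> y [qy yd]; exact: hd.
have cK : compact K.
  rewrite compact_ultra => U UU UK.
  have [y hy] : exists y : V, (id : V -> V) @ U --> y.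
    apply: ultra_bounded_col => j; exists (`|z| + d); apply: filterS UK => y [_ yd].
    apply: (le_trans (col_norm_ge y j)); rewrite -[in leLHS](subrK z y) addrC.
    by apply: (le_trans (ler_normD _ _)); rewrite lerD2l.
  exists y; split; last exact: hy.
  split.
    apply/eqP; rewrite eq_le; apply/andP; split;
      [apply: (cvgr_to_le (cvg_bil hy hy))|apply: (cvgr_to_ge (cvg_bil hy hy))];
      by apply: filterS UK => y' [q _]; rewrite -/(qf _) q.
  have hn : (fun y' : V => `|y' - z|) @ U --> `|y - z|.
    by apply: cvg_norm; apply: cvgB => //; exact: cvg_cst.
  by apply: (cvgr_to_le hn); apply: filterS UK => y' [].
have /finite_seqP[L LE] := pdE KE cK.
apply/not_exists2P => h.
have /choice[gx hgx] : forall k : nat, exists gx : Gamma * V, [/\ gx.1 != 1%g, qf gx.2 = -1,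
    `|gx.2 - z| <= d * k.+1%:R^-1 & `|rho gx.1 *m gx.2 - z| <= d * k.+1%:R^-1].
  move=> k; have dk : 0 < d * k.+1%:R^-1 by rewrite mulr_gt0 ?invr_gt0.
  have dd : d * k.+1%:R^-1 <= d by rewrite ler_piMr ?(ltW d0)// invf_le1 ?ltr0n// ler1n.
  have [//|h'] := h (d * k.+1%:R^-1).
  apply: contrapT => /forallNP h2; apply: h'; split=> [y qy yd|g x qx xd gxd].
    by apply: hd => //; exact: le_trans dd.
  by apply/eqP/negPn/negP => g1; apply: (h2 (g, x)).
have [U [UU sU]] := nat_ultra.
have gL : \forall k \near U, (gx k).1 \in L.
  apply: filterE => k; have [_ qk h1 h2] := hgx k.
  have dd : d * k.+1%:R^-1 <= d by rewrite ler_piMr ?(ltW d0)// invf_le1 ?ltr0n// ler1n.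
  have : [set` L] (gx k).1 by rewrite -LE; exists (gx k).2; split; rewrite ?/qf ?rho_bil//; exact: le_trans dd.
  by [].
have [g _ gU] := ultra_seq UU gL.
have dU : (fun k => d * k.+1%:R^-1) @ U --> (0 : R).
  rewrite -(mulr0 d); apply: cvgM; first exact: cvg_cst.
  by apply: ultra_cvg_near => //; exact: cvg_harmonic.
have lim (Y : nat -> V) : (\forall k \near U, `|Y k - z| <= d * k.+1%:R^-1) -> Y @ U --> z.
  move=> hY; apply/cvgrPdist_lt => eps eps0.
  have n1 : \forall k \near U, d * k.+1%:R^-1 < eps by exact: (cvgr_lt _ dU).
  by apply: filterS2 hY n1 => k h1 h2; rewrite distrC; exact: le_lt_trans h2.
have l1 : (fun k => (gx k).2) @ U --> z by apply: lim; apply: filterE => k; have [] := hgx k.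
have l2 : (fun k => rho g *m (gx k).2) @ U --> z.
  by apply: lim; apply: filterS gU => k <-; have [] := hgx k.
have E1 : rho g *m z = z.
  have l3 : (fun k => rho g *m (gx k).2) @ U --> rho g *m z by exact: mulmx_cvg.
  exact: (cvg_unique (@norm_hausdorff _ V) l3 l2).
have [k gk] := filter_ex gU; have [g1 _ _ _] := hgx k.
by move: g1; rewrite gk (freeE Ez E1) eqxx.
Qed.

(* Near the limit in the quotient the curve stays in a single translate of a slice. *)
Lemma quotient_escape (c : R -> V) b z : continuous c -> (forall t, qf (c t) = -1) ->
  c t @[t --> +oo] --> b -> ~ E b -> E z ->
  ~ (\pi_(orbit_space rho) (c t) @[t --> +oo] --> \pi_(orbit_space rho) z).
Proof.
move=> cc qc cb Eb Ez cz; have [d d0 [hd hs]] := slice Ez.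
pose B : set V := [set y | `|z - y| < d].
have oB : open B.
  rewrite openE => y By; have d1 : 0 < d - `|z - y| by rewrite subr_gt0.
  apply/nbhs_ballP; exists (d - `|z - y|) => //= y'; rewrite -ball_normE /= => h.
  by rewrite /B /= -(subrK y z) -addrA; apply: (le_lt_trans (ler_normD _ _)); lra.
have Bz : B z by rewrite /B /= subrr normr0.
have : \forall t \near +oo, quotient_of (rho := rho) B (\pi_(orbit_space rho) (c t)).
  have hn : nbhs (\pi_(orbit_space rho) z) (quotient_of (rho := rho) B).
    by apply: open_nbhs_nbhs; split; [exact: quotient_of_open|exists z].
  exact: (cz _ hn).
move=> [T [_ hT]].
have hg t : T < t -> exists g, B (rho g *m c t).
  by move=> /hT[y By /esym/pi_orbit_eq[g E1]]; exists g; rewrite -E1.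
have uniq t g g' : B (rho g *m c t) -> B (rho g' *m c t) -> g = g'.
  move=> B1 B2; suff : (g' * g^-1)%g = 1%g by move/(canRL (mulgVK _)); rewrite mul1g.
  apply: (hs _ (rho g *m c t)); first by rewrite /qf rho_bil -/(qf _) qc.
    by rewrite distrC; exact: ltW.
  by rewrite repM -mulmxA rhoVK distrC; exact: ltW.
have [|g0 Bg0] := hg (T + 1); first by rewrite ltrDl.
have og g : open [set t | B (rho g *m c t)].
  apply: (@open_comp _ _ (fun t => rho g *m c t)) => // t _.
  by apply: mulmx_cvg; exact: cc.
have all t : T < t -> B (rho g0 *m c t).
  move=> Tt; pose I := [set t : R | T < t].
  have cI : connected I.
    apply/connected_intervalP => x y; rewrite /I /= => Tx Ty w /andP[xw _].
    exact: lt_le_trans xw.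
  have E1 : I `&` [set t | B (rho g0 *m c t)] = I.
    apply: cI.
    - by exists (T + 1); split; rewrite /I /= ?ltrDl.
    - by exists [set t | B (rho g0 *m c t)].
    - exists (~` \bigcup_(g in [set g | g != g0]) [set t | B (rho g *m c t)]).
        by apply: open_closedC; apply: bigcup_open => g _.
      apply/seteqP; split=> s [Is hs']; split=> //.
        by move=> [g /= gg0 Bg]; move: gg0; rewrite (uniq s g g0 Bg hs') eqxx.
      have [g Bg] := hg s Is; have [<-//|gg0] := eqVneq g g0.
      by case: hs'; exists g.
  by have : I t := Tt; rewrite -E1 => -[].
have gb : (rho g0 *m c t) @[t --> +oo] --> rho g0 *m b by apply: mulmx_cvg.
have qb : qf b = -1.
  apply/eqP; rewrite eq_le; apply/andP; split;
    [apply: (cvgr_to_le (cvg_bil cb cb))|apply: (cvgr_to_ge (cvg_bil cb cb))];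
    by apply: filterE => t; rewrite -/(qf _) qc.
have Egb : E (rho g0 *m b).
  apply: hd; first by rewrite /qf rho_bil.
  have hn : (fun t => `|rho g0 *m c t - z|) @ +oo --> `|rho g0 *m b - z|.
    by apply: cvg_norm; apply: cvgB => //; exact: cvg_cst.
  apply: (cvgr_to_le hn); exists T; split; first exact: num_real.
  by move=> t /all; rewrite /B /= distrC => /ltW.
by apply: Eb; rewrite -(rhoVK g0 b); exact: regular_domain_rho.
Qed.

End GroupAction.

(** * Circles as timelike curves, and cocompactness *)

Section CircleCurves.
Context {R : realType} {n : nat}.
Local Notation V := 'cV[R]_(2 + n).
Implicit Types (x y z p v w N : V) (t r s d : R).

(** The derivative of the rotation at angle 0. *)
Definition turn x : V := \col_i (if i == lshift n 0 then - tv x else if i == lshift n 1 then tu x else 0).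

Lemma tu_turn x : tu (turn x) = - tv x.
Proof. by rewrite {1}/tu mxE eqxx. Qed.

Lemma tv_turn x : tv (turn x) = tu x.
Proof. by rewrite {1}/tv mxE (inj_eq (@lshift_inj _ _)) eqxx. Qed.

Lemma turn_space x i : turn x (rshift 2 i) 0 = 0.
Proof. by rewrite mxE !eq_rlshift. Qed.

Lemma qf_turn x : qf (turn x) = - (tu x ^+ 2 + tv x ^+ 2).
Proof.
rewrite /qf bil_coord tu_turn tv_turn [sp _ _]big1 => [|i _]; last by rewrite turn_space mul0r.
by ring.
Qed.

Lemma rot_is_derive (phi : R -> R) x t d : is_derive t 1 phi d ->
  is_derive t 1 (fun t => rot (phi t) x) (d *: rot (phi t) (turn x)).
Proof.
move=> dphi.
have dc : is_derive t 1 (fun t => cos (phi t)) (- sin (phi t) * d).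
  exact: (@is_derive1_comp _ cos phi).
have ds : is_derive t 1 (fun t => sin (phi t)) (cos (phi t) * d).
  exact: (@is_derive1_comp _ sin phi).
have dj i : is_derive t 1 (fun t => rot (phi t) x i 0) ((d *: rot (phi t) (turn x)) i 0).
  case: (split_ordP i) => j ->; last first.
    rewrite mxE rot_space turn_space mulr0.
    rewrite (_ : (fun t => _) = cst (x (rshift 2 j) 0)); last by apply/funext => s; rewrite rot_space.
    exact: is_derive_cst.
  case: j => [[|[|//]] hj].
    rewrite (_ : Ordinal hj = 0); last exact: val_inj.
    rewrite (_ : (fun t => _) = (fun t => tu x *: cos (phi t) - tv x *: sin (phi t))); last first.
      by apply/funext => s; rewrite -/(tu _) tu_rot /GRing.scale/= mulrC (mulrC (sin _)).
    rewrite [X in is_derive _ _ _ X](_ : _ = tu x *: (- sin (phi t) * d) - tv x *: (cos (phi t) * d)).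
      by apply: is_deriveB; exact: is_deriveZ.
    by rewrite mxE -/(tu _) tu_rot tu_turn tv_turn /GRing.scale/=; ring.
  rewrite (_ : Ordinal hj = 1); last exact: val_inj.
  rewrite (_ : (fun t => _) = (fun t => tu x *: sin (phi t) + tv x *: cos (phi t))); last first.
    by apply/funext => s; rewrite -/(tv _) tv_rot /GRing.scale/= mulrC (mulrC (cos _)).
  rewrite [X in is_derive _ _ _ X](_ : _ = tu x *: (cos (phi t) * d) + tv x *: (- sin (phi t) * d)).
    by apply: is_deriveD; exact: is_deriveZ.
  by rewrite mxE -/(tv _) tv_rot tu_turn tv_turn /GRing.scale/=; ring.
have der : derivable (fun t => rot (phi t) x) t 1.
  by apply/derivable_mxP => i j; rewrite ord1; have [] := dj i.
split=> //; rewrite derive_mx//; apply/matrixP => i j; rewrite ord1 mxE.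
by have [_ ->] := dj i.
Qed.

Variable P : set V.
Hypothesis lP : lightlike_sphere P.
Local Notation Cs := (dual_cone P).
Local Notation Cc := (bidual_cone P).
Local Notation Lambda := (rays_through P : set (rays R n)).
Local Notation E := (regular_domain Lambda).

(** For the point [p] over the space direction of [x], the products of [x] and of its half turn with
    [p] add up to [2 * r], so they are not both negative. *)
Lemma rot_pi_exit e x : e ^+ 2 = 1 -> E x -> ~ E (rot (e * pi) x).
Proof.
move=> e2 /(regular_domainE lP)[qx hx] /(regular_domainE lP)[_ hx'].
have [p [r [Pp r0 hr]]] := ls_surj lP x; have [u1 s1] := ls_unit lP Pp.
have xp : sp x p = r by rewrite (sp_scale _ hr) s1 mulr1.
have := hx p Pp; have := hx' p Pp.
by rewrite !bil_coord !rotE cos_sgn// sin_sgn// sinpi cospi xp; lra.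
Qed.

Lemma circle_exit e x : e ^+ 2 = 1 -> E x -> exists s, [/\ 0 < s,
  forall t, 0 <= t -> t < s -> E (rot (e * t) x) & ~ E (rot (e * s) x)].
Proof.
move=> e2 Ex; pose h s := rot (e * s) x.
have qh s : qf (h s) = -1 by have [q _] := Ex; rewrite qf_rot.
have hcont : continuous h.
  move=> s; apply: (@cvg_comp _ _ _ (fun s => e * s) (fun t => rot t x) _ (nbhs (e * s))).
    by apply: cvgM; [exact: cvg_cst|exact: cvg_id].
  exact: rot_continuous.
have nearE s : E (h s) -> exists2 d : R, 0 < d & forall t, `|s - t| < d -> E (h t).
  move=> /(regular_domain_near lP)[d d0 hd].
  have /cvgrPdist_lt/(_ d d0)/nbhs_ballP[d' /= d'0 hd'] := hcont s.
  exists d' => // t st; apply: hd => //; rewrite distrC; apply/ltW/hd'.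
  by rewrite /ball.
pose A := [set s : R | 0 <= s <= pi /\ forall t, 0 <= t -> t <= s -> E (h t)].
have h0 : h 0 = x by rewrite /h mulr0 rot0.
have A0 : A 0.
  split; first by rewrite lexx pi_ge0.
  by move=> t t0 t0'; rewrite (_ : t = 0) ?h0//; apply/eqP; rewrite eq_le t0 t0'.
have hA : has_sup A by split; [exists 0|exists pi => s [/andP[]]].
set s1 := sup A; have s1ge : 0 <= s1 by exact: (sup_upper_bound hA).
have s1le : s1 <= pi by apply: ge_sup; [exists 0|move=> s [/andP[]]].
have below t : 0 <= t -> t < s1 -> E (h t).
  move=> t0 ts; have st : 0 < s1 - t by rewrite subr_gt0.
  have [s [_ hs] ss] := sup_adherent st hA; apply: hs => //; apply: ltW.
  by move: ss; rewrite -/s1; lra.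
have n1 : ~ E (h s1).
  move=> Es; have spi : s1 < pi.
    by rewrite lt_neqAle s1le andbT; apply/eqP => E1; move: Es; rewrite E1; exact: rot_pi_exit.
  have [d d0 hd] := nearE _ Es.
  pose s2 := s1 + Num.min (d / 2) (pi - s1).
  have m0 : 0 < Num.min (d / 2) (pi - s1) by rewrite lt_min divr_gt0//= subr_gt0.
  have : s2 <= s1.
    apply: (sup_upper_bound hA); split.
      apply/andP; split; first by rewrite addr_ge0// ltW.
      by rewrite /s2 addrC -lerBrDr ge_min lexx orbT.
    move=> t t0 ts; have [ts1|ts1] := ltP t s1; first exact: below.
    apply: hd; rewrite ler0_norm ?subr_le0//.
    have : Num.min (d / 2) (pi - s1) <= d / 2 by rewrite ge_min lexx.
    by move: ts; rewrite /s2; lra.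
  by rewrite /s2; lra.
exists s1; split=> //; rewrite lt_neqAle s1ge andbT eq_sym; apply/eqP => E1.
by apply: n1; rewrite E1 h0.
Qed.

Variables (Gamma : groupType) (rho : representation Gamma R n).
Hypothesis invL : forall g, [set rho g *m x | x in cone Lambda] = cone Lambda.
Hypothesis freeE : acts_freely rho E.
Hypothesis pdE : acts_properly_discontinuously rho E.
Variable Sigma : set (orbit_space rho).
Hypothesis cauchy : Cauchy_hypersurface E Sigma.
Hypothesis compactS : compact Sigma.

(* The arc of circle through [x] in [E], parametrized by the whole line with the
   arc tangent. *)
Lemma circle_meets_Cauchy x : E x -> exists t, E (rot t x) /\ Sigma (\pi_(orbit_space rho) (rot t x)).
Proof.
move=> Ex; have [sp [sp0 Ep np]] := circle_exit (expr1n _ 2) Ex.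
have N1 : (-1 : R) ^+ 2 = 1 by rewrite sqrrN expr1n.
have [sm [sm0 Em nm]] := circle_exit N1 Ex; have [qx _] := Ex.
have pi0 := pi_gt0 R.
(* With these constants [al + be * atan t] runs over the open interval from [- sm] to [sp], the
   angles of the arc in [E]. *)
pose be := (sp + sm) / pi; pose al := (sp - sm) / 2.
have be0 : 0 < be by rewrite divr_gt0// addr_gt0.
pose phi t := al + be * atan t.
have bpi : be * (pi / 2) = (sp + sm) / 2.
  by rewrite /be; move: (@pi R) (lt0r_neq0 pi0) => q q0; field.
have phib t : - sm < phi t < sp.
  have h1 := atan_ltpi2 t; have h2 := atan_gtNpi2 t.
  have h3 : be * atan t < be * (pi / 2) by rewrite ltr_pM2l.
  have h4 : be * - (pi / 2) < be * atan t by rewrite ltr_pM2l.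
  by rewrite /phi /al; apply/andP; split; move: h3 h4; rewrite mulrN bpi; lra.
have Ephi t : E (rot (phi t) x).
  have [h1 h2] := andP (phib t); have [h|h] := leP 0 (phi t).
    by have := Ep _ h h2; rewrite mul1r.
  by have := Em (- phi t); rewrite mulN1r opprK; apply; lra.
have dphi t : is_derive t 1 phi (be * (1 + t ^+ 2)^-1).
  by rewrite -[X in is_derive _ _ _ X]add0r; apply: is_deriveD.
have cphi : continuous phi.
  move=> t; apply: cvgD; first exact: cvg_cst.
  by apply: cvgM; [exact: cvg_cst|exact: continuous_atan].
pose c t := rot (phi t) x.
have dc t : is_derive t 1 c ((be * (1 + t ^+ 2)^-1) *: rot (phi t) (turn x)).
  exact: rot_is_derive.
have cc : continuous c.
  move=> t; apply: (@cvg_comp _ _ _ phi (fun t => rot t x) _ (nbhs (phi t))); first exact: cphi.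
  exact: rot_continuous.
have c1 : derive1 c = fun t => (be * (1 + t ^+ 2)^-1) *: rot (phi t) (turn x).
  by apply/funext => t; rewrite derive1E; have [] := dc t.
have tl t : timelike_at E c t.
  split; [exact: Ephi|by have [] := dc t| |].
  - rewrite c1; have h1 : {for t, continuous (fun t => be * (1 + t ^+ 2)^-1)}.
      apply: cvgM; first exact: cvg_cst.
      apply: cvgV; first by rewrite gt_eqF// ltr_pwDl// sqr_ge0.
      apply: cvgD; first exact: cvg_cst.
      by rewrite expr2; under eq_fun do rewrite expr2; apply: cvgM; exact: cvg_id.
    apply: cvgZ => //.
    apply: (@cvg_comp _ _ _ phi (fun t => rot t (turn x)) _ (nbhs (phi t))); first exact: cphi.
    exact: rot_continuous.
  - rewrite c1 /qf bilZl bilZr -/(qf _) qf_rot qf_turn AdS_norm//.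
    have b0 : 0 < be * (1 + t ^+ 2)^-1 by rewrite mulr_gt0// invr_gt0 ltr_pwDl// sqr_ge0.
    by have := sp_ge0 x; have := mulr_gt0 b0 b0; nra.
have qc t : qf (c t) = -1 by rewrite qf_rot.
have limp : c t @[t --> +oo] --> rot sp x.
  apply: (@cvg_comp _ _ _ phi (fun t => rot t x) _ (nbhs sp)); last exact: rot_continuous.
  have h : phi t @[t --> +oo] --> al + be * (pi / 2).
    by apply: cvgD; [exact: cvg_cst|apply: cvgM; [exact: cvg_cst|exact: cvgy_atan]].
  by rewrite (_ : al + _ = sp) in h; last by rewrite bpi /al; field.
have limm : c (- t) @[t --> +oo] --> rot (- sm) x.
  apply: (@cvg_comp _ _ _ (fun t => phi (- t)) (fun t => rot t x) _ (nbhs (- sm))); last exact: rot_continuous.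
  have h : al - be * atan t @[t --> +oo] --> al - be * (pi / 2).
    by apply: cvgB; [exact: cvg_cst|apply: cvgM; [exact: cvg_cst|exact: cvgy_atan]].
  rewrite (_ : al - _ = - sm) in h; last by rewrite bpi /al; field.
  by rewrite (_ : (fun t => phi (- t)) = (fun t => al - be * atan t))//; apply/funext => t; rewrite /phi atanN mulrN.
pose cq t := \pi_(orbit_space rho) (c t).
have [_ hS] := cauchy; have [||t [St _]] := hS cq.
- by move=> t0; exists c; apply: filterE => t; split=> //; exact: tl.
- move=> _ [z Ez <-]; split.
    apply: (quotient_escape lP invL freeE pdE cc qc limp) => //.
    by move: np; rewrite mul1r.
  move=> hz; have ccN : continuous (fun t => c (- t)).
    move=> t; apply: (@cvg_comp _ _ _ (fun t => - t) c _ (nbhs (- t))); last exact: cc.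
    by apply: cvgN; exact: cvg_id.
  have nm' : ~ E (rot (- sm) x) by move: nm; rewrite mulN1r.
  apply: (quotient_escape lP invL freeE pdE ccN (fun t => qc (- t)) limm nm' Ez).
  apply: (@cvg_comp _ _ _ (fun t : R => - t) cq _ (-oo%R : set_system R)) => //.
  by apply/cvgNry; rewrite (_ : - (fun t : R => - t) = id) //; apply/funext => t /=; rewrite opprfctE /= opprK.
by exists (phi t); split; [exact: Ephi|exact: St].
Qed.

(** An increasing sequence of open sets covering [E], so that the compact Cauchy hypersurface lies
    in the image of one of them. Each comes with a radius of balls contained in the dual cone. *)
Definition robust (j : nat) : set V := [set k | exists2 d : R, 0 < d &
  forall v, `|v| <= j.+1%:R^-1 + d -> Cs (k + v)].

Lemma robust_open j : open (robust j).
Proof.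
rewrite openE => k [d d0 hd]; have d2 : 0 < d / 2 by rewrite divr_gt0.
apply/nbhs_ballP; exists (d / 2) => //= k'; rewrite -ball_normE /= => kk'.
exists (d / 2) => // v hv; rewrite (_ : k' + v = k + (k' - k + v)); last first.
  by rewrite addrA (addrC k) subrK.
have h1 : `|k' - k| < d / 2 by rewrite distrC.
apply: hd; apply: (le_trans (ler_normD _ _)); move: hv; set i := j.+1%:R^-1.
by clearbody i; lra.
Qed.

Lemma robust_mono i j : (i <= j)%N -> robust i `<=` robust j.
Proof.
move=> ij k [d d0 hd]; exists d => // v hv; apply: hd; apply: (le_trans hv).
by rewrite lerD2r lef_pV2 ?posrE ?ltr0n// ler_nat.
Qed.

Lemma robust_cover k : E k -> exists j, robust j k.
Proof.
move=> /(regular_domainE lP)[_ hk]; have [d d0 hd] := dual_open lP hk.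
have d2 : 0 < d / 2 by rewrite divr_gt0.
have [j hj] : exists j : nat, j.+1%:R^-1 <= d / 2.
  exists (Num.truncn (d / 2)^-1); rewrite -[leRHS]invrK lef_pV2 ?posrE ?invr_gt0 ?ltr0n//.
  exact/ltW/truncnS_gt.
exists j; exists (d / 2) => // v hv; apply: hd; apply: (le_trans hv).
by rewrite [leRHS](splitr d) lerD2r.
Qed.

Lemma Cauchy_robust : exists j, Sigma `<=` quotient_of (rho := rho) (robust j).
Proof.
apply: contrapT => /forallNP h.
have /choice[r hr] : forall j : nat, exists r : orbit_space rho,
    Sigma r /\ ~ quotient_of (rho := rho) (robust j) r.
  by move=> j; move/existsNP: (h j) => [q /not_implyP]; exists q.
have [U [UU sU]] := nat_ultra.
have := compactS; rewrite compact_ultra => /(_ _ (fmap_ultra r UU))[|p [Sp rp]].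
  have : \forall j \near U, Sigma (r j) by apply: filterE => j; have [] := hr j.
  by [].
have [k Ek kp] := (proj1 cauchy) p Sp; have [j jk] := robust_cover Ek.
have hn : nbhs p (quotient_of (rho := rho) (robust j)).
  apply: open_nbhs_nbhs; split; last by exists k.
  by apply: quotient_of_open; exact: robust_open.
have n1 : \forall i \near U, quotient_of (rho := rho) (robust j) (r i) by exact: (rp _ hn).
have n2 : \forall i \near U, (j <= i)%N by apply: sU; exists j.
have [i [[y ry yE] ji]] := filter_ex (filterI n1 n2); have [_] := hr i; apply.
by exists y => //; exact: (robust_mono ji).
Qed.

(** The circle through [x] meets the Cauchy hypersurface at a point that some [rho g] carries to a
    robust [k]. With [y = rho g *m x], the circle formula gives [bil k y >= -1]. As [k + v] is dual
    for [v] of norm [1 / (j + 1)], taking [v] along [refl y] shows that [y] has norm at most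
    [j + 1]. *)
Lemma hull_boundary_cocompact e : e ^+ 2 = 1 -> exists Q : R, forall x, hull_boundary P e x ->
  exists A B, [/\ surface_symmetry e (hull_boundary P e) A, surface_symmetry e (hull_boundary P e) B,
    A *m B = 1%:M, B *m A = 1%:M & forall j, `|(A *m x) j 0| <= Q].
Proof.
move=> e2; have [j hj] := Cauchy_robust; exists j.+1%:R => x [qx Cx _].
have [t [Et /hj[k [d d0 hk] /esym/pi_orbit_eq[g kE]]]] := circle_meets_Cauchy (bidual_regular lP Cx qx).
exists (rho g), (rho g^-1%g); split.
- exact: (hull_boundary_symmetry lP invL).
- exact: (hull_boundary_symmetry lP invL).
- by rewrite -repM mulgV rep1.
- by rewrite -repM mulVg rep1.
have Cy : Cc (rho g *m x) by exact: (bidual_rho lP invL).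
have ky : -1 <= bil k (rho g *m x).
  by rewrite kE rho_bil bil_rot_self AdS_norm//; have := cos_le1 t; have := sp_ge0 x; nra.
have qy : qf (rho g *m x) = -1 by rewrite /qf rho_bil.
move: (rho g *m x) Cy ky qy => y Cy ky qy i.
have y0 : 0 < `|y| by rewrite normr_gt0; apply/eqP => E0; move: qy; rewrite E0 /qf bil0l; lra.
have J0 : 0 < j.+1%:R :> R by rewrite ltr0n.
pose v := (j.+1%:R^-1 / `|y|) *: refl y.
have vn : `|v| <= j.+1%:R^-1 + d.
  rewrite normrZ gtr0_norm ?divr_gt0 ?invr_gt0//; apply: (@le_trans _ _ j.+1%:R^-1); last by rewrite lerDl ltW.
  by rewrite mulrAC ler_pdivrMr// ler_wpM2l ?invr_ge0// norm_refl.
have := Cy _ (hk v vn); rewrite bilC bilDl (bilC v) bilZr bil_refl => hb.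
have yN : `|y| ^+ 2 <= tu y ^+ 2 + tv y ^+ 2 + sp y y.
  have N0 : 0 <= tu y ^+ 2 + tv y ^+ 2 + sp y y by rewrite !addr_ge0 ?sqr_ge0 ?sp_ge0.
  rewrite -[leRHS]sqr_sqrtr// lerXn2r ?nnegrE ?sqrtr_ge0//.
  by apply: col_norm_le => // l; apply: coord_le_sum; rewrite ?sqr_sqrtr.
apply: (le_trans (col_norm_ge y i)).
have h1 : j.+1%:R^-1 / `|y| * `|y| ^+ 2 <= 1.
  apply: (@le_trans _ _ (j.+1%:R^-1 / `|y| * (tu y ^+ 2 + tv y ^+ 2 + sp y y))); last first.
    by move: hb; rewrite -lerBrDl sub0r => hb; apply: le_trans hb _; rewrite lerNl.
  by rewrite ler_wpM2l// divr_ge0 ?invr_ge0.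
move: h1; rewrite (_ : _ * _ = j.+1%:R^-1 * `|y|); last by field; rewrite ?gt_eqF.
by rewrite ler_pdivrMl// mulr1.
Qed.

End CircleCurves.

Theorem proposition5p2 (R : realType) (n : nat) (Gamma : groupType)
    (rho : representation Gamma R n) (Lambda Sp Sm : set (rays R n)) :
  (2 <= n)%N ->
  GHC_regular_acausal rho Lambda ->
  (Conv Lambda)° !=set0 ->
  future_past_components Lambda Sp Sm ->
  complete_CATm1 (AdS_lift Sp) (length_dist (AdS_lift Sp)) /\
  complete_CATm1 (AdS_lift Sm) (length_dist (AdS_lift Sm)).
Proof.
move=> n2 [_ [[f [lf LE]] invL] freeE pdE [Sigma [cauchy compactS]]] int [Bp Bm _ _].
have lP := ein_lightlike (ltnW n2) lf; move: lP LE.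
set P := [set ein_point (f y) y | y in unit_sphere] => lP LE.
rewrite {}LE in invL freeE pdE cauchy int Bp Bm *.
have int0 : bidual_interior P !=set0.
  by have [r hr] := int; have [u uE] := rays_surj r; exists (set_val u); apply/(Conv_interior lP); rewrite uE.
suff main Q : boundary_components (rays_through P) Q ->
    complete_CATm1 (AdS_lift Q) (length_dist (AdS_lift Q)) by split; exact: main.
move=> /(boundary_component_lift lP int0)[e e2 ->].
apply: (surface_complete_CATm1 (hull_boundary_convex lP e2 _)).
  by have [z [_ hz]] := int0; exists z.
exact: (hull_boundary_cocompact lP invL freeE pdE cauchy compactS e2).
Qed.
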